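(* Let $r>\sigma_0$ be real, and if $m_L\ge 1$ assume moreover $r\neq 1$. Then the following are equivalent: (i) $\psi\in L^2\big((1,+\infty),\frac{du}{u^{1+2r}}\big)$; (ii) the function $t\mapsto L(r+it)\hat\varphi(r+it)$ belongs to $L^2(\mathbb{R})$.
   Context: Let $L(s)=\sum_{n\ge1}a_n n^{-s}$ be a Dirichlet series such that: $a_n=O_\varepsilon(n^{\varepsilon})$ for every $\varepsilon>0$; there is $\sigma_0<1$ such that $L$ has a meromorphic continuation to $\Pi_{\sigma_0}=\{s:\Re s>\sigma_0\}$ with a unique pole, at $s=1$, of order $m_L\ge 0$ ($m_L=0$ meaning no pole); and $s\mapsto (s-1)^{m_L}L(s)$ is analytic of finite order in $\Pi_{\sigma_0}$. Let $\varphi:[0,+\infty)\to\mathbb{C}$ be supported on $[0,1]$, locally bounded on $(0,1)$, with $\varphi(x)=O(x^{-\sigma_0})$ as $x\to0^+$ and $\varphi(x)=O((1-x)^{-\sigma_1})$ as $x\to1^-$ for some $\sigma_1<1/2$. Its Mellin transform is $\hat\varphi(s)=\int_0^{\infty}\varphi(t)t^{s-1}\,dt$, analytic on $\Pi_{\sigma_0}$. Define, for $u>0$, $\psi(u)=\operatorname{Res}_{s=1}\big(L(s)\hat\varphi(s)u^s\big)-\sum_{n<u}a_n\varphi(n/u)$. *)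

(* Defs.v *)
From HB Require Import structures.
From mathcomp Require Export all_boot all_order all_algebra.
From mathcomp Require Export complex.
From mathcomp Require Export all_classical all_reals all_analysis.
Set Implicit Arguments.
Unset Strict Implicit.
Unset Printing Implicit Defensive.
Export Order.TTheory GRing.Theory Num.Theory.
Export numFieldNormedType.Exports.
Export ComplexField.Normc.

Local Open Scope classical_set_scope.
Local Open Scope ring_scope.

(* R[i]^o is R[i] seen as a normed module over itself: this is the instance that
   carries the topology, and over which [derivable f s 1] is complex
   differentiability at s. *)
Notation Cplx R := (R[i]^o) (only parsing).

Section ComplexAnalysis.
Variable R : realType.
Implicit Types (f : Cplx R -> Cplx R) (s a c : Cplx R).

Definition half_plane (sigma : R) : set (Cplx R) :=
  [set s | sigma < complex.Re s].

(* Only used on open sets U, where it means analytic on U. *)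
Definition holomorphic_on (U : set (Cplx R)) f : Prop :=
  forall s, U s -> derivable f s 1.

Definition holomorphic_at f a : Prop := \forall s \near a, derivable f s 1.

(* Order m = 0 means that f is analytic at a (in particular f a is the right
   value there), not that f has a removable singularity. *)
Definition pole_of_order f a (m : nat) : Prop :=
  if m is 0 then holomorphic_at f a
  else exists h : Cplx R -> Cplx R,
    [/\ holomorphic_at h a, h a <> 0 &
        \forall s \near a^', f s = h s / (s - a) ^+ m].

(* f(s) = O(exp(|s|^A)) for some A, as |s| -> oo within U. *)
Definition finite_order_on (U : set (Cplx R)) f : Prop :=
  exists A M rho : R, forall s, U s -> rho <= normc s ->
    normc (f s) <= M * expR (normc s `^ A).

(* c is the coefficient of (s - a)^-1 in the Laurent expansion of f at a, for f
   analytic around a except for at most a pole at a: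
   f(s) = b_N (s - a)^-(N+1) + ... + b_0 (s - a)^-1 + h(s), h analytic at a. *)
Definition is_residue f a c : Prop :=
  exists (N : nat) (b : nat -> R[i]) (h : Cplx R -> Cplx R),
    [/\ holomorphic_at h a, b 0%N = c &
        \forall s \near a^',
          f s = h s + \sum_(k < N.+1) b k / (s - a) ^+ k.+1].

Definition Res f a : R[i] := xget 0 [set c | is_residue f a c].

(* x ^ s = exp(s ln x) for a real x > 0 and a complex s *)
Definition cpow (x : R) (s : R[i]) : R[i] :=
  let y := complex.Im s * ln x in
  (expR (complex.Re s * ln x))%:C%C * (cos y +i* sin y)%C.

End ComplexAnalysis.

Section Lebesgue.
Variable R : realType.
Implicit Types (D : set R) (f : R -> R[i]).

(* R with its Lebesgue sigma-algebra, i.e. the Caratheodory sigma-algebra on which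
   [completed_lebesgue_measure] is defined (the default one is Borel). *)
Local Notation leb := (caratheodory_type ((wlength (@idfun R))^*)%mu).
Local Notation mu := (@completed_lebesgue_measure R).

Definition cmeasurable D f : Prop :=
  measurable_fun (D : set leb) ((fun x => complex.Re (f x)) : leb -> R) /\
  measurable_fun (D : set leb) ((fun x => complex.Im (f x)) : leb -> R).

Definition cintegral D f : R[i] :=
  (Rintegral mu D (fun x => complex.Re (f x))
   +i* Rintegral mu D (fun x => complex.Im (f x)))%C.

(* f belongs to L^2(D, w(x) dx) *)
Definition L2 D (w : R -> R) f : Prop :=
  cmeasurable D f /\
  (\int[mu]_(x in D) (normc (f x) ^+ 2 * w x)%:E < +oo)%E.

Definition mellin f (s : R[i]) : R[i] :=
  cintegral `]0, +oo[ (fun t => f t * cpow t (s - 1)).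

Definition locally_bounded_on D f : Prop :=
  forall x, D x -> exists M : R, \forall y \near x, normc (f y) <= M.

End Lebesgue.

Section Psi.
Variable R : realType.

Definition dirichlet_series (a : nat -> R[i]) (s : R[i]) : (Cplx R)^nat :=
  series (fun k => a k.+1 * cpow k.+1%:R (- s)).

(* The range 1 <= n <= floor u contains every n >= 1 with n < u. *)
Definition psi (a : nat -> R[i]) (L : Cplx R -> Cplx R) (phi : R -> R[i])
    (u : R) : R[i] :=
  Res (fun s => L s * mellin phi s * cpow u s) 1
  - \sum_(1 <= n < (Num.truncn u).+1 | n%:R < u) a n * phi (n%:R / u).

End Psi.

(* Main.v *)
(** Put [u = e^x] and [q(x) = phi(e^-x)].  For [x > 0] outside a null set
    [psi(e^x) = - f(x)] with
      [f(x) = sum_{n < e^x} a_n q(x - ln n) - e^x sum_{k < m} b_k x^k / k!],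
    where [sum_k b_k (s - 1)^-(k+1)] is the polar part at [1] of [L * mellin phi].
    The Laplace transform of [f], which converges far to the right, is
    [K(s) = L(s) mellin phi (s) - sum_k b_k (s - 1)^-(k+1)], and [K] is analytic and
    of finite order on [Re s > sigma0].  Since the polar part is square integrable on
    [Re s = r], the theorem says that [f(x) e^(-r x)] is in [L^2] if and only if
    [K(r + i .)] is.

    If [f(x) e^(-r x)] is in [L^2], the Laplace integral converges for [Re s > r], it
    equals [K] there by moving a line of integration, and the Plancherel inequality
    on [Re s = r'] with [r' -> r] gives the [L^2] bound.  Conversely, smooth [f] by
    convolution and insert a Gaussian factor into the inversion formula; the line of
    integration moves from the far right to [Re s = r], where the Plancherel
    inequality applies, and Fatou's lemma removes both regularizations.  In either
    direction the finite order growth of [K] in a strip is absorbed by a factor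
    [exp (- 2 e cos (d (s - r)))]. *)

Require Import Defs.
From mathcomp Require Import ring lra measurable_realfun.
Set Implicit Arguments.
Unset Strict Implicit.
Unset Printing Implicit Defensive.

Local Open Scope classical_set_scope.
Local Open Scope ring_scope.

(** * Complex norm, exponential and differentiability *)

(** Only finiteness of integrals is at stake, so inequalities with some positive constant suffice,
    and the complex analysis reduces to Goursat's theorem on rectangles. Growth like [exp(|s|^A)]
    with [A] arbitrary defeats every Gaussian, which is why the damping factor is doubly exponential
    in [Im s]; on the strip it is bounded by 1 and tends to 1, so dominated convergence removes it.
    The function [K] does not come from a Laurent series: [(s - 1)^m L(s) mellin phi (s)] is divided
    [m] times by [s - 1], each time after subtracting the value at 1, and such a division preserves
    growth because [|s - 1| >= 1] as soon as [|Im s| >= 1]. In the converse direction a Gaussian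
    mean recovers a function where it is continuous, while [f] may be unbounded near every [ln n];
    hence a preliminary convolution with a Lipschitz bump, undone at Lebesgue points. Far to the
    right means [Re s > 3], where the crude bound [|a_n| <= A n] leaves the convergent sum of
    [n^-2]. *)

Section ComplexNorm.
Variable R : realType.
Implicit Types (x y : R) (z w : R[i]).

Lemma normr_normc z : `|z| = (normc z)%:C%C.
Proof. by []. Qed.

Lemma normc_ge0 z : 0 <= normc z.
Proof. by case: z => a b; exact: sqrtr_ge0. Qed.

Lemma normc_eq0 z : (normc z == 0) = (z == 0).
Proof. by apply/eqP/eqP => [/eq0_normc//|->]; rewrite normc0. Qed.

Lemma normc_gt0 z : (0 < normc z) = (z != 0).
Proof. by rewrite lt_neqAle normc_ge0 andbT eq_sym normc_eq0. Qed.

Lemma ler_normcD z w : normc (z + w) <= normc z + normc w.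
Proof. exact: (le_normcD (z : Rcomplex R) w). Qed.

Lemma normcN z : normc (- z) = normc z.
Proof. by case: z => a b /=; rewrite !sqrrN. Qed.

Lemma normcC z w : normc (z - w) = normc (w - z).
Proof. by rewrite -normcN opprB. Qed.

Lemma ler_normcB z w : normc (z - w) <= normc z + normc w.
Proof. by rewrite -(normcN w) ler_normcD. Qed.

Lemma ler_dist_normc z w : normc z - normc w <= normc (z - w).
Proof. by rewrite lerBlDr -{1}(subrK w z) ler_normcD. Qed.

Lemma normcR x : normc (x%:C)%C = `|x|.
Proof. by rewrite /= expr0n addr0 sqrtr_sqr. Qed.

Lemma normcX z n : normc (z ^+ n) = normc z ^+ n.
Proof. by elim: n => [|n IH]; rewrite ?normc1 // !exprS normcM IH. Qed.

Lemma sqr_normcE z : normc z ^+ 2 = complex.Re z ^+ 2 + complex.Im z ^+ 2.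
Proof. by case: z => a b /=; rewrite sqr_sqrtr// addr_ge0// sqr_ge0. Qed.

Lemma normc_Re z : `|complex.Re z| <= normc z.
Proof.
by rewrite -ler_sqr ?nnegrE ?normc_ge0// sqr_normcE -normrX ger0_norm ?sqr_ge0// lerDl sqr_ge0.
Qed.

Lemma normc_Im z : `|complex.Im z| <= normc z.
Proof.
by rewrite -ler_sqr ?nnegrE ?normc_ge0// sqr_normcE -normrX ger0_norm ?sqr_ge0// lerDr sqr_ge0.
Qed.

Lemma normc_leD z : normc z <= `|complex.Re z| + `|complex.Im z|.
Proof.
rewrite -ler_sqr ?nnegrE ?normc_ge0 ?addr_ge0// sqr_normcE.
rewrite -(real_normK (num_real (complex.Re z))) -(real_normK (num_real (complex.Im z))).
have := mulr_ge0 (normr_ge0 (complex.Re z)) (normr_ge0 (complex.Im z)).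
by nra.
Qed.

Lemma normc_conj z : normc (z^*%C) = normc z.
Proof. by case: z => a b /=; rewrite sqrrN. Qed.

Lemma mulc_conj z : z * z^*%C = ((normc z ^+ 2)%:C)%C.
Proof. by rewrite -sqr_normc normr_normc rmorphXn. Qed.

Lemma ReD z w : complex.Re (z + w) = complex.Re z + complex.Re w.
Proof. by case: z => a b; case: w. Qed.

Lemma ImD z w : complex.Im (z + w) = complex.Im z + complex.Im w.
Proof. by case: z => a b; case: w. Qed.

Lemma ReN z : complex.Re (- z) = - complex.Re z.
Proof. by case: z. Qed.

Lemma ImN z : complex.Im (- z) = - complex.Im z.
Proof. by case: z. Qed.

Lemma ReM z w :
  complex.Re (z * w) = complex.Re z * complex.Re w - complex.Im z * complex.Im w.
Proof. by case: z => a b; case: w. Qed.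

Lemma ImM z w :
  complex.Im (z * w) = complex.Re z * complex.Im w + complex.Im z * complex.Re w.
Proof. by case: z => a b; case: w => c d /=; rewrite addrC. Qed.

Definition ReImE := (ReD, ImD, ReN, ImN, ReM, ImM).

Lemma complexP z w : complex.Re z = complex.Re w -> complex.Im z = complex.Im w -> z = w.
Proof. by case: z => a b; case: w => c d /= -> ->. Qed.

Lemma normc_sum (I : Type) (s : seq I) (P : pred I) (F : I -> R[i]) :
  normc (\sum_(i <- s | P i) F i) <= \sum_(i <- s | P i) normc (F i).
Proof.
elim/big_ind2 : _ => [|z a w b za wb|//]; first by rewrite normc0.
by rewrite (le_trans (ler_normcD _ _))// lerD.
Qed.

End ComplexNorm.

Section Cexp.
Variable R : realType.
Implicit Types (x y : R) (z w : R[i]).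

Definition cexp z : R[i] :=
  (expR (complex.Re z))%:C%C * (cos (complex.Im z) +i* sin (complex.Im z))%C.

Lemma Re_cexp z : complex.Re (cexp z) = expR (complex.Re z) * cos (complex.Im z).
Proof. by rewrite ReM /= mul0r subr0. Qed.

Lemma Im_cexp z : complex.Im (cexp z) = expR (complex.Re z) * sin (complex.Im z).
Proof. by rewrite ImM /= mul0r addr0. Qed.

Lemma cexp0 : cexp 0 = 1.
Proof. by apply: complexP; rewrite ?Re_cexp ?Im_cexp /= expR0 ?cos0 ?sin0 mul1r. Qed.

Lemma cexpD z w : cexp (z + w) = cexp z * cexp w.
Proof.
apply: complexP.
  by rewrite Re_cexp ReM !Re_cexp !Im_cexp ReD ImD expRD cosD; ring.
by rewrite Im_cexp ImM !Re_cexp !Im_cexp ReD ImD expRD sinD; ring.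
Qed.

Lemma normc_cexp z : normc (cexp z) = expR (complex.Re z).
Proof.
rewrite normcM normcR ger0_norm ?expR_ge0//= cos2Dsin2 sqrtr1.
by rewrite mulr1.
Qed.

Lemma cexp_neq0 z : cexp z != 0.
Proof. by rewrite -normc_gt0 normc_cexp expR_gt0. Qed.

Lemma cexpR x : cexp (x%:C)%C = (expR x)%:C%C.
Proof. by rewrite /cexp /= cos0 sin0 mulr1. Qed.

Lemma cexp_conj z : cexp (z^*%C) = (cexp z)^*%C.
Proof.
by case: z => a b; apply: complexP; rewrite /= ?Re_cexp ?Im_cexp /= ?cosN ?sinN; ring.
Qed.

Lemma cpow_cexp x s : cpow x s = cexp (s * (ln x)%:C%C).
Proof. by rewrite /cpow /cexp ReM ImM /= !mulr0 subr0 add0r. Qed.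

End Cexp.

Lemma le_abs_segment (R : realType) (g dg : R -> R) (M : R) :
  (forall t : R, is_derive t 1 g (dg t)) ->
  (forall t, 0 <= t <= 1 -> `|dg t| <= M) -> `|g 1 - g 0| <= M.
Proof.
move=> dgP bd.
have [|t t01 ->] := @MVT_segment R g dg 0 1 ler01 (fun x _ => dgP x).
  by apply: derivable_within_continuous => x _; have [] := dgP x.
by rewrite subr0 mulr1 bd//; move: t01; rewrite in_itv.
Qed.

Section RealVariable.
Variable R : realType.
Implicit Types (z w : R[i]) (G : R -> R[i]).

(** Real and imaginary parts are differentiated separately, so that the mean value theorem and the
    fundamental theorem of calculus for real functions apply. *)
Definition cderive G (t : R) (d : R[i]) : Prop :=
  is_derive t (1 : R) (fun x => complex.Re (G x)) (complex.Re d) /\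
  is_derive t (1 : R) (fun x => complex.Im (G x)) (complex.Im d).

(** The mean value theorem fails for complex values; applied to the real and to the imaginary part
    it costs a factor 2. *)
Lemma cderive_segment G dG (M : R) : (forall t, cderive G t (dG t)) ->
  (forall t, 0 <= t <= 1 -> normc (dG t) <= M) -> normc (G 1 - G 0) <= 2 * M.
Proof.
move=> GP bd; rewrite (le_trans (normc_leD _))// mulr2n mulrDl mul1r ReD ReN ImD ImN.
have dRe := @le_abs_segment R (fun t => complex.Re (G t)) (fun t => complex.Re (dG t)) M.
have dIm := @le_abs_segment R (fun t => complex.Im (G t)) (fun t => complex.Im (dG t)) M.
apply: lerD; [apply: dRe|apply: dIm] => t.
- exact: (GP t).1.
- by move=> /bd; apply: le_trans; exact: normc_Re.
- exact: (GP t).2.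
- by move=> /bd; apply: le_trans; exact: normc_Im.
Qed.

Lemma cderiveD G H t d e : cderive G t d -> cderive H t e ->
  cderive (fun x => G x + H x) t (d + e).
Proof.
move=> [G1 G2] [H1 H2]; split.
  by under eq_fun do rewrite ReD; rewrite ReD; exact: is_deriveD.
by under eq_fun do rewrite ImD; rewrite ImD; exact: is_deriveD.
Qed.

Lemma cderive_cst w t : cderive (fun=> w) t 0.
Proof. by split; exact: is_derive_cst. Qed.

Lemma cderiveM G H t d e : cderive G t d -> cderive H t e ->
  cderive (fun x => G x * H x) t (d * H t + G t * e).
Proof.
move=> [G1 G2] [H1 H2]; split.
  under eq_fun do rewrite ReM.
  apply: is_derive_eq.
  by rewrite /GRing.scale /= ReD !ReM; ring.
under eq_fun do rewrite ImM.
apply: is_derive_eq.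
by rewrite /GRing.scale /= ImD !ImM; ring.
Qed.

Lemma cderive_real t : cderive (fun x => x%:C%C) t 1.
Proof. by split; [exact: is_derive_id|exact: is_derive_cst]. Qed.

Lemma cderiveZ w G t d : cderive G t d -> cderive (fun x => w * G x) t (w * d).
Proof. by move=> /(cderiveM (cderive_cst w t)); rewrite mul0r add0r. Qed.

Lemma cderive_cexp z t : cderive (fun x => cexp (x%:C%C * z)) t (z * cexp (t%:C%C * z)).
Proof.
case: z => a b.
split.
  under eq_fun do rewrite Re_cexp /= !mul0r subr0 addr0.
  rewrite ReM Re_cexp Im_cexp /= !mul0r subr0 addr0.
  by apply: is_derive_eq; rewrite /GRing.scale /=; ring.
under eq_fun do rewrite Im_cexp /= !mul0r subr0 addr0.
rewrite ImM Re_cexp Im_cexp /= !mul0r subr0 addr0.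
by apply: is_derive_eq; rewrite /GRing.scale /=; ring.
Qed.

End RealVariable.

Section CexpBounds.
Variable R : realType.
Implicit Types (z w : R[i]).

Lemma normc_cexp_le z : normc (cexp z) <= expR (normc z).
Proof.
by rewrite normc_cexp ler_expR (le_trans _ (normc_Re z))// ler_norm.
Qed.

Lemma normc_segment z (t : R) : 0 <= t <= 1 -> normc (t%:C%C * z) <= normc z.
Proof.
by move=> /andP[t0 t1]; rewrite normcM normcR ger0_norm// ler_piMl ?normc_ge0.
Qed.

Lemma cexp_sub1 z : normc (cexp z - 1) <= 2 * normc z * expR (normc z).
Proof.
have := @cderive_segment R (fun t => cexp (t%:C%C * z)) (fun t => z * cexp (t%:C%C * z))
  (normc z * expR (normc z)).
rewrite mul1r mul0r cexp0 mulrA; apply => t; first exact: cderive_cexp.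
move=> t01; rewrite normcM ler_wpM2l ?normc_ge0// (le_trans (normc_cexp_le _))//.
by rewrite ler_expR normc_segment.
Qed.

(** Along the segment, [cexp (t z) - t z] has derivative [z (cexp (t z) - 1)], which is quadratic in
    [z] by [cexp_sub1]. *)
Lemma cexp_sub1Dx z : normc (cexp z - 1 - z) <= 4 * normc z ^+ 2 * expR (normc z).
Proof.
have := @cderive_segment R (fun t => cexp (t%:C%C * z) + - z * t%:C%C)
  (fun t => z * cexp (t%:C%C * z) + - z * 1) (2 * normc z ^+ 2 * expR (normc z)).
rewrite mul1r mul0r cexp0 !mulr1 mulr0 addr0 addrAC => le0.
rewrite (_ : 4 * _ * _ = 2 * (2 * normc z ^+ 2 * expR (normc z))); last by ring.
apply: le0 => t.
  have -> : z * cexp (t%:C%C * z) - z = z * cexp (t%:C%C * z) + - z * 1 by rewrite mulr1.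
  by apply: cderiveD; [exact: cderive_cexp|apply: cderiveZ; exact: cderive_real].
move=> t01; rewrite -{3}(mulr1 z) -mulrBr normcM.
have le1 := cexp_sub1 (t%:C%C * z); have le2 := normc_segment z t01.
have le3 : 2 * normc (t%:C%C * z) * expR (normc (t%:C%C * z)) <= 2 * normc z * expR (normc z).
  by apply: ler_pM; rewrite ?mulr_ge0 ?normc_ge0 ?expR_ge0 ?ler_expR ?ler_pM2l.
apply: le_trans (ler_wpM2l (normc_ge0 z) (le_trans le1 le3)) _.
by rewrite le_eqVlt; apply/orP; left; apply/eqP; ring.
Qed.

End CexpBounds.

Section Holomorphy.
Variable R : realType.
Implicit Types (z w s d : R[i]) (f g : Cplx R -> Cplx R).

(** Radii of balls are elements of [R[i]]; being positive in the order of [R[i]] forces them to be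
    real. *)
Lemma nbhs_complexP z (P : set (Cplx R)) :
  (\forall w \near (z : Cplx R), P w) <->
  exists2 e : R, 0 < e & forall w, normc (w - z) < e -> P w.
Proof.
split.
  move=> /nbhs_normP[[a b]]; rewrite /= ltcE /= => /andP[/eqP b0 a0] aP.
  exists a => // w wa; apply: aP => /=.
  by rewrite b0 normr_normc complexr0 ltcR normcC.
move=> [e e0 eP]; apply/nbhs_normP; exists (e%:C)%C; first by rewrite /= ltcR.
by move=> w /=; rewrite normr_normc ltcR normcC => we; exact: eP.
Qed.

Lemma dnbhs_complexP z (P : set (Cplx R)) :
  (\forall w \near (z : Cplx R)^', P w) <->
  exists2 e : R, 0 < e & forall w, normc (w - z) < e -> w != z -> P w.
Proof.
have -> : (\forall w \near (z : Cplx R)^', P w) =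
          (\forall w \near (z : Cplx R), w != z -> P w) by [].
exact: nbhs_complexP.
Qed.

(** The increment form of complex differentiability avoids dividing by [h] and includes [h = 0]. *)
Definition cdiff f s d := forall e : R, 0 < e -> exists2 r : R, 0 < r &
  forall h, normc h < r -> normc (f (s + h) - f s - d * h) <= e * normc h.

Lemma is_derive_cdiff f s d : is_derive (s : Cplx R) (1 : Cplx R) f d <-> cdiff f s d.
Proof.
split.
  move=> [dv dE] e e0.
  have : (h : Cplx R)^-1 *: (f (h *: (1 : Cplx R) + s) - f s) @[h --> (0 : Cplx R)^'] --> (d : Cplx R).
    by rewrite -dE; exact: dv.
  move=> /cvgr_dist_le => /(_ (e%:C)%C); rewrite ltcR => /(_ e0).
  move=> /dnbhs_complexP[r r0 rP]; exists r => // h hr.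
  have [->|h0] := eqVneq h 0; first by rewrite addr0 mulr0 subrr subr0 normc0 mulr0.
  have := rP h; rewrite subr0 => /(_ hr h0).
  rewrite normr_normc lecR => le1.
  rewrite -(ler_pM2r (_ : 0 < (normc h)^-1)); last by rewrite invr_gt0 normc_gt0.
  rewrite mulfK ?normc_eq0// -normcV -normcM; apply: le_trans le1.
  rewrite normcC scaler1 (addrC h s) mulrBl mulfK//.
  by rewrite mulrC.
move=> fd.
have fc : (h : Cplx R)^-1 *: (f (h *: (1 : Cplx R) + s) - f s) @[h --> (0 : Cplx R)^'] --> (d : Cplx R).
  apply/cvgrPdist_le => -[e b]; rewrite ltcE /= => /andP[/eqP -> e0].
  have [r r0 rP] := fd _ e0.
  apply/dnbhs_complexP; exists r => // h; rewrite subr0 => hr h0.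
  rewrite normr_normc complexr0 lecR.
  rewrite -(ler_pM2r (_ : 0 < normc h)); last by rewrite normc_gt0.
  apply: le_trans (rP _ hr); rewrite -normcM normcC scaler1 (addrC h s).
  rewrite mulrBl [X in _ - X](_ : _ = f (s + h) - f s)//.
  by rewrite /GRing.scale /= mulrAC mulVf// mul1r.
apply: DeriveDef; first by apply/cvg_ex; exists d.
exact: (@cvg_lim (Cplx R)).
Qed.

Lemma derivable_cdiff f s : derivable f (s : Cplx R) (1 : Cplx R) <-> exists d, cdiff f s d.
Proof.
split=> [/derivableP fs|[d /is_derive_cdiff []//]].
by exists ('D_(1 : Cplx R) f (s : Cplx R)); exact/is_derive_cdiff.
Qed.

Lemma cdiff_unique f s d e : cdiff f s d -> cdiff f s e -> d = e.
Proof. by move=> /is_derive_cdiff [_ <-] /is_derive_cdiff [_ <-]. Qed.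

Definition hol f s := exists d, cdiff f s d.

Lemma holP f s : hol f s <-> derivable f (s : Cplx R) (1 : Cplx R).
Proof. by split=> /derivable_cdiff. Qed.

Lemma hol_cst w s : hol (fun=> w) s.
Proof. by apply/holP; exact: derivable_cst. Qed.

Lemma hol_id s : hol id s.
Proof. by apply/holP; exact: derivable_id. Qed.

Lemma holD f g s : hol f s -> hol g s -> hol (fun z => f z + g z) s.
Proof. by move=> /holP fs /holP gs; apply/holP; exact: derivableD. Qed.

Lemma holN f s : hol f s -> hol (fun z => - f z) s.
Proof. by move=> /holP fs; apply/holP; exact: derivableN. Qed.

Lemma holB f g s : hol f s -> hol g s -> hol (fun z => f z - g z) s.
Proof. by move=> /holP fs /holP gs; apply/holP; exact: derivableB. Qed.

Lemma hol_continuous f s : hol f s -> forall e : R, 0 < e ->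
  exists2 r : R, 0 < r & forall w, normc (w - s) < r -> normc (f w - f s) < e.
Proof.
move=> /holP/derivable1_diffP /differentiable_continuous /cvgrPdist_lt fs e e0.
have := fs (e%:C)%C; rewrite ltcR => /(_ e0) /nbhs_complexP[r r0 rP].
by exists r => // w /rP; rewrite normr_normc ltcR normcC.
Qed.

Lemma cdiffM f g s d e : cdiff f s d -> cdiff g s e ->
  cdiff (fun z => f z * g z) s (d * g s + f s * e).
Proof.
move=> fd ge eps eps0.
have p1 (z : R[i]) : 0 < normc z + 1 by rewrite ltr_wpDl ?normc_ge0.
have q0 (z : R[i]) : 0 < eps / 3 / (normc z + 1) by rewrite !divr_gt0.
have q1 (z : R[i]) : normc z * (eps / 3 / (normc z + 1)) <= eps / 3.
  by rewrite mulrA ler_pdivrMr// mulrC ler_wpM2l ?lerDl// ltW// divr_gt0.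
have [r1 r10 r1P] := fd _ (q0 (g s)); have [r3 r30 r3P] := ge _ (q0 (f s)).
have [|r2 r20 r2P] := @hol_continuous g s (ex_intro _ e ge) (Num.min 1 (eps / 3 / (normc d + 1))).
  by rewrite lt_min ltr01 q0.
exists (Num.min r1 (Num.min r2 r3)) => [|h]; first by rewrite !lt_min r10 r20 r30.
rewrite !lt_min => /and3P[hr1 hr2 hr3].
have := r2P (s + h); rewrite (_ : s + h - s = h); last by rewrite addrC addKr.
move=> /(_ hr2); rewrite lt_min => /andP[g1 g2].
(* Three error terms; the radii were chosen to make each at most [eps / 3 * normc h]. *)
rewrite (_ : _ - _ = (f (s + h) - f s - d * h) * g (s + h) +
   (d * h * (g (s + h) - g s) + f s * (g (s + h) - g s - e * h))); last by ring.
have n0 := normc_ge0 h.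
have gs : normc (g (s + h)) <= normc (g s) + 1.
  by rewrite -lerBlDl (le_trans (ler_dist_normc _ _))// ltW.
have h1 : normc ((f (s + h) - f s - d * h) * g (s + h)) <= eps / 3 * normc h.
  rewrite normcM; apply: le_trans (ler_pM (normc_ge0 _) (normc_ge0 _) (r1P _ hr1) gs) _.
  by rewrite mulrAC divfK// gt_eqF.
have h2 : normc (d * h * (g (s + h) - g s)) <= eps / 3 * normc h.
  rewrite !normcM mulrAC ler_wpM2r//.
  have := ler_pM (normc_ge0 d) (normc_ge0 _) (lexx _) (ltW g2); move/le_trans; apply.
  exact: q1.
have h3 : normc (f s * (g (s + h) - g s - e * h)) <= eps / 3 * normc h.
  rewrite normcM; apply: le_trans (ler_wpM2l (normc_ge0 _) (r3P _ hr3)) _.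
  by rewrite mulrA ler_wpM2r.
apply: le_trans (ler_normcD _ _) _; apply: le_trans (lerD h1 (ler_normcD _ _)) _.
apply: le_trans (lerD (lexx _) (lerD h2 h3)) _.
by rewrite le_eqVlt; apply/orP; left; apply/eqP; field.
Qed.

Lemma holM f g s : hol f s -> hol g s -> hol (fun z => f z * g z) s.
Proof. by move=> [d fd] [e ge]; eexists; exact: cdiffM fd ge. Qed.

Lemma holV f s : f s != 0 -> hol f s -> hol (fun z => (f z)^-1) s.
Proof. by move=> fs0 /holP fs; apply/holP; exact: derivableV. Qed.

Lemma eq_hol f g s : f =1 g -> hol f s -> hol g s.
Proof. by move=> /funext ->. Qed.

Lemma holX f n s : hol f s -> hol (fun z => f z ^+ n) s.
Proof.
move=> fs; elim: n => [|n IH].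
  apply: (@eq_hol (fun=> 1) _ _ _ (hol_cst 1 s)).
  by move=> z; rewrite expr0.
by apply: (@eq_hol (fun z => f z * f z ^+ n) _ _ _ (holM fs IH)) => z; rewrite exprS.
Qed.

Lemma hol_sum n (h : nat -> Cplx R -> Cplx R) s : (forall i, hol (h i) s) ->
  hol (fun z => \sum_(i < n) h i z) s.
Proof.
move=> hs; elim: n => [|n IH].
  apply: (@eq_hol (fun=> 0) _ _ _ (hol_cst 0 s)).
  by move=> z; rewrite big_ord0.
apply: (@eq_hol (fun z => (\sum_(i < n) h i z) + h n z) _ _ _ (holD IH (hs n))) => z.
by rewrite big_ord_recr.
Qed.

Lemma hol_comp f g s : hol f s -> hol g (f s) -> hol (fun z => g (f z)) s.
Proof.
move=> /holP/derivable1_diffP fs /holP/derivable1_diffP gs; apply/holP/derivable1_diffP.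
exact: (differentiable_comp fs gs).
Qed.

Lemma near_hol f g s : (\forall z \near (s : Cplx R), f z = g z) -> hol f s -> hol g s.
Proof.
move=> /nbhs_complexP[r0 r00 fg] [d fd]; exists d => e e0; have [r r0' rP] := fd _ e0.
exists (Num.min r r0) => [|h]; first by rewrite lt_min r0'.
rewrite lt_min => /andP[hr hr0]; rewrite -!fg; first exact: rP.
  by rewrite subrr normc0.
by rewrite addrC addKr.
Qed.

Lemma cdiff_cexp s : cdiff (@cexp R) s (cexp s).
Proof.
move=> e e0; set M := normc (cexp s) * (4 * expR 1) + 1.
have M1 : 0 < M by rewrite ltr_wpDl ?mulr_ge0 ?normc_ge0 ?expR_ge0.
exists (Num.min 1 (e / M)) => [|h]; first by rewrite lt_min ltr01 divr_gt0.
rewrite lt_min => /andP[h1 he].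
rewrite cexpD -{2}(mulr1 (cexp s)) -!mulrBr normcM.
apply: le_trans (ler_wpM2l (normc_ge0 _) (cexp_sub1Dx _)) _.
have le1 : expR (normc h) <= expR 1 by rewrite ler_expR ltW.
have le2 : normc (cexp s) * (4 * normc h ^+ 2 * expR (normc h)) <= M * normc h ^+ 2.
  rewrite (_ : _ * _ = (normc (cexp s) * (4 * expR (normc h))) * normc h ^+ 2); last by ring.
  rewrite ler_wpM2r ?sqr_ge0// /M -[leLHS]addr0 lerD// ler_wpM2l ?normc_ge0//.
  by rewrite ler_pM2l.
apply: le_trans le2 _; rewrite expr2 mulrA ler_wpM2r ?normc_ge0//.
by rewrite mulrC -ler_pdivlMr// ltW.
Qed.

Lemma hol_cexp s : hol (@cexp R) s.
Proof. by exists (cexp s); exact: cdiff_cexp. Qed.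

Definition ccont (G : R -> R[i]) (t : R) := forall e, 0 < e -> exists2 r, 0 < r &
  forall u, `|u - t| < r -> normc (G u - G t) < e.

Lemma ccontP (G : R -> R[i]) (t : R) : ccont G t <->
  {for t, continuous (fun x => complex.Re (G x))} /\
  {for t, continuous (fun x => complex.Im (G x))}.
Proof.
split=> [Gt|[/cvgrPdist_lt G1 /cvgrPdist_lt G2] e e0].
  split; apply/cvgrPdist_lt => e e0; have [r r0 rP] := Gt _ e0;
    apply/nbhs_normP; exists r => // u /=; rewrite distrC => /rP; rewrite normcC;
    apply: le_lt_trans.
    by rewrite -ReN -ReD; exact: normc_Re.
  by rewrite -ImN -ImD; exact: normc_Im.
have e2 : 0 < e / 2 by rewrite divr_gt0.
have /nbhs_normP[r1 /= r10 r1P] := G1 _ e2.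
have /nbhs_normP[r2 /= r20 r2P] := G2 _ e2.
exists (Num.min r1 r2) => [|u]; first by rewrite lt_min r10.
rewrite lt_min distrC => /andP[/r1P/= u1 /r2P/= u2].
rewrite normcC (le_lt_trans (normc_leD _))// ReD ReN ImD ImN (splitr e) ltrD//.
Qed.

Lemma hol_line f (a w : R[i]) (t : R) : hol f (a + t%:C%C * w) ->
  ccont (fun x => f (a + x%:C%C * w)) t.
Proof.
move=> /hol_continuous fc e e0; have [r r0 rP] := fc _ e0.
exists (r / (normc w + 1)) => [|u].
  by rewrite divr_gt0// ltr_wpDl ?normc_ge0.
rewrite ltr_pdivlMr ?ltr_wpDl ?normc_ge0// => ur; apply: rP.
rewrite opprD addrACA subrr add0r -mulrBl normcM -rmorphB normcR.
by apply: le_lt_trans ur; rewrite ler_wpM2l// lerDl.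
Qed.

End Holomorphy.

(** * Integrals of complex-valued functions *)

Section Cmeas.
Context d (T : measurableType d) (R : realType).
Implicit Types (D : set T) (f g : T -> R[i]).

Definition cmf D f := measurable_fun D (fun x => complex.Re (f x)) /\
  measurable_fun D (fun x => complex.Im (f x)).

Lemma cmf_cst D (c : R[i]) : cmf D (fun=> c).
Proof. by split; exact: measurable_cst. Qed.

Lemma cmfD D f g : cmf D f -> cmf D g -> cmf D (fun x => f x + g x).
Proof.
move=> [f1 f2] [g1 g2]; split.
  by under eq_fun do rewrite ReD; exact: measurable_funD.
by under eq_fun do rewrite ImD; exact: measurable_funD.
Qed.

Lemma cmfM D f g : cmf D f -> cmf D g -> cmf D (fun x => f x * g x).
Proof.
move=> [f1 f2] [g1 g2]; split.
  by under eq_fun do rewrite ReM; apply: measurable_funB; exact: measurable_funM.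
by under eq_fun do rewrite ImM; apply: measurable_funD; exact: measurable_funM.
Qed.

Lemma cmfZ D (c : R[i]) f : cmf D f -> cmf D (fun x => c * f x).
Proof. by apply: cmfM; exact: cmf_cst. Qed.

Lemma cmfN D f : cmf D f -> cmf D (fun x => - f x).
Proof.
move=> /(cmfZ (-1)); rewrite (_ : (fun x => -1 * f x) = fun x => - f x)//.
by apply/funext => x; rewrite mulN1r.
Qed.

Lemma cmfB D f g : cmf D f -> cmf D g -> cmf D (fun x => f x - g x).
Proof. by move=> mf mg; apply: cmfD => //; exact: cmfN. Qed.

Lemma cmf_real D (h : T -> R) : measurable_fun D h -> cmf D (fun x => (h x)%:C%C).
Proof. by move=> mh; split => //; exact: measurable_cst. Qed.

Lemma cmf_conj D f : cmf D f -> cmf D (fun x => (f x)^*%C).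
Proof.
move=> [f1 f2]; split.
  by rewrite (_ : (fun x => _) = fun x => complex.Re (f x))//; apply/funext => x; case: (f x).
rewrite (_ : (fun x => _) = fun x => - complex.Im (f x)).
  exact: measurableT_comp.
by apply/funext => x; case: (f x).
Qed.

Lemma cmf_normc D f : cmf D f -> measurable_fun D (fun x => normc (f x)).
Proof.
move=> [f1 f2].
rewrite (_ : (fun x => _) = fun x => Num.sqrt (complex.Re (f x) ^+ 2 + complex.Im (f x) ^+ 2)).
  apply: measurableT_comp; first exact: (@continuous_measurable_fun R Num.sqrt (@sqrt_continuous R)).
  by apply: measurable_funD; exact: measurable_funX.
by apply/funext => x; case: (f x).
Qed.

Lemma cmfS D E f : measurable E -> D `<=` E -> cmf E f -> cmf D f.
Proof. by move=> mE DE [f1 f2]; split; [move: f1|move: f2]; apply: measurable_funS. Qed.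

Lemma cmf_sum D (I : Type) (s : seq I) (P : pred I) (h : I -> T -> R[i]) :
  (forall i, cmf D (h i)) -> cmf D (fun x => \sum_(i <- s | P i) h i x).
Proof.
move=> mh; elim: s => [|i s IH].
  by rewrite (_ : (fun x => _) = fun=> 0); [exact: cmf_cst|apply/funext => x; rewrite big_nil].
rewrite (_ : (fun x => _) = if P i then fun x => h i x + \sum_(i <- s | P i) h i x
    else fun x => \sum_(i <- s | P i) h i x); last first.
  by case: ifPn => Pi; apply/funext => x; rewrite big_cons ?Pi// (negbTE Pi).
by case: ifP => // _; exact: cmfD.
Qed.

Lemma cmf_cexp D f : cmf D f -> cmf D (fun x => cexp (f x)).
Proof.
move=> [f1 f2]; split.
  under eq_fun do rewrite Re_cexp.
  apply: measurable_funM; first exact: (measurableT_comp (@measurable_expR R) f1).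
  exact: (measurableT_comp (continuous_measurable_fun (@continuous_cos R)) f2).
under eq_fun do rewrite Im_cexp.
apply: measurable_funM; first exact: (measurableT_comp (@measurable_expR R) f1).
exact: (measurableT_comp (continuous_measurable_fun (@continuous_sin R)) f2).
Qed.

End Cmeas.

Lemma cmf_comp d d' (T : measurableType d) (T' : measurableType d') (R : realType)
  (f : T' -> R[i]) (g : T -> T') :
  measurable_fun setT g -> cmf setT f -> cmf setT (fun x => f (g x)).
Proof. by move=> mg [f1 f2]; split; [exact: (measurableT_comp f1 mg)|exact: (measurableT_comp f2 mg)]. Qed.

Lemma ccont_cmf (R : realType) (D : set R) (G : R -> R[i]) :
  measurable D -> (forall t, ccont G t) -> cmf D G.
Proof.
move=> mD Gc; split; apply: measurable_funTS; apply: continuous_measurable_fun => t;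
  by have /ccontP[] := Gc t.
Qed.

Section Cint.
Context d (T : measurableType d) (R : realType) (mu : {measure set T -> \bar R}).
Implicit Types (D : set T) (f g : T -> R[i]).

Definition cint D f : R[i] :=
  (Rintegral mu D (fun x => complex.Re (f x)) +i* Rintegral mu D (fun x => complex.Im (f x)))%C.

Definition cintegrable D f :=
  mu.-integrable D (fun x => (complex.Re (f x))%:E) /\
  mu.-integrable D (fun x => (complex.Im (f x))%:E).

Lemma cintegrable_cmf D f : cintegrable D f -> cmf D f.
Proof.
by move=> [/integrableP[/measurable_EFinP f1 _] /integrableP[/measurable_EFinP f2 _]].
Qed.

Lemma le_cintegrable D f (g : T -> R) : measurable D -> cmf D f ->
  mu.-integrable D (fun x => (g x)%:E) -> (forall x, D x -> normc (f x) <= g x) ->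
  cintegrable D f.
Proof.
move=> mD [f1 f2] ig fg; split; apply: (le_integrable mD _ _ ig);
  try (by apply/measurable_EFinP); move=> x Dx; rewrite /= lee_fin.
  by rewrite (le_trans (normc_Re _))// (le_trans (fg _ Dx))// ler_norm.
by rewrite (le_trans (normc_Im _))// (le_trans (fg _ Dx))// ler_norm.
Qed.

Lemma integrable_normc D f : measurable D -> cintegrable D f ->
  mu.-integrable D (fun x => (normc (f x))%:E).
Proof.
move=> mD fi; have mf := cintegrable_cmf fi; have [f1 f2] := fi.
have i1 := integrable_abse f1; have i2 := integrable_abse f2.
apply: (le_integrable mD _ _ (integrableD mD i1 i2)).
  by apply/measurable_EFinP; exact: cmf_normc.
move=> x Dx; rewrite /= !lee_fin ger0_norm ?normc_ge0// ger0_norm ?addr_ge0//.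
exact: normc_leD.
Qed.

Lemma cintegrableP D f : measurable D -> cmf D f ->
  (\int[mu]_(x in D) (normc (f x))%:E < +oo)%E -> cintegrable D f.
Proof.
move=> mD mf fi; apply: (@le_cintegrable D f (fun x => normc (f x))) => //.
apply/integrableP; split; first by apply/measurable_EFinP; exact: cmf_normc.
by under eq_integral do rewrite /= ger0_norm ?normc_ge0//.
Qed.

Lemma cintegrable_lty D f : measurable D -> cintegrable D f ->
  (\int[mu]_(x in D) (normc (f x))%:E < +oo)%E.
Proof.
move=> mD /(integrable_normc mD) /integrableP[_].
by under eq_integral do rewrite /= ger0_norm ?normc_ge0//.
Qed.

Lemma eq_cint D f g : (forall x, D x -> f x = g x) -> cint D f = cint D g.
Proof.
move=> fg; congr Complex; apply: eq_Rintegral => x xD; rewrite fg//; exact: set_mem.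
Qed.

Lemma eq_cintegrable D f g : measurable D -> (forall x, D x -> f x = g x) ->
  cintegrable D f -> cintegrable D g.
Proof.
move=> mD fg [f1 f2]; split; [move: f1|move: f2]; apply: eq_integrable => // x xD;
  rewrite fg//; exact: set_mem.
Qed.

Lemma cintegrableD D f g : measurable D -> cintegrable D f -> cintegrable D g ->
  cintegrable D (fun x => f x + g x).
Proof.
move=> mD [f1 f2] [g1 g2]; split.
  rewrite (_ : (fun x => _) = (fun x => (complex.Re (f x))%:E + (complex.Re (g x))%:E)%E).
    exact: integrableD.
  by apply/funext => x; rewrite ReD EFinD.
rewrite (_ : (fun x => _) = (fun x => (complex.Im (f x))%:E + (complex.Im (g x))%:E)%E).
  exact: integrableD.
by apply/funext => x; rewrite ImD EFinD.
Qed.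

Lemma cintD D f g : measurable D -> cintegrable D f -> cintegrable D g ->
  cint D (fun x => f x + g x) = cint D f + cint D g.
Proof.
move=> mD [f1 f2] [g1 g2]; apply: complexP; rewrite ?ReD ?ImD /=.
  by under eq_Rintegral do rewrite ReD; rewrite RintegralD.
by under eq_Rintegral do rewrite ImD; rewrite RintegralD.
Qed.

Lemma cintegrableZ D c f : measurable D -> cintegrable D f ->
  cintegrable D (fun x => c * f x).
Proof.
move=> mD fi; apply: (@le_cintegrable D _ (fun x => normc c * normc (f x))) => //.
- by apply: cmfZ; exact: cintegrable_cmf.
- under eq_fun do rewrite EFinM.
  by apply: integrableZl => //; exact: integrable_normc.
- by move=> x _; rewrite normcM.
Qed.

Lemma cintZ D c f : measurable D -> cintegrable D f ->
  cint D (fun x => c * f x) = c * cint D f.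
Proof.
move=> mD [f1 f2].
have Z (k : R) (h : T -> R) : mu.-integrable D (fun x => (h x)%:E) ->
    mu.-integrable D (fun x => (k * h x)%:E).
  by move=> hi; under eq_fun do rewrite EFinM; exact: integrableZl.
apply: complexP; rewrite ?ReM ?ImM /=.
  by under eq_Rintegral do rewrite ReM; rewrite RintegralB ?RintegralZl//; exact: Z.
by under eq_Rintegral do rewrite ImM; rewrite RintegralD ?RintegralZl//; exact: Z.
Qed.

Lemma cintegrableN D f : measurable D -> cintegrable D f -> cintegrable D (fun x => - f x).
Proof.
move=> mD /(cintegrableZ (-1) mD); apply: eq_cintegrable => // x _.
by rewrite mulN1r.
Qed.

Lemma cintN D f : measurable D -> cintegrable D f -> cint D (fun x => - f x) = - cint D f.
Proof.
move=> mD fi; rewrite -mulN1r -cintZ//; apply: eq_cint => x _.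
by rewrite mulN1r.
Qed.

Lemma cintegrableB D f g : measurable D -> cintegrable D f -> cintegrable D g ->
  cintegrable D (fun x => f x - g x).
Proof. by move=> mD fi gi; apply: cintegrableD => //; exact: cintegrableN. Qed.

Lemma cintB D f g : measurable D -> cintegrable D f -> cintegrable D g ->
  cint D (fun x => f x - g x) = cint D f - cint D g.
Proof. by move=> mD fi gi; rewrite cintD ?cintN//; exact: cintegrableN. Qed.

Lemma cint0 D : cint D (fun=> 0) = 0.
Proof. by congr Complex; rewrite /= /Rintegral integral0. Qed.

Lemma cintegrable0 D : cintegrable D (fun=> 0).
Proof. by split => /=; exact: integrable0. Qed.

Lemma cintegrable_sum D (I : Type) (s : seq I) (P : pred I) (h : I -> T -> R[i]) :
  measurable D -> (forall i, cintegrable D (h i)) ->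
  cintegrable D (fun x => \sum_(i <- s | P i) h i x).
Proof.
move=> mD hi; elim: s => [|i s IH].
  apply: (eq_cintegrable mD) (cintegrable0 D) => x _.
  by rewrite big_nil.
have [Pi|/negbTE Pi] := boolP (P i).
  by apply: (eq_cintegrable mD) (cintegrableD mD (hi i) IH) => x _; rewrite big_cons Pi.
by apply: (eq_cintegrable mD) IH => x _; rewrite big_cons Pi.
Qed.

Lemma cint_sum D (I : Type) (s : seq I) (P : pred I) (h : I -> T -> R[i]) :
  measurable D -> (forall i, cintegrable D (h i)) ->
  cint D (fun x => \sum_(i <- s | P i) h i x) = \sum_(i <- s | P i) cint D (h i).
Proof.
move=> mD hi; elim: s => [|i s IH].
  by rewrite big_nil -[RHS](cint0 D); apply: eq_cint => x _; rewrite big_nil.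
rewrite big_cons -IH.
case: ifP => Pi.
  rewrite -cintD//; last exact: cintegrable_sum.
  by apply: eq_cint => x _; rewrite big_cons Pi.
by apply: eq_cint => x _; rewrite big_cons Pi.
Qed.

Lemma cintegrable_conj D f : cintegrable D f -> cintegrable D (fun x => (f x)^*%C).
Proof.
move=> [f1 f2]; split.
  by rewrite (_ : (fun x => _) = fun x => (complex.Re (f x))%:E)//; apply/funext => x; case: (f x).
rewrite (_ : (fun x => _) = fun x => (- (complex.Im (f x))%:E)%E).
  exact: integrableN.
by apply/funext => x; case: (f x).
Qed.

Lemma cint_conj D f : measurable D -> cintegrable D f ->
  cint D (fun x => (f x)^*%C) = (cint D f)^*%C.
Proof.
move=> mD [f1 f2]; apply: complexP => /=.
  by apply: eq_Rintegral => x _; case: (f x).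
rewrite -mulN1r -RintegralZl//.
by apply: eq_Rintegral => x _; rewrite mulN1r; case: (f x).
Qed.

(** Rotation trick: if [z] is the integral of [f], then [|z|^2] is the integral of
    [Re (conj z * f)], which is at most [|z|] times the integral of [g]. *)
Lemma normc_cint_le D f (g : T -> R) : measurable D -> cmf D f ->
  mu.-integrable D (fun x => (g x)%:E) -> (forall x, D x -> normc (f x) <= g x) ->
  normc (cint D f) <= Rintegral mu D g.
Proof.
move=> mD mf ig fg; have fi := le_cintegrable mD mf ig fg.
have [z0|z0] := eqVneq (cint D f) 0.
  rewrite z0 normc0 Rintegral_ge0// => x Dx.
  by rewrite (le_trans _ (fg _ Dx))// normc_ge0.
set z := cint D f in z0 *.
have nz : 0 < normc z by rewrite normc_gt0.
have : Rintegral mu D (fun x => complex.Re (z^*%C * f x)) <= Rintegral mu D (fun x => normc z * g x).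
  have zi := cintegrableZ (z^*%C) mD fi.
  apply: le_Rintegral => //; [exact: zi.1| |].
    by rewrite /comp; under eq_fun do rewrite EFinM; exact: integrableZl.
  move=> x Dx; rewrite (le_trans (ler_norm _))// (le_trans (normc_Re _))// normcM normc_conj.
  by rewrite ler_pM2l// fg.
rewrite RintegralZl//.
have -> : Rintegral mu D (fun x => complex.Re (z^*%C * f x)) = normc z ^+ 2.
  have -> : Rintegral mu D (fun x => complex.Re (z^*%C * f x)) = complex.Re (cint D (fun x => z^*%C * f x)) by [].
  by rewrite cintZ// -/z mulrC mulc_conj.
by rewrite expr2 ler_pM2l.
Qed.

Lemma normc_cint D f : measurable D -> cintegrable D f ->
  normc (cint D f) <= Rintegral mu D (fun x => normc (f x)).
Proof.
move=> mD fi; apply: normc_cint_le => //; first exact: cintegrable_cmf.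
exact: integrable_normc.
Qed.

(** Convergence is expressed by [normc (f_ n x - f x)], so the real theorem applies to this norm,
    with majorant [2 g] and limit 0. *)
Lemma cint_dominated D (f_ : nat -> T -> R[i]) f (g : T -> R) : measurable D ->
  (forall n, cmf D (f_ n)) -> cmf D f ->
  (forall x, D x -> normc (f_ n x - f x) @[n --> \oo] --> (0 : R)) ->
  mu.-integrable D (fun x => (g x)%:E) -> (forall n x, D x -> normc (f_ n x) <= g x) ->
  cintegrable D f /\ normc (cint D (f_ n) - cint D f) @[n --> \oo] --> (0 : R).
Proof.
move=> mD mf_ mf fcv ig fg.
have fgl x : D x -> normc (f x) <= g x.
  move=> Dx; apply/ler_addgt0Pr => e e0.
  have /cvgrPdist_lt/(_ _ e0)[N _ /(_ N (leqnn N))] := fcv x Dx.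
  rewrite sub0r normrN ger0_norm ?normc_ge0// normcC => lte.
  rewrite -(subrK (f_ N x) (f x)) (le_trans (ler_normcD _ _))// addrC lerD ?fg//.
  exact: ltW.
have fi := le_cintegrable mD mf ig fgl.
have fni n := le_cintegrable mD (mf_ n) ig (fg n).
split => //.
have [||| _ _] := @dominated_convergence _ _ _ mu D mD (fun n x => (normc (f_ n x - f x))%:E)
  (fun=> 0%E) (fun x => ((g x)%:E + (g x)%:E)%E) _ (measurable_cst _) _ (integrableD mD ig ig) _.
- by move=> n; apply/measurable_EFinP; apply: cmf_normc; exact: cmfB.
- apply: aeW => x Dx; apply: cvg_EFin; first by apply: nearW.
  exact: fcv.
- apply: aeW => x n Dx; rewrite /= lee_fin ger0_norm ?normc_ge0//.
  by rewrite (le_trans (ler_normcB _ _))// lerD ?fg ?fgl.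
rewrite integral0 => H.
have : Rintegral mu D (fun x => normc (f_ n x - f x)) @[n --> \oo] --> (0 : R).
  exact: fine_cvg H.
move=> cv0; apply: (squeeze_cvgr _ (cvg_cst 0) cv0).
apply: nearW => n; rewrite normc_ge0 andTb -(cintB mD (fni n) fi).
by apply: normc_cint => //; exact: cintegrableB.
Qed.

End Cint.

Arguments cint : simpl never.

(** * Fubini's theorem for complex-valued integrands *)

Section CFubini.
Context d1 d2 (T1 : measurableType d1) (T2 : measurableType d2) (R : realType).
Variables (m1 : {sigma_finite_measure set T1 -> \bar R})
  (m2 : {sigma_finite_measure set T2 -> \bar R}).
Implicit Type k : T1 * T2 -> R[i].

Lemma cFubini k : cmf setT k ->
  (\int[m1]_x \int[m2]_y (normc (k (x, y)))%:E < +oo)%E ->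
  cint m1 setT (fun x => cint m2 setT (fun y => k (x, y))) =
  cint m2 setT (fun y => cint m1 setT (fun x => k (x, y))).
Proof.
move=> mk kfin; have [k1 k2] := mk.
have [i1 i2] : cintegrable (m1 \x m2)%E setT k.
  apply: cintegrableP => //.
  rewrite fubini_tonelli1//=; first by apply/measurable_EFinP; exact: cmf_normc.
  by move=> x; rewrite lee_fin normc_ge0.
(* Inner integrals enter [Rintegral] through [fine], which changes them only where they are
   infinite, that is, on a null set. *)
have fineF d (T : measurableType d) (m : {measure set T -> \bar R}) (F : T -> \bar R) :
    measurable_fun setT F -> (\forall x \ae m, F x \is a fin_num) ->
    (\int[m]_x (fine (F x))%:E = \int[m]_x F x)%E.
  move=> mF Ffin; apply: ae_eq_integral => //.
    by apply/measurable_EFinP; exact: (measurableT_comp (@fine_measurable R setT measurableT) mF).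
  by apply: filterS Ffin => x Fx _; rewrite fineK.
have F (h : T1 * T2 -> R) : (m1 \x m2)%E.-integrable setT (EFin \o h) ->
    Rintegral m1 setT (fun x => Rintegral m2 setT (fun y => h (x, y))) =
    Rintegral m2 setT (fun y => Rintegral m1 setT (fun x => h (x, y))).
  move=> hi; rewrite /Rintegral; congr fine.
  rewrite (fineF _ _ _ (fun x => \int[m2]_y (h (x, y))%:E)%E).
  - rewrite (fineF _ _ _ (fun y => \int[m1]_x (h (x, y))%:E)%E).
    + exact: (Fubini hi).
    + exact: (measurable_fubini_G hi).
    + by apply: filterS (ae_integrable2 hi) => y; exact: integrable_fin_num.
  - exact: (measurable_fubini_F hi).
  - by apply: filterS (ae_integrable1 hi) => x; exact: integrable_fin_num.
by congr Complex; [exact: (F (fun z => complex.Re (k z)) i1)|exact: (F (fun z => complex.Im (k z)) i2)].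
Qed.

Lemma cmf_cint k : cmf setT k ->
  (\int[m1]_x \int[m2]_y (normc (k (x, y)))%:E < +oo)%E ->
  cmf setT (fun x => cint m2 setT (fun y => k (x, y))).
Proof.
move=> mk kfin; have [k1 k2] := mk.
have [i1 i2] : cintegrable (m1 \x m2)%E setT k.
  apply: cintegrableP => //.
  rewrite fubini_tonelli1//=; first by apply/measurable_EFinP; exact: cmf_normc.
  by move=> x; rewrite lee_fin normc_ge0.
by split; [have := measurable_fubini_F i1|have := measurable_fubini_F i2];
  exact: (measurableT_comp (@fine_measurable R setT measurableT)).
Qed.

End CFubini.

(** * Affine changes of variable *)

Section LebesgueAffine.
Variable R : realType.
Notation mu := (@lebesgue_measure R).

Definition affine (a c : R) (x : measurableTypeR R) : measurableTypeR R := a * x + c.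

Lemma measurable_affine (a c : R) : measurable_fun setT (affine a c).
Proof. by apply: measurable_funD => //; exact: measurable_funM. Qed.

Definition affine_measure (a c : R) : {measure set (measurableTypeR R) -> \bar R} :=
  measure_function_pushforward__canonical__measure_function_Measure mu (measurable_affine a c).

(** By uniqueness of the Lebesgue measure it is enough to compare the two sides on the intervals
    []u, v]]. *)
Lemma lebesgue_measure_affine (a c : R) (A : set (measurableTypeR R)) (a0 : 0 < a) :
  measurable A ->
  mu A = mscale (NngNum (ltW a0)) (affine_measure a c) A.
Proof.
move=> mA; apply: lebesgue_measure_unique => //= _ [[u v] /= uv <-].
rewrite /mscale/= /pushforward /=.
have -> : affine a c @^-1` `]u, v] = `](u - c) / a, (v - c) / a]%classic.
  by apply/seteqP; split=> x /=; rewrite !in_itv/= /affine ltr_pdivrMr// ler_pdivlMr// ltrBlDr lerBrDr mulrC.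
rewrite !lebesgue_measure_itv /= !lte_fin ltr_pM2r ?invr_gt0// ltrD2r.
case: ifP => _; last by rewrite mule0.
rewrite -!EFinB -EFinM; congr EFin; field.
by rewrite gt_eqF.
Qed.

Lemma ge0_integral_affine (a c : R) (f : R -> \bar R) : 0 < a ->
  measurable_fun setT f -> (forall x, 0 <= f x)%E ->
  (\int[mu]_x f x = a%:E * \int[mu]_x f (a * x + c)%R)%E.
Proof.
move=> a0 mf f0.
have := @ge0_integral_pushforward _ _ (measurableTypeR R) (measurableTypeR R) R
  _ (measurable_affine a c) mu setT f measurableT mf (fun x _ => f0 x).
rewrite preimage_setT => /= <-.
rewrite -(@ge0_integral_mscale _ (measurableTypeR R) R (affine_measure a c) setT measurableT (NngNum (ltW a0)) f)//.
by apply: eq_measure_integral => A mA _; exact: lebesgue_measure_affine.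
Qed.

Lemma ge0_integral_shift (c : R) (f : R -> \bar R) :
  measurable_fun setT f -> (forall x, 0 <= f x)%E ->
  (\int[mu]_x f (x + c)%R = \int[mu]_x f x)%E.
Proof.
move=> mf f0; rewrite [RHS](@ge0_integral_affine 1 c)// mul1e.
by apply: eq_integral => x _; rewrite mul1r.
Qed.

Lemma integrable_affine (a c : R) (f : R -> R) : 0 < a ->
  mu.-integrable setT (EFin \o f) -> mu.-integrable setT (fun x => (f (a * x + c))%:E).
Proof.
move=> a0 /integrableP[mf fi].
have mf' : measurable_fun setT f by exact/measurable_EFinP.
apply/integrableP; split.
  by apply/measurable_EFinP; exact: (measurableT_comp (mf' : measurable_fun setT (f : measurableTypeR R -> R)) (measurable_affine a c)).
move: fi; rewrite (@ge0_integral_affine a c)//=; last first.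
  by apply/measurable_EFinP; exact: (measurableT_comp (@normr_measurable R setT) mf').
by rewrite -lte_pdivlMl// mulry gtr0_sg ?invr_gt0// mul1e.
Qed.

Lemma integral_affine (a c : R) (f : R -> R) : 0 < a ->
  mu.-integrable setT (EFin \o f) ->
  (\int[mu]_x (f x)%:E = a%:E * \int[mu]_x (f (a * x + c)%R)%:E)%E.
Proof.
move=> a0 fi; have gi := integrable_affine c a0 fi; have mf := measurable_int _ fi.
rewrite [in LHS]integralE [in RHS]integralE.
rewrite muleBr//; last first.
  rewrite fin_num_adde_defl//.
  by rewrite fin_numN; exact: integrable_neg_fin_num.
have mf' : measurable_fun [set: R] (EFin \o f) by [].
congr (_ - _)%E.
  apply: etrans (@ge0_integral_affine a c (EFin \o f)^\+%E a0 (measurable_funepos mf') (fun x => funepos_ge0 _ x)) _.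
    by congr (_ * _)%E; apply: eq_integral => x _; rewrite !funeposE.
apply: etrans (@ge0_integral_affine a c (EFin \o f)^\-%E a0 (measurable_funeneg mf') (fun x => funeneg_ge0 _ x)) _.
  by congr (_ * _)%E; apply: eq_integral => x _; rewrite !funenegE.
Qed.

Lemma cintegrable_affine (a c : R) (f : R -> R[i]) : 0 < a ->
  cintegrable mu setT f -> cintegrable mu setT (fun x => f (a * x + c)).
Proof.
by move=> a0 [f1 f2]; split; [exact: (integrable_affine c a0 f1)|exact: (integrable_affine c a0 f2)].
Qed.

Lemma cint_affine (a c : R) (f : R -> R[i]) : 0 < a -> cintegrable mu setT f ->
  cint mu setT f = a%:C%C * cint mu setT (fun x => f (a * x + c)).
Proof.
move=> a0 [f1 f2]; have [g1 g2] := cintegrable_affine c a0 (conj f1 f2).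
by apply: complexP; rewrite ?ReM ?ImM /= mul0r ?subr0 ?addr0 /Rintegral
  (@integral_affine a c)// fineM//; exact: integrable_fin_num.
Qed.

Lemma cintegrable_shift (c : R) (f : R -> R[i]) :
  cintegrable mu setT f -> cintegrable mu setT (fun x => f (x + c)).
Proof.
move=> /(cintegrable_affine c ltr01); apply: eq_cintegrable => // x _.
by rewrite mul1r.
Qed.

Lemma cint_shift (c : R) (f : R -> R[i]) : cintegrable mu setT f ->
  cint mu setT (fun x => f (x + c)) = cint mu setT f.
Proof.
move=> fi; rewrite (cint_affine c ltr01 fi) mul1r.
by apply: eq_cint => x _; rewrite mul1r.
Qed.

End LebesgueAffine.

(** * Goursat's theorem and contour shifts *)

Section Segment.
Variable R : realType.
Notation mu := (@lebesgue_measure R).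
Implicit Types (G dG : R -> R[i]) (a b : R).

Lemma ccont_cintegrable a b G : (forall t, a <= t <= b -> ccont G t) ->
  cintegrable mu `[a, b] G.
Proof.
move=> Gc.
have W (h : R -> R) : (forall t, a <= t <= b -> {for t, continuous h}) ->
    mu.-integrable `[a, b] (fun t => (h t)%:E).
  move=> hc; apply: continuous_compact_integrable; first exact: segment_compact.
  apply: continuous_in_subspaceT => t; rewrite inE /= in_itv /= => tab.
  exact: hc.
by split; apply: W => t /Gc /ccontP[].
Qed.

Lemma cint_FTC a b G dG : a <= b -> (forall t, cderive G t (dG t)) ->
  (forall t, ccont dG t) -> cint mu `[a, b] dG = G b - G a.
Proof.
rewrite le_eqVlt => /predU1P[-> _ _|ab GP dGc].
  by rewrite subrr set_itv1; congr Complex; rewrite /= Rintegral_set1.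
have W (g dg : R -> R) : (forall t : R, is_derive t 1 g (dg t)) -> continuous dg ->
    Rintegral mu `[a, b] dg = g b - g a.
  move=> gP dgc; rewrite /Rintegral (@continuous_FTC2 _ dg g)//.
  - exact: continuous_subspaceT.
  - have gc : continuous g.
      by move=> t; apply: differentiable_continuous; apply/derivable1_diffP; have [] := gP t.
    split; [by move=> t _; have [] := gP t| |].
      by apply: cvg_at_right_filter; exact: gc.
    by apply: cvg_at_left_filter; exact: gc.
  - by move=> t _; rewrite derive1E; have [_ ->] := gP t.
apply: complexP; rewrite ?ReD ?ImD ?ReN ?ImN /=.
  apply: (W (fun t => complex.Re (G t)) (fun t => complex.Re (dG t))) => t.
    exact: (GP t).1.
  by have /ccontP[] := dGc t.
apply: (W (fun t => complex.Im (G t)) (fun t => complex.Im (dG t))) => t.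
  exact: (GP t).2.
by have /ccontP[] := dGc t.
Qed.

Lemma cint_itv_split a c b G : a <= c <= b -> cintegrable mu `[a, b] G ->
  cint mu `[a, b] G = cint mu `[a, c] G + cint mu `[c, b] G.
Proof.
move=> /andP[ac cb] [g1 g2].
have W (h : R -> R) : mu.-integrable `[a, b] (fun t => (h t)%:E) ->
    Rintegral mu `[a, b] h = Rintegral mu `[a, c] h + Rintegral mu `[c, b] h.
  move=> hi; have := @Rintegral_itvB R h (BLeft a) (BRight b) c hi.
  rewrite !bnd_simp => /(_ ac cb) /eqP; rewrite subr_eq => /eqP ->.
  rewrite addrC Rintegral_itv_obnd_cbnd//.
  by apply: integrableS hi => //; apply: subset_itvr; rewrite bnd_simp.
by apply: complexP; rewrite ?ReD ?ImD /=; exact: W.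
Qed.

Lemma normc_cint_itv a b G (M : R) : a <= b -> cmf `[a, b] G ->
  (forall t, a <= t <= b -> normc (G t) <= M) ->
  normc (cint mu `[a, b] G) <= M * (b - a).
Proof.
move=> ab mG GM.
have -> : M * (b - a) = Rintegral mu `[a, b] (fun=> M).
  by rewrite Rintegral_cst//= lebesgue_measure_itv /= lte_fin; case: ltgtP ab => // -> _; rewrite subrr.
apply: normc_cint_le => //.
  have [] // := @ccont_cintegrable a b (fun=> M%:C%C) _.
  by move=> t _ e e0; exists 1 => // u _; rewrite subrr normc0.
Qed.

End Segment.

Section Goursat.
Variable R : realType.
Notation mu := (@lebesgue_measure R).
Implicit Types (f g : R[i] -> R[i]) (a b x y : R).

Lemma dist_le_width (c w u v : R) : c <= u <= c + w -> c <= v <= c + w -> `|u - v| <= w.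
Proof. by move=> /andP[? ?] /andP[? ?]; rewrite ler_norml; apply/andP; split; lra. Qed.

Definition hseg f a b x : R[i] := cint mu `[a, a + x] (fun t => f (t +i* b)%C).

Definition vseg f a b y : R[i] := 'i%C * cint mu `[b, b + y] (fun t => f (a +i* t)%C).

(** Counterclockwise contour integral around the rectangle with lower left corner [a + i b] and side
    lengths [x] and [y]. *)
Definition rect f a b x y : R[i] :=
  hseg f a b x + vseg f (a + x) b y - hseg f a (b + y) x - vseg f a b y.

Definition hol_rect f a b x y := forall u v,
  a <= u <= a + x -> b <= v <= b + y -> hol f (u +i* v)%C.

Lemma hol_ccont_h f t b : hol f (t +i* b)%C -> ccont (fun t => f (t +i* b)%C) t.
Proof.
have E (u : R) : (u +i* b)%C = (0 +i* b)%C + u%:C%C * 1.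
  by apply: complexP; rewrite ?ReD ?ImD ?ReM ?ImM /=; ring.
rewrite E => /hol_line H e e0; have [r r0 rP] := H _ e0.
by exists r => // u /rP; rewrite -!E.
Qed.

Lemma hol_ccont_v f a t : hol f (a +i* t)%C -> ccont (fun t => f (a +i* t)%C) t.
Proof.
have E (u : R) : (a +i* u)%C = (a +i* 0)%C + u%:C%C * 'i%C.
  by apply: complexP; rewrite ?ReD ?ImD ?ReM ?ImM /=; ring.
rewrite E => /hol_line H e e0; have [r r0 rP] := H _ e0.
by exists r => // u /rP; rewrite -!E.
Qed.

Lemma rect_split f a b x y : 0 <= x -> 0 <= y -> hol_rect f a b (x + x) (y + y) ->
  rect f a b (x + x) (y + y) = rect f a b x y + rect f (a + x) b x y +
    rect f a (b + y) x y + rect f (a + x) (b + y) x y.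
Proof.
move=> x0 y0 hf.
have H v : b <= v <= b + (y + y) -> hseg f a v (x + x) = hseg f a v x + hseg f (a + x) v x.
  move=> bv; rewrite /hseg addrA (@cint_itv_split _ a (a + x))//.
    by rewrite !lerDl x0.
  by apply: ccont_cintegrable => t; rewrite -addrA => tx; apply: hol_ccont_h; exact: hf.
have V u : a <= u <= a + (x + x) -> vseg f u b (y + y) = vseg f u b y + vseg f u (b + y) y.
  move=> bv; rewrite /vseg addrA (@cint_itv_split _ b (b + y)) ?mulrDr//.
    by rewrite !lerDl y0.
  by apply: ccont_cintegrable => t; rewrite -addrA => ty; apply: hol_ccont_v; exact: hf.
rewrite /rect !H ?V ?addrA; try ring.
all: by rewrite -?addrA ?lexx ?lerD2l ?lerDl ?addr_ge0.
Qed.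

(** Cauchy kernels are singular inside the contour, so the estimates below may only ask for
    regularity on the boundary. *)
Definition on_edge a b x y u v :=
  [/\ a <= u <= a + x, b <= v <= b + y & [\/ u = a, u = a + x, v = b | v = b + y]].

Definition hol_edge f a b x y := forall u v,
  on_edge a b x y u v -> hol f (u +i* v)%C.

Lemma hol_rect_edge f a b x y : hol_rect f a b x y -> hol_edge f a b x y.
Proof. by move=> hf u v []; auto. Qed.

Lemma rect_bound f a b x y (M : R) : 0 <= x -> 0 <= y -> hol_edge f a b x y ->
  (forall u v, on_edge a b x y u v -> normc (f (u +i* v)%C) <= M) ->
  normc (rect f a b x y) <= 2 * M * (x + y).
Proof.
move=> x0 y0 hf fM.
have H v : v = b \/ v = b + y -> normc (hseg f a v x) <= M * x.
  move=> bv; rewrite [X in _ * X](_ : x = a + x - a); last by ring.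
  have on u : a <= u <= a + x -> on_edge a b x y u v.
    by move=> ua; case: bv => ->; split; rewrite ?lexx ?lerDl ?y0//; [constructor 3|constructor 4].
  apply: normc_cint_itv; rewrite ?lerDl//; last by move=> t ta; apply: fM; exact: on.
  apply: (@cintegrable_cmf _ _ _ mu); apply: (@ccont_cintegrable _ a (a + x)) => t ta.
  by apply: hol_ccont_h; apply: hf; exact: on.
have V u : u = a \/ u = a + x -> normc (vseg f u b y) <= M * y.
  move=> bv; rewrite [X in _ * X](_ : y = b + y - b); last by ring.
  have on v : b <= v <= b + y -> on_edge a b x y u v.
    by move=> ua; case: bv => ->; split; rewrite ?lexx ?lerDl ?x0//; [constructor 1|constructor 2].
  rewrite /vseg normcM (_ : normc 'i%C = 1) ?mul1r; last by rewrite /= expr0n add0r expr1n sqrtr1.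
  apply: normc_cint_itv; rewrite ?lerDl//; last by move=> t ta; apply: fM; exact: on.
  apply: (@cintegrable_cmf _ _ _ mu); apply: (@ccont_cintegrable _ b (b + y)) => t ta.
  by apply: hol_ccont_v; apply: hf; exact: on.
rewrite (_ : 2 * M * (x + y) = M * x + M * y + M * x + M * y); last by ring.
rewrite /rect.
have h1 : normc (hseg f a b x) <= M * x by apply: H; left.
have h2 : normc (vseg f (a + x) b y) <= M * y by apply: V; right.
have h3 : normc (hseg f a (b + y) x) <= M * x by apply: H; right.
have h4 : normc (vseg f a b y) <= M * y by apply: V; left.
apply: le_trans (ler_normcB _ _) (lerD _ h4).
apply: le_trans (ler_normcB _ _) (lerD _ h3).
exact: le_trans (ler_normcD _ _) (lerD h1 h2).
Qed.

Lemma rectB f g a b x y : hol_edge f a b x y -> hol_edge g a b x y ->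
  0 <= x -> 0 <= y ->
  rect (fun z => f z - g z) a b x y = rect f a b x y - rect g a b x y.
Proof.
move=> hf hg x0 y0.
have H v : v = b \/ v = b + y ->
    hseg (fun z => f z - g z) a v x = hseg f a v x - hseg g a v x.
  move=> bv.
  have on u : a <= u <= a + x -> on_edge a b x y u v.
    by move=> ua; case: bv => ->; split; rewrite ?lexx ?lerDl ?y0//; [constructor 3|constructor 4].
  rewrite /hseg cintB//; apply: ccont_cintegrable => t ta; apply: hol_ccont_h;
    [apply: hf|apply: hg]; exact: on.
have V u : u = a \/ u = a + x ->
    vseg (fun z => f z - g z) u b y = vseg f u b y - vseg g u b y.
  move=> bv.
  have on v : b <= v <= b + y -> on_edge a b x y u v.
    by move=> ua; case: bv => ->; split; rewrite ?lexx ?lerDl ?x0//; [constructor 1|constructor 2].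
  rewrite /vseg cintB ?mulrBr//; apply: ccont_cintegrable => t ta;
    apply: hol_ccont_v; [apply: hf|apply: hg]; exact: on.
by rewrite /rect !H ?V; try ring; auto.
Qed.

(** An affine function has a quadratic primitive [P], and the increments of [P] along the four sides
    cancel. *)
Lemma rect_affine (c d : R[i]) a b x y : 0 <= x -> 0 <= y ->
  rect (fun z => c + d * z) a b x y = 0.
Proof.
move=> x0 y0; pose P (z : R[i]) : R[i] := c * z + d / 2 * (z * z).
have hP z : hol (fun z => c + d * z : R[i]) z.
  by apply: holD; [exact: hol_cst|apply: holM; [exact: hol_cst|exact: hol_id]].
have cd (w z0 : R[i]) t : cderive (fun t => P (z0 + t%:C%C * w)) t (w * (c + d * (z0 + t%:C%C * w))).
  have L : cderive (fun t => z0 + t%:C%C * w) t w.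
    have := cderiveD (cderive_cst z0 t) (cderiveM (cderive_real t) (cderive_cst w t)).
    by rewrite mulr0 mul1r addr0 add0r.
  have := cderiveD (cderiveZ c L) (cderiveZ (d / 2) (cderiveM L L)).
  rewrite (_ : c * w + _ = w * (c + d * (z0 + t%:C%C * w)))//.
  by field.
have H v : hseg (fun z => c + d * z) a v x = P ((a + x) +i* v)%C - P (a +i* v)%C.
  have E (u : R) : (u +i* v)%C = (0 +i* v)%C + u%:C%C * 1.
    by apply: complexP; rewrite ?ReD ?ImD ?ReM ?ImM /=; ring.
  rewrite /hseg (E (a + x)) (E a) -(cint_FTC (G := fun t => P ((0 +i* v)%C + t%:C%C * 1)) (dG := fun t => 1 * (c + d * ((0 +i* v)%C + t%:C%C * 1)))).
  - by apply: eq_cint => t _; rewrite mul1r E.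
  - by rewrite lerDl.
  - by move=> t; exact: cd.
  - move=> t; apply: (@hol_line _ (fun z => 1 * (c + d * z))).
    by apply: holM; [exact: hol_cst|exact: hP].
have V u : vseg (fun z => c + d * z) u b y = P (u +i* (b + y))%C - P (u +i* b)%C.
  have E (v : R) : (u +i* v)%C = (u +i* 0)%C + v%:C%C * 'i%C.
    by apply: complexP; rewrite ?ReD ?ImD ?ReM ?ImM /=; ring.
  have hc t : ccont (fun t => c + d * ((u +i* 0)%C + t%:C%C * 'i%C)) t.
    by apply: (@hol_line _ (fun z => c + d * z)); exact: hP.
  rewrite /vseg (E (b + y)) (E b) -(cint_FTC (G := fun t => P ((u +i* 0)%C + t%:C%C * 'i%C)) (dG := fun t => 'i%C * (c + d * ((u +i* 0)%C + t%:C%C * 'i%C)))).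
  - rewrite cintZ//; last first.
      by apply: ccont_cintegrable => t _; exact: hc.
    by congr (_ * _); apply: eq_cint => t _; rewrite E.
  - by rewrite lerDl.
  - by move=> t; exact: cd.
  - move=> t; apply: (@hol_line _ (fun z => 'i%C * (c + d * z))).
    by apply: holM; [exact: hol_cst|exact: hP].
rewrite /rect !H !V; ring.
Qed.

(** Subtracting the first order expansion at [p + i q] does not change the contour integral; what
    remains is at most [e (x + y)] on a boundary of length [2 (x + y)]. *)
Lemma goursat_bound f a b x y (p q e : R) (d : R[i]) : 0 <= x -> 0 <= y -> 0 <= e ->
  hol_rect f a b x y -> a <= p <= a + x -> b <= q <= b + y ->
  (forall u v, a <= u <= a + x -> b <= v <= b + y ->
     normc (f (u +i* v)%C - f (p +i* q)%C - d * ((u - p) +i* (v - q))%C) <=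
     e * normc ((u - p) +i* (v - q))%C) ->
  normc (rect f a b x y) <= 2 * e * (x + y) ^+ 2.
Proof.
move=> x0 y0 e0 hf pa qb fe.
pose c := f (p +i* q)%C - d * (p +i* q)%C.
have hA : hol_rect (fun z => c + d * z : R[i]) a b x y.
  by move=> u v _ _; apply: holD; [exact: hol_cst|apply: holM; [exact: hol_cst|exact: hol_id]].
have hB : hol_rect (fun z => f z - (c + d * z) : R[i]) a b x y.
  by move=> u v ua vb; apply: holB; [exact: hf|exact: hA].
rewrite -[rect f _ _ _ _]subr0 -(@rect_affine c d a b x y)// -rectB//; last 2 first.
- exact: hol_rect_edge.
- exact: hol_rect_edge.
rewrite expr2 mulrA -(mulrA 2 e).
apply: rect_bound => //; first exact: hol_rect_edge.
move=> u v [ua vb _].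
rewrite (_ : f _ - _ = f (u +i* v)%C - f (p +i* q)%C - d * ((u - p) +i* (v - q))%C); last first.
  rewrite (_ : ((u - p) +i* (v - q))%C = (u +i* v)%C - (p +i* q)%C)// /c; ring.
apply: le_trans (fe _ _ ua vb) _; rewrite ler_wpM2l// (le_trans (normc_leD _))//=.
exact: lerD (dist_le_width ua pa) (dist_le_width vb qb).
Qed.

(** Otherwise each quarter would contribute less than a fourth of the norm of the whole,
    contradicting [rect_split]. *)
Lemma goursat_step f a b x y : 0 <= x -> 0 <= y -> hol_rect f a b (x + x) (y + y) ->
  exists2 ab : R * R, ((ab.1 = a \/ ab.1 = a + x) /\ (ab.2 = b \/ ab.2 = b + y)) &
    normc (rect f a b (x + x) (y + y)) <= 4 * normc (rect f ab.1 ab.2 x y).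
Proof.
move=> x0 y0 hf; rewrite rect_split//; apply: contrapT => H.
have N (ab : R * R) : (ab.1 = a \/ ab.1 = a + x) /\ (ab.2 = b \/ ab.2 = b + y) ->
    4 * normc (rect f ab.1 ab.2 x y) < normc (rect f a b x y + rect f (a + x) b x y +
    rect f a (b + y) x y + rect f (a + x) (b + y) x y).
  by move=> abP; rewrite ltNge; apply/negP => le4; apply: H; exists ab.
have sum4 (s s1 s2 A B C D : R) : 4 * A < s -> 4 * B < s -> 4 * C < s -> 4 * D < s ->
    s <= s1 + D -> s1 <= s2 + C -> s2 <= A + B -> False.
  by clear; lra.
have n1 := N (a, b) (conj (or_introl erefl) (or_introl erefl)).
have n2 := N (a + x, b) (conj (or_intror erefl) (or_introl erefl)).
have n3 := N (a, b + y) (conj (or_introl erefl) (or_intror erefl)).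
have n4 := N (a + x, b + y) (conj (or_intror erefl) (or_intror erefl)).
have t1 := ler_normcD (rect f a b x y + rect f (a + x) b x y + rect f a (b + y) x y) (rect f (a + x) (b + y) x y).
have t2 := ler_normcD (rect f a b x y + rect f (a + x) b x y) (rect f a (b + y) x y).
have t3 := ler_normcD (rect f a b x y) (rect f (a + x) b x y).
exact: (sum4 _ _ _ _ _ _ _ n1 n2 n3 n4 t1 t2 t3).
Qed.

Theorem goursat f a b x y : 0 <= x -> 0 <= y -> hol_rect f a b x y -> rect f a b x y = 0.
Proof.
move=> x0 y0 hf.
pose X n := x / 2 ^+ n; pose Y n := y / 2 ^+ n.
have X0 n : 0 <= X n by rewrite divr_ge0// exprn_ge0.
have Y0 n : 0 <= Y n by rewrite divr_ge0// exprn_ge0.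
have XS n : X n = X n.+1 + X n.+1.
  by rewrite /X exprS; field; rewrite expf_neq0.
have YS n : Y n = Y n.+1 + Y n.+1.
  by rewrite /Y exprS; field; rewrite expf_neq0.
pose sub (ab : R * R) n := [/\ a <= ab.1, ab.1 + X n <= a + x, b <= ab.2 & ab.2 + Y n <= b + y].
have hsub ab n : sub ab n -> hol_rect f ab.1 ab.2 (X n) (Y n).
  move=> [s1 s2 s3 s4] u v /andP[u1 u2] /andP[v1 v2]; apply: hf.
    by rewrite (le_trans s1)//= (le_trans u2).
  by rewrite (le_trans s3)//= (le_trans v2).
(* The implication under the existential makes the choice total: nothing is promised for rectangles
   that leave the initial one. *)
have step (ab : R * R) n : exists cd : R * R, sub ab n ->
    [/\ sub cd n.+1, ab.1 <= cd.1 & ab.2 <= cd.2] /\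
    [/\ cd.1 + X n.+1 <= ab.1 + X n, cd.2 + Y n.+1 <= ab.2 + Y n &
      normc (rect f ab.1 ab.2 (X n) (Y n)) <= 4 * normc (rect f cd.1 cd.2 (X n.+1) (Y n.+1))].
  have [sab|nsab] := pselect (sub ab n); last by exists ab.
  have := hsub _ _ sab; rewrite XS YS => /(goursat_step (X0 _) (Y0 _)) [cd [c1 c2] cdP].
  exists cd => _; move: sab => [s1 s2 s3 s4]; move: (X0 n.+1) (Y0 n.+1) (XS n) (YS n) => ? ? ? ?.
  split; split => //; try split; try (by case: c1 => ->; lra); by case: c2 => ->; lra.
pose nx (ab : R * R) n := projT1 (cid (step ab n)).
have nxP ab n := projT2 (cid (step ab n)).
pose P := fix P n := if n is m.+1 then nx (P m) m else (a, b).
have subP n : sub (P n) n.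
  elim: n => [|n IH]; first by rewrite /sub /X /Y expr0 !divr1.
  by have [[]] := nxP (P n) n IH.
have P1 n : (P n).1 <= (P n.+1).1 by have [[]] := nxP (P n) n (subP n).
have P2 n : (P n).2 <= (P n.+1).2 by have [[]] := nxP (P n) n (subP n).
have Q1 n : (P n.+1).1 + X n.+1 <= (P n).1 + X n by have [_ []] := nxP (P n) n (subP n).
have Q2 n : (P n.+1).2 + Y n.+1 <= (P n).2 + Y n by have [_ []] := nxP (P n) n (subP n).
have rP n : normc (rect f a b x y) <= 4 ^+ n * normc (rect f (P n).1 (P n).2 (X n) (Y n)).
  elim: n => [|n IH]; first by rewrite expr0 mul1r /= /X /Y expr0 !divr1.
  apply: le_trans IH _; rewrite exprSr -mulrA ler_wpM2l ?exprn_ge0//.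
  by have [_ []] := nxP (P n) n (subP n).
(* Nested intervals: the supremum of the left ends lies in all of them. *)
have lim (u w : nat -> R) : (forall n, 0 <= w n) -> (forall n, u n <= u n.+1) ->
    (forall n, u n.+1 + w n.+1 <= u n + w n) ->
    exists p : R, forall n, u n <= p <= u n + w n.
  move=> w0 u1 uw.
  have und : {homo u : m n / (m <= n)%N >-> m <= n} by apply/nondecreasing_seqP.
  have uwn : {homo (fun n => u n + w n) : m n / (m <= n)%N >-> n <= m} by apply/nonincreasing_seqP.
  have ub m n : u m <= u n + w n.
    apply: (@le_trans _ _ (u (maxn m n))); first by apply: und; rewrite leq_maxl.
    apply: (@le_trans _ _ (u (maxn m n) + w (maxn m n))); first by rewrite lerDl.
    by apply: uwn; rewrite leq_maxr.
  have hs : has_sup (range u).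
    by split; [exists (u 0%N); exists 0%N|exists (u 0%N + w 0%N) => _ [n _ <-]].
  exists (sup (range u)) => n; apply/andP; split.
    by apply: ub_le_sup; [exact: hs.2|exists n].
  by apply: ge_sup; [exact: hs.1|move=> _ [m _ <-]].
have [p pP] := lim (fun n => (P n).1) X X0 P1 Q1.
have [q qP] := lim (fun n => (P n).2) Y Y0 P2 Q2.
have [d dP] : hol f (p +i* q)%C.
  apply: hf; first by have := pP 0%N; rewrite /= /X expr0 divr1.
  by have := qP 0%N; rewrite /= /Y expr0 divr1.
apply/eqP; rewrite -normc_eq0 eq_le normc_ge0 andbT; apply/ler_addgt0Pl => e e0; rewrite addr0.
have xy0 : 0 <= x + y by rewrite addr_ge0.
(* Makes [e1 * (2 * (x + y) ^+ 2)] at most [e]; the added 1 keeps the denominator positive for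
   degenerate rectangles. *)
pose e1 := e / (2 * (x + y) ^+ 2 + 1).
have D0 : 0 < 2 * (x + y) ^+ 2 + 1 by rewrite ltr_wpDl// mulr_ge0 ?sqr_ge0.
have e10 : 0 < e1 by rewrite divr_gt0.
have [r r0 rP'] := dP _ e10.
have [n nP] : exists n, X n + Y n < r.
  have r10 : 0 < r / (x + y + 1) by rewrite divr_gt0// ltr_wpDl.
  have [n _ /(_ n (leqnn n))] := near_infty_natSinv_expn_lt (PosNum r10).
  rewrite /= => nr; exists n; rewrite /X /Y -mulrDl.
  move: nr; rewrite div1r ltr_pdivlMr ?ltr_wpDl//; apply: le_lt_trans.
  by rewrite mulrC ler_wpM2l ?invr_ge0 ?exprn_ge0// lerDl.
apply: le_trans (rP n) _.
have B := @goursat_bound f (P n).1 (P n).2 (X n) (Y n) p q e1 d (X0 n) (Y0 n) (ltW e10)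
  (hsub _ _ (subP n)) (pP n) (qP n).
have {}B : normc (rect f (P n).1 (P n).2 (X n) (Y n)) <= 2 * e1 * (X n + Y n) ^+ 2.
  apply: B => u v un vn.
  have := rP' ((u - p) +i* (v - q))%C.
  rewrite (_ : (p +i* q)%C + ((u - p) +i* (v - q))%C = (u +i* v)%C); last first.
    by apply: complexP; rewrite /= addrC subrK.
  apply; apply: le_lt_trans (normc_leD _) _ => /=; apply: le_lt_trans nP.
  exact: lerD (dist_le_width un (pP n)) (dist_le_width vn (qP n)).
apply: le_trans (ler_wpM2l (exprn_ge0 n _) B) _ => //.
(* The loss of a factor 4 at each bisection is compensated exactly by the square of the halved
   perimeter. *)
have -> : 4 ^+ n * (2 * e1 * (X n + Y n) ^+ 2) = e1 * (2 * (x + y) ^+ 2).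
  rewrite /X /Y -mulrDl exprMn exprVn -exprM mulnC exprM.
  have -> : (2 : R) ^+ 2 = 4 by ring.
  by field; rewrite expf_neq0.
rewrite /e1 mulrAC ler_pdivrMr// ler_wpM2l ?ltW//.
by rewrite ltrDl.
Qed.

End Goursat.

Lemma ler_cvg_cst (R : realType) (x l : R) (u : nat -> R) : (forall n, x <= u n) ->
  u n @[n --> \oo] --> l -> x <= l.
Proof.
move=> xu ul; rewrite -(cvg_lim _ ul)//; apply: limr_ge; last exact: nearW.
by apply/cvg_ex; exists l.
Qed.

(** * Moving a vertical line of integration *)

Section ContourShift.
Variable R : realType.
Notation mu := (@lebesgue_measure R).

Lemma measurable_expabs (k : R) : measurable_fun setT (fun t : R => expR (- (k * `|t|))).
Proof.
apply: measurableT_comp; first exact: measurable_expR.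
by apply: measurableT_comp => //; apply: measurable_funM => //; exact: measurable_normr.
Qed.

(** By symmetry this is twice an integral over the half line, where the function is the density of
    the exponential law. *)
Lemma integrable_expNabs : mu.-integrable setT (fun t => (expR (- `|t|))%:E).
Proof.
have mf : measurable_fun setT (fun t : R => expR (- `|t|)).
  by have := measurable_expabs 1; under eq_fun do rewrite mul1r.
apply/integrableP; split; first exact/measurable_EFinP.
under eq_integral do rewrite /= ger0_norm ?expR_ge0//.
rewrite ge0_symfun_integralT//; last 2 first.
- by move=> x; apply: continuous_comp; [apply: continuousN; exact: norm_continuous|exact: continuous_expR].
- by move=> x; rewrite /= normrN.
have le1 : (\int[mu]_(x in [set x | (0 <= x)%R]) (expR (- `|x|))%:E <=
    \int[mu]_x (exponential_pdf 1 x)%:E)%E.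
  rewrite integral_mkcond; apply: ge0_le_integral => //.
  - by move=> x _; rewrite patchE; case: ifP => // _; rewrite lee_fin expR_ge0.
  - apply/(measurable_restrictT _ _).1; first by rewrite -set_itvcy; exact: measurable_itv.
    by apply: measurable_funTS; exact/measurable_EFinP.
  - by apply/measurable_EFinP; exact: measurable_exponential_pdf.
  - move=> x _; rewrite /exponential_pdf !patchE.
    rewrite (_ : (x \in `[0, +oo[%classic) = (x \in [set x | 0 <= x])); last first.
      by rewrite set_itvcy.
    by case: ifPn => // /set_mem /= x0; rewrite ger0_norm// mul1r mulN1r.
rewrite integral_exponential_pdf// in le1.
by apply: le_lt_trans (lee_wpmul2l _ le1) _; rewrite ?mule1 ?ltry.
Qed.

Lemma integrable_expabs (k : R) : 0 < k -> mu.-integrable setT (fun t => (expR (- (k * `|t|)))%:E).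
Proof.
move=> k0; have := integrable_affine 0 k0 integrable_expNabs.
by under eq_fun do rewrite addr0 normrM gtr0_norm//.
Qed.

Lemma cint_mkcond (D : set R) (f : R -> R[i]) :
  cint mu D f = cint mu setT (fun x => if x \in D then f x else 0).
Proof.
congr Complex; rewrite Rintegral_mkcond; apply: eq_Rintegral => x _; rewrite patchE.
  by case: ifP.
by case: ifP.
Qed.

Lemma cmf_if (D : set R) (f : R -> R[i]) : measurable D -> cmf setT f ->
  cmf setT (fun x => if x \in D then f x else 0).
Proof.
move=> mD [f1 f2]; split.
  rewrite (_ : (fun x => _) = (fun x => complex.Re (f x)) \_ D).
    by apply/(measurable_restrictT _ mD); exact: measurable_funTS.
  by apply/funext => x; rewrite patchE; case: ifP.
rewrite (_ : (fun x => _) = (fun x => complex.Im (f x)) \_ D).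
  by apply/(measurable_restrictT _ mD); exact: measurable_funTS.
by apply/funext => x; rewrite patchE; case: ifP.
Qed.

Lemma cint_truncated (f : R -> R[i]) : cintegrable mu setT f ->
  normc (cint mu `[- n%:R, n%:R] f - cint mu setT f) @[n --> \oo] --> (0 : R).
Proof.
move=> fi; have mf := cintegrable_cmf fi.
under eq_fun do rewrite cint_mkcond.
have [] // := @cint_dominated _ _ _ mu setT
  (fun n x => if x \in `[- n%:R, n%:R]%classic then f x else 0) f (fun x => normc (f x)).
- by move=> n; apply: cmf_if.
- move=> x _; apply: cvg_near_cst.
  near=> n; rewrite ifT ?subrr ?normc0// inE /= in_itv /= -ler_norml.
  near: n; exact: nbhs_infty_ger.
- exact: integrable_normc.
- by move=> n x _; case: ifP => //; rewrite normc0 normc_ge0.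
Unshelve. all: end_near. Qed.

Lemma cvg_expRN : expR (- (n%:R : R)) @[n --> \oo] --> (0 : R).
Proof.
apply: (cvg_comp (fun n => n%:R : R) (fun x => expR (- x))); first exact: cvgr_idn.
exact: cvgr_expR.
Qed.

(** Goursat on the rectangles [[a, b] x [-n, n]]: the horizontal sides contribute at most
    [C e^-n (b - a)] each and disappear in the limit. *)
Theorem contour_shift (a b C : R) (f : R[i] -> R[i]) : a <= b ->
  (forall s, a <= complex.Re s <= b -> hol f s) ->
  (forall s, a <= complex.Re s <= b -> normc (f s) <= C * expR (- `|complex.Im s|)) ->
  [/\ cintegrable mu setT (fun t => f (a +i* t)%C),
      cintegrable mu setT (fun t => f (b +i* t)%C) &
      cint mu setT (fun t => f (a +i* t)%C) = cint mu setT (fun t => f (b +i* t)%C)].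
Proof.
move=> ab hf fC.
have ic : mu.-integrable setT (fun t => (C * expR (- `|t|))%:E).
  by under eq_fun do rewrite EFinM; apply: integrableZl => //; exact: integrable_expNabs.
have I (u : R) : a <= u <= b -> cintegrable mu setT (fun t => f (u +i* t)%C).
  move=> ub; apply: (le_cintegrable _ _ ic) => //.
    by apply: ccont_cmf => // t; apply: hol_ccont_v; exact: hf.
  by move=> t _; exact: fC.
have Ia : cintegrable mu setT (fun t => f (a +i* t)%C) by apply: I; rewrite lexx.
have Ib : cintegrable mu setT (fun t => f (b +i* t)%C) by apply: I; rewrite lexx ab.
split => //.
have C0 : 0 <= C.
  have := le_trans (normc_ge0 _) (fC (a +i* 0)%C _); rewrite /= lexx normr0 oppr0 expR0 mulr1; exact.
have ta := cint_truncated Ia; have tb := cint_truncated Ib.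
set A := cint mu setT (fun t => f (a +i* t)%C) in ta *.
set B := cint mu setT (fun t => f (b +i* t)%C) in tb *.
suff : normc (A - B) <= 0.
  rewrite le_eqVlt ltNge normc_ge0 orbF normc_eq0 subr_eq0 => /eqP; exact: id.
pose w (n : nat) : R := 2 * (C * expR (- n%:R) * (b - a)).
have wn : w n @[n --> \oo] --> (0 : R).
  rewrite (_ : w = fun n => 2 * C * (b - a) * expR (- n%:R)); last first.
    by apply/funext => n; rewrite /w; ring.
  rewrite -(mulr0 (2 * C * (b - a))); apply: cvgM; [exact: cvg_cst|exact: cvg_expRN].
pose An (n : nat) := cint mu `[- n%:R, n%:R] (fun t => f (a +i* t)%C).
pose Bn (n : nat) := cint mu `[- n%:R, n%:R] (fun t => f (b +i* t)%C).
have cv : normc (An n - A) + normc (Bn n - B) + w n @[n --> \oo] --> (0 + 0 + 0 : R).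
  by apply: cvgD wn; exact: cvgD ta tb.
rewrite !addr0 in cv; apply: ler_cvg_cst cv => n.
have n0 : 0 <= n%:R :> R by [].
have hw v : `|v| = n%:R -> normc (hseg f a v (b - a)) <= C * expR (- n%:R) * (b - a).
  move=> vn; rewrite [X in _ * X](_ : b - a = a + (b - a) - a); last by ring.
  apply: normc_cint_itv; first by rewrite lerDl subr_ge0.
    apply: (@cintegrable_cmf _ _ _ mu); apply: (@ccont_cintegrable _ a (a + (b - a))) => t ta'.
    by apply: hol_ccont_h; apply: hf => /=; rewrite addrC subrK in ta'.
  move=> t; rewrite addrC subrK => tab.
  by apply: le_trans (fC _ _) _ => //=; rewrite vn.
have : rect f a (- n%:R) (b - a) (n%:R + n%:R) = 0.
  apply: goursat; rewrite ?subr_ge0 ?addr_ge0// => u v; rewrite (addrC a) subrK => uab _.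
  exact: hf.
have e1 : - n%:R + (n%:R + n%:R) = n%:R :> R by rewrite addrA addNr add0r.
have e2 : a + (b - a) = b by rewrite addrC subrK.
rewrite /rect /vseg e1 e2 -/(An n) -/(Bn n) => rect0.
have i1 : normc ('i%C : R[i]) = 1 by rewrite /= expr0n add0r expr1n sqrtr1.
have : normc (An n - Bn n) <= w n.
  rewrite -[leLHS]mul1r -{1}i1 -normcM mulrBr.
  have -> : 'i%C * An n - 'i%C * Bn n = hseg f a (- n%:R) (b - a) - hseg f a n%:R (b - a).
    by apply/eqP; rewrite -subr_eq0; apply/eqP; rewrite -[RHS]oppr0 -rect0; ring.
  rewrite /w mulr2n mulrDl mul1r; apply: le_trans (ler_normcB _ _) _.
  by apply: lerD; apply: hw; rewrite ?normrN ger0_norm.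
have -> : A - B = (Bn n - B) - (An n - A) + (An n - Bn n) by ring.
move=> le1; apply: le_trans (ler_normcD _ _) (lerD _ le1).
by rewrite (addrC (normc (An n - A))); exact: ler_normcB.
Qed.

End ContourShift.

Lemma conjcM (R : realType) (z w : R[i]) : ((z * w)^* = z^* * w^*)%C.
Proof. by case: z => a b; case: w => c d; apply: complexP => /=; ring. Qed.

Lemma conjc_realM (R : realType) (x : R) (z : R[i]) : ((x%:C * z)^* = x%:C * z^*)%C.
Proof. by case: z => a b; apply: complexP => /=; ring. Qed.

(** * Gaussians and the Plancherel inequality *)

Section Gauss.
Variable R : realType.
Notation mu := (@lebesgue_measure R).

Definition gauss (x : R) : R := expR (- (x ^+ 2 / 2)).

Lemma gauss_gt0 x : 0 < gauss x. Proof. exact: expR_gt0. Qed.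

Lemma gauss_ge0 x : 0 <= gauss x. Proof. exact: expR_ge0. Qed.

Lemma gaussN x : gauss (- x) = gauss x. Proof. by rewrite /gauss sqrrN. Qed.

Lemma gauss_le_exp (k x : R) : gauss x <= expR ((k + 1) ^+ 2 / 2) * expR (- (k + 1) * `|x|).
Proof.
rewrite -expRD ler_expR -subr_ge0.
have -> : (k + 1) ^+ 2 / 2 + - (k + 1) * `|x| - - (x ^+ 2 / 2) = (`|x| - (k + 1)) ^+ 2 / 2.
  by rewrite -(real_normK (num_real x)); field.
by rewrite divr_ge0// sqr_ge0.
Qed.

Lemma expabs_gauss_le (k x : R) :
  expR (k * `|x|) * gauss x <= expR ((k + 1) ^+ 2 / 2) * expR (- `|x|).
Proof.
apply: le_trans (ler_wpM2l (expR_ge0 _) (gauss_le_exp k x)) _.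
rewrite mulrCA ler_pM2l ?expR_gt0// -expRD ler_expR le_eqVlt; apply/orP; left; apply/eqP; ring.
Qed.

Lemma measurable_gauss : measurable_fun setT gauss.
Proof.
apply: measurableT_comp; first exact: measurable_expR.
apply: measurableT_comp => //; apply: measurable_funM => //; exact: measurable_funX.
Qed.

Lemma integrable_expabs_gauss (k : R) :
  mu.-integrable setT (fun x => (expR (k * `|x|) * gauss x)%:E).
Proof.
have ic : mu.-integrable setT (fun x => (expR ((k + 1) ^+ 2 / 2) * expR (- `|x|))%:E).
  by under eq_fun do rewrite EFinM; apply: integrableZl => //; exact: integrable_expNabs.
apply: (le_integrable measurableT _ _ ic).
  apply/measurable_EFinP; apply: measurable_funM; last exact: measurable_gauss.
  by have := measurable_expabs (- k); under eq_fun do rewrite mulNr opprK.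
move=> x _ /=; rewrite lee_fin [leLHS]ger0_norm ?[leRHS]ger0_norm ?mulr_ge0 ?expR_ge0//.
exact: expabs_gauss_le.
Qed.

Lemma integrable_gauss : mu.-integrable setT (fun x => (gauss x)%:E).
Proof.
by have := integrable_expabs_gauss 0; under eq_fun do rewrite mul0r expR0 mul1r.
Qed.

(** This is the square root of [2 pi]; the arguments rely on its being finite and positive. *)
Definition gaussI : R := Rintegral mu setT gauss.

Lemma gaussIE : (\int[mu]_x (gauss x)%:E = gaussI%:E)%E.
Proof. by rewrite fineK//; exact: integrable_fin_num integrable_gauss. Qed.

Lemma gaussI_ge0 : 0 <= gaussI.
Proof. by apply: Rintegral_ge0 => x _; exact: gauss_ge0. Qed.

Lemma gaussI_gt0 : 0 < gaussI.
Proof.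
rewrite lt_neqAle gaussI_ge0 andbT eq_sym; apply/eqP => I0.
have := gaussIE; rewrite I0 => i0.
have : (\int[mu]_(x in `[0%R, 1%R]) (gauss 1)%:E <= 0)%E.
  rewrite -[leRHS]i0 integral_mkcond; apply: ge0_le_integral => //.
  - by move=> x _; rewrite patchE; case: ifP => // _; rewrite lee_fin gauss_ge0.
  - by apply/(measurable_restrictT _ _).1 => //; exact: measurable_cst.
  - by apply/measurable_EFinP; exact: measurable_gauss.
  - move=> x _; rewrite patchE; case: ifPn => [/set_mem /=|_]; last by rewrite lee_fin gauss_ge0.
    rewrite in_itv /= => /andP[x0 x1]; rewrite lee_fin ler_expR lerN2 ler_pM2r ?invr_gt0//.
    by rewrite ler_sqr ?nnegrE.
rewrite integral_cst//= lebesgue_measure_itv /= lte_fin ltr01 -EFinB -EFinM lee_fin subr0 mulr1.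
by rewrite leNgt gauss_gt0.
Qed.

Lemma cint_gauss : cint mu setT (fun x => (gauss x)%:C%C) = gaussI%:C%C.
Proof. by congr Complex; rewrite /= /Rintegral integral0. Qed.

Lemma cintegrable_real (h : R -> R) : mu.-integrable setT (fun x => (h x)%:E) ->
  cintegrable mu setT (fun x => (h x)%:C%C).
Proof. by move=> hi; split => //=; exact: integrable0. Qed.

Definition expi (x : R) : R[i] := cexp (0 +i* x)%C.

Lemma normc_expi x : normc (expi x) = 1.
Proof. by rewrite normc_cexp /= expR0. Qed.

Lemma expiD x y : expi (x + y) = expi x * expi y.
Proof. by rewrite /expi -cexpD; congr cexp; apply: complexP; rewrite ?ReD ?ImD /= ?addr0. Qed.

Lemma expi_conj x : (expi x)^*%C = expi (- x).
Proof. by rewrite /expi -cexp_conj. Qed.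

Lemma expi0 : expi 0 = 1. Proof. exact: cexp0. Qed.

Lemma cmf_expi d (T : measurableType d) (D : set T) (h : T -> R) : measurable_fun D h ->
  cmf D (fun x => expi (h x)).
Proof. by move=> mh; apply: cmf_cexp; split => //=; exact: measurable_cst. Qed.

Lemma cintegrable_gauss_expi (xi : R) :
  cintegrable mu setT (fun t => (gauss t)%:C%C * expi (xi * t)).
Proof.
apply: (le_cintegrable _ _ integrable_gauss) => //.
  apply: cmfM; first by apply: cmf_real; exact: measurable_gauss.
  by apply: cmf_expi; exact: measurable_funM.
by move=> t _; rewrite normcM normc_expi mulr1 normcR ger0_norm ?gauss_ge0.
Qed.

(** The entire function [exp (s^2 / 2)] is [gauss t] on [Re s = 0] and
    [e^(xi^2 / 2) gauss t e^(i xi t)] on [Re s = xi]; its integrals over the two lines agree by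
    [contour_shift]. *)
Lemma gauss_ft_ge0 (xi : R) : 0 <= xi ->
  cint mu setT (fun t => (gauss t)%:C%C * expi (xi * t)) = (gaussI * gauss xi)%:C%C.
Proof.
move=> xi0.
have E (u t : R) : cexp ((u +i* t)%C * (u +i* t)%C / 2%:C%C) =
    (expR (u ^+ 2 / 2))%:C%C * ((gauss t)%:C%C * expi (u * t)).
  rewrite -!cexpR /expi -!cexpD; congr cexp; rewrite -[2%:C%C]/((2 : R)%:C%C) -fmorphV.
  by apply: complexP; rewrite ?ReD ?ImD ?ReM ?ImM /=; field.
have [||_ I2] := @contour_shift R 0 xi (expR (xi ^+ 2 / 2 + 1)) (fun s => cexp (s * s / 2%:C%C)) xi0.
- move=> s _; apply: hol_comp; last exact: hol_cexp.
  by apply: holM; [apply: holM; exact: hol_id|exact: hol_cst].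
- case=> u t uxi; have /andP[u0 u1] : 0 <= u <= xi := uxi.
  rewrite E normcM normcM normc_expi mulr1 !normcR (ger0_norm (expR_ge0 _)) (ger0_norm (gauss_ge0 _)).
  rewrite expRD -mulrA; apply: ler_pM; rewrite ?expR_ge0//.
    by rewrite ler_expR ler_pM2r ?invr_gt0// ler_sqr ?nnegrE.
  have := expabs_gauss_le 0 t; rewrite mul0r expR0 mul1r; move/le_trans; apply.
  by rewrite ler_pM2r ?expR_gt0// ler_expR; lra.
have -> : cint mu setT (fun t => cexp ((0 +i* t)%C * (0 +i* t)%C / 2%:C%C)) = gaussI%:C%C.
  rewrite -cint_gauss; apply: eq_cint => t _.
  by rewrite E expr0n /= mul0r expR0 mul0r expi0 mulr1 mul1r.
have -> : cint mu setT (fun t => cexp ((xi +i* t)%C * (xi +i* t)%C / 2%:C%C)) =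
    (expR (xi ^+ 2 / 2))%:C%C * cint mu setT (fun t => (gauss t)%:C%C * expi (xi * t)).
  rewrite -cintZ//; last exact: cintegrable_gauss_expi.
  by apply: eq_cint => t _; rewrite E.
move=> I3; rewrite rmorphM /= I3 mulrAC -rmorphM /= /gauss expRN divff ?mul1r//.
by rewrite gt_eqF// expR_gt0.
Qed.

Lemma gauss_ft (xi : R) :
  cint mu setT (fun t => (gauss t)%:C%C * expi (xi * t)) = (gaussI * gauss xi)%:C%C.
Proof.
have [/gauss_ft_ge0//|xi0] := leP 0 xi.
rewrite -[xi]opprK; set z := - xi; have z0 : 0 <= z by rewrite oppr_ge0 ltW.
rewrite -[LHS]conjcK -cint_conj//; last exact: cintegrable_gauss_expi.
have -> : cint mu setT (fun t => (((gauss t)%:C * expi (- z * t))^*)%C) =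
    cint mu setT (fun t => (gauss t)%:C%C * expi (z * t)).
  apply: eq_cint => t _; apply: etrans (conjc_realM _ _) _; congr (_ * _).
  by apply: etrans (expi_conj _) _; rewrite mulNr opprK.
by rewrite gauss_ft_ge0// gaussN; apply: complexP; rewrite /= ?oppr0 // /z opprK.
Qed.

Lemma gauss_ft_scale (a xi : R) : 0 < a ->
  cint mu setT (fun t => (gauss (a * t))%:C%C * expi (xi * t)) =
  (gaussI / a * gauss (xi / a))%:C%C.
Proof.
move=> a0; have := gauss_ft (xi / a).
rewrite (cint_affine 0 a0); last exact: cintegrable_gauss_expi.
under eq_cint => t _ do rewrite addr0 mulrA divfK ?gt_eqF//.
move=> e; apply: (@mulfI _ (a%:C%C)).
  by rewrite (inj_eq (@complexI R)) gt_eqF.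
rewrite e -rmorphM /=; congr (_%:C)%C; field.
by rewrite gt_eqF.
Qed.

Lemma integral_gauss_scale (a c : R) : 0 < a ->
  (\int[mu]_x (gauss ((x - c) / a))%:E = (a * gaussI)%:E)%E.
Proof.
move=> a0; rewrite (@ge0_integral_affine R a c)//.
- by rewrite EFinM -gaussIE; congr (_ * _)%E; apply: eq_integral => x _; rewrite addrK mulrAC divff ?mul1r ?gt_eqF.
- apply/measurable_EFinP; apply: measurableT_comp; first exact: measurable_gauss.
  by apply: measurable_funM => //; apply: measurable_funB.
- by move=> x; rewrite lee_fin gauss_ge0.
Qed.

(** Gaussian means of width [a_ n] form an approximate identity of mass [gaussI]. The bound
    [a_ n <= 1] gives a majorant independent of [n], and [gauss] absorbs any factor [e^(k |z|)]. *)
Lemma gauss_approx (h : R -> R[i]) (tau M k : R) (a_ : nat -> R) : 0 <= k ->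
  cmf setT h -> ccont h tau -> (forall t, normc (h t) <= M * expR (k * `|t|)) ->
  (forall n, 0 <= a_ n <= 1) -> a_ n @[n --> \oo] --> (0 : R) ->
  normc (cint mu setT (fun z => h (tau + a_ n * z) * (gauss z)%:C%C) - h tau * gaussI%:C%C)
    @[n --> \oo] --> (0 : R).
Proof.
move=> k0 mh ch hM a01 a0.
have -> : h tau * gaussI%:C%C = cint mu setT (fun z => h tau * (gauss z)%:C%C).
  by rewrite cintZ ?cint_gauss//; apply: cintegrable_real; exact: integrable_gauss.
have M0 : 0 <= M.
  by have := le_trans (normc_ge0 _) (hM 0); rewrite normr0 mulr0 expR0 mulr1.
have mg : cmf setT (fun z => (gauss z)%:C%C : R[i]) by apply: cmf_real; exact: measurable_gauss.
have [] // := @cint_dominated _ _ _ mu setT (fun n z => h (tau + a_ n * z) * (gauss z)%:C%C)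
  (fun z => h tau * (gauss z)%:C%C) (fun z => M * expR (k * `|tau|) * (expR (k * `|z|) * gauss z)).
- move=> n; apply: cmfM => //; apply: (@cmf_comp _ _ _ _ _ h) => //.
  by apply: measurable_funD => //; exact: measurable_funM.
- exact: cmfZ.
- move=> z _; apply/cvgrPdist_lt => e e0.
  have ez : 0 < e / (gauss z + 1) by rewrite divr_gt0// ltr_wpDl// gauss_ge0.
  have [r r0 rP] := ch _ ez.
  have rz : 0 < r / (`|z| + 1) by rewrite divr_gt0// ltr_wpDl.
  have /cvgrPdist_lt/(_ _ rz) := a0; apply: filterS => n; rewrite sub0r normrN => an.
  rewrite sub0r normrN ger0_norm ?normc_ge0// -mulrBl normcM normcR ger0_norm ?gauss_ge0//.
  have /rP : `|tau + a_ n * z - tau| < r.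
    rewrite addrAC subrr add0r normrM; move: an; rewrite ltr_pdivlMr ?ltr_wpDl//.
    by apply: le_lt_trans; rewrite ler_wpM2l// lerDl.
  rewrite ltr_pdivlMr ?ltr_wpDl ?gauss_ge0//; apply: le_lt_trans.
  by rewrite ler_wpM2l ?normc_ge0// lerDl.
- under eq_fun do rewrite EFinM; apply: integrableZl => //; exact: integrable_expabs_gauss.
- move=> n z _; rewrite normcM normcR ger0_norm ?gauss_ge0// mulrA ler_wpM2r ?gauss_ge0//.
  apply: le_trans (hM _) _; rewrite -mulrA ler_wpM2l// -expRD ler_expR -mulrDr ler_wpM2l//.
  apply: le_trans (ler_normD _ _) _; rewrite lerD2l normrM.
  by have /andP[an0 an1] := a01 n; rewrite ger0_norm// ler_piMl.
Qed.

End Gauss.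

Arguments normc : simpl never.

Section Fourier.
Variable R : realType.
Notation mu := (@lebesgue_measure R).
Implicit Types (h v : R -> R[i]).

Definition fourier h (t : R) : R[i] := cint mu setT (fun x => h x * expi (- (x * t))).

Lemma cintegrable_expiM h (g : R -> R) : measurable_fun setT g ->
  cintegrable mu setT h -> cintegrable mu setT (fun x => h x * expi (g x)).
Proof.
move=> mg hi; apply: (le_cintegrable _ _ (integrable_normc measurableT hi)) => //.
  by apply: cmfM; [exact: cintegrable_cmf hi|exact: cmf_expi].
by move=> x _; rewrite normcM normc_expi mulr1.
Qed.

Lemma measurable_mulNl (t : R) : measurable_fun setT (fun x : R => - (x * t)).
Proof. by apply: measurableT_comp => //; exact: measurable_funM. Qed.

Lemma normc_ft h t : cintegrable mu setT h ->
  normc (fourier h t) <= Rintegral mu setT (fun x => normc (h x)).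
Proof.
move=> hi; apply: normc_cint_le => //.
- exact: (cintegrable_cmf (cintegrable_expiM (measurable_mulNl t) hi)).
- exact: integrable_normc.
- by move=> x _; rewrite normcM normc_expi mulr1.
Qed.

Lemma ft_kernel h v : cintegrable mu setT h -> cintegrable mu setT v ->
  cmf setT (fun z : R * R => h z.1 * v z.2 * expi (- (z.1 * z.2))) /\
  (\int[mu]_x \int[mu]_y (normc (h x * v y * expi (- (x * y))))%:E < +oo)%E.
Proof.
move=> hi vi; have mh := cintegrable_cmf hi; have mv := cintegrable_cmf vi; split.
  apply: cmfM; first by apply: cmfM; apply: cmf_comp.
  by apply: cmf_expi; apply: measurableT_comp => //; exact: measurable_funM.
have -> : (\int[mu]_x \int[mu]_y (normc (h x * v y * expi (- (x * y))))%:E =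
    \int[mu]_x ((normc (h x))%:E * \int[mu]_y (normc (v y))%:E))%E.
  apply: eq_integral => x _; rewrite -ge0_integralZl//.
  - by apply: eq_integral => y _; rewrite normcM normc_expi mulr1 normcM EFinM.
  - by apply/measurable_EFinP; exact: cmf_normc.
  - by move=> y _; rewrite lee_fin normc_ge0.
  - by rewrite lee_fin normc_ge0.
have fv := cintegrable_lty measurableT vi; have fh := cintegrable_lty measurableT hi.
rewrite ge0_integralZr//.
- rewrite lte_mul_pinfty ?integral_ge0//.
  + by move=> x _; rewrite lee_fin normc_ge0.
  + by rewrite ge0_fin_numE// integral_ge0// => x _; rewrite lee_fin normc_ge0.
- by apply/measurable_EFinP; exact: cmf_normc.
- by move=> x _; rewrite lee_fin normc_ge0.
- by rewrite integral_ge0// => x _; rewrite lee_fin normc_ge0.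
Qed.

(** Fubini gives measurability for kernels integrable on the plane, and [h x * expi (- (x * t))]
    does not decay in [t]. The factor [gauss t] is inserted and divided out again. *)
Lemma cmf_ft h : cintegrable mu setT h -> cmf setT (fourier h).
Proof.
move=> hi; pose k (z : R * R) := h z.2 * expi (- (z.2 * z.1)).
have g1 : cintegrable mu setT (fun x => (gauss x)%:C%C : R[i]).
  by apply: cintegrable_real; exact: integrable_gauss.
have [mk kfin] := ft_kernel g1 hi.
have H := @cmf_cint _ _ _ _ R mu mu _ mk kfin.
rewrite (_ : fourier h = fun t => ((gauss t)^-1)%:C%C * cint mu setT (fun y => (gauss t)%:C%C * h y * expi (- (t * y)))).
  apply: cmfM => //; apply: cmf_real; apply: measurable_funTS.
  rewrite (_ : (fun x => _) = fun x : R => expR (x ^+ 2 / 2)).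
    apply: measurableT_comp; first exact: measurable_expR.
    by apply: measurable_funM => //; exact: measurable_funX.
  by apply/funext => x; rewrite /gauss -expRN opprK.
apply/funext => t.
have -> : (fun y => (gauss t)%:C%C * h y * expi (- (t * y))) =
    (fun y => (gauss t)%:C%C * (h y * expi (- (y * t)))).
  by apply/funext => y; rewrite mulrA (mulrC t).
rewrite cintZ//; last by apply: cintegrable_expiM => //; exact: measurable_mulNl.
by rewrite mulrA -rmorphM /= mulVf ?mul1r// gt_eqF// gauss_gt0.
Qed.

Lemma mul_ft (c : R[i]) h t : cintegrable mu setT h ->
  c * fourier h t = cint mu setT (fun x => c * (h x * expi (- (x * t)))).
Proof.
by move=> hi; rewrite cintZ//; apply: cintegrable_expiM => //; exact: measurable_mulNl.
Qed.

Lemma ft_mul h v : cintegrable mu setT h -> cintegrable mu setT v ->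
  cint mu setT (fun t => fourier h t * v t) = cint mu setT (fun x => h x * fourier v x).
Proof.
move=> hi vi; have [mk kfin] := ft_kernel hi vi.
have F := @cFubini _ _ _ _ R mu mu _ mk kfin; rewrite /= in F.
transitivity (cint mu setT (fun y => cint mu setT (fun x => h x * v y * expi (- (x * y))))).
  apply: eq_cint => t _; rewrite mulrC (mul_ft _ _ hi).
  by apply: eq_cint => y _; rewrite mulrA (mulrC (v t)).
rewrite -F; apply: eq_cint => x _; rewrite (mul_ft _ _ vi).
by apply: eq_cint => y _; rewrite mulrA (mulrC y).
Qed.

Lemma ft_gauss (a x : R) : 0 < a ->
  fourier (fun t => (gauss (a * t))%:C%C * expi (x * t)) =1
  (fun y => (gaussI R / a * gauss ((y - x) / a))%:C%C).
Proof.
move=> a0 y; rewrite -(gaussN (_ / _)) -mulNr opprB -gauss_ft_scale//.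
apply: eq_cint => t _; rewrite -mulrA -expiD; congr (_ * expi _).
by rewrite mulrBl (mulrC y).
Qed.

Lemma cintegrable_gauss_scale (a x : R) : 0 < a ->
  cintegrable mu setT (fun t => (gauss (a * t))%:C%C * expi (x * t)).
Proof.
move=> a0; apply: cintegrable_expiM; first exact: measurable_funM.
have := cintegrable_affine 0 a0 (cintegrable_real (integrable_gauss R)).
by under eq_fun do rewrite addr0.
Qed.

Lemma le_mul_sqr (p q : R) : p * q <= 2^-1 * (p ^+ 2 + q ^+ 2).
Proof. by have := sqr_ge0 (p - q); rewrite -(ler_pM2l (_ : 0 < 2)) //; nra. Qed.

Lemma measurable_integral_r (K : R * R -> R) : measurable_fun setT K ->
  (forall z, 0 <= K z) -> measurable_fun setT (fun x => \int[mu]_y (K (x, y))%:E)%E.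
Proof.
move=> mK K0; have mK' : measurable_fun setT (EFin \o K) by exact/measurable_EFinP.
by apply: (@measurable_fun_fubini_tonelli_F _ _ _ _ R mu (EFin \o K) mK') => z; rewrite lee_fin.
Qed.

(** Write [|ft h|^2 gauss(a t)] as [ft h * v]. The multiplication formula moves the transform onto
    [v], and the transform of [v] is the conjugate of the integral of [h(y) G x y], with [G] a
    symmetric positive Gaussian kernel. Bounding [|h(x) h(y)|] by half the sum of the squares and
    integrating out one variable leaves the mass of [G]. The right-hand side may be infinite. *)
Lemma plancherel_gauss h (a : R) : 0 < a -> cintegrable mu setT h ->
  (\int[mu]_t (normc (fourier h t) ^+ 2 * gauss (a * t))%:E <=
   (gaussI R ^+ 2)%:E * \int[mu]_x (normc (h x) ^+ 2)%:E)%E.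
Proof.
move=> a0 hi; have mh := cintegrable_cmf hi; have mfh := cmf_ft hi.
pose M := Rintegral mu setT (fun x => normc (h x)).
pose v t := (fourier h t)^*%C * (gauss (a * t))%:C%C.
have mg : measurable_fun setT (fun t => gauss (a * t)).
  by apply: measurableT_comp; [exact: measurable_gauss|exact: measurable_funM].
have ig : mu.-integrable setT (fun t => (M * gauss (a * t))%:E).
  under eq_fun do rewrite EFinM; apply: integrableZl => //.
  have := integrable_affine 0 a0 (integrable_gauss R).
  by under eq_fun do rewrite addr0.
have vM t : normc (v t) <= M * gauss (a * t).
  rewrite normcM normc_conj normcR ger0_norm ?gauss_ge0// ler_wpM2r ?gauss_ge0//.
  exact: normc_ft.
have vi : cintegrable mu setT v.
  apply: (le_cintegrable _ _ ig) => //.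
  by apply: cmfM; [exact: cmf_conj|exact: cmf_real].
have mul := ft_mul hi vi.
have E1 : (\int[mu]_t (normc (fourier h t) ^+ 2 * gauss (a * t))%:E =
    (complex.Re (cint mu setT (fun t => fourier h t * v t)))%:E)%E.
  have -> : cint mu setT (fun t => fourier h t * v t) =
      cint mu setT (fun t => (normc (fourier h t) ^+ 2 * gauss (a * t))%:C%C).
    by apply: eq_cint => t _; rewrite /v mulrA mulc_conj -rmorphM.
  rewrite /= /Rintegral fineK// ge0_fin_numE; last first.
    by apply: integral_ge0 => t _; rewrite lee_fin mulr_ge0 ?sqr_ge0 ?gauss_ge0.
  have : mu.-integrable setT (fun t => (M * (M * gauss (a * t)))%:E).
    by under eq_fun do rewrite EFinM; exact: integrableZl.
  move=> /integrable_lty-/(_ measurableT); apply: le_lt_trans.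
  apply: ge0_le_integral => //.
  - by move=> t _; rewrite lee_fin mulr_ge0 ?sqr_ge0 ?gauss_ge0.
  - apply/measurable_EFinP; apply: measurable_funM => //.
    by apply: measurable_funX; exact: cmf_normc.
  - by apply/measurable_EFinP; apply: measurable_funM => //; exact: measurable_funM.
  - move=> t _; rewrite lee_fin expr2 mulrA ler_wpM2r ?gauss_ge0//.
    by rewrite ler_pM ?normc_ge0// normc_ft.
have [G GE] : exists G : R -> R -> R, forall x y, G x y = gaussI R / a * gauss ((y - x) / a).
  by exists (fun x y => gaussI R / a * gauss ((y - x) / a)).
have G0 x y : 0 <= G x y by rewrite GE mulr_ge0 ?gauss_ge0 ?divr_ge0 ?gaussI_ge0 ?ltW.
have mG : measurable_fun setT (fun z : R * R => G z.1 z.2).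
  under eq_fun do rewrite GE.
  apply: measurable_funM => //; apply: measurableT_comp; first exact: measurable_gauss.
  by apply: measurable_funM => //; exact: measurable_funB.
have ggE x y : gauss ((y - x) / a) = gauss ((x - y) / a).
  by rewrite -gaussN -mulNr opprB.
have gle1 x : gauss x <= 1.
  by rewrite -expR0 ler_expR oppr_le0 divr_ge0// sqr_ge0.
have ftv x : fourier v x = (cint mu setT (fun y => h y * (G x y)%:C%C))^*%C.
  have mulx := ft_mul hi (cintegrable_gauss_scale x a0).
  have -> : cint mu setT (fun y => h y * (G x y)%:C%C) =
      cint mu setT (fun t => fourier h t * ((gauss (a * t))%:C%C * expi (x * t))).
    by rewrite mulx; apply: eq_cint => y _; rewrite ft_gauss// GE.
  have Xi : cintegrable mu setT (fun t => fourier h t * ((gauss (a * t))%:C%C * expi (x * t))).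
    apply: (le_cintegrable _ _ ig) => //.
      by apply: cmfM => //; exact: cintegrable_cmf (cintegrable_gauss_scale x a0).
    move=> t _; rewrite normcM normcM normc_expi mulr1 normcR ger0_norm ?gauss_ge0//.
    by rewrite ler_wpM2r ?gauss_ge0//; exact: normc_ft.
  apply: etrans (cint_conj measurableT Xi); apply: eq_cint => t _.
  apply/esym; apply: etrans (conjcM _ _) _; rewrite /v -mulrA; congr (_ * _).
  apply: etrans (conjc_realM _ _) _; congr (_ * _).
  by apply: etrans (expi_conj _) _; rewrite mulrC.
have mGx x : measurable_fun setT (G x).
  rewrite (_ : G x = fun y => gaussI R / a * gauss ((y - x) / a)); last exact/funext.
  apply: measurable_funM => //; apply: measurableT_comp; first exact: measurable_gauss.
  by apply: measurable_funM => //; exact: measurable_funB.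
have hG x : cintegrable mu setT (fun y => h y * (G x y)%:C%C).
  have ic : mu.-integrable setT (fun y => (gaussI R / a * normc (h y))%:E).
    by under eq_fun do rewrite EFinM; apply: integrableZl => //; exact: integrable_normc.
  apply: (le_cintegrable _ _ ic) => //; first exact: (cmfM mh (cmf_real (mGx x))).
  move=> y _; rewrite normcM normcR ger0_norm// mulrC ler_wpM2r ?normc_ge0//.
  by rewrite GE ler_piMr ?gle1// divr_ge0 ?gaussI_ge0// ltW.
have nftv x : ((normc (fourier v x))%:E <= \int[mu]_y (normc (h y) * G x y)%:E)%E.
  rewrite ftv normc_conj; have hGx := hG x.
  apply: (@le_trans _ _ (Rintegral mu setT (fun y => normc (h y * (G x y)%:C%C)))%:E).
    by rewrite lee_fin; exact: normc_cint.
  have -> : (fun y => normc (h y * (G x y)%:C%C)) = (fun y => normc (h y) * G x y).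
    by apply/funext => y; rewrite normcM normcR ger0_norm.
  rewrite fineK// ge0_fin_numE; last first.
    by apply: integral_ge0 => y _; rewrite lee_fin mulr_ge0 ?normc_ge0.
  have := cintegrable_lty measurableT hGx; congr (_ < _)%E; apply: eq_integral => y _.
  by rewrite normcM normcR ger0_norm.
have mK : measurable_fun setT (fun z : R * R => normc (h z.1) * (normc (h z.2) * G z.1 z.2)).
  apply: measurable_funM.
    by apply: (cmf_normc (D := setT)); apply: cmf_comp => //.
  apply: measurable_funM => //.
  by apply: (cmf_normc (D := setT)); apply: cmf_comp => //.
have step1 : (\int[mu]_t (normc (fourier h t) ^+ 2 * gauss (a * t))%:E <=
    \int[mu]_x \int[mu]_y (normc (h x) * (normc (h y) * G x y))%:E)%E.
  rewrite E1 mul.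
  have vb x : normc (fourier v x) <= Rintegral mu setT (fun y => normc (v y)) by exact: normc_ft.
  have hfi : cintegrable mu setT (fun x => h x * fourier v x).
    have ic : mu.-integrable setT
        (fun x => (Rintegral mu setT (fun y => normc (v y)) * normc (h x))%:E).
      by under eq_fun do rewrite EFinM; apply: integrableZl => //; exact: integrable_normc.
    apply: (le_cintegrable _ _ ic) => //; first by apply: cmfM => //; exact: cmf_ft.
    by move=> x _; rewrite normcM mulrC ler_wpM2r ?normc_ge0.
  apply: (@le_trans _ _ (\int[mu]_x (normc (h x * fourier v x))%:E)%E).
    have := normc_cint measurableT hfi; rewrite -lee_fin fineK; last first.
      rewrite ge0_fin_numE; first exact: cintegrable_lty.
      by apply: integral_ge0 => x _; rewrite lee_fin normc_ge0.
    apply: le_trans; rewrite lee_fin (le_trans (ler_norm _))//; exact: normc_Re.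
  apply: ge0_le_integral => //.
  - by move=> x _; rewrite lee_fin normc_ge0.
  - by apply/measurable_EFinP; apply: cmf_normc; exact: cintegrable_cmf hfi.
  - by apply: (measurable_integral_r mK) => z; rewrite !mulr_ge0 ?normc_ge0.
  - move=> x _; rewrite normcM EFinM.
    have -> : (\int[mu]_y (normc (h x) * (normc (h y) * G x y))%:E =
        (normc (h x))%:E * \int[mu]_y (normc (h y) * G x y)%:E)%E.
      rewrite -ge0_integralZl//.
      + by apply/measurable_EFinP; exact: (measurable_funM (cmf_normc mh) (mGx x)).
      + by move=> y _; rewrite lee_fin mulr_ge0 ?normc_ge0.
      + by rewrite lee_fin normc_ge0.
    by rewrite lee_wpmul2l// lee_fin normc_ge0.
apply: le_trans step1 _.
have mh2 : measurable_fun setT (fun x => normc (h x) ^+ 2).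
  by apply: measurable_funX; exact: cmf_normc.
(* The mass of the kernel does not depend on the width [a]: the prefactor [1 / a] cancels the width
   of the Gaussian. *)
have iG x : (\int[mu]_y (G x y)%:E = (gaussI R ^+ 2)%:E)%E.
  under eq_integral do rewrite GE EFinM.
  rewrite ge0_integralZl//.
  - rewrite integral_gauss_scale// -EFinM; congr EFin; field.
    by rewrite gt_eqF.
  - apply/measurable_EFinP; apply: measurableT_comp; first exact: measurable_gauss.
    by apply: measurable_funM => //; exact: measurable_funB.
  - by move=> y _; rewrite lee_fin gauss_ge0.
  - by rewrite lee_fin divr_ge0 ?gaussI_ge0 ?ltW.
have GC x y : G x y = G y x by rewrite !GE ggE.
have mE1 : measurable_fun setT (fun z : R * R => 2^-1 * (normc (h z.1) ^+ 2 * G z.1 z.2)).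
  apply: measurable_funM => //; apply: measurable_funM => //.
  exact: (measurableT_comp mh2 measurable_fst).
have mE2 : measurable_fun setT (fun z : R * R => 2^-1 * (normc (h z.2) ^+ 2 * G z.1 z.2)).
  apply: measurable_funM => //; apply: measurable_funM => //.
  exact: (measurableT_comp mh2 measurable_snd).
have half : (\int[mu]_x \int[mu]_y (2^-1 * (normc (h x) ^+ 2 * G x y))%:E =
    (2^-1)%:E * ((gaussI R ^+ 2)%:E * \int[mu]_x (normc (h x) ^+ 2)%:E))%E.
  rewrite -ge0_integralZl//; last 3 first.
  - exact/measurable_EFinP.
  - by move=> x _; rewrite lee_fin sqr_ge0.
  - by rewrite lee_fin sqr_ge0.
  rewrite -ge0_integralZl//; last 2 first.
  - by apply: emeasurable_funM => //; exact/measurable_EFinP.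
  - by move=> x _; rewrite mule_ge0 ?lee_fin ?sqr_ge0.
  apply: eq_integral => x _.
  transitivity (\int[mu]_y ((2^-1 * normc (h x) ^+ 2)%:E * (G x y)%:E))%E.
    by apply: eq_integral => y _; rewrite -EFinM mulrA.
  rewrite ge0_integralZl//.
  - by rewrite iG -!EFinM -mulrA (mulrC (gaussI R ^+ 2)).
  - by apply/measurable_EFinP; exact: mGx.
  - by move=> y _; rewrite lee_fin.
  - by rewrite lee_fin mulr_ge0 ?invr_ge0 ?sqr_ge0.
have q0 (p x y : R) : 0 <= 2^-1 * (p ^+ 2 * G x y).
  by apply: mulr_ge0; rewrite ?invr_ge0//; apply: mulr_ge0 => //; exact: sqr_ge0.
apply: (@le_trans _ _ (\int[mu]_x \int[mu]_y ((2^-1 * (normc (h x) ^+ 2 * G x y))%:E +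
    (2^-1 * (normc (h y) ^+ 2 * G x y))%:E))%E).
  apply: ge0_le_integral => //.
  - by move=> x _; apply: integral_ge0 => y _; rewrite lee_fin !mulr_ge0 ?normc_ge0.
  - by apply: (measurable_integral_r mK) => z; rewrite !mulr_ge0 ?normc_ge0.
  - apply: (measurable_integral_r (K := fun z => 2^-1 * (normc (h z.1) ^+ 2 * G z.1 z.2) +
      2^-1 * (normc (h z.2) ^+ 2 * G z.1 z.2))).
    + exact: measurable_funD.
    + by move=> z; rewrite addr_ge0// q0.
  - move=> x _; apply: ge0_le_integral => //.
    + by move=> y _; rewrite lee_fin !mulr_ge0 ?normc_ge0.
    + by apply/measurable_EFinP; exact: (measurable_funM (measurable_cst _) (measurable_funM (cmf_normc mh) (mGx x))).
    + by apply/measurable_EFinP; apply: measurable_funD;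
        [exact: (measurable_funM (measurable_cst _) (measurable_funM (measurable_cst _) (mGx x)))|
         exact: (measurable_funM (measurable_cst _) (measurable_funM mh2 (mGx x)))].
    + move=> y _; rewrite lee_fin -mulrDr -mulrDl !mulrA ler_wpM2r//.
      exact: le_mul_sqr.
have split2 x : (\int[mu]_y ((2^-1 * (normc (h x) ^+ 2 * G x y))%:E +
    (2^-1 * (normc (h y) ^+ 2 * G x y))%:E) =
    \int[mu]_y (2^-1 * (normc (h x) ^+ 2 * G x y))%:E +
    \int[mu]_y (2^-1 * (normc (h y) ^+ 2 * G x y))%:E)%E.
  rewrite ge0_integralD//.
  - by move=> y _; rewrite lee_fin q0.
  - by apply/measurable_EFinP; exact: (measurable_funM (measurable_cst _) (measurable_funM (measurable_cst _) (mGx x))).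
  - by move=> y _; rewrite lee_fin q0.
  - by apply/measurable_EFinP; exact: (measurable_funM (measurable_cst _) (measurable_funM mh2 (mGx x))).
under eq_integral do rewrite split2.
rewrite ge0_integralD//; last 4 first.
- by move=> x _; apply: integral_ge0 => y _; rewrite lee_fin q0.
- apply: (measurable_integral_r mE1) => z.
  by rewrite q0.
- by move=> x _; apply: integral_ge0 => y _; rewrite lee_fin q0.
- apply: (measurable_integral_r mE2) => z.
  by rewrite q0.
(* Exchanging the variables, by Tonelli and the symmetry of [G], turns the second half into the
   first. *)
rewrite [X in (_ + X <= _)%E](_ : _ = \int[mu]_x \int[mu]_y (2^-1 * (normc (h x) ^+ 2 * G x y))%:E)%E; last first.
  rewrite (@fubini_tonelli _ _ _ _ R mu mu (EFin \o (fun z => 2^-1 * (normc (h z.2) ^+ 2 * G z.1 z.2))))/=; last 2 first.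
    exact/measurable_EFinP.
    by move=> z; rewrite lee_fin q0.
  by apply: eq_integral => x _; apply: eq_integral => y _; rewrite GC.
rewrite half -ge0_muleDl ?lee_fin ?invr_ge0// -EFinD.
have -> : 2^-1 + 2^-1 = 1 :> R by rewrite [RHS]splitr mul1r.
by rewrite mul1e.
Qed.

Lemma fatou_bound (f_ : nat -> R -> R) (f : R -> R) (C : \bar R) :
  (forall n, measurable_fun setT (f_ n)) -> measurable_fun setT f ->
  (forall n x, 0 <= f_ n x) -> (forall x, 0 <= f x) ->
  (\forall x \ae mu, f_ n x @[n --> \oo] --> f x) ->
  (forall n, \int[mu]_x (f_ n x)%:E <= C)%E -> (\int[mu]_x (f x)%:E <= C)%E.
Proof.
move=> mf_ mf f0_ f0 cv le1.
have mf_' n : measurable_fun setT (EFin \o f_ n) by exact/measurable_EFinP.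
have f0' n x : setT x -> (0 <= (EFin \o f_ n) x)%E by move=> _ /=; rewrite lee_fin.
have F := @fatou _ _ R mu setT measurableT (fun n => EFin \o f_ n) mf_' f0'.
have minf : measurable_fun setT (fun x => limn_einf (fun n => (f_ n x)%:E)).
  apply: (measurableT_comp (f := @oppe R)) => //.
  apply: (measurable_fun_limn_esup (f := fun n x => (- (f_ n x)%:E)%E)) => n.
  under eq_fun do rewrite -EFinN; apply/measurable_EFinP; apply: measurableT_comp => //; exact: mf_.
have inf0 x : (0 <= limn_einf (fun n => (f_ n x)%:E))%E.
  rewrite limn_einf_lim; apply: lime_ge; first exact: is_cvg_einfs.
  by apply: nearW => n; apply: le_ereal_inf_tmp => _ [k /= _ <-]; rewrite lee_fin.
apply: (@le_trans _ _ (\int[mu]_x limn_einf (fun n => (f_ n x)%:E))%E).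
  apply: ae_ge0_le_integral => //.
  - by move=> x _; rewrite lee_fin.
  - exact/measurable_EFinP.
  - case: cv => N [mN N0 sub]; exists N; split => // x nx; apply: sub => fx; apply: nx => _.
    have fx' : (f_ n x)%:E @[n --> \oo] --> (f x)%:E by apply: cvg_EFin => //; exact: nearW.
    by rewrite is_cvg_limn_einfE; [rewrite (cvg_lim _ fx')|apply/cvg_ex; exists (f x)%:E].
apply: le_trans F _; rewrite limn_einf_lim.
apply: lime_le; first exact: is_cvg_einfs.
apply: nearW => n; apply: le_trans (le1 n).
by apply: ereal_inf_lbound; exists n => /=.
Qed.

Lemma cvg_gauss_harmonic (t : R) : gauss (n.+1%:R^-1 * t) @[n --> \oo] --> (1 : R).
Proof.
suff : gauss (n.+1%:R^-1 * t) @[n --> \oo] --> gauss (0 * t).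
  by rewrite [X in _ --> X]/gauss mul0r expr0n /= mul0r oppr0 expR0.
have c : n.+1%:R^-1 * t @[n --> \oo] --> 0 * t.
  by apply: cvgM; [exact: cvg_harmonic|exact: cvg_cst].
have c2 : -((n.+1%:R^-1 * t) ^+ 2 / 2) @[n --> \oo] --> - ((0 * t) ^+ 2 / 2).
  apply: cvgN; apply: cvgM; last exact: cvg_cst.
  by rewrite expr2; under eq_cvg do rewrite expr2; apply: cvgM.
exact: (@continuous_cvg _ R R _ _ _ expR _ (@continuous_expR R _) c2).
Qed.

(** The Gaussian weight of [plancherel_gauss] tends to 1 when its parameter tends to 0, and the
    bound there is uniform, so Fatou applies. Since [gaussI ^+ 2] is [2 pi], the constant is the one
    of Plancherel's identity. *)
Theorem plancherel_le h : cintegrable mu setT h ->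
  (\int[mu]_t (normc (fourier h t) ^+ 2)%:E <=
   (gaussI R ^+ 2)%:E * \int[mu]_x (normc (h x) ^+ 2)%:E)%E.
Proof.
move=> hi; have mfh := cmf_ft hi.
have m2 : measurable_fun setT (fun t => normc (fourier h t) ^+ 2).
  by apply: measurable_funX; exact: cmf_normc.
apply: (@fatou_bound (fun n t => normc (fourier h t) ^+ 2 * gauss (n.+1%:R^-1 * t))) => //.
- move=> n; apply: measurable_funM => //.
  by apply: measurableT_comp; [exact: measurable_gauss|exact: measurable_funM].
- by move=> n t; rewrite mulr_ge0 ?sqr_ge0 ?gauss_ge0.
- by move=> t; rewrite sqr_ge0.
- apply: aeW => t; rewrite -[X in _ --> X]mulr1; apply: cvgM; first exact: cvg_cst.
  exact: cvg_gauss_harmonic.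
- by move=> n; apply: plancherel_gauss => //; rewrite invr_gt0.
Qed.

End Fourier.

Arguments normc : simpl never.

(** * Removing a zero of a holomorphic function *)

Section Cauchy.
Variable R : realType.
Notation mu := (@lebesgue_measure R).
Implicit Types (f g Y : Cplx R -> Cplx R) (z s : R[i]) (a b x y u v : R).

(** The integral along the cut occurs with both signs and cancels whatever [f] does there;
    regularity is needed on the two horizontal sides that are split. *)
Lemma rect_cut_h f a b x1 x2 y : 0 <= x1 -> 0 <= x2 ->
  (forall u v, a <= u <= a + (x1 + x2) -> v = b \/ v = b + y -> hol f (u +i* v)%C) ->
  rect f a b (x1 + x2) y = rect f a b x1 y + rect f (a + x1) b x2 y.
Proof.
move=> x10 x20 hf.
have H v : v = b \/ v = b + y -> hseg f a v (x1 + x2) = hseg f a v x1 + hseg f (a + x1) v x2.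
  move=> bv; rewrite /hseg addrA (@cint_itv_split _ a (a + x1))//.
    by rewrite !lerDl x10.
  by apply: ccont_cintegrable => t; rewrite -addrA => tx; apply: hol_ccont_h; exact: hf.
by rewrite /rect !H ?addrA; [ring|right|left].
Qed.

Lemma rect_cut_v f a b x y1 y2 : 0 <= y1 -> 0 <= y2 ->
  (forall u v, u = a \/ u = a + x -> b <= v <= b + (y1 + y2) -> hol f (u +i* v)%C) ->
  rect f a b x (y1 + y2) = rect f a b x y1 + rect f a (b + y1) x y2.
Proof.
move=> x10 x20 hf.
have H u : u = a \/ u = a + x -> vseg f u b (y1 + y2) = vseg f u b y1 + vseg f u (b + y1) y2.
  move=> bv; rewrite /vseg addrA (@cint_itv_split _ b (b + y1))// ?mulrDr//.
    by rewrite !lerDl x10.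
  by apply: ccont_cintegrable => t; rewrite -addrA => tx; apply: hol_ccont_v; exact: hf.
by rewrite /rect !H; [rewrite (addrA b y1); ring|left|right].
Qed.

Lemma rectZ (c : R[i]) f a b x y : 0 <= x -> 0 <= y -> hol_edge f a b x y ->
  rect (fun z => c * f z) a b x y = c * rect f a b x y.
Proof.
move=> x0 y0 hf.
have H v : v = b \/ v = b + y -> hseg (fun z => c * f z) a v x = c * hseg f a v x.
  move=> bv.
  have on u : a <= u <= a + x -> on_edge a b x y u v.
    by move=> ua; case: bv => ->; split; rewrite ?lexx ?lerDl ?y0//; [constructor 3|constructor 4].
  rewrite /hseg cintZ//; apply: ccont_cintegrable => t ta; apply: hol_ccont_h.
  by apply: hf; exact: on.
have V u : u = a \/ u = a + x -> vseg (fun z => c * f z) u b y = c * vseg f u b y.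
  move=> bv.
  have on v : b <= v <= b + y -> on_edge a b x y u v.
    by move=> ua; case: bv => ->; split; rewrite ?lexx ?lerDl ?x0//; [constructor 1|constructor 2].
  rewrite /vseg cintZ//; first by ring.
  by apply: ccont_cintegrable => t ta; apply: hol_ccont_v; apply: hf; exact: on.
by rewrite /rect !H ?V; try ring; auto.
Qed.

Lemma eq_rect_edge f g a b x y : 0 <= x -> 0 <= y ->
  (forall u v, on_edge a b x y u v -> f (u +i* v)%C = g (u +i* v)%C) ->
  rect f a b x y = rect g a b x y.
Proof.
move=> x0 y0 fg.
have H v : v = b \/ v = b + y -> hseg f a v x = hseg g a v x.
  move=> bv; apply: eq_cint => u /= ua; apply: fg; move: ua; rewrite in_itv /=.
  by move=> ua; case: bv => ->; split; rewrite ?lexx ?lerDl ?y0//; [constructor 3|constructor 4].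
have V u : u = a \/ u = a + x -> vseg f u b y = vseg g u b y.
  move=> bv; rewrite /vseg; congr (_ * _).
  apply: eq_cint => v /= va; apply: fg; move: va; rewrite in_itv /=.
  by move=> ua; case: bv => ->; split; rewrite ?lexx ?lerDl ?x0//; [constructor 1|constructor 2].
by rewrite /rect !H ?V; auto.
Qed.

Notation sq f := (rect f (- 1) (- 1) 2 2).
Notation edge := (on_edge (- 1) (- 1) 2 2).

Lemma edge_norm u v : edge u v -> 1 <= normc (u +i* v)%C.
Proof.
have E : (-1 : R) + 2 = 1 by ring.
move=> [_ _]; rewrite E => -[] ->.
- by apply: le_trans (normc_Re _); rewrite /= normrN normr1.
- by apply: le_trans (normc_Re _); rewrite /= normr1.
- by apply: le_trans (normc_Im _); rewrite /= normrN normr1.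
- by apply: le_trans (normc_Im _); rewrite /= normr1.
Qed.

Lemma edge_sub u v z : edge u v -> normc z <= 2^-1 -> 2^-1 <= normc ((u +i* v)%C - z).
Proof.
move=> /edge_norm e1 z1; have := ler_dist_normc (u +i* v)%C z; lra.
Qed.

Lemma edge_neq u v z : edge u v -> normc z <= 2^-1 -> (u +i* v)%C - z != 0.
Proof.
by move=> e1 z1; rewrite -normc_gt0; apply: lt_le_trans (edge_sub e1 z1); rewrite invr_gt0.
Qed.

(** Four rectangles avoiding [z] are cut off around the small square, and Goursat makes each of
    their contributions vanish. *)
Lemma rect_shrink f z (e : R) : 0 < e -> e <= 2^-1 -> normc z <= 2^-1 ->
  (forall u v, - 1 <= u <= 1 -> - 1 <= v <= 1 -> (u +i* v)%C != z -> hol f (u +i* v)%C) ->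
  sq f = rect f (complex.Re z - e) (complex.Im z - e) (e + e) (e + e).
Proof.
case: z => p q e0 e1 z1 hf; have := normc_Re (p +i* q)%C; have := normc_Im (p +i* q)%C.
rewrite /= => /le_trans/(_ z1); rewrite ler_norml => /andP[q1 q2].
move=> /le_trans/(_ z1); rewrite ler_norml => /andP[p1 p2].
have hp u v : - 1 <= u <= 1 -> - 1 <= v <= 1 -> u != p \/ v != q -> hol f (u +i* v)%C.
  by move=> u1 v1 uv; apply: hf => //; apply/eqP => -[up vq]; case: uv; rewrite ?up ?vq eqxx.
have E : 2 = (p - e + 1) + ((e + e) + (1 - p - e)) by ring.
have F : 2 = (q - e + 1) + ((e + e) + (1 - q - e)) by ring.
rewrite {1}E rect_cut_h; [|lra|lra|]; last first.
  move=> u v; rewrite -E => u1 v1; apply: hp; first (by lra); first by lra.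
  by right; apply/eqP; lra.
rewrite (@rect_cut_h _ _ _ (e + e)); [|lra|lra|]; last first.
  move=> u v u1 v1; apply: hp; first (by lra); first by lra.
  by right; apply/eqP; lra.
rewrite [rect f (-1) _ _ _]goursat; [|lra|lra|]; last first.
  move=> u v u1 v1; apply: hp; [lra|lra|].
  by left; apply/eqP; lra.
rewrite [rect f (-1 + (_ + _) + _) _ _ _]goursat; [|lra|lra|]; last first.
  move=> u v u1 v1; apply: hp; [lra|lra|].
  by left; apply/eqP; lra.
rewrite addr0 add0r (_ : -1 + (p - e + 1) = p - e); last by ring.
rewrite {1}F rect_cut_v; [|lra|lra|]; last first.
  move=> u v u1 v1; apply: hp; [lra|lra|].
  by left; apply/eqP; lra.
rewrite (@rect_cut_v _ _ _ _ (e + e)); [|lra|lra|]; last first.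
  move=> u v u1 v1; apply: hp; [lra|lra|].
  by left; apply/eqP; lra.
rewrite [rect f _ (-1) _ _]goursat; [|lra|lra|]; last first.
  move=> u v u1 v1; apply: hp; [lra|lra|].
  by right; apply/eqP; lra.
rewrite [rect f _ (-1 + (_ + _) + _) _ _]goursat; [|lra|lra|]; last first.
  move=> u v u1 v1; apply: hp; [lra|lra|].
  by right; apply/eqP; lra.
by rewrite addr0 add0r (_ : -1 + (q - e + 1) = q - e)//; ring.
Qed.

(* [sq] integrates along the boundary of [-1, 1]^2.  The value [2 i pi] of
   [cauchy (fun=> 1)] is never computed: only its non-vanishing is used. *)
Definition cauchy f z := sq (fun s => f s / (s - z)).

Lemma hol_edge_div f z : hol_edge f (-1) (-1) 2 2 -> normc z <= 2^-1 ->
  hol_edge (fun s => f s / (s - z)) (-1) (-1) 2 2.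
Proof.
move=> hf z1 u v uv; apply: holM; first exact: hf.
apply: holV; first exact: edge_neq.
by apply: holB; [exact: hol_id|exact: hol_cst].
Qed.

(** The difference of the two sides is the contour integral of [(Y s - Y z) / (s - z)], which is
    bounded near [z] because [Y] is differentiable there; shrinking the square to [z] makes it
    vanish. *)
Lemma cauchy_formula Y z : hol_rect Y (-1) (-1) 2 2 -> normc z <= 2^-1 ->
  cauchy Y z = Y z * cauchy (fun=> 1) z.
Proof.
move=> hY z1; have hYe := hol_rect_edge hY.
have h1 : hol_edge (fun=> 1 : Cplx R) (-1) (-1) 2 2 by move=> u v _; exact: hol_cst.
have hz : hol Y z.
  case: z z1 => p q z1; have := normc_Re (p +i* q)%C; have := normc_Im (p +i* q)%C.
  rewrite /= => /le_trans/(_ z1); rewrite ler_norml => /andP[q1 q2].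
  move=> /le_trans/(_ z1); rewrite ler_norml => /andP[p1 p2].
  by apply: hY; lra.
rewrite /cauchy -rectZ//; [|exact: hol_edge_div]; apply/eqP; rewrite -subr_eq0 -rectB//; last 2 first.
- exact: hol_edge_div.
- by move=> u v uv; apply: holM; [exact: hol_cst|exact: (hol_edge_div h1 z1)].
have [d dP] := hz.
pose g s := Y s / (s - z) - Y z * (1 / (s - z)).
have gz u v : - 1 <= u <= 1 -> - 1 <= v <= 1 -> (u +i* v)%C != z -> hol g (u +i* v)%C.
  move=> u1 v1 uz.
  have i1 : hol (fun s => (s - z)^-1 : Cplx R) (u +i* v)%C.
    apply: holV; first by rewrite subr_eq0.
    by apply: holB; [exact: hol_id|exact: hol_cst].
  apply: holB; apply: holM => //; [|exact: hol_cst|apply: holM => //; exact: hol_cst].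
  by apply: hY; lra.
have [r r0 rP] := dP 1 ltr01.
rewrite -normc_eq0 eq_le normc_ge0 andbT; apply/ler_addgt0Pr => e e0; rewrite add0r.
pose M := normc d + 1; have M0 : 0 < M by rewrite ltr_wpDl ?normc_ge0.
(* [1/2] keeps the small square inside the large one, [r / 4] keeps it where the difference quotient
   is at most [M], and [e / (8 M)] matches its perimeter [8 t]. *)
pose t := Num.min (2^-1) (Num.min (r / 4) (e / (8 * M))).
have t0 : 0 < t by rewrite !lt_min invr_gt0 ltr0n divr_gt0//= divr_gt0 ?mulr_gt0.
have t1 : t <= 2^-1 by rewrite ge_min lexx.
have t2 : t <= r / 4 by rewrite ge_min ge_min lexx orbT.
have t3 : t <= e / (8 * M) by rewrite ge_min ge_min lexx !orbT.
rewrite (@rect_shrink g z t)//.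
apply: le_trans (rect_bound (M := M) _ _ _ _) _; rewrite ?addr_ge0 ?(ltW t0)//; last first.
- move: t3; rewrite ler_pdivlMr ?mulr_gt0// => t3.
  by rewrite (_ : 2 * M * _ = t * (8 * M))//; ring.
- move=> u v [u1 v1 on].
  have uz : (u +i* v)%C - z != 0.
    case: (z) on => p q on; apply/eqP => -[up vq]; move: on; rewrite /=.
    by case => E; lra.
  have -> : g (u +i* v)%C = (Y (u +i* v)%C - Y z) / ((u +i* v)%C - z) by rewrite /g; field.
  have rz : normc ((u +i* v)%C - z) < r.
    apply: le_lt_trans (normc_leD _) _; case: (z) u1 v1 => p q /= /andP[u1 u2] /andP[v1 v2].
    apply: (@le_lt_trans _ _ (t + t)); last by lra.
    by apply: lerD; rewrite ler_norml; apply/andP; split; lra.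
  have := rP ((u +i* v)%C - z) rz; rewrite (addrC z) subrK mul1r => H.
  rewrite normcM normcV ler_pdivrMr ?normc_gt0//.
  rewrite (_ : Y _ - Y z = Y (u +i* v)%C - Y z - d * ((u +i* v)%C - z) + d * ((u +i* v)%C - z)); last by ring.
  by apply: le_trans (ler_normcD _ _) _; rewrite normcM /M mulrDl mul1r addrC lerD2l.
- move=> u v [u1 v1 on].
  have := normc_Re z; have := normc_Im z.
  move=> /le_trans/(_ z1); rewrite ler_norml => /andP[q1 q2].
  move=> /le_trans/(_ z1); rewrite ler_norml => /andP[p1 p2].
  apply: gz; [by lra|by lra|].
  apply/eqP => E; move: on u1 v1; rewrite -E /=.
  by case => E'; lra.
Qed.

(** The resolvent identity [1/(s - z) - 1/(s - w) = (z - w) / ((s - z) (s - w))]. It yields both the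
    derivative of [cauchy f] and the quotient in [divide0]. *)
Lemma cauchy_sub f z w : hol_edge f (-1) (-1) 2 2 -> normc z <= 2^-1 -> normc w <= 2^-1 ->
  cauchy f z - cauchy f w = (z - w) * cauchy (fun s => f s / (s - w)) z.
Proof.
move=> hf z1 w1; rewrite /cauchy -rectB//; last 2 first.
- exact: hol_edge_div.
- exact: hol_edge_div.
rewrite -rectZ//; last by apply: hol_edge_div => //; exact: hol_edge_div.
apply: eq_rect_edge => // u v uv.
have := edge_neq uv z1; have := edge_neq uv w1.
by move: (u +i* v)%C => s sw sz; field; rewrite sw sz.
Qed.

Lemma hol_edge_bounded f : hol_edge f (-1) (-1) 2 2 ->
  exists M : R, forall u v, edge u v -> normc (f (u +i* v)%C) <= M.
Proof.
move=> hf.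
have W (G : R -> R[i]) : (forall t, -1 <= t <= 1 -> ccont G t) ->
    exists M : R, forall t, -1 <= t <= 1 -> normc (G t) <= M.
  move=> Gc.
  have : {within `[-1, 1], continuous (fun t : R => normc (G t))}.
    apply: continuous_in_subspaceT => t; rewrite inE /= in_itv /= => t1.
    apply/(@cvgrPdist_lt _ R) => e e0; have [d d0 dP] := Gc t t1 e e0.
    near=> x.
    have xd : `|x - t| < d by near: x; exact: (cvgr_distC_lt id).
    apply: le_lt_trans (dP x xd); rewrite ler_norml; apply/andP; split.
      by have := ler_dist_normc (G x) (G t); lra.
    by have := ler_dist_normc (G t) (G x); rewrite normcC; lra.
  case/(EVT_max _) => [|c _ cP]; first by lra.
  by exists (normc (G c)) => t t1; apply: cP; rewrite in_itv.
have E : (-1 : R) + 2 = 1 by ring.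
have eH v u : v = -1 \/ v = 1 -> -1 <= u <= 1 -> edge u v.
  by move=> vE u1; rewrite /on_edge E; split => //; case: vE => ->; [lra|lra|constructor 3|constructor 4].
have eV v u : u = -1 \/ u = 1 -> -1 <= v <= 1 -> edge u v.
  by move=> vE u1; rewrite /on_edge E; split => //; case: vE => ->; [lra|lra|constructor 1|constructor 2].
have [M1 M1P] : exists M : R, forall t, -1 <= t <= 1 -> normc (f (t +i* (-1))%C) <= M.
  by apply: W => t t1; apply: hol_ccont_h; apply: hf; apply: eH => //; left.
have [M2 M2P] : exists M : R, forall t, -1 <= t <= 1 -> normc (f (t +i* 1)%C) <= M.
  by apply: W => t t1; apply: hol_ccont_h; apply: hf; apply: eH => //; right.
have [M3 M3P] : exists M : R, forall t, -1 <= t <= 1 -> normc (f ((-1) +i* t)%C) <= M.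
  by apply: W => t t1; apply: hol_ccont_v; apply: hf; apply: eV => //; left.
have [M4 M4P] : exists M : R, forall t, -1 <= t <= 1 -> normc (f (1 +i* t)%C) <= M.
  by apply: W => t t1; apply: hol_ccont_v; apply: hf; apply: eV => //; right.
exists (Num.max (Num.max M1 M2) (Num.max M3 M4)) => u v; rewrite /on_edge E => -[u1 v1].
by case=> ->; rewrite !le_max ?M1P ?M2P ?M3P ?M4P ?orbT.
Unshelve. all: by end_near. Qed.

Lemma hol_cauchy f z : hol_edge f (-1) (-1) 2 2 -> normc z < 2^-1 -> hol (cauchy f) z.
Proof.
move=> hf z1; have [M fM] := hol_edge_bounded hf.
exists (cauchy (fun s => f s / (s - z)) z) => e e0.
have z1' := ltW z1.
have M0 : 0 <= M.
  apply: le_trans (normc_ge0 _) (fM (-1) (-1) _).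
  by split; [lra|lra|constructor 1].
(* The first bound keeps [z + h] in the disc of radius 1/2. In [64 M], the perimeter is 8 and each
   of three Cauchy kernels is at most 2 on the boundary. *)
pose r := Num.min (2^-1 - normc z) (e / (64 * M + 1)).
have r0 : 0 < r by rewrite lt_min subr_gt0 z1 divr_gt0// ltr_wpDl// mulr_ge0.
exists r => // h hr.
have hr1 : normc h < 2^-1 - normc z by apply: lt_le_trans hr _; rewrite ge_min lexx.
have hr2 : normc h <= e / (64 * M + 1) by apply: le_trans (ltW hr) _; rewrite ge_min lexx orbT.
have zh : normc (z + h) <= 2^-1 by apply: le_trans (ler_normcD _ _) _; lra.
rewrite cauchy_sub// (addrC z) addrK (mulrC _ h) -mulrBr (addrC h).
rewrite cauchy_sub//; last exact: hol_edge_div.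
rewrite (addrC z) addrK 2!normcM mulrC ler_wpM2r ?normc_ge0//.
have H : normc (cauchy (fun s => f s / (s - z) / (s - z)) (h + z)) <= 2 * (8 * M) * (2 + 2).
  rewrite addrC; apply: rect_bound => //.
    by apply: hol_edge_div => //; apply: hol_edge_div => //; exact: hol_edge_div.
  move=> u v uv; have := edge_sub uv z1'; have := edge_sub uv zh; have := fM u v uv.
  move: (u +i* v)%C => s sM s1 s2; rewrite !normcM !normcV.
  rewrite (_ : 8 * M = M / 2^-1 / 2^-1 / 2^-1); last by field.
  by do 3 (apply: ler_pM; rewrite ?normc_ge0 ?invr_ge0 ?normc_ge0 ?mulr_ge0 ?invr_ge0 ?normc_ge0//; last by rewrite lef_pV2 ?posrE// (lt_le_trans _ s1, lt_le_trans _ s2)//).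
apply: (@le_trans _ _ (e / (64 * M + 1) * (64 * M))).
  apply: ler_pM; rewrite ?normc_ge0//; apply: le_trans H _.
  by rewrite (_ : 2 * _ * _ = 64 * M)//; ring.
rewrite mulrAC ler_pdivrMr ?ltr_wpDl ?mulr_ge0//.
by rewrite ler_wpM2l ?(ltW e0)// lerDl.
Qed.

(** After parametrization the bottom and right sides both have integrand [1/(t - i)], the top and
    left sides both [-1/(t + i)]; the sum is [4 i / (1 + t^2)], whose integral over [[-1, 1]] is not
    0. *)
Lemma cauchy_neq0 : cauchy (fun=> 1) 0 != 0.
Proof.
have E : (-1 : R) + 2 = 1 by ring.
have ne (t p : R) : p ^+ 2 = 1 -> (t +i* p)%C != 0 /\ (p +i* t)%C != 0.
  move=> p2; split; apply/eqP => -[A B]; move: p2; rewrite ?A ?B expr0n /=; lra.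
have inv (z : R[i]) : 1 / (z - 0) = z^-1 by rewrite subr0 mul1r.
have h (p t : R) : p ^+ 2 = 1 -> ccont (fun t => 1 / ((t +i* p)%C - 0)) t.
  move=> p2; apply: (@hol_ccont_h _ (fun s => 1 / (s - 0))).
  apply: holM; [exact: hol_cst|apply: holV; last by apply: holB; [exact: hol_id|exact: hol_cst]].
  by rewrite subr0; have [] := ne t p p2.
have v (p t : R) : p ^+ 2 = 1 -> ccont (fun t => 1 / ((p +i* t)%C - 0)) t.
  move=> p2; apply: (@hol_ccont_v _ (fun s => 1 / (s - 0))).
  apply: holM; [exact: hol_cst|apply: holV; last by apply: holB; [exact: hol_id|exact: hol_cst]].
  by rewrite subr0; have [] := ne t p p2.
have p1 : (1 : R) ^+ 2 = 1 by rewrite expr1n.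
have m1 : (-1 : R) ^+ 2 = 1 by rewrite sqrrN expr1n.
have I k : (forall t : R, ccont k t) -> cintegrable mu `[(-1 : R), 1] k.
  by move=> kc; apply: ccont_cintegrable => t _; exact: kc.
have i0 : mu.-integrable `[(-1 : R), 1] (fun t => ((1 + t ^+ 2)^-1)%:E).
  apply: continuous_compact_integrable; first exact: segment_compact.
  apply: continuous_subspaceT => t; apply: cvgV.
    by rewrite gt_eqF// ltr_wpDr ?sqr_ge0.
  by apply: cvgD; [exact: cvg_cst|exact: exprn_continuous].
have m11 : measurable (`[(-1 : R), 1]%classic : set (measurableTypeR R)) by [].
have -> : cauchy (fun=> 1) 0 =
    4 * 'i%C * cint mu `[(-1 : R), 1] (fun t => ((1 + t ^+ 2)^-1)%:C%C).
  rewrite /cauchy /rect /hseg /vseg E.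
  rewrite -[in X in X - 'i%C * _]cintZ//; last by apply: I => t; exact: v.
  have vi (p : R) : p ^+ 2 = 1 -> cintegrable mu `[(-1 : R), 1] (fun t => 'i%C * (1 / ((p +i* t)%C - 0))).
    by move=> p2; apply: cintegrableZ => //; apply: I => t; exact: v.
  have hi (p : R) : p ^+ 2 = 1 -> cintegrable mu `[(-1 : R), 1] (fun t => 1 / ((t +i* p)%C - 0)).
    by move=> p2; apply: I => t; exact: h.
  rewrite -[in X in _ - X]cintZ//; last by apply: I => t; exact: v.
  have i1 := hi _ m1; have i2 := vi _ p1; have i3 := hi _ p1; have i4 := vi _ m1.
  have i12 := cintegrableD m11 i1 i2.
  have i123 := cintegrableB m11 i12 i3.
  rewrite -cintD// -cintB// -cintB//.
  rewrite -cintZ//; last by split => //; exact: integrable0.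
  apply: eq_cint => t _; rewrite !inv.
  have T1 : (t +i* (-1))%C = t%:C%C - 'i%C by apply: complexP; rewrite ReImE /= ?oppr0 ?addr0 ?add0r.
  have T2 : (t +i* 1)%C = t%:C%C + 'i%C by apply: complexP; rewrite ReImE /= ?addr0 ?add0r.
  have T3 : (1 +i* t)%C = 'i%C * (t%:C%C - 'i%C) by apply: complexP; rewrite !ReImE /=; ring.
  have T4 : (-1 +i* t)%C = 'i%C * (t%:C%C + 'i%C) by apply: complexP; rewrite !ReImE /=; ring.
  have I0 : 'i%C != 0 :> R[i] by apply/eqP => -[] /eqP; rewrite oner_eq0.
  have [n1 _] := ne t _ m1; have [n2 _] := ne t _ p1.
  rewrite T3 T4 T1 T2; rewrite T1 in n1; rewrite T2 in n2.
  have -> : ((1 + t ^+ 2)^-1)%:C%C = ((t%:C%C - 'i%C) * (t%:C%C + 'i%C))^-1 :> R[i].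
    rewrite -[LHS]/(real_complex R _) fmorphV /=; congr (_^-1).
    by apply: complexP; rewrite !ReImE /=; ring.
  by field; rewrite n1 n2 I0.
rewrite mulf_neq0// ?mulf_neq0//.
  by apply/eqP => -[] /eqP; rewrite oner_eq0.
apply/eqP => -[] /eqP; rewrite gt_eqF//.
have i2 : mu.-integrable `[(-1 : R), 1] (fun=> (2^-1)%:E).
  by apply: continuous_compact_integrable; [exact: segment_compact|apply: continuous_subspaceT => t; exact: cvg_cst].
have : Rintegral mu `[(-1 : R), 1] (fun=> 2^-1) <= Rintegral mu `[(-1 : R), 1] (fun t => (1 + t ^+ 2)^-1).
  apply: le_Rintegral => // t; rewrite /= in_itv /= => t1.
  by rewrite lef_pV2 ?posrE ?ltr_wpDr ?sqr_ge0//; nra.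
apply: lt_le_trans; rewrite Rintegral_cst//= lebesgue_measure_itv /= lte_fin (_ : (-1 < 1 :> R) = true) /=; lra.
Qed.

(** By Cauchy's formula [Y = g / w] near 0, and [cauchy_sub] exhibits a factor [z] in [g z - g 0]
    and in [w z - w 0]. The quotient rule combines them into a factor [z] in [Y z - Y 0], with a
    denominator [w z * w 0] that does not vanish near 0. *)
Lemma divide0 Y : hol_rect Y (-1) (-1) 2 2 -> exists Y1 (r : R),
  [/\ hol Y1 (0 : R[i]), 0 < r & forall z, normc z < r -> Y z = Y 0 + z * Y1 z].
Proof.
move=> hY.
pose w := cauchy (fun=> 1); pose g := cauchy Y.
have h1 : hol_edge (fun=> 1 : Cplx R) (-1) (-1) 2 2 by move=> u v _; exact: hol_cst.
have hYe := hol_rect_edge hY.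
have z0 : normc (0 : R[i]) <= 2^-1 by rewrite normc0 invr_ge0.
have z0' : normc (0 : R[i]) < 2^-1 by rewrite normc0 invr_gt0.
pose w1 := cauchy (fun s => 1 / (s - 0)); pose g1 := cauchy (fun s => Y s / (s - 0)).
have wn : w 0 != 0 := cauchy_neq0.
have gE z : normc z <= 2^-1 -> g z = Y z * w z by exact: cauchy_formula.
have hw : hol w 0 by exact: hol_cauchy.
have wn0 : 0 < normc (w 0) by rewrite normc_gt0.
have [r r0 rP] := hol_continuous hw wn0.
exists (fun z => (g1 z * w 0 - g 0 * w1 z) / (w z * w 0)), (Num.min r (2^-1)); split.
- apply: holM; last first.
    apply: holV; first by rewrite mulf_neq0.
    by apply: holM => //; exact: hol_cst.
  apply: holB; apply: holM; try exact: hol_cst.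
    by apply: hol_cauchy => //; exact: hol_edge_div.
  by apply: hol_cauchy => //; exact: hol_edge_div.
- by rewrite lt_min r0 invr_gt0 ltr0n.
move=> z; rewrite lt_min => /andP[zr /ltW z1].
have wz : w z != 0.
  have := rP z; rewrite subr0 => /(_ zr); apply: contraTneq => ->.
  by rewrite sub0r normcN ltxx.
have e1 := cauchy_sub h1 z1 z0; have e2 := cauchy_sub hYe z1 z0.
rewrite subr0 in e1 e2.
rewrite mulrA mulrBr mulrA -e2 mulrCA -e1 -/w -/g gE// gE//.
by field; rewrite wz wn.
Qed.

Lemma hol_divide Y (s0 : R[i]) (r : R) : 0 < r -> (forall s, normc (s - s0) < r -> hol Y s) ->
  exists Y1, (forall s, Y s = Y s0 + (s - s0) * Y1 s) /\ (forall s, hol Y s -> hol Y1 s).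
Proof.
move=> r0 hY.
(* [s0 + k s] maps the square [[-1, 1]^2], whose points have norm at most 2, into the disc of radius
   [r / 2] about [s0]. *)
pose k := (r / 4)%:C%C : R[i]; have k0 : k != 0 by apply/eqP => -[] /eqP; rewrite gt_eqF// divr_gt0.
have hlin s : hol (fun s => s0 + k * s : Cplx R) s.
  by apply: holD; [exact: hol_cst|apply: holM; [exact: hol_cst|exact: hol_id]].
have E2 : -1 + 2 = 1 :> R by ring.
have [|Z1 [d [hZ d0 dP]]] := @divide0 (fun s => Y (s0 + k * s)).
  move=> u v; rewrite E2 => u1 v1; apply: (hol_comp (f := fun s => s0 + k * s)) => //.
  apply: hY; rewrite (addrC s0) addrK normcM normcR gtr0_norm ?divr_gt0//.
  have uv : normc (u +i* v)%C <= 1 + 1.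
    by apply: le_trans (normc_leD _) (lerD _ _); rewrite /= ler_norml.
  apply: (@le_lt_trans _ _ (r / 4 * 2)); last by lra.
  by rewrite ler_wpM2l// divr_ge0 ?ltW.
rewrite mulr0 addr0 in dP.
pose Y1 s := if s == s0 then Z1 0 / k else (Y s - Y s0) / (s - s0).
exists Y1; split=> s.
  rewrite /Y1; have [->|ss0] := eqVneq s s0; first by rewrite subrr mul0r addr0.
  by rewrite mulrC divfK ?subr_eq0// addrC subrK.
move=> hs; have [ss0|ss0] := eqVneq s s0.
  rewrite ss0; apply: (near_hol (f := fun s => Z1 ((s - s0) / k) / k)).
    apply/nbhs_complexP; exists (d * (r / 4)); first by rewrite mulr_gt0 ?divr_gt0.
    move=> w wd; rewrite /Y1; have [->|ws0] := eqVneq w s0; first by rewrite subrr mul0r.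
    have zd : normc ((w - s0) / k) < d.
      by rewrite normcM normcV normcR gtr0_norm ?divr_gt0// ltr_pdivrMr// divr_gt0.
    have := dP _ zd; rewrite (mulrC k) divfK// addrC subrK => ->.
    have ws : w - s0 != 0 by rewrite subr_eq0.
    rewrite [Y s0 + _]addrC addrK.
    by rewrite mulrAC [_ / k / _]mulrAC mulfV// mul1r mulrC.
  apply: holM; last exact: hol_cst.
  apply: (hol_comp (f := fun s => (s - s0) / k)); last by rewrite subrr mul0r.
  apply: holM; last exact: hol_cst.
  by apply: holB; [exact: hol_id|exact: hol_cst].
apply: (near_hol (f := fun s => (Y s - Y s0) / (s - s0))).
  apply/nbhs_complexP; exists (normc (s - s0)); first by rewrite normc_gt0 subr_eq0.
  move=> w ws; rewrite /Y1; have [ws0|//] := eqVneq w s0.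
  by move: ws; rewrite ws0 normcC ltxx.
apply: holM; first by apply: holB => //; exact: hol_cst.
apply: holV; first by rewrite subr_eq0.
by apply: holB; [exact: hol_id|exact: hol_cst].
Qed.

End Cauchy.

(** * Laplace transforms *)

Section Laplace.
Variable R : realType.
Notation mu := (@lebesgue_measure R).
Implicit Types (f g : R -> R[i]) (s z : R[i]).

Definition laplace f s : R[i] := cint mu setT (fun x => f x * cexp (- (s * x%:C%C))).

(** Nothing is required on the boundary [b = a], which makes the class stable under multiplication
    by [x] and leaves room for differentiating under the integral. *)
Definition laplace_dom (a : R) f := [/\ cmf setT f, forall x, x <= 0 -> f x = 0 &
  forall b, a < b -> mu.-integrable setT (fun x => (normc (f x) * expR (- (b * x)))%:E)].

Lemma normc_cexpN s (x : R) : normc (cexp (- (s * x%:C%C))) = expR (- (complex.Re s * x)).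
Proof. by rewrite normc_cexp ReN ReM /= mulr0 subr0. Qed.

Lemma cmf_cexpN s : cmf (R := R) setT (fun x : R => cexp (- (s * x%:C%C))).
Proof.
by apply: cmf_cexp; apply: cmfN; apply: cmfM; [exact: cmf_cst|apply: cmf_real].
Qed.

Lemma measurable_expN (a : R) : measurable_fun setT (fun x : R => expR (- (a * x))).
Proof.
apply: measurableT_comp; first exact: measurable_expR.
by apply: measurableT_comp => //; exact: measurable_funM.
Qed.

Lemma cintegrable_laplace a f s : laplace_dom a f -> a < complex.Re s ->
  cintegrable mu setT (fun x => f x * cexp (- (s * x%:C%C))).
Proof.
move=> [mf _ fi] sa; apply: (le_cintegrable _ _ (fi _ sa)) => //.
  by apply: cmfM => //; exact: cmf_cexpN.
by move=> x _; rewrite normcM normc_cexpN.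
Qed.

Lemma cintegrable_laplace_real a f (b : R) : laplace_dom a f -> a < b ->
  cintegrable mu setT (fun x => f x * (expR (- (b * x)))%:C%C).
Proof.
move=> [mf _ fi] ab; apply: (le_cintegrable _ _ (fi _ ab)) => //.
  by apply: cmfM => //; apply: cmf_real; exact: measurable_expN.
by move=> x _; rewrite normcM normcR ger0_norm ?expR_ge0.
Qed.

Lemma laplace_ft f (b t : R) : laplace f (b +i* t)%C = fourier (fun x => f x * (expR (- (b * x)))%:C%C) t.
Proof.
apply: eq_cint => x _; rewrite -mulrA; congr (_ * _).
rewrite /expi -cexpR -cexpD; congr cexp.
by apply: complexP; rewrite !ReImE /=; ring.
Qed.

Lemma normc_laplace a f s : laplace_dom a f -> a < complex.Re s ->
  normc (laplace f s) <= Rintegral mu setT (fun x => normc (f x) * expR (- (complex.Re s * x))).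
Proof.
move=> [mf f0 fi] sa; apply: normc_cint_le => //.
- by apply: cmfM => //; exact: cmf_cexpN.
- exact: fi.
- by move=> x _; rewrite normcM normc_cexpN.
Qed.

Lemma laplace_domW a b f : a <= b -> laplace_dom a f -> laplace_dom b f.
Proof. by move=> ab [mf f0 fi]; split => // c bc; apply: fi; exact: le_lt_trans bc. Qed.

Lemma laplace_domD a f g : laplace_dom a f -> laplace_dom a g -> laplace_dom a (fun x => f x + g x).
Proof.
move=> [mf f0 fi] [mg g0 gi]; split; first exact: cmfD.
  by move=> x x0; rewrite f0// g0// addr0.
move=> b ab; apply: (le_integrable _ _ _ (integrableD _ (fi b ab) (gi b ab))) => //.
  apply/measurable_EFinP; apply: measurable_funM; last exact: measurable_expN.
  by apply: cmf_normc; exact: cmfD.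
move=> x _; rewrite /= lee_fin -mulrDl !normrM ler_wpM2r//.
by rewrite !ger0_norm ?addr_ge0 ?normc_ge0// ler_normcD.
Qed.

Lemma laplace_domZ a c f : laplace_dom a f -> laplace_dom a (fun x => c * f x).
Proof.
move=> [mf f0 fi]; split; first exact: cmfZ.
  by move=> x x0; rewrite f0// mulr0.
move=> b ab; under eq_fun do rewrite normcM -mulrA EFinM.
by apply: integrableZl => //; exact: fi.
Qed.

Lemma laplaceD a f g s : laplace_dom a f -> laplace_dom a g -> a < complex.Re s ->
  laplace (fun x => f x + g x) s = laplace f s + laplace g s.
Proof.
move=> df dg sa; rewrite /laplace -cintD//; [|exact: cintegrable_laplace df sa|exact: cintegrable_laplace dg sa].
by apply: eq_cint => x _; rewrite mulrDl.
Qed.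

Lemma laplaceZ a c f s : laplace_dom a f -> a < complex.Re s ->
  laplace (fun x => c * f x) s = c * laplace f s.
Proof.
move=> df sa; rewrite /laplace -cintZ//; last exact: cintegrable_laplace df sa.
by apply: eq_cint => x _; rewrite mulrA.
Qed.

Lemma le_expR_id (x : R) : x <= expR x.
Proof. by apply: le_trans (expR_ge1Dx x); rewrite lerDr. Qed.

Lemma le_expR_div (d x : R) : 0 < d -> x <= d^-1 * expR (d * x).
Proof. by move=> d0; rewrite ler_pdivlMl//; exact: le_expR_id. Qed.

(** Half of the room between [a] and [b] pays for [x <= d^-1 e^(d x)]. *)
Lemma laplace_domX a f : laplace_dom a f -> laplace_dom a (fun x => x%:C%C * f x).
Proof.
move=> [mf f0 fi].
have mx : cmf setT (fun x : R => x%:C%C * f x) by apply: cmfM => //; apply: cmf_real.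
split => //; first by move=> x x0; rewrite f0// mulr0.
move=> b ab; pose d := (b - a) / 2.
have d0 : 0 < d by rewrite divr_gt0// subr_gt0.
have ad : a < b - d by rewrite /d; lra.
have I : mu.-integrable setT (fun x => (d^-1 * (normc (f x) * expR (- ((b - d) * x))))%:E).
  by under eq_fun do rewrite EFinM; apply: integrableZl => //; exact: fi.
apply: (le_integrable _ _ _ I) => //.
  apply/measurable_EFinP; apply: measurable_funM; last exact: measurable_expN.
  exact: cmf_normc.
move=> x _; rewrite /= lee_fin ger0_norm ?mulr_ge0 ?normc_ge0 ?expR_ge0//.
rewrite ger0_norm ?mulr_ge0 ?normc_ge0 ?expR_ge0 ?invr_ge0 ?(ltW d0)//.
have [x0|] := boolP (x <= 0); first by rewrite f0// mulr0 normc0 !mul0r mulr0.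
rewrite -ltNge => x0.
rewrite normcM normcR gtr0_norm// (mulrC x) -mulrA (mulrCA d^-1) ler_wpM2l ?normc_ge0//.
rewrite (_ : - ((b - d) * x) = d * x + - (b * x)); last by ring.
by rewrite expRD mulrA ler_wpM2r ?expR_ge0// le_expR_div.
Qed.

Lemma cdiff_laplace a f s : laplace_dom a f -> a < complex.Re s ->
  cdiff (laplace f) s (- laplace (fun x => x%:C%C * f x) s).
Proof.
move=> df sa; have [mf f0 fi] := df; have dxf := laplace_domX df.
(* Three of the four parts of the room are spent: [x^2] costs [e^(2 d x)] and the remainder factor
   [e^(|h| x)] costs [e^(d x)]. *)
pose d := (complex.Re s - a) / 4; have d0 : 0 < d by rewrite divr_gt0// subr_gt0.
pose G x := normc (f x) * expR (- ((complex.Re s - 3 * d) * x)).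
have iG : mu.-integrable setT (fun x => (G x)%:E) by apply: fi; rewrite /d; lra.
pose C := Rintegral mu setT G.
have C0 : 0 <= C by apply: Rintegral_ge0 => x _; rewrite mulr_ge0 ?normc_ge0 ?expR_ge0.
have key h : normc h < d ->
    normc (laplace f (s + h) - laplace f s - - laplace (fun x => x%:C%C * f x) s * h) <=
    4 * d^-1 ^+ 2 * normc h ^+ 2 * C.
  move=> hd.
  have sh : a < complex.Re (s + h).
    by rewrite ReD; have := normc_Re h; rewrite ler_norml => /andP[+ _]; rewrite /d in hd; lra.
  have i1 := cintegrable_laplace df sh; have i2 := cintegrable_laplace df sa.
  have i3 := cintegrable_laplace dxf sa.
  have -> : laplace f (s + h) - laplace f s - - laplace (fun x => x%:C%C * f x) s * h =
      cint mu setT (fun x => f x * cexp (- ((s + h) * x%:C%C)) - f x * cexp (- (s * x%:C%C)) +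
        h * (x%:C%C * f x * cexp (- (s * x%:C%C)))).
    rewrite cintD//; [|exact: cintegrableB|exact: cintegrableZ].
    by rewrite cintB// cintZ// /laplace mulNr opprK (mulrC h).
  have -> : 4 * d^-1 ^+ 2 * normc h ^+ 2 * C =
      Rintegral mu setT (fun x => 4 * d^-1 ^+ 2 * normc h ^+ 2 * G x).
    by rewrite RintegralZl.
  apply: normc_cint_le => //.
  - apply: (@cintegrable_cmf _ _ _ mu); apply: cintegrableD => //; [exact: cintegrableB|exact: cintegrableZ].
  - by under eq_fun do rewrite EFinM; apply: integrableZl.
  move=> x _; have [x0|x0] := leP x 0.
    rewrite f0// !mul0r mulr0 mul0r mulr0 subr0 addr0 normc0.
    apply: mulr_ge0.
      by apply: mulr_ge0; [apply: mulr_ge0 => //|]; exact: sqr_ge0.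
    by rewrite mulr_ge0 ?normc_ge0 ?expR_ge0.
  have -> : f x * cexp (- ((s + h) * x%:C%C)) - f x * cexp (- (s * x%:C%C)) +
        h * (x%:C%C * f x * cexp (- (s * x%:C%C))) =
      f x * cexp (- (s * x%:C%C)) * (cexp (- (h * x%:C%C)) - 1 - - (h * x%:C%C)).
    by rewrite mulrDl opprD cexpD; ring.
  rewrite normcM normcM normc_cexpN.
  apply: le_trans (ler_wpM2l _ (cexp_sub1Dx _)) _; first by rewrite mulr_ge0 ?normc_ge0 ?expR_ge0.
  rewrite normcN normcM normcR gtr0_norm// /G.
  have xd : x ^+ 2 <= d^-1 ^+ 2 * expR (2 * d * x).
    apply: (@le_trans _ _ ((d^-1 * expR (d * x)) ^+ 2)).
      apply: lerXn2r; rewrite ?nnegrE ?(ltW x0)//; last exact: le_expR_div.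
      by apply: mulr_ge0; [rewrite invr_ge0 ltW|exact: expR_ge0].
    by rewrite exprMn ler_wpM2l ?sqr_ge0// expr2 -expRD (_ : d * x + d * x = 2 * d * x)//; ring.
  have hx : expR (normc h * x) <= expR (d * x) by rewrite ler_expR ler_pM2r// ltW.
  have -> : normc (f x) * expR (- (complex.Re s * x)) * (4 * (normc h * x) ^+ 2 * expR (normc h * x)) =
      4 * normc h ^+ 2 * (normc (f x) * expR (- (complex.Re s * x))) * (x ^+ 2 * expR (normc h * x)).
    by ring.
  have -> : 4 * d^-1 ^+ 2 * normc h ^+ 2 * (normc (f x) * expR (- ((complex.Re s - 3 * d) * x))) =
     4 * normc h ^+ 2 * (normc (f x) * expR (- (complex.Re s * x))) * (d^-1 ^+ 2 * expR (2 * d * x) * expR (d * x)).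
    rewrite (_ : - _ = - (complex.Re s * x) + 2 * d * x + d * x); last by ring.
    by rewrite !expRD; ring.
  apply: ler_wpM2l; first by rewrite !mulr_ge0 ?sqr_ge0 ?normc_ge0 ?expR_ge0.
  by apply: ler_pM => //; rewrite ?sqr_ge0 ?expR_ge0.
move=> e e0; exists (Num.min d (e / (4 * d^-1 ^+ 2 * C + 1))).
  rewrite lt_min d0 divr_gt0//= ltr_wpDl//.
  by apply: mulr_ge0 => //; apply: mulr_ge0 => //; exact: sqr_ge0.
move=> h; rewrite lt_min => /andP[hd he]; apply: le_trans (key h hd) _.
rewrite -mulrA (mulrC (normc h ^+ 2)) [X in _ * (_ * X)]expr2 !mulrA ler_wpM2r ?normc_ge0//.
have p0 : 0 <= 4 * d^-1 ^+ 2 * C by apply: mulr_ge0 => //; apply: mulr_ge0 => //; exact: sqr_ge0.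
apply: (@le_trans _ _ (4 * d^-1 ^+ 2 * C * (e / (4 * d^-1 ^+ 2 * C + 1)))).
  have -> : 4 / d / d * C * normc h = (4 * d^-1 ^+ 2 * C) * normc h by rewrite expr2; ring.
  by rewrite ler_wpM2l// ltW.
rewrite mulrCA ler_piMr ?ltW// ltr_pdivrMr ?mul1r ?ltrDl//.
by rewrite ltr_wpDl.
Qed.

Lemma hol_laplace a f s : laplace_dom a f -> a < complex.Re s -> hol (laplace f) s.
Proof. by move=> df sa; eexists; exact: cdiff_laplace df sa. Qed.

Definition heavi (x : R) : R[i] := if 0 < x then 1 else 0.

Lemma heaviE : heavi = fun x : R => if x \in `]0%R, +oo[%classic then 1 else 0.
Proof. by apply/funext => x; rewrite /heavi mem_setE in_itv /= andbT. Qed.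

Lemma laplace_dom_heavi : laplace_dom 0 heavi.
Proof.
split.
- by rewrite heaviE; apply: (cmf_if (f := fun=> 1)).
- by move=> x x0; rewrite /heavi ltNge x0.
move=> b b0; apply: (le_integrable _ _ _ (integrable_expabs b0)) => //.
  apply/measurable_EFinP; apply: measurable_funM; last exact: measurable_expN.
  by apply: cmf_normc; rewrite heaviE; apply: (cmf_if (f := fun=> 1)).
move=> x _; rewrite /= lee_fin ger0_norm ?mulr_ge0 ?normc_ge0 ?expR_ge0//.
rewrite [leRHS]ger0_norm ?expR_ge0// /heavi; case: ifP => [x0|_]; last by rewrite normc0 mul0r expR_ge0.
by rewrite normc1 mul1r gtr0_norm.
Qed.

Lemma ccont_cexp z (t : R) : ccont (fun t : R => cexp (t%:C%C * z)) t.
Proof.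
rewrite (_ : (fun t => _) = (fun x => (fun w => cexp (w * z)) (0 + x%:C%C * 1))).
  apply: (@hol_line R (fun w => cexp (w * z))); apply: (hol_comp (f := fun w => w * z)).
    by apply: holM; [exact: hol_id|exact: hol_cst].
  exact: hol_cexp.
by apply/funext => u; rewrite add0r mulr1.
Qed.

Lemma cint_cexp z (a b : R) : a <= b -> z != 0 ->
  cint mu `[a, b] (fun x => cexp (x%:C%C * z)) = (cexp (b%:C%C * z) - cexp (a%:C%C * z)) / z.
Proof.
move=> ab z0.
have D t : cderive (fun x => z^-1 * cexp (x%:C%C * z)) t (cexp (t%:C%C * z)).
  by have := cderiveZ z^-1 (cderive_cexp z t); rewrite mulKf.
rewrite (cint_FTC ab D); first by rewrite -mulrBr mulrC.
by move=> t; exact: ccont_cexp.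
Qed.

(** Translating by 1 gives [l = e^-z (I + l)], where [l] is the transform and [I] an integral over
    [[-1, 0]] computed from a primitive. The equation determines [l] because [|e^-z| < 1]. *)
Lemma laplace_heavi z : 0 < complex.Re z -> laplace heavi z = z^-1.
Proof.
move=> z0; have zn : z != 0 by apply: contraTneq z0 => ->; rewrite ltxx.
have hi := cintegrable_laplace laplace_dom_heavi z0.
have ne : 1 - cexp (- z) != 0.
  rewrite subr_eq0 eq_sym; apply/eqP => E; have := normc_cexp (- z).
  rewrite E normc1 ReN => H; have : expR (- complex.Re z) < 1 by rewrite expR_lt1 oppr_lt0.
  by rewrite -H ltxx.
apply: (mulIf ne); rewrite mulrBr mulr1.
have m1 : measurable (`]-1, 0]%classic : set (measurableTypeR R)) by [].
have cc : cintegrable mu `]-1, 0] (fun x : R => cexp (x%:C%C * - z)).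
  have [c1 c2] : cintegrable mu `[-1, 0] (fun x : R => cexp (x%:C%C * - z)).
    by apply: ccont_cintegrable => t _; exact: ccont_cexp.
  by split; [apply: integrableS c1|apply: integrableS c2] => //; apply: subset_itv; rewrite bnd_simp.
have E0 : cint mu `[-1, 0] (fun x : R => cexp (x%:C%C * - z)) =
    cint mu `]-1, 0] (fun x : R => cexp (x%:C%C * - z)).
  by apply/esym; congr Complex; apply: Rintegral_itv_obnd_cbnd; [exact: cc.1|exact: cc.2].
have I0 : cintegrable mu setT (fun x : R => if x \in `]-1, 0]%classic then cexp (x%:C%C * - z) else 0).
  apply: cintegrableP; first exact: measurableT.
    apply: cmf_if; first exact: m1.
    by apply: cmf_cexp; apply: cmfM; [apply: cmf_real|exact: cmf_cst].
  have := cintegrable_lty m1 cc; rewrite integral_mkcond; congr (_ < _)%E.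
  by apply: eq_integral => x _; rewrite patchE; case: ifP => //; rewrite normc0.
have HL : laplace heavi z = cexp (- z) * (cint mu `[-1, 0] (fun x => cexp (x%:C%C * - z)) + laplace heavi z).
  rewrite E0 /laplace -[in LHS](cint_shift 1 hi) (cint_mkcond `]-1, 0]) -cintD// -cintZ//; last exact: cintegrableD.
  apply: eq_cint => x _; rewrite /heavi mem_setE in_itv /=.
  rewrite rmorphD mulrDr mulr1 opprD cexpD mulrA [_ * cexp (- z)]mulrC; congr (_ * _).
  rewrite mulrN (mulrC x%:C%C).
  have [x0|x0] := ltP 0 x.
    by rewrite addr_gt0// andbF add0r.
  by rewrite andbT mul0r addr0 -ltrBlDr sub0r; case: ifP; rewrite ?mul1r ?mul0r.
rewrite cint_cexp ?oppr_eq0 ?lerN10// mul0r cexp0 rmorphN1 mulN1r opprK in HL.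
rewrite [X in X - _]HL mulrDr [laplace heavi z * _]mulrC addrK mulrA mulrBr mulr1 -cexpD addNr cexp0.
by rewrite invrN mulrN -mulNr opprB mulrC.
Qed.

Lemma near_cdiff (f g : R[i] -> R[i]) s d :
  (\forall z \near (s : Cplx R), f z = g z) -> cdiff f s d -> cdiff g s d.
Proof.
move=> /nbhs_complexP[e e0 eP] fd e1 /fd[r r0 rP].
exists (Num.min r e) => [|h]; first by rewrite lt_min r0.
rewrite lt_min => /andP[hr he]; rewrite -!eP ?subrr ?normc0//; first exact: rP.
by rewrite (addrC s) addrK.
Qed.

Lemma cdiff_id s : cdiff (R := R) id s 1.
Proof.
move=> e e0; exists 1 => // h _.
by rewrite (addrC s) addrK mul1r subrr normc0 mulr_ge0 ?normc_ge0 ?ltW.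
Qed.

Definition heavi_pow k (x : R) : R[i] := (x ^+ k / k`!%:R)%:C%C * heavi x.

Lemma heavi_powS k : heavi_pow k.+1 =
  fun x : R => (k.+1%:R^-1)%:C%C * (x%:C%C * heavi_pow k x).
Proof.
apply/funext => x; rewrite /heavi_pow !mulrA -!rmorphM /=; congr (_%:C%C * _).
rewrite factS natrM invfM exprS; ring.
Qed.

Lemma laplace_dom_heavi_pow k : laplace_dom 0 (heavi_pow k).
Proof.
elim: k => [|k IH]; last by rewrite heavi_powS; apply: laplace_domZ; exact: laplace_domX.
rewrite (_ : heavi_pow 0 = heavi); first exact: laplace_dom_heavi.
by apply/funext => x; rewrite /heavi_pow expr0 fact0 divr1 mul1r.
Qed.

(** Write [l_k] for the transform of [heavi_pow k]. Differentiating [z l_k = l_(k-1)] gives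
    [l_k - (k + 1) z l_(k+1) = - k l_k], which is the next case; for [k = 0] the derivative of the
    constant 1 plays the same part. *)
Lemma mul_laplace_heavi_pow k z : 0 < complex.Re z ->
  z * laplace (heavi_pow k) z = if k is k'.+1 then laplace (heavi_pow k') z else 1.
Proof.
have lxE j w : 0 < complex.Re w ->
    laplace (fun x => x%:C%C * heavi_pow j x) w = j.+1%:R * laplace (heavi_pow j.+1) w.
  move=> w0; rewrite heavi_powS (laplaceZ _ (laplace_domX (laplace_dom_heavi_pow j)) w0) mulrA.
  rewrite (_ : j.+1%:R * _ = 1) ?mul1r//.
  rewrite -(rmorph_nat (real_complex R)) -rmorphM /= mulfV ?pnatr_eq0//.
have near0 w : 0 < complex.Re w -> \forall v \near (w : Cplx R), 0 < complex.Re v.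
  move=> w0; apply/nbhs_complexP; exists (complex.Re w) => // v.
  move=> /(le_lt_trans (normc_Re _)); rewrite ReD ReN ltr_norml => /andP[+ _]; lra.
elim: k z => [|k IH] z z0.
  rewrite (_ : heavi_pow 0 = heavi); last first.
    by apply/funext => x; rewrite /heavi_pow expr0 fact0 divr1 mul1r.
  by rewrite laplace_heavi// mulfV//; apply: contraTneq z0 => ->; rewrite ltxx.
have d1 := cdiffM (cdiff_id z) (cdiff_laplace (laplace_dom_heavi_pow k) z0).
have kn : k.+1%:R != 0 :> R[i] by rewrite pnatr_eq0.
have d2 : cdiff (fun w => w * laplace (heavi_pow k) w) z (- (k%:R * laplace (heavi_pow k) z)).
  case: k IH d1 kn => [|k] IH d1 kn.
    rewrite mul0r oppr0; apply: (near_cdiff (f := fun=> 1)); last first.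
      by move=> e e0; exists 1 => // h _; rewrite subrr mul0r subr0 normc0 mulr_ge0 ?normc_ge0 ?ltW.
    by apply: filterS (near0 _ z0) => w w0; rewrite (IH _ w0).
  rewrite -lxE//; apply: near_cdiff (cdiff_laplace (laplace_dom_heavi_pow k) z0).
  by apply: filterS (near0 _ z0) => w w0; rewrite (IH _ w0).
have := cdiff_unique d1 d2; rewrite lxE// mul1r => E.
apply: (mulfI kn); rewrite mulrCA.
rewrite mulrN in E.
by rewrite -[LHS](subKr (laplace (heavi_pow k) z)) E -natr1; ring.
Qed.

Lemma laplace_heavi_pow k z : 0 < complex.Re z -> laplace (heavi_pow k) z = (z ^+ k.+1)^-1.
Proof.
move=> z0; have zn : z != 0 by apply: contraTneq z0 => ->; rewrite ltxx.
elim: k => [|k IH]; apply: (mulfI zn); rewrite mul_laplace_heavi_pow//.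
  by rewrite expr1 mulfV.
by rewrite IH [in RHS]exprS invfM mulrA mulfV// mul1r.
Qed.

Definition expheavi_pow k (x : R) : R[i] := (expR x)%:C%C * heavi_pow k x.

Lemma laplace_dom_expheavi_pow k : laplace_dom 1 (expheavi_pow k).
Proof.
have [mf f0 fi] := laplace_dom_heavi_pow k; split.
- by apply: cmfM => //; apply: cmf_real; exact: measurable_expR.
- by move=> x x0; rewrite /expheavi_pow f0// mulr0.
move=> b b1; have := fi (b - 1); rewrite subr_gt0 => /(_ b1).
congr (integrable _ _ _); apply/funext => x; congr (_%:E).
rewrite /expheavi_pow (normcM _ (heavi_pow k x)) normcR ger0_norm ?expR_ge0//.
rewrite [RHS]mulrAC -expRD [RHS]mulrC; congr (_ * expR _); ring.
Qed.

Lemma laplace_expheavi_pow k s : 1 < complex.Re s ->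
  laplace (expheavi_pow k) s = ((s - 1) ^+ k.+1)^-1.
Proof.
move=> s1; rewrite -laplace_heavi_pow; last by rewrite ReD ReN /= subr_gt0.
apply: eq_cint => x _; rewrite /expheavi_pow -cexpR mulrAC -cexpD mulrC; congr (_ * cexp _).
ring.
Qed.

End Laplace.

(** * The Paley-Wiener equivalence *)

Section Damping.
Variable R : realType.
Implicit Types (s : R[i]) (e d : R).

Lemma le_cos (x : R) : 0 <= x <= 1 -> cos 1 <= cos x.
Proof.
move=> /andP[x0 x1]; have pi1 : 1 <= pi :> R by apply: le_trans (pi_ge2 R); rewrite ler1n.
move: x1; rewrite le_eqVlt => /predU1P[->//|x1]; apply: ltW.
by rewrite ltr_cos// in_itv /= ?x0 ?ler01// (le_trans (ltW x1)).
Qed.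

Lemma exprn_le_expR (d y : R) n : 0 < d -> 0 <= y ->
  y ^+ n <= (n.+1%:R / d) ^+ n * expR (d * y).
Proof.
move=> d0 y0; case: n => [|n]; first by rewrite !expr0 mul1r -expR0 ler_expR mulr_ge0// ltW.
have n0 : 0 < n.+2%:R :> R by [].
have h : y <= n.+2%:R / d * expR (d / n.+2%:R * y).
  rewrite -(invf_div d); apply: le_expR_div; exact: divr_gt0.
apply: (@le_trans _ _ ((n.+2%:R / d * expR (d / n.+2%:R * y)) ^+ n.+1)).
  by apply: lerXn2r => //; rewrite nnegrE (le_trans y0).
rewrite exprMn ler_wpM2l ?exprn_ge0 ?divr_ge0 ?(ltW d0)// -expRM_natl ler_expR.
rewrite -[leRHS]mul1r [X in X <= _](_ : _ = (n.+1%:R / n.+2%:R) * (d * y)); last by field; rewrite ?gt_eqF.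
by apply: ler_wpM2r; [rewrite mulr_ge0// ltW|rewrite ler_pdivrMr// mul1r ler_nat].
Qed.

Lemma expR_beats_pow (e d M : R) n : 0 < e -> 0 < d -> 0 <= M ->
  exists C : R, forall y, 0 <= y -> M * (1 + y) ^+ n - e * expR (d * y) <= C.
Proof.
move=> e0 d0 M0.
pose A := (n.+2%:R / d) ^+ n.+1 * expR d.
have A0 : 0 < A by rewrite mulr_gt0 ?expR_gt0// exprn_gt0// divr_gt0.
(* As long as [1 + y <= M A / e] the polynomial is at most this constant; beyond that point
   [(1 + y)^(n+1) <= A e^(d y)] makes the difference negative. *)
exists (M * (M * A / e) ^+ n) => y y0.
have y1 : 0 <= 1 + y by rewrite addr_ge0.
have h : (1 + y) ^+ n.+1 <= A * expR (d * y).
  apply: le_trans (exprn_le_expR n.+1 d0 y1) _.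
  by rewrite mulrDr mulr1 expRD mulrA.
have h2 : e * expR (d * y) >= e / A * (1 + y) ^+ n.+1.
  by rewrite -mulrA ler_wpM2l ?(ltW e0)// ler_pdivrMl.
have [yb|yb] := leP (1 + y) (M * A / e).
  apply: (@le_trans _ _ (M * (1 + y) ^+ n)); first by rewrite gerBl mulr_ge0 ?(ltW e0) ?expR_ge0.
  by rewrite ler_wpM2l// lerXn2r ?nnegrE// (le_trans y1).
apply: (@le_trans _ _ 0); last first.
  apply: mulr_ge0 => //; apply: exprn_ge0; apply: divr_ge0; last exact: ltW.
  by apply: mulr_ge0 => //; exact: ltW.
rewrite subr_le0 (le_trans _ h2)// exprS mulrA ler_wpM2r ?exprn_ge0//.
move: yb; rewrite ltr_pdivrMr// => yb.
by rewrite mulrAC ler_pdivlMr// mulrC (mulrC A) (mulrC e) ltW.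
Qed.

Variables (r c : R).
Hypothesis rc : r <= c.

Let d := (c - r + 1)^-1.

(* The two exponentials add up to [2 cos (d (s - r))], and [d] is so small that
   [Re (d (s - r))] stays in [[0, 1]] on the strip [r <= Re s <= c]. *)
Definition damp e s : R[i] :=
  cexp (- e%:C%C * (cexp ('i%C * (d%:C%C * (s - r%:C%C))) + cexp (- ('i%C * (d%:C%C * (s - r%:C%C)))))).

Let d0 : 0 < d. Proof. by rewrite invr_gt0 ltr_wpDl// subr_ge0. Qed.

Lemma hol_damp e s : hol (damp e) s.
Proof.
have hl z : hol (fun s => 'i%C * (d%:C%C * (s - r%:C%C)) : Cplx R) z.
  by apply: holM; [exact: hol_cst|apply: holM; [exact: hol_cst|apply: holB; [exact: hol_id|exact: hol_cst]]].
apply: (hol_comp (g := @cexp R)); last exact: hol_cexp.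
apply: holM; first exact: hol_cst.
apply: holD; first by apply: (hol_comp (g := @cexp R)) => //; exact: hol_cexp.
by apply: (hol_comp (g := @cexp R)); [apply: holN|exact: hol_cexp].
Qed.

Lemma damp_neq0 e s : damp e s != 0. Proof. exact: cexp_neq0. Qed.

(** With [s = u + i v], the real part of the sum of exponentials is
    [(e^(d v) + e^(- d v)) cos (d (u - r))], and the cosine is at least [cos 1 > 0] on the strip. *)
Lemma normc_damp e s : 0 <= e -> r <= complex.Re s <= c ->
  normc (damp e s) <= expR (- (e * cos 1 * expR (d * `|complex.Im s|))).
Proof.
move=> e0; case: s => u v /= /andP[ru uc].
have E (z : R[i]) : complex.Re (- e%:C%C * z) = - e * complex.Re z.
  by rewrite ReM ReN ImN /=; ring.
rewrite /damp.
have -> : 'i%C * (d%:C%C * ((u +i* v)%C - r%:C%C)) = ((- (d * v)) +i* (d * (u - r)))%C.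
  by apply: complexP; rewrite !ReImE /=; ring.
rewrite normc_cexp ler_expR E ReD Re_cexp Re_cexp /= cosN opprK mulNr lerN2 -mulrDl.
rewrite -!mulrA ler_wpM2l// mulrC; apply: ler_pM; rewrite ?expR_ge0 ?(ltW (cos1_gt0 R))//.
  case: (ger0P v) => v0; first by rewrite lerDr expR_ge0.
  by rewrite mulrN lerDl expR_ge0.
apply: le_cos; rewrite mulr_ge0 ?(ltW d0) ?subr_ge0//=.
rewrite /d mulrC ler_pdivrMr ?mul1r; first by lra.
by rewrite ltr_wpDl// subr_ge0.
Qed.

Lemma normc_damp_le1 e s : 0 <= e -> r <= complex.Re s <= c -> normc (damp e s) <= 1.
Proof.
move=> e0 sr; apply: le_trans (normc_damp e0 sr) _.
rewrite expR_le1 oppr_le0; apply: mulr_ge0; last exact: expR_ge0.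
by apply: mulr_ge0 => //; exact: ltW (cos1_gt0 R).
Qed.

(** Finite order on a closed strip, with a polynomial in [1 + |Im s|] as exponent: a form stable
    under sums and products, and valid near the real axis too. *)
Definition strip_growth (K : R[i] -> R[i]) := exists (M : R) (n : nat), 0 <= M /\
  forall s, r <= complex.Re s <= c -> normc (K s) <= expR (M * (1 + `|complex.Im s|) ^+ n).

Lemma damp_growth K e : strip_growth K -> 0 < e -> exists C : R, forall s,
  r <= complex.Re s <= c -> normc (K s * damp e s) <= C * expR (- `|complex.Im s|).
Proof.
move=> [M [n [M0 KM]]] e0.
have e1 : 0 < e * cos 1 by rewrite mulr_gt0// cos1_gt0.
have M1 : 0 <= M + 1 by rewrite addr_ge0.
(* Both [M] and [n] are raised by 1: the additional term in the exponent dominates [|Im s|] and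
   becomes the decay [e^(- |Im s|)] required by [contour_shift]. *)
have [C CP] := expR_beats_pow n.+1 e1 d0 M1.
exists (expR C) => s sr; rewrite normcM.
apply: le_trans (ler_pM _ _ (KM s sr) (normc_damp (ltW e0) sr)) _; rewrite ?normc_ge0//.
rewrite -!expRD ler_expR -lerBlDr opprK.
apply: le_trans (CP `|complex.Im s| _) => //.
rewrite addrAC lerD2r mulrDl mul1r; apply: lerD.
  by rewrite ler_wpM2l// ler_weXn2l// lerDl.
by apply: le_trans (_ : 1 + `|complex.Im s| <= _); rewrite ?lerDr// ler_eXnr// lerDl.
Qed.

Lemma strip_growthD K L : strip_growth K -> strip_growth L -> strip_growth (fun s => K s + L s).
Proof.
move=> [M [n [M0 KM]]] [N [m [N0 LN]]]; exists (M + N + 1), (maxn n m); split; first by rewrite !addr_ge0.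
move=> s sr; apply: le_trans (ler_normcD _ _) _.
set y := 1 + `|complex.Im s|; have y1 : 1 <= y by rewrite lerDl.
apply: (@le_trans _ _ (expR (M * y ^+ n) * expR (N * y ^+ m) * 2)).
  have e1 : 1 <= expR (M * y ^+ n) by rewrite -expR0 ler_expR mulr_ge0// exprn_ge0// (le_trans ler01).
  have e2 : 1 <= expR (N * y ^+ m) by rewrite -expR0 ler_expR mulr_ge0// exprn_ge0// (le_trans ler01).
  rewrite mulrDr mulr1; apply: lerD.
    by apply: le_trans (KM s sr) _; rewrite ler_peMr// expR_ge0.
  by apply: le_trans (LN s sr) _; rewrite ler_peMl// expR_ge0.
have -> : M + N + 1 = M + (N + 1) by rewrite addrA.
rewrite mulrDl mulrDl mul1r !expRD -!mulrA; apply: ler_pM; rewrite ?expR_ge0 ?mulr_ge0 ?expR_ge0//.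
  by rewrite ler_expR ler_wpM2l// ler_weXn2l// leq_maxl.
apply: ler_pM; rewrite ?expR_ge0//.
  by rewrite ler_expR ler_wpM2l// ler_weXn2l// leq_maxr.
apply: (@le_trans _ _ (expR 1)); first by apply: le_trans (expR_ge1Dx 1).
by rewrite ler_expR exprn_ege1.
Qed.

Lemma strip_growthM K L : strip_growth K -> strip_growth L -> strip_growth (fun s => K s * L s).
Proof.
move=> [M [n [M0 KM]]] [N [m [N0 LN]]]; exists (M + N), (maxn n m); split; first by rewrite !addr_ge0.
move=> s sr; rewrite normcM.
set y := 1 + `|complex.Im s|; have y1 : 1 <= y by rewrite lerDl.
rewrite mulrDl expRD; apply: ler_pM; rewrite ?normc_ge0//.
  by apply: le_trans (KM s sr) _; rewrite ler_expR ler_wpM2l// ler_weXn2l// leq_maxl.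
by apply: le_trans (LN s sr) _; rewrite ler_expR ler_wpM2l// ler_weXn2l// leq_maxr.
Qed.

Lemma strip_growth_bounded K (C : R) : (forall s, r <= complex.Re s <= c -> normc (K s) <= C) ->
  strip_growth K.
Proof.
move=> KC; exists `|C|, 0%N; split => // s sr; rewrite expr0 mulr1.
apply: le_trans (KC s sr) _; apply: le_trans (ler_norm _) _; exact: le_expR_id.
Qed.

End Damping.

Section PaleyWiener.
Variable R : realType.
Notation mu := (@lebesgue_measure R).
Implicit Types (f : R -> R[i]) (K : R[i] -> R[i]).

Lemma laplace_bounded a b f : laplace_dom a f -> a < b ->
  exists C : R, forall s, b <= complex.Re s -> normc (laplace f s) <= C.
Proof.
move=> df ab; have [mf f0 fi] := df.
exists (Rintegral mu setT (fun x => normc (f x) * expR (- (b * x)))) => s bs.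
apply: le_trans (normc_laplace df (lt_le_trans ab bs)) _.
apply: le_Rintegral => //; [by apply: fi; exact: lt_le_trans bs|exact: fi|].
move=> x _; have [x0|] := boolP (x <= 0); first by rewrite f0// normc0 !mul0r.
by rewrite -ltNge => x0; rewrite ler_wpM2l ?normc_ge0// ler_expR lerN2 ler_pM2r.
Qed.

Lemma cexp_sqr_bound (q b c : R) s : 0 <= q -> b <= complex.Re s <= c ->
  normc (cexp (q%:C%C * (s * s))) <= expR (q * (b ^+ 2 + c ^+ 2)).
Proof.
move=> q0 /andP[bs sc]; rewrite normc_cexp ler_expR !ReM /= mul0r subr0 ler_wpM2l//.
have := sqr_ge0 (complex.Im s); move: (complex.Re s) bs sc => x bx xc y0.
have [x0|] := boolP (0 <= x); first by nra.
by rewrite -ltNge => /ltW x0; nra.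
Qed.

(** The difference [D] vanishes on [Re s = c] and must vanish on [Re s = b]. Multiplied by [damp]
    and by a narrow Gaussian centred at [b + i tau], it has equal integrals over the two lines,
    hence integral 0. As the Gaussian narrows, these integrals, rescaled, converge to a non-zero
    multiple of the value of [D] at the centre. *)
Lemma laplace_line_eq (b c c0 : R) K f : b <= c -> c0 < b -> laplace_dom c0 f ->
  (forall s, b <= complex.Re s <= c -> hol K s) -> strip_growth b c K ->
  (forall t, K (c +i* t)%C = laplace f (c +i* t)%C) ->
  forall t, K (b +i* t)%C = laplace f (b +i* t)%C.
Proof.
move=> bc c0b df hK gK KE tau.
pose D s := K s - laplace f s.
have gD : strip_growth b c D.
  have [C CP] := laplace_bounded df c0b.
  apply: strip_growthD => //; apply: (@strip_growth_bounded _ b c _ C) => s /andP[bs _].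
  by rewrite normcN; exact: CP.
have hD s : b <= complex.Re s <= c -> hol D s.
  move=> bs; apply: holB; first exact: hK.
  by apply: hol_laplace df _; case/andP: bs => bs _; exact: lt_le_trans bs.
have [C CP] := damp_growth bc gD ltr01.
pose h t := D (b +i* t)%C * damp b c 1 (b +i* t)%C.
have hb t : b <= complex.Re (b +i* t)%C <= c by rewrite /= lexx.
have hh t : ccont h t.
  by apply: (@hol_ccont_v _ (fun s => D s * damp b c 1 s)); apply: holM; [exact: hD|exact: hol_damp].
have key n : cint mu setT (fun z => h (tau + n.+1%:R^-1 * z) * (gauss z)%:C%C) = 0.
  pose a : R := n.+1%:R^-1; have a0 : 0 < a by rewrite invr_gt0.
  (* At [s = b + i (tau + a z)] the exponent [q (s - w)^2] becomes [- z^2 / 2], so the factor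
     restricts to [gauss z]. *)
  pose q := (2 * a ^+ 2)^-1; have q0 : 0 < q by rewrite invr_gt0 mulr_gt0 ?exprn_gt0.
  pose w : R[i] := (b +i* tau)%C.
  pose F s := D s * damp b c 1 s * cexp (q%:C%C * ((s - w) * (s - w))).
  have [||i1 i2 E] := @contour_shift R b c (C * expR (q * (0 ^+ 2 + (c - b) ^+ 2))) F bc.
  - move=> s bs; apply: holM; first by apply: holM; [exact: hD|exact: hol_damp].
    apply: (hol_comp (g := @cexp R)); last exact: hol_cexp.
    apply: holM; first exact: hol_cst.
    by apply: holM; apply: holB; [exact: hol_id|exact: hol_cst|exact: hol_id|exact: hol_cst].
  - move=> s bs; rewrite mulrAC normcM; apply: ler_pM; rewrite ?normc_ge0//; first exact: CP.
    by apply: cexp_sqr_bound; [exact: ltW|rewrite ReD ReN /= subr_ge0 lerD2r].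
  have E2 : cint mu setT (fun t => F (c +i* t)%C) = 0.
    transitivity (cint mu setT (fun _ : R => 0 : R[i])); last exact: cint0.
    by apply: eq_cint => t _; rewrite /F /D KE subrr !mul0r.
  have E3 : cint mu setT (fun t => F (b +i* t)%C) =
      a%:C%C * cint mu setT (fun z => h (tau + a * z) * (gauss z)%:C%C).
    rewrite (cint_affine tau a0 i1); congr (_ * _); apply: eq_cint => z _.
    rewrite /F -/(h _) [a * z + tau]addrC; congr (_ * _).
    rewrite (_ : q%:C%C * _ = (- (z ^+ 2 / 2))%:C%C) ?cexpR//.
    rewrite (_ : (b +i* (tau + a * z))%C - w = (0 +i* (a * z))%C).
      by apply: complexP; rewrite !ReImE /= /q; field; rewrite gt_eqF.
    by apply: complexP; rewrite !ReImE /=; ring.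
  move: E; rewrite E2 E3 => /eqP; rewrite mulf_eq0 => /orP[/eqP[/eqP]|/eqP//].
  by rewrite gt_eqF.
have M0 : 0 <= C.
  have := le_trans (normc_ge0 _) (CP _ (hb 0)).
  by rewrite pmulr_lge0 ?expR_gt0.
have A : normc (cint mu setT (fun z => h (tau + n.+1%:R^-1 * z) * (gauss z)%:C%C) -
    h tau * (gaussI R)%:C%C) @[n --> \oo] --> (0 : R).
  apply: (@gauss_approx R h tau C 0 (fun n => n.+1%:R^-1)) => //.
  - by apply: ccont_cmf => //; exact: hh.
  - move=> t; rewrite mul0r expR0 mulr1; apply: le_trans (CP _ (hb t)) _.
    by rewrite ler_piMr// expR_le1 oppr_le0.
  - by move=> n; rewrite invr_ge0 ler0n invf_le1// ler1n.
  - exact: cvg_harmonic.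
move: A; under eq_cvg do rewrite key sub0r normcN.
move=> /(cvg_unique (@Rhausdorff R) (cvg_cst _))/eqP.
move=> E; have : h tau * (gaussI R)%:C%C == 0 by rewrite -normc_eq0; move: E; rewrite eq_sym.
rewrite mulf_eq0 => /orP[|/eqP[/eqP]]; last by rewrite gt_eqF// gaussI_gt0.
by rewrite mulf_eq0 (negbTE (damp_neq0 _ _ _ _)) orbF subr_eq0 => /eqP.
Qed.

Lemma integrable_expN_pos (b : R) : 0 < b ->
  mu.-integrable setT (fun x => (normc (heavi x : R[i]) * expR (- (b * x)))%:E).
Proof. by move=> b0; have [_ _] := laplace_dom_heavi R; apply. Qed.

Definition wL2 (r : R) f := (\int[mu]_x (normc (f x) ^+ 2 * expR (- (2 * r * x)))%:E < +oo)%E.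

Lemma measurable_wL2 r f : cmf setT f ->
  measurable_fun setT (fun x => normc (f x) ^+ 2 * expR (- (2 * r * x))).
Proof.
move=> mf; apply: measurable_funM; last exact: measurable_expN.
by apply: measurable_funX; exact: cmf_normc.
Qed.

(** Cauchy-Schwarz in the pointwise form [p q <= p^2 + q^2], with [p = |f| e^(- r x)] and
    [q = e^(- (b - r) x)], the latter square integrable on the half line. *)
Lemma wL2_laplace_dom r f : cmf setT f -> (forall x, x <= 0 -> f x = 0) -> wL2 r f -> laplace_dom r f.
Proof.
move=> mf f0 f2; split => // b rb.
have b0 : 0 < 2 * (b - r) by rewrite mulr_gt0// subr_gt0.
have q0 x : 0 <= normc (f x) ^+ 2 * expR (- (2 * r * x)).
  by apply: mulr_ge0; [exact: sqr_ge0|exact: expR_ge0].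
have i1 : mu.-integrable setT (fun x => (normc (f x) ^+ 2 * expR (- (2 * r * x)))%:E).
  apply/integrableP; split; first by apply/measurable_EFinP; exact: measurable_wL2.
  apply: le_lt_trans f2; apply: ge0_le_integral => //.
  - by apply/measurable_EFinP; apply: measurableT_comp => //; exact: measurable_wL2.
  - by apply/measurable_EFinP; exact: measurable_wL2.
  - by move=> x _; rewrite /= lee_fin ger0_norm.
have i2 := integrableD measurableT i1 (integrable_expN_pos b0).
apply: (le_integrable _ _ _ i2) => //.
  by apply/measurable_EFinP; apply: measurable_funM; [exact: cmf_normc|exact: measurable_expN].
move=> x _; rewrite /= lee_fin ger0_norm ?mulr_ge0 ?normc_ge0 ?expR_ge0//.
rewrite [leRHS]ger0_norm; last first.
  by apply: addr_ge0 => //; apply: mulr_ge0; [exact: normc_ge0|exact: expR_ge0].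
have [x0|] := boolP (x <= 0).
  by rewrite f0// normc0 mul0r expr0n mul0r add0r mulr_ge0 ?normc_ge0 ?expR_ge0.
rewrite -ltNge => x0; rewrite /heavi x0 normc1 mul1r.
have -> : expR (- (b * x)) = expR (- (r * x)) * expR (- ((b - r) * x)).
  by rewrite -expRD; congr expR; ring.
have -> : expR (- (2 * r * x)) = expR (- (r * x)) ^+ 2.
  by rewrite -expRM_natl; congr expR; ring.
have -> : expR (- (2 * (b - r) * x)) = expR (- ((b - r) * x)) ^+ 2.
  by rewrite -expRM_natl; congr expR; ring.
rewrite -exprMn mulrA; apply: le_trans (le_mul_sqr _ _) _.
by rewrite ler_piMl ?addr_ge0 ?sqr_ge0// invf_le1// ler1n.
Qed.

Lemma cvg_normc_sqr (G : R -> R[i]) (x : R) (u : nat -> R) : ccont G x ->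
  u n @[n --> \oo] --> x -> normc (G (u n)) ^+ 2 @[n --> \oo] --> normc (G x) ^+ 2.
Proof.
move=> /ccontP[g1 g2] ux; rewrite sqr_normcE; under eq_cvg do rewrite sqr_normcE.
have c1 : complex.Re (G (u n)) @[n --> \oo] --> complex.Re (G x) by exact: (continuous_cvg _ g1 ux).
have c2 : complex.Im (G (u n)) @[n --> \oo] --> complex.Im (G x) by exact: (continuous_cvg _ g2 ux).
by apply: cvgD; rewrite expr2; under eq_cvg do rewrite expr2; apply: cvgM.
Qed.

Lemma wL2_laplace_L2 (r c c0 : R) K f : r < c -> laplace_dom c0 f ->
  (forall s, r <= complex.Re s <= c -> hol K s) -> strip_growth r c K ->
  (forall t, K (c +i* t)%C = laplace f (c +i* t)%C) -> wL2 r f ->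
  (\int[mu]_t (normc (K (r +i* t)%C) ^+ 2)%:E < +oo)%E.
Proof.
move=> rc [mf f0 _] hK [M [N [M0 KM]]] KE f2.
have df := wL2_laplace_dom mf f0 f2.
have KE' b : r < b <= c -> forall t, K (b +i* t)%C = laplace f (b +i* t)%C.
  move=> /andP[rb bc]; apply: (laplace_line_eq bc rb df _ _ KE).
    by move=> s /andP[bs sc]; apply: hK; rewrite sc (le_trans (ltW rb)).
  exists M, N; split => // s /andP[bs sc]; apply: KM.
  by rewrite sc (le_trans (ltW rb)).
(* Since [f] lives on [x > 0], where [e^(- b x)] decreases in [b], the weight at [r] dominates: the
   Plancherel bound is uniform in [b]. *)
have wb b : r <= b -> (\int[mu]_x (normc (f x * (expR (- (b * x)))%:C%C) ^+ 2)%:E <=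
    \int[mu]_x (normc (f x) ^+ 2 * expR (- (2 * r * x)))%:E)%E.
  move=> rb; apply: ge0_le_integral => //.
  - by move=> x _; rewrite lee_fin sqr_ge0.
  - apply/measurable_EFinP; apply: measurable_funX; apply: (@cmf_normc _ _ _ setT).
    by apply: cmfM => //; apply: cmf_real; exact: measurable_expN.
  - by apply/measurable_EFinP; exact: measurable_wL2.
  - move=> x _; rewrite lee_fin normcM normcR exprMn ger0_norm ?expR_ge0//.
    have [x0|] := boolP (x <= 0); first by rewrite f0// normc0 expr0n !mul0r.
    rewrite -ltNge => x0; rewrite ler_wpM2l ?sqr_ge0// -expRM_natl ler_expR.
    by rewrite mulrN lerN2 mulrA ler_pM2r// ler_pM2l.
(* Lines decreasing to [r]. The Laplace integral represents [K] on each of them, but it need not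
   converge on [Re s = r] itself. *)
pose b_ n : R := r + (c - r) * n.+1%:R^-1.
have rb n : r < b_ n <= c.
  rewrite /b_ ltrDl mulr_gt0 ?subr_gt0 ?invr_gt0//= -lerBrDl ler_piMr ?subr_ge0 ?(ltW rc)//.
  by rewrite invf_le1// ler1n.
apply: (@le_lt_trans _ _ ((gaussI R ^+ 2)%:E * \int[mu]_x (normc (f x) ^+ 2 * expR (- (2 * r * x)))%:E)%E); last first.
  apply: lte_mul_pinfty => //; rewrite ?lee_fin ?sqr_ge0//.
have hKb b : r <= b <= c -> forall t, hol K (b +i* t)%C by move=> rbc t; apply: hK.
have cK b : r <= b <= c -> forall t, ccont (fun t => K (b +i* t)%C) t.
  by move=> rbc t; apply: hol_ccont_v; exact: hKb.
have rr : r <= r <= c by rewrite lexx ltW.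
apply: (@fatou_bound R (fun n t => normc (K (b_ n +i* t)%C) ^+ 2)).
- move=> n; apply: measurable_funX; apply: (@cmf_normc _ _ _ setT).
  by apply: ccont_cmf => //; apply: cK; have /andP[/ltW -> ->] := rb n.
- by apply: measurable_funX; apply: (@cmf_normc _ _ _ setT); apply: ccont_cmf => //; exact: cK.
- by move=> n x; rewrite sqr_ge0.
- by move=> x; rewrite sqr_ge0.
- apply: aeW => t; apply: (@cvg_normc_sqr (fun u => K (u +i* t)%C)).
    by apply: hol_ccont_h; apply: hK.
  rewrite -[X in _ --> X]addr0 -[X in _ --> _ + X](mulr0 (c - r)).
  by apply: cvgD; [exact: cvg_cst|apply: cvgM; [exact: cvg_cst|exact: cvg_harmonic]].
- move=> n; have /andP[rbn _] := rb n.
  apply: (@le_trans _ _ ((gaussI R ^+ 2)%:E * \int[mu]_x (normc (f x * (expR (- (b_ n * x)))%:C%C) ^+ 2)%:E)%E).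
    under eq_integral do rewrite (KE' _ (rb n)) laplace_ft.
    by apply: plancherel_le; exact: cintegrable_laplace_real df rbn.
  by apply: lee_wpmul2l; [rewrite lee_fin sqr_ge0|apply: wb; exact: ltW].
Qed.

End PaleyWiener.

(** * From the line of integration back to the function *)

Section InversePaleyWiener.
Variable R : realType.
Notation mu := (@lebesgue_measure R).
Implicit Types (f : R -> R[i]) (K : R[i] -> R[i]).

Lemma ccontM (G H : R -> R[i]) t : ccont G t -> ccont H t -> ccont (fun x => G x * H x) t.
Proof.
move=> /ccontP[g1 g2] /ccontP[h1 h2]; apply/ccontP; split.
  rewrite (_ : (fun x => _) = fun x => complex.Re (G x) * complex.Re (H x) - complex.Im (G x) * complex.Im (H x)).
    by apply: cvgB; apply: cvgM.
  by apply/funext => x; rewrite ReM.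
rewrite (_ : (fun x => _) = fun x => complex.Re (G x) * complex.Im (H x) + complex.Im (G x) * complex.Re (H x)).
  by apply: cvgD; apply: cvgM.
by apply/funext => x; rewrite ImM.
Qed.

Lemma ccont_real (g : R -> R) t : {for t, continuous g} -> ccont (fun x => (g x)%:C%C) t.
Proof. by move=> gt; apply/ccontP; split => //=; exact: cvg_cst. Qed.

Lemma cvg_damp (r c : R) s :
  normc (damp r c n.+1%:R^-1 s - 1) @[n --> \oo] --> (0 : R).
Proof.
rewrite /damp; move: (cexp _ + cexp _) => z.
apply: (@squeeze_cvgr _ _ _ _ (fun=> 0) (fun n => 2 * normc z * expR (normc z) * n.+1%:R^-1)).
- near=> n; rewrite normc_ge0/=; apply: le_trans (cexp_sub1 _) _.
  have n1 : n.+1%:R^-1 <= 1 :> R by rewrite invf_le1// ler1n.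
  have nE : normc (- (n.+1%:R^-1)%:C%C * z) = n.+1%:R^-1 * normc z.
    by rewrite mulNr normcN normcM normcR ger0_norm.
  rewrite nE (mulrC n.+1%:R^-1) mulrA mulrAC ler_wpM2r ?invr_ge0//.
  rewrite ler_wpM2l ?mulr_ge0 ?normc_ge0// ler_expR ler_piMr ?normc_ge0//.
- exact: cvg_cst.
- rewrite -[X in _ --> X](mulr0 (2 * normc z * expR (normc z))).
  by apply: cvgM; [exact: cvg_cst|exact: cvg_harmonic].
Unshelve. all: end_near. Qed.

Lemma cint_undamp (r c b : R) (F : R[i] -> R[i]) : r <= c -> r <= b <= c ->
  cintegrable mu setT (fun t => F (b +i* t)%C) ->
  normc (cint mu setT (fun t => F (b +i* t)%C * damp r c n.+1%:R^-1 (b +i* t)%C) -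
    cint mu setT (fun t => F (b +i* t)%C)) @[n --> \oo] --> (0 : R).
Proof.
move=> rc rbc Fi; have mF := cintegrable_cmf Fi.
have [] // := @cint_dominated _ _ _ mu setT
  (fun n t => F (b +i* t)%C * damp r c n.+1%:R^-1 (b +i* t)%C) (fun t => F (b +i* t)%C)
  (fun t => normc (F (b +i* t)%C)) measurableT.
- move=> n; apply: cmfM => //; apply: ccont_cmf => // t; apply: hol_ccont_v; exact: hol_damp.
- move=> t _.
  have : normc (F (b +i* t)%C) * normc (damp r c n.+1%:R^-1 (b +i* t)%C - 1) @[n --> \oo] --> normc (F (b +i* t)%C) * 0.
    by apply: cvgM; [exact: cvg_cst|exact: cvg_damp].
  by rewrite mulr0; under eq_cvg do rewrite -normcM mulrBr mulr1.
- exact: integrable_normc.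
- by move=> n t _; rewrite normcM ler_piMr ?normc_ge0// normc_damp_le1.
Qed.

(** With [damp] the integrand decays and [contour_shift] applies. As [damp] has norm at most 1 on
    the strip and tends to 1, integrability of [F] on the two lines is enough to remove it. *)
Lemma line_shift (r c : R) (F : R[i] -> R[i]) : r <= c ->
  (forall s, r <= complex.Re s <= c -> hol F s) -> strip_growth r c F ->
  cintegrable mu setT (fun t => F (r +i* t)%C) ->
  cintegrable mu setT (fun t => F (c +i* t)%C) ->
  cint mu setT (fun t => F (r +i* t)%C) = cint mu setT (fun t => F (c +i* t)%C).
Proof.
move=> rc hF gF ir ic.
have key n : cint mu setT (fun t => F (r +i* t)%C * damp r c n.+1%:R^-1 (r +i* t)%C) =
    cint mu setT (fun t => F (c +i* t)%C * damp r c n.+1%:R^-1 (c +i* t)%C).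
  have n0 : 0 < n.+1%:R^-1 :> R by rewrite invr_gt0.
  have [C CP] := damp_growth rc gF n0.
  have [||_ _ //] := @contour_shift R r c C (fun s => F s * damp r c n.+1%:R^-1 s) rc.
    by move=> s rs; apply: holM; [exact: hF|exact: hol_damp].
  exact: CP.
have rr : r <= r <= c by rewrite lexx.
have cc : r <= c <= c by rewrite lexx rc.
have c1 := cint_undamp rc rr ir; have c2 := cint_undamp rc cc ic.
pose I n := cint mu setT (fun t => F (c +i* t)%C * damp r c n.+1%:R^-1 (c +i* t)%C).
have c12 : normc (I n - cint mu setT (fun t => F (r +i* t)%C)) +
    normc (I n - cint mu setT (fun t => F (c +i* t)%C)) @[n --> \oo] --> (0 : R).
  rewrite -[X in _ --> X]addr0; apply: cvgD; last exact: c2.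
  rewrite (_ : (fun n => normc (I n - _)) = fun n => normc (cint mu setT (fun t => F (r +i* t)%C * damp r c n.+1%:R^-1 (r +i* t)%C) - cint mu setT (fun t => F (r +i* t)%C))); first exact: c1.
  by apply/funext => n; rewrite /I -key.
apply/eqP; rewrite -subr_eq0 -normc_eq0 eq_le normc_ge0 andbT.
apply: (@ler_cvg_cst R _ 0 _ _ c12) => n; move: (I n) => J.
rewrite [X in normc X](_ : _ = (J - cint mu setT (fun t => F (c +i* t)%C)) - (J - cint mu setT (fun t => F (r +i* t)%C))).
  by rewrite [leRHS]addrC; exact: ler_normcB.
ring.
Qed.

Lemma cauchy_schwarz_gauss (a : R) (k : R -> R[i]) : 0 < a -> cmf setT k ->
  (\int[mu]_t (normc (k t) ^+ 2)%:E < +oo)%E ->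
  cintegrable mu setT (fun t => k t * (gauss (a * t))%:C%C).
Proof.
move=> a0 mk k2.
have i1 : mu.-integrable setT (fun t => (normc (k t) ^+ 2)%:E).
  have m2 : measurable_fun setT (fun t => normc (k t) ^+ 2).
    by apply: measurable_funX; exact: cmf_normc.
  apply/integrableP; split; first exact/measurable_EFinP.
  apply: le_lt_trans k2; apply: ge0_le_integral => //.
  - by apply/measurable_EFinP; exact: measurableT_comp.
  - exact/measurable_EFinP.
  - by move=> x _; rewrite /= lee_fin ger0_norm ?sqr_ge0.
have i2 : mu.-integrable setT (fun t => (gauss (a * t))%:E).
  have := integrable_affine 0 a0 (integrable_gauss R).
  by under eq_fun do rewrite addr0.
have i3 := integrableD measurableT i1 i2.
have i3' : mu.-integrable setT (fun t => (normc (k t) ^+ 2 + gauss (a * t))%:E) by exact: i3.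
apply: (le_cintegrable _ _ i3') => //.
  apply: cmfM => //; apply: cmf_real; apply: measurableT_comp; first exact: measurable_gauss.
  exact: measurable_funM.
move=> t _; rewrite normcM normcR ger0_norm ?gauss_ge0//.
have g1 : gauss (a * t) <= 1 by rewrite /gauss expR_le1 oppr_le0 divr_ge0 ?sqr_ge0.
have g0 := gauss_ge0 (a * t); have n0 := normc_ge0 (k t).
have := sqr_ge0 (normc (k t) - 1); nra.
Qed.

Lemma ftN k t : cintegrable mu setT k -> fourier k (- t) = (fourier (fun x => (k x)^*%C) t)^*%C.
Proof.
move=> ki; rewrite /fourier.
have ki' : cintegrable mu setT (fun x => (k x)^*%C * expi (- (x * t))).
  by apply: cintegrable_expiM; [exact: measurable_mulNl|exact: cintegrable_conj].
apply: etrans (cint_conj measurableT ki'); apply: eq_cint => x _.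
apply/esym; apply: etrans (conjcM _ _) _; congr (_ * _); first exact: conjcK.
by apply: etrans (expi_conj _) _; rewrite mulrN.
Qed.

(** Let [h = f e^(- c x)], [q = c - r] and [H a] its Gaussian mean of width [a]. The inversion
    formula writes [gaussI * H a x] as the integral over [Re s = c] of [K(s)] times
    [exp (a^2 (s - c)^2 / 2 + x (s - c))]. On [Re s = r], where [s - c = - q + i t], it becomes
    [e^(a^2 q^2 / 2 - q x)] times the Fourier transform of [K(r + i t) gauss(a t)] at [a^2 q - x].
    Plancherel, translation invariance and Fatou as [a -> 0] conclude. *)
Lemma L2_laplace_wL2_cont (r c c0 M k : R) K f : r < c -> c0 < c -> laplace_dom c0 f ->
  (forall s, r <= complex.Re s <= c -> hol K s) -> strip_growth r c K ->
  (forall t, K (c +i* t)%C = laplace f (c +i* t)%C) ->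
  (forall t, ccont f t) -> 0 <= k -> (forall x, normc (f x) <= M * expR (k * `|x|)) ->
  (\int[mu]_t (normc (K (r +i* t)%C) ^+ 2)%:E < +oo)%E ->
  (\int[mu]_x (normc (f x) ^+ 2 * expR (- (2 * r * x)))%:E <=
   (expR ((c - r) ^+ 2) / gaussI R ^+ 2)%:E * \int[mu]_t (normc (K (r +i* t)%C) ^+ 2)%:E)%E.
Proof.
move=> rc c0c df hK gK KE cf k0 fM K2.
have I0 := gaussI_gt0 R.
pose q := c - r; have q0 : 0 < q by rewrite subr_gt0.
pose h x := f x * (expR (- (c * x)))%:C%C.
have hi : cintegrable mu setT h := cintegrable_laplace_real df c0c.
have hKE t : fourier h t = K (c +i* t)%C by rewrite KE laplace_ft.
have ch t : ccont h t.
  apply: ccontM => //; apply: ccont_real.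
  apply: (continuous_comp (f := fun x => - (c * x)) (g := @expR R)); last exact: continuous_expR.
  by apply: cvgN; apply: cvgM; [exact: cvg_cst|exact: cvg_id].
have hM x : normc (h x) <= M * expR ((k + `|c|) * `|x|).
  rewrite normcM normcR (ger0_norm (expR_ge0 _)) mulrDl expRD mulrA.
  apply: ler_pM; rewrite ?normc_ge0 ?expR_ge0// ler_expR -normrM.
  by rewrite -normrN ler_norm.
pose H a x := cint mu setT (fun z => h (x + a * z) * (gauss z)%:C%C).
pose kk (a t : R) := K (r +i* t)%C * (gauss (a * t))%:C%C.
have rr : r <= r <= c by rewrite lexx ltW.
have cKr t : ccont (fun t => K (r +i* t)%C) t by apply: hol_ccont_v; exact: hK.
have mKr : cmf setT (fun t => K (r +i* t)%C) by exact: ccont_cmf.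
have kki a : 0 < a -> cintegrable mu setT (kk a) by move=> a0; exact: cauchy_schwarz_gauss.
have HE a x : 0 < a -> (gaussI R)%:C%C * H a x =
    (expR (a ^+ 2 / 2 * q ^+ 2 - q * x))%:C%C * fourier (kk a) (a ^+ 2 * q - x).
  move=> a0; pose F s := K s * (cexp ((a ^+ 2 / 2)%:C%C * ((s - c%:C%C) * (s - c%:C%C))) * cexp (x%:C%C * (s - c%:C%C))).
  have Fc t : F (c +i* t)%C = fourier h t * ((gauss (a * t))%:C%C * expi (x * t)).
    rewrite /F -hKE; congr (_ * _).
    have -> : (c +i* t)%C - c%:C%C = (0 +i* t)%C by apply: complexP; rewrite !ReImE /=; ring.
    rewrite /gauss /expi -cexpR; congr (cexp _ * cexp _); by apply: complexP; rewrite !ReImE /=; field.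
  have Fr t : F (r +i* t)%C = (expR (a ^+ 2 / 2 * q ^+ 2 - q * x))%:C%C * (kk a t * expi (- (t * (a ^+ 2 * q - x)))).
    rewrite /F /kk /gauss /expi -!cexpR -cexpD.
    set w := K _; set A := cexp _; set B := cexp _; set C := cexp _; set D := cexp _.
    rewrite (_ : B * (w * C * D) = w * (B * C * D)); last by ring.
    rewrite /A /B /C /D -!cexpD; congr (_ * cexp _); rewrite /q.
    by apply: complexP; rewrite !ReImE /=; field.
  have g1 y : gauss y <= 1 by rewrite /gauss expR_le1 oppr_le0 divr_ge0 ?sqr_ge0.
  have E1 : cint mu setT (fun t => F (c +i* t)%C) = (gaussI R)%:C%C * H a x.
    pose k1 y := h y * (gauss ((y - x) / a))%:C%C.
    have k1i : cintegrable mu setT k1.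
      apply: (le_cintegrable _ _ (integrable_normc measurableT hi)) => //.
        apply: cmfM; first exact: cintegrable_cmf hi.
        apply: cmf_real; apply: measurableT_comp; first exact: measurable_gauss.
        by apply: measurable_funM => //; exact: measurable_funB.
      by move=> y _; rewrite /k1 (normcM (h y)) normcR ger0_norm ?gauss_ge0// ler_piMr ?normc_ge0 ?g1.
    transitivity (cint mu setT (fun y => (gaussI R / a)%:C%C * k1 y)).
      transitivity (cint mu setT (fun t => fourier h t * ((gauss (a * t))%:C%C * expi (x * t)))).
        by apply: eq_cint => t _; exact: Fc.
      rewrite (ft_mul hi (cintegrable_gauss_scale x a0)); apply: eq_cint => y _.
      by rewrite ft_gauss// rmorphM /= mulrCA.
    rewrite (cintZ _ measurableT k1i) (cint_affine x a0 k1i) mulrA -rmorphM /= divfK; last by rewrite gt_eqF.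
    apply: (congr1 (fun w => (gaussI R)%:C%C * w)); apply: eq_cint => z _; rewrite /k1 addrK [a * z + x]addrC mulrC.
    by rewrite [in RHS]mulrC mulrAC mulfV ?gt_eqF// mul1r.
  have E2 : cint mu setT (fun t => F (r +i* t)%C) = (expR (a ^+ 2 / 2 * q ^+ 2 - q * x))%:C%C * fourier (kk a) (a ^+ 2 * q - x).
    by rewrite (mul_ft _ _ (kki _ a0)); apply: eq_cint => t _; rewrite Fr.
  have hl s : hol (fun s => s - c%:C%C : Cplx R) s by apply: holB; [exact: hol_id|exact: hol_cst].
  rewrite -E1 -E2; apply/esym; apply: line_shift (ltW rc) _ _ _ _.
  - move=> s rs; apply: holM; first exact: hK.
    apply: holM; apply: (hol_comp (g := @cexp R)); try exact: hol_cexp.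
      by apply: holM; [exact: hol_cst|apply: holM].
    by apply: holM; [exact: hol_cst|].
  - apply: strip_growthM => //.
    apply: (@strip_growth_bounded _ _ _ _ (expR (a ^+ 2 / 2 * ((r - c) ^+ 2 + 0 ^+ 2)) * expR (`|x| * q))).
    move=> s /andP[rs sc]; rewrite (normcM (cexp _)); apply: ler_pM; rewrite ?normc_ge0//.
      apply: cexp_sqr_bound; first by rewrite divr_ge0 ?sqr_ge0.
      by rewrite ReD ReN /= subr_le0 sc lerB.
    rewrite normc_cexp ler_expR ReM /= mul0r subr0 ReD ReN /=.
    apply: le_trans (ler_norm _) _; rewrite normrM ler_wpM2l// ler_norml /q.
    by apply/andP; split; lra.
  - rewrite (funext Fr); apply: cintegrableZ => //.
    by apply: cintegrable_expiM (kki _ a0); exact: measurable_mulNl.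
  - rewrite (funext Fc).
    have gi := cintegrable_gauss_scale x a0.
    have gi2 : mu.-integrable setT (fun t => (Rintegral mu setT (fun x => normc (h x)) * normc ((gauss (a * t))%:C%C * expi (x * t)))%:E).
      by under eq_fun do rewrite EFinM; apply: integrableZl => //; exact: integrable_normc.
    apply: (le_cintegrable _ _ gi2) => //.
      by apply: cmfM; [exact: cmf_ft|exact: cintegrable_cmf gi].
    by move=> t _; rewrite (normcM (fourier h t)) ler_wpM2r ?normc_ge0// normc_ft.
(* Since [h^2 e^(2 q x) = f^2 e^(- 2 r x)], this is the weighted square of [f] with [h] replaced by
   its Gaussian mean; [g_] is the same quantity computed on [Re s = r]. *)
pose f_ n x := (normc (H n.+1%:R^-1 x) / gaussI R) ^+ 2 * expR (2 * q * x).
pose g_ n x := expR (n.+1%:R^-1 ^+ 2 * q ^+ 2) / gaussI R ^+ 4 *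
  normc (fourier (fun t => (kk n.+1%:R^-1 t)^*%C) (x - n.+1%:R^-1 ^+ 2 * q)) ^+ 2.
have a0 n : 0 < n.+1%:R^-1 :> R by rewrite invr_gt0.
have fg n x : f_ n x = g_ n x.
  have kn := kki _ (a0 n).
  have I4 : gaussI R != 0 by rewrite gt_eqF.
  have HH : gaussI R * normc (H n.+1%:R^-1 x) = expR (n.+1%:R^-1 ^+ 2 / 2 * q ^+ 2 - q * x) *
      normc (fourier (kk n.+1%:R^-1) (n.+1%:R^-1 ^+ 2 * q - x)).
    have := congr1 (fun z => normc z) (HE _ x (a0 n)).
    by rewrite !normcM !normcR !ger0_norm ?expR_ge0 ?(ltW I0).
  have -> : f_ n x = (gaussI R * normc (H n.+1%:R^-1 x)) ^+ 2 * expR (2 * q * x) / gaussI R ^+ 4.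
    by rewrite /f_; field.
  rewrite HH -(opprB x) (ftN _ kn) normc_conj /g_ exprMn -expRM_natl.
  rewrite (mulrAC (expR _)) -expRD mulrAC; congr (expR _ / _ * _).
  by field.
have cpos n : 0 <= expR (n.+1%:R^-1 ^+ 2 * q ^+ 2) / gaussI R ^+ 4.
  by rewrite divr_ge0 ?expR_ge0 ?exprn_ge0// ltW.
have kci n : cintegrable mu setT (fun t => (kk n.+1%:R^-1 t)^*%C).
  by apply: cintegrable_conj; exact: kki.
have mft n : measurable_fun setT (fun x => normc (fourier (fun t => (kk n.+1%:R^-1 t)^*%C) x) ^+ 2).
  by apply: measurable_funX; apply: cmf_normc; exact: cmf_ft.
have mft' n : measurable_fun setT (fun x : R => normc (fourier (fun t => (kk n.+1%:R^-1 t)^*%C) (x - n.+1%:R^-1 ^+ 2 * q)) ^+ 2).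
  have ms : measurable_fun setT (fun x : R => x - n.+1%:R^-1 ^+ 2 * q) by apply: measurable_funB.
  exact: (measurableT_comp (mft n) ms).
apply: (@fatou_bound R f_).
- by move=> n; rewrite (_ : f_ n = g_ n); [exact: measurable_funM|apply/funext => x].
- by apply: measurable_wL2; exact: ccont_cmf.
- by move=> n x; apply: mulr_ge0; [exact: sqr_ge0|exact: expR_ge0].
- by move=> x; apply: mulr_ge0; [exact: sqr_ge0|exact: expR_ge0].
- apply: aeW => x.
  have A : normc (H n.+1%:R^-1 x - h x * (gaussI R)%:C%C) @[n --> \oo] --> (0 : R).
    apply: (@gauss_approx R h x M (k + `|c|) (fun n => n.+1%:R^-1)) => //.
    + by rewrite addr_ge0.
    + by apply: ccont_cmf.
    + by move=> n; rewrite invr_ge0 ler0n invf_le1// ler1n.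
    + exact: cvg_harmonic.
  have B : normc (H n.+1%:R^-1 x) @[n --> \oo] --> normc (h x) * gaussI R.
    have <- : normc (h x * (gaussI R)%:C%C) = normc (h x) * gaussI R by rewrite normcM normcR gtr0_norm.
    apply/(@cvgrPdist_lt _ R) => e e0; move/(@cvgrPdist_lt _ R)/(_ e e0): A.
    apply: filterS => n; rewrite sub0r normrN ger0_norm ?normc_ge0//.
    apply: le_lt_trans; rewrite ler_norml; apply/andP; split.
      by have := ler_dist_normc (H n.+1%:R^-1 x) (h x * (gaussI R)%:C%C); lra.
    by have := ler_dist_normc (h x * (gaussI R)%:C%C) (H n.+1%:R^-1 x); rewrite normcC; lra.
  have -> : normc (f x) ^+ 2 * expR (- (2 * r * x)) = (normc (h x) * gaussI R / gaussI R) ^+ 2 * expR (2 * q * x).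
    rewrite mulfK ?gt_eqF// normcM normcR ger0_norm ?expR_ge0// exprMn -expRM_natl -(mulrA (normc (f x) ^+ 2)) -expRD.
    by congr (_ * expR _); rewrite /q; ring.
  apply: cvgM; last exact: cvg_cst.
  have B2 : normc (H n.+1%:R^-1 x) / gaussI R @[n --> \oo] --> normc (h x) * gaussI R / gaussI R.
    by apply: cvgM; [exact: B|exact: cvg_cst].
  by rewrite expr2; under eq_cvg do rewrite expr2; apply: cvgM.
- move=> n; under eq_integral do rewrite fg /g_ EFinM.
  rewrite ge0_integralZl; [|exact: measurableT|by apply/measurable_EFinP; exact: mft'|
    by move=> x _; rewrite lee_fin sqr_ge0|by rewrite lee_fin cpos].
  rewrite (@ge0_integral_shift R _ (fun x => (normc (fourier (fun t => (kk n.+1%:R^-1 t)^*%C) x) ^+ 2)%:E)); last 2 first.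
  + exact/measurable_EFinP.
  + by move=> x; rewrite lee_fin sqr_ge0.
  have P := plancherel_le (kci n).
  apply: le_trans (lee_wpmul2l _ P) _; first by rewrite lee_fin.
  rewrite muleA -EFinM; apply: lee_pmul.
  + by rewrite lee_fin mulr_ge0 ?sqr_ge0.
  + by apply: integral_ge0 => x _; rewrite lee_fin sqr_ge0.
  (* Here [e^(a^2 q^2) <= e^(q^2)] because the width [a] is at most 1; this is the origin of the
     constant in the statement. *)
  + rewrite lee_fin (_ : _ / gaussI R ^+ 4 * _ = expR (n.+1%:R^-1 ^+ 2 * q ^+ 2) / gaussI R ^+ 2); last first.
      by field; rewrite gt_eqF.
    rewrite ler_wpM2r ?invr_ge0 ?sqr_ge0// ler_expR -/q ler_piMl ?sqr_ge0//.
    by rewrite expr_le1// invf_le1// ler1n.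
  + apply: ge0_le_integral => //.
    * by move=> x _; rewrite lee_fin sqr_ge0.
    * by apply/measurable_EFinP; apply: measurable_funX; apply: cmf_normc; exact: cintegrable_cmf (kci n).
    * by apply/measurable_EFinP; apply: measurable_funX; exact: (cmf_normc mKr).
    * move=> x _; rewrite lee_fin normc_conj lerXn2r ?nnegrE ?normc_ge0//.
      by rewrite normcM normcR ger0_norm ?gauss_ge0// ler_piMr ?normc_ge0// /gauss expR_le1 oppr_le0 divr_ge0 ?sqr_ge0.
Qed.

End InversePaleyWiener.

(** * Convolutions on the half line and their Laplace transforms *)

Section Convolution.
Variable R : realType.
Notation mu := (@lebesgue_measure R).
Implicit Types (f g : R -> R[i]).

Definition conv f g x := cint mu setT (fun y => f y * g (x - y)).

Section Conv.
Variables (a B : R) (f g : R -> R[i]).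
Hypotheses (df : laplace_dom a f) (dg : laplace_dom a g) (gB : forall x, normc (g x) <= B).

(** The product vanishes unless [0 < y < x], and there [|b| x - b y >= 0]. *)
Lemma le_conv_expR (b x y : R) : normc (f y * g (x - y)) <=
  B * expR (`|b| * `|x|) * (normc (f y) * expR (- (b * y))).
Proof.
have [mf f0 _] := df; have [mg g0 _] := dg.
have B0 : 0 <= B := le_trans (normc_ge0 _) (gB 0).
have R0 : 0 <= B * expR (`|b| * `|x|) * (normc (f y) * expR (- (b * y))).
  by apply: mulr_ge0; apply: mulr_ge0; rewrite ?normc_ge0 ?expR_ge0.
have [y0|] := boolP (y <= 0); first by apply: le_trans R0; rewrite f0// mul0r normc0.
rewrite -ltNge => y0.
have [xy|] := boolP (x - y <= 0); first by apply: le_trans R0; rewrite (g0 _ xy) mulr0 normc0.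
rewrite -ltNge subr_gt0 => xy; rewrite normcM.
have -> : B * expR (`|b| * `|x|) * (normc (f y) * expR (- (b * y))) =
    normc (f y) * (B * (expR (`|b| * `|x|) * expR (- (b * y)))) by ring.
rewrite ler_wpM2l ?normc_ge0//; apply: le_trans (gB _) _; rewrite ler_peMr//.
have x0 := lt_trans y0 xy.
rewrite -expRD -expR0 ler_expR (gtr0_norm x0).
have := ler_norm b; have := normr_ge0 b; have := ltW xy; nra.
Qed.

Lemma cintegrable_conv x : cintegrable mu setT (fun y => f y * g (x - y)).
Proof.
have [mf f0 fi] := df; have [mg g0 _] := dg.
have a1 : a < a + 1 by rewrite ltrDl.
have I : mu.-integrable setT (fun y => (B * expR (`|a + 1| * `|x|) *
    (normc (f y) * expR (- ((a + 1) * y))))%:E).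
  by under eq_fun do rewrite EFinM; apply: integrableZl => //; exact: fi.
apply: (le_cintegrable _ _ I) => //; last by move=> y _; exact: le_conv_expR.
apply: cmfM => //; apply: (cmf_comp _ mg); exact: measurable_funB.
Qed.

(** The factor [e^(- s x)] is split as [e^(- s y) e^(- s (x - y))], so that integrating in [x] first
    separates the two functions. *)
Let kern (s : R[i]) (z : R * R) := f z.2 * cexp (- (s * z.2%:C%C)) *
  (g (z.1 - z.2) * cexp (- (s * (z.1 - z.2)%:C%C))).

Let kernE s x y : kern s (x, y) = cexp (- (s * x%:C%C)) * (f y * g (x - y)).
Proof.
rewrite /kern /= (_ : - (s * x%:C%C) = - (s * y%:C%C) + - (s * (x - y)%:C%C)).
  by rewrite cexpD; ring.
by rewrite rmorphB /=; ring.
Qed.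

Let cmf_kern s : cmf setT (kern s).
Proof.
have [mf f0 fi] := df; have [mg g0 _] := dg.
have m12 : measurable_fun setT (fun z : R * R => z.1 - z.2) by exact: measurable_funB.
apply: cmfM; apply: cmfM.
- exact: (cmf_comp (@measurable_snd _ _ _ _) mf).
- exact: (cmf_comp (@measurable_snd _ _ _ _) (cmf_cexpN s)).
- exact: (cmf_comp m12 mg).
- exact: (cmf_comp m12 (cmf_cexpN s)).
Qed.

Let kern_fin s : a < complex.Re s ->
  (\int[mu]_x \int[mu]_y (normc (kern s (x, y)))%:E < +oo)%E.
Proof.
move=> sa; have [mf f0 fi] := df; have [mg g0 gi] := dg.
have mk : measurable_fun setT (fun z => (normc (kern s z))%:E).
  by apply/measurable_EFinP; exact: cmf_normc.
rewrite (@fubini_tonelli _ _ _ _ R mu mu _ mk)/=; last by move=> z; rewrite lee_fin normc_ge0.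
have mf' : measurable_fun setT (fun y => (normc (f y) * expR (- (complex.Re s * y)))%:E).
  by apply/measurable_EFinP; apply: measurable_funM; [exact: cmf_normc|exact: measurable_expN].
have mg' : measurable_fun setT (fun y => (normc (g y) * expR (- (complex.Re s * y)))%:E).
  by apply/measurable_EFinP; apply: measurable_funM; [exact: cmf_normc|exact: measurable_expN].
have nn (h : R -> R[i]) y : (0 <= (normc (h y) * expR (- (complex.Re s * y)))%:E)%E.
  by rewrite lee_fin mulr_ge0 ?normc_ge0 ?expR_ge0.
have -> : (\int[mu]_y \int[mu]_x (normc (kern s (x, y)))%:E =
    \int[mu]_y ((normc (f y) * expR (- (complex.Re s * y)))%:E *
      \int[mu]_x (normc (g x) * expR (- (complex.Re s * x)))%:E))%E.
  apply: eq_integral => y _.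
  rewrite -(@ge0_integral_shift R (- y) _ mg' (nn g)) -ge0_integralZl//.
  - apply: eq_integral => x _; rewrite /kern /= normcM (normcM (f y)) (normcM (g _)).
    by rewrite !normc_cexpN EFinM.
  - have ms : measurable_fun setT (fun x : R => x - y) by exact: measurable_funB.
    exact: (measurableT_comp mg' ms).
rewrite ge0_integralZr//; last by apply: integral_ge0 => x _; exact: nn.
have gfin := integrable_lty measurableT (gi _ sa).
apply: lte_mul_pinfty; first by apply: integral_ge0 => y _; exact: nn.
- have ffin := integrable_lty measurableT (fi _ sa).
  by rewrite ge0_fin_numE//; apply: integral_ge0 => y _; exact: nn.
- exact: gfin.
Qed.

Let convE s x : cint mu setT (fun y => kern s (x, y)) = cexp (- (s * x%:C%C)) * conv f g x.
Proof.
rewrite /conv -cintZ//; last exact: cintegrable_conv.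
by apply: eq_cint => y _; exact: kernE.
Qed.

Lemma laplace_dom_conv : laplace_dom a (conv f g).
Proof.
have [mf f0 fi] := df; have [mg g0 gi] := dg.
have mc : cmf setT (conv f g).
  have sa : a < complex.Re ((a + 1)%:C%C : R[i]) by rewrite /= ltrDl.
  have := @cmf_cint _ _ _ _ R mu mu _ (cmf_kern _) (kern_fin sa).
  under eq_fun do rewrite convE; set s := (_%:C)%C => mk.
  rewrite (_ : conv f g = fun x : R => cexp (- (- s * x%:C%C)) * (cexp (- (s * x%:C%C)) * conv f g x)).
    by apply: cmfM => //; exact: cmf_cexpN.
  by apply/funext => x; rewrite mulrA -cexpD mulNr opprK addrN cexp0 mul1r.
split => //.
  move=> x x0; rewrite /conv; transitivity (cint mu setT (fun _ : R => 0 : R[i])); last exact: cint0.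
  apply: eq_cint => y _; have [y0|] := boolP (y <= 0); first by rewrite f0// mul0r.
  by rewrite -ltNge => y0; rewrite g0 ?mulr0//; lra.
move=> b ab; have sa : a < complex.Re (b%:C%C : R[i]) by [].
have E x : normc (conv f g x) * expR (- (b * x)) = normc (cint mu setT (fun y => kern b%:C%C (x, y))).
  by rewrite convE normcM normc_cexpN mulrC.
have mb : measurable_fun setT (fun x => normc (conv f g x) * expR (- (b * x))).
  by apply: measurable_funM; [exact: cmf_normc|exact: measurable_expN].
apply/integrableP; split; first exact/measurable_EFinP.
apply: le_lt_trans (kern_fin sa); apply: ge0_le_integral => //.
- by apply/measurable_EFinP; exact: measurableT_comp.
- apply: (measurable_integral_r (K := fun z => normc (kern b%:C%C z))).
    exact: cmf_normc.
  by move=> z; exact: normc_ge0.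
- move=> x _; rewrite /= ger0_norm ?mulr_ge0 ?normc_ge0 ?expR_ge0// E.
  have ki : cintegrable mu setT (fun y => kern b%:C%C (x, y)).
    by under eq_fun do rewrite kernE; apply: cintegrableZ => //; exact: cintegrable_conv.
  have := normc_cint measurableT ki; rewrite -lee_fin fineK// ge0_fin_numE.
    exact: (cintegrable_lty measurableT ki).
  by apply: integral_ge0 => y _; rewrite lee_fin normc_ge0.
Qed.

Lemma laplace_conv s : a < complex.Re s -> laplace (conv f g) s = laplace f s * laplace g s.
Proof.
move=> sa; rewrite /laplace.
transitivity (cint mu setT (fun x => cint mu setT (fun y => kern s (x, y)))).
  by apply: eq_cint => x _; rewrite convE mulrC.
rewrite (@cFubini _ _ _ _ R mu mu _ (cmf_kern s) (kern_fin sa)).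
rewrite [in RHS]mulrC -cintZ//; last exact: cintegrable_laplace df sa.
apply: eq_cint => y _; rewrite /kern /=.
have gi := cintegrable_laplace dg sa.
have gi' := cintegrable_shift (- y) gi.
rewrite -[in RHS](cint_shift (- y) gi) [RHS]mulrC -(cintZ _ measurableT gi').
exact: eq_cint.
Qed.

End Conv.

(** For [u] within 1 of [x], points [y >= |x| + 1] do not contribute; on the remaining bounded range
    the Lipschitz bound for [g] leaves [|u - x|] times an integral of [f]. *)
Lemma ccont_conv a (B L : R) f g : laplace_dom a f -> laplace_dom a g ->
  (forall x, normc (g x) <= B) -> (forall x y, normc (g x - g y) <= L * `|x - y|) ->
  0 <= L -> forall x, ccont (conv f g) x.
Proof.
move=> df dg gB gL L0 x e e0; have [mf f0 fi] := df; have [mg g0 gi] := dg.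
have a1 : a < a + 1 by rewrite ltrDl.
set b := a + 1 in a1.
pose I := Rintegral mu setT (fun y => normc (f y) * expR (- (b * y))).
have I0 : 0 <= I by apply: Rintegral_ge0 => y _; rewrite mulr_ge0 ?normc_ge0 ?expR_ge0.
pose C := L * expR (`|b| * (`|x| + 1)) * I.
have C0 : 0 <= C by rewrite !mulr_ge0 ?expR_ge0.
exists (Num.min 1 (e / (C + 1))) => [|u].
  by rewrite lt_min ltr01 divr_gt0// ltr_wpDl.
rewrite lt_min => /andP[ux1 uxe].
have i1 := cintegrable_conv df dg gB u; have i2 := cintegrable_conv df dg gB x.
rewrite /conv -cintB//.
apply: (@le_lt_trans _ _ (`|u - x| * C)); last first.
  apply: (@le_lt_trans _ _ (e / (C + 1) * C)); first by rewrite ler_wpM2r// ltW.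
  by rewrite mulrAC ltr_pdivrMr ?ltr_wpDl// ltr_pM2l// ltrDl.
have -> : `|u - x| * C = Rintegral mu setT (fun y => `|u - x| * (L * expR (`|b| * (`|x| + 1))) *
    (normc (f y) * expR (- (b * y)))).
  by rewrite RintegralZl//; [rewrite -/I /C; ring|exact: fi].
apply: normc_cint_le => //.
- apply: (@cintegrable_cmf _ _ _ mu); exact: cintegrableB.
- by under eq_fun do rewrite EFinM; apply: integrableZl => //; exact: fi.
move=> y _; have R0 : 0 <= `|u - x| * (L * expR (`|b| * (`|x| + 1))) * (normc (f y) * expR (- (b * y))).
  by rewrite !mulr_ge0 ?normc_ge0 ?expR_ge0.
have [y0|] := boolP (y <= 0); first by apply: le_trans R0; rewrite f0// !mul0r subr0 normc0.
rewrite -ltNge => y0.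
have [yx|] := boolP (`|x| + 1 <= y).
  apply: le_trans R0; rewrite !g0 ?mulr0 ?subr0 ?normc0//.
    by have := ler_norm x; lra.
  by have := ler_norm x; move: ux1; rewrite ltr_norml => /andP[]; lra.
rewrite -ltNge => yx.
rewrite -mulrBr normcM.
have -> : `|u - x| * (L * expR (`|b| * (`|x| + 1))) * (normc (f y) * expR (- (b * y))) =
  normc (f y) * (L * `|u - x| * (expR (`|b| * (`|x| + 1)) * expR (- (b * y)))) by ring.
rewrite ler_wpM2l ?normc_ge0//; apply: le_trans (gL _ _) _.
rewrite (_ : u - y - (x - y) = u - x); last by ring.
rewrite ler_peMr ?mulr_ge0// -expRD -[leLHS]expR0 ler_expR.
have := ler_norm b; have := normr_ge0 b; nra.
Qed.

Lemma conv_growth a (B : R) f g : laplace_dom a f -> laplace_dom a g ->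
  (forall x, normc (g x) <= B) -> exists M k : R, 0 <= k /\
  forall x, normc (conv f g x) <= M * expR (k * `|x|).
Proof.
move=> df dg gB; have [mf f0 fi] := df; have a1 : a < a + 1 by rewrite ltrDl.
exists (B * Rintegral mu setT (fun y => normc (f y) * expR (- ((a + 1) * y)))), `|a + 1|.
split=> // x.
have -> : B * Rintegral mu setT (fun y => normc (f y) * expR (- ((a + 1) * y))) * expR (`|a + 1| * `|x|) =
    Rintegral mu setT (fun y => B * expR (`|a + 1| * `|x|) * (normc (f y) * expR (- ((a + 1) * y)))).
  by rewrite RintegralZl//; [ring|exact: fi].
apply: normc_cint_le => //.
- exact: cintegrable_cmf (cintegrable_conv df dg gB x).
- by under eq_fun do rewrite EFinM; apply: integrableZl => //; exact: fi.
- by move=> y _; exact: (le_conv_expR df dg gB).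
Qed.

End Convolution.

(** * An approximate identity and convergence at Lebesgue points *)

Section Tent.
Variable R : realType.
Notation mu := (@lebesgue_measure R).

(* A Lipschitz kernel makes the convolution continuous; its support in [[0, 2]]
   keeps the convolution supported on the half line. *)
Definition tent (x : R) : R := Num.max 0 (1 - `|x - 1|).

Lemma tent_ge0 x : 0 <= tent x. Proof. by rewrite le_max lexx. Qed.

Lemma tent_le1 x : tent x <= 1. Proof. by rewrite ge_max ler01 gerBl normr_ge0. Qed.

Lemma tent_eq0 x : x <= 0 \/ 2 <= x -> tent x = 0.
Proof.
move=> x02; apply/eqP; rewrite eq_le tent_ge0 andbT ge_max lexx/= subr_le0.
case: x02 => h; last by rewrite ger0_norm; lra.
by rewrite ler0_norm; lra.
Qed.

Lemma tent_lip x y : `|tent x - tent y| <= `|x - y|.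
Proof.
have := lerB_dist (x - 1) (y - 1); have := lerB_dist (y - 1) (x - 1).
rewrite (_ : x - 1 - (y - 1) = x - y); last by ring.
rewrite (_ : y - 1 - (x - 1) = y - x); last by ring.
rewrite (distrC y x); rewrite /tent; set p := `|x - 1|; set q := `|y - 1|; set d := `|x - y| => h1 h2.
have d0 : 0 <= d by exact: normr_ge0.
rewrite ler_norml; case: (leP 0 (1 - p)) => ?; case: (leP 0 (1 - q)) => ?;
  by apply/andP; split; lra.
Qed.

Lemma continuous_tent : continuous tent.
Proof.
move=> x; apply/(@cvgrPdist_lt _ R) => e e0; near=> y.
apply: le_lt_trans (tent_lip _ _) _; near: y; exact: (@cvgr_dist_lt _ _ _ _ _ id).
Unshelve. all: end_near. Qed.

Lemma measurable_tent : measurable_fun setT tent.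
Proof. exact: continuous_measurable_fun continuous_tent. Qed.

(** The bump rescaled to the support [[0, 2 d]], with the same mass [tentI] for every [d]. *)
Definition tentk (d x : R) : R := d^-1 * tent (d^-1 * x).

Section Tentk.
Variable d : R.
Hypothesis d0 : 0 < d.

Lemma tentk_ge0 x : 0 <= tentk d x.
Proof. by rewrite mulr_ge0 ?tent_ge0// invr_ge0 ltW. Qed.

Lemma tentk_le x : tentk d x <= d^-1.
Proof. by rewrite ler_piMr ?tent_le1// invr_ge0 ltW. Qed.

Lemma tentk_eq0 x : x <= 0 \/ 2 * d <= x -> tentk d x = 0.
Proof.
move=> h; rewrite /tentk tent_eq0 ?mulr0//; case: h => h; [left|right].
  by rewrite mulrC pmulr_lle0// invr_gt0.
by rewrite ler_pdivlMl// mulrC.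
Qed.

Lemma tentk_lip x y : `|tentk d x - tentk d y| <= d^-1 ^+ 2 * `|x - y|.
Proof.
have i0 : 0 < d^-1 by rewrite invr_gt0.
rewrite /tentk -mulrBr normrM gtr0_norm// expr2 -mulrA ler_wpM2l ?(ltW i0)//.
by apply: le_trans (tent_lip _ _) _; rewrite -mulrBr normrM gtr0_norm.
Qed.

Lemma measurable_tentk : measurable_fun setT (tentk d).
Proof.
apply: measurable_funM => //; apply: measurableT_comp; first exact: measurable_tent.
exact: measurable_funM.
Qed.

Lemma laplace_dom_tentk a : laplace_dom a (fun x => (tentk d x)%:C%C).
Proof.
split; first by apply: cmf_real; exact: measurable_tentk.
  by move=> x x0; rewrite tentk_eq0//; left.
move=> b _; have [_ _ hi] := laplace_dom_heavi R.
(* On [0 < x < 2 d] the constant dominates [e^(- b x + x)], so any exponential weight is controlled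
   by [e^(- x)] on the half line. *)
have I : mu.-integrable setT (fun x => (d^-1 * expR ((`|b| + 1) * (2 * d)) *
    (normc (heavi x : R[i]) * expR (- (1 * x))))%:E).
  by under eq_fun do rewrite EFinM; apply: integrableZl => //; exact: hi.
apply: (le_integrable _ _ _ I) => //.
  apply/measurable_EFinP; apply: measurable_funM; last exact: measurable_expN.
  by apply: cmf_normc; apply: cmf_real; exact: measurable_tentk.
move=> x _; rewrite /= lee_fin.
have i0 : 0 <= d^-1 by rewrite invr_ge0 ltW.
rewrite [leLHS]ger0_norm ?mulr_ge0 ?normc_ge0 ?expR_ge0//.
rewrite [leRHS]ger0_norm; last by rewrite !mulr_ge0 ?normc_ge0 ?expR_ge0.
have [h|h] : (x <= 0 \/ 2 * d <= x) \/ 0 < x < 2 * d.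
- have [x0|x0] := lerP x 0; first by left; left.
  have [x2|x2] := lerP (2 * d) x; first by left; right.
  by right.
- by rewrite tentk_eq0// normc0 mul0r !mulr_ge0 ?normc_ge0 ?expR_ge0.
move: h => /andP[x0 x2].
rewrite /heavi x0 normc1 !mul1r normcR ger0_norm ?tentk_ge0// -mulrA.
apply: ler_pM; rewrite ?tentk_ge0 ?expR_ge0 ?tentk_le// -expRD ler_expR.
by have := ler_norm (- b); rewrite normrN; have := normr_ge0 b; nra.
Qed.

End Tentk.

Definition tentI := Rintegral mu setT tent.

Lemma integrable_tentk d : 0 < d -> mu.-integrable setT (fun x => (tentk d x)%:E).
Proof.
move=> d0; have [_ _ /(_ 0)] := laplace_dom_tentk d0 (-1).
rewrite ltrN10 => /(_ isT); congr (integrable _ _ _); apply/funext => x; congr (_%:E).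
by rewrite mul0r oppr0 expR0 mulr1 normcR ger0_norm// tentk_ge0.
Qed.

Lemma integrable_tent : mu.-integrable setT (fun x => (tent x)%:E).
Proof.
have := integrable_tentk ltr01; congr (integrable _ _ _); apply/funext => x.
by rewrite /tentk invr1 !mul1r.
Qed.

Lemma integral_tentk d : 0 < d -> (\int[mu]_x (tentk d x)%:E = tentI%:E)%E.
Proof.
move=> d0; have i0 : 0 < d^-1 by rewrite invr_gt0.
rewrite /tentI fineK; last exact: integrable_fin_num integrable_tent.
rewrite [RHS](@integral_affine R d^-1 0)//; last exact: integrable_tent.
rewrite -integralZl//; last exact: (integrable_affine 0 i0 integrable_tent).
by apply: eq_integral => x _; rewrite addr0 -EFinM.
Qed.

Lemma tentI_gt0 : 0 < tentI.
Proof.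
(* On [[1/2, 3/2]], of length 1, the bump is at least 1/2. *)
apply: (@lt_le_trans _ _ 2^-1); first by rewrite invr_gt0.
rewrite /tentI -lee_fin fineK; last exact: integrable_fin_num integrable_tent.
apply: (@le_trans _ _ (\int[mu]_(x in `[2^-1%R, (1 + 2^-1)%R]) (tent x)%:E)%E); last first.
  apply: ge0_subset_integral => //.
  - by apply/measurable_EFinP; exact: measurable_tent.
  - by move=> x _; rewrite lee_fin tent_ge0.
apply: (@le_trans _ _ (\int[mu]_(x in `[2^-1%R, (1 + 2^-1)%R]) (2^-1)%:E)%E).
  rewrite integral_cst//= lebesgue_measure_itv /= lte_fin (_ : (2^-1 < 1 + 2^-1 :> R) = true); last first.
    by apply/idP; lra.
  by rewrite -EFinB addrK -EFinM mulr1.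
apply: ge0_le_integral => //.
- by apply/measurable_EFinP; apply: measurable_funTS; exact: measurable_tent.
- move=> x; rewrite /= in_itv /= => /andP[x1 x2]; rewrite lee_fin le_max; apply/orP; right.
  by rewrite lerBrDl -lerBrDr ler_norml; apply/andP; split; lra.
Qed.

Lemma tentkC d x : 0 < d -> tentk d (2 * d - x) = tentk d x.
Proof.
move=> d0; rewrite /tentk /tent; congr (_ * Num.max _ (1 - _)).
rewrite -normrN; congr (`|_|); field; exact: lt0r_neq0.
Qed.

Lemma integral_tentk_reflect d x : 0 < d ->
  (\int[mu]_y (tentk d (x - y))%:E = tentI%:E)%E.
Proof.
move=> d0; rewrite -(integral_tentk d0).
have mt : measurable_fun setT (fun y => (tentk d y)%:E) by apply/measurable_EFinP; exact: measurable_tentk.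
rewrite -(@ge0_integral_shift R (2 * d - x) _ mt); last by move=> y; rewrite lee_fin tentk_ge0.
by apply: eq_integral => y _; rewrite -tentkC//; congr (tentk d _)%:E; ring.
Qed.

(** To be used with [p] the real or the imaginary part, as the differentiation theorem concerns real
    functions. On a bounded set an exponential weight is bounded below. *)
Lemma locally_integrable_laplace_dom a (f : R -> R[i]) (p : R[i] -> R) : laplace_dom a f ->
  measurable_fun setT (fun x => p (f x)) -> (forall z, `|p z| <= normc z) ->
  locally_integrable [set: R] (fun x => p (f x)).
Proof.
move=> [mf f0 fi] mp pz; split => //; first exact: openT.
move=> K _ Kc; have [N [_ KN]] := compact_bounded Kc.
have mK := compact_measurable Kc.
pose b := a + 1; pose C := expR (`|b| * `|N + 1|).
have ab : a < b by rewrite ltrDl.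
have := fi b ab => I.
have IC : mu.-integrable setT (fun x => (C * (normc (f x) * expR (- (b * x))))%:E).
  by under eq_fun do rewrite EFinM; apply: integrableZl.
have ICK : mu.-integrable K (fun x => (C * (normc (f x) * expR (- (b * x))))%:E).
  exact: integrableS IC.
apply: (@le_lt_trans _ _ (\int[mu]_(x in K) (C * (normc (f x) * expR (- (b * x))))%:E)%E); last exact: integrable_lty.
apply: ge0_le_integral => //.
- by apply/measurable_EFinP; apply: measurable_funTS; exact: measurableT_comp.
- by apply: (measurable_int mu); exact: ICK.
- move=> x Kx; rewrite lee_fin; apply: le_trans (pz _) _.
  rewrite mulrCA ler_peMr ?normc_ge0// /C -expRD -[leLHS]expR0 ler_expR.
  have xN : `|x| <= `|N + 1|.
    apply: le_trans (ler_norm (N + 1)); apply: KN => //; first by rewrite ltrDl.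
  have := ler_norm (b * x); rewrite normrM.
  have := ler_wpM2l (normr_ge0 b) xN; lra.
Qed.

(** The kernel is at most [1 / d] and lives on the ball of radius [2 d] about [x], of measure [4 d];
    this gives the factor 4 in front of the averages. *)
Lemma conv_tent_le a (f : R -> R[i]) d x : 0 < d -> laplace_dom a f ->
  ((normc (conv f (fun w => (tentk d w)%:C%C) x - f x * tentI%:C%C))%:E <=
   4%:E * (davg (fun y => complex.Re (f y)) x (2 * d) + davg (fun y => complex.Im (f y)) x (2 * d)))%E.
Proof.
move=> d0 df; have [mf f0 fi] := df.
have dt := laplace_dom_tentk d0 a.
have tB w : normc ((tentk d w)%:C%C : R[i]) <= d^-1.
  by rewrite normcR ger0_norm ?tentk_ge0// tentk_le.
have i1 := cintegrable_conv df dt tB x.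
have mtx : measurable_fun setT (fun y : R => tentk d (x - y)).
  apply: measurableT_comp; first exact: measurable_tentk.
  exact: measurable_funB.
have i2 : cintegrable mu setT (fun y => f x * (tentk d (x - y))%:C%C).
  apply: cintegrableZ => //; apply: cintegrable_real; apply/integrableP; split.
    exact/measurable_EFinP.
  under eq_integral do rewrite /= ger0_norm ?tentk_ge0//.
  by rewrite integral_tentk_reflect// ltry.
have -> : f x * tentI%:C%C = cint mu setT (fun y => f x * (tentk d (x - y))%:C%C).
  rewrite cintZ//; last first.
    apply: cintegrable_real; apply/integrableP; split; first exact/measurable_EFinP.
    under eq_integral do rewrite /= ger0_norm ?tentk_ge0//.
    by rewrite integral_tentk_reflect// ltry.
  by congr (_ * _); congr Complex; rewrite /= /Rintegral ?integral_tentk_reflect// integral0.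
have i12 := cintegrableB measurableT i1 i2.
rewrite /conv -cintB//.
apply: (@le_trans _ _ (\int[mu]_y (normc (f y * (tentk d (x - y))%:C%C - f x * (tentk d (x - y))%:C%C))%:E)%E).
  have := normc_cint measurableT i12; rewrite -lee_fin fineK// ge0_fin_numE.
    exact: (cintegrable_lty measurableT i12).
  by apply: integral_ge0 => y _; rewrite lee_fin normc_ge0.
have r0 : 0 < 2 * d by rewrite mulr_gt0.
have mB : measurable (ball x (2 * d)) by exact: measurable_ball.
have mp : measurable_fun setT (fun y => `|complex.Re (f y) - complex.Re (f x)|).
  by apply: measurableT_comp => //; apply: measurable_funB => //; exact: mf.1.
have mq : measurable_fun setT (fun y => `|complex.Im (f y) - complex.Im (f x)|).
  by apply: measurableT_comp => //; apply: measurable_funB => //; exact: mf.2.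
have davgE (p : R -> R) : davg p x (2 * d) =
    ((4 * d)^-1%:E * \int[mu]_(y in ball x (2 * d)) (`|p y - p x|)%:E)%E.
  rewrite /davg /iavg lebesgue_measure_ball ?(ltW r0)//.
  rewrite inver (_ : (2 * d) *+ 2 = 4 * d); last by rewrite -mulr_natl mulrA -natrM.
  by rewrite gt_eqF ?mulr_gt0.
rewrite !davgE -ge0_muleDr; last 2 first.
- by apply: integral_ge0 => y _; rewrite lee_fin.
- by apply: integral_ge0 => y _; rewrite lee_fin.
rewrite muleA -EFinM -ge0_integralD//; last 2 first.
- by apply/measurable_EFinP; exact: measurable_funTS.
- by apply/measurable_EFinP; exact: measurable_funTS.
rewrite -ge0_integralZl//; last 3 first.
- by apply: emeasurable_funD; apply/measurable_EFinP; exact: measurable_funTS.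
- by move=> y _; rewrite adde_ge0 ?lee_fin.
- by rewrite lee_fin divr_ge0 ?mulr_ge0 ?(ltW d0).
rewrite [leRHS]integral_mkcond; apply: ge0_le_integral => //.
- by move=> y _; rewrite lee_fin normc_ge0.
- by apply/measurable_EFinP; apply: cmf_normc; exact: cintegrable_cmf i12.
- apply/(measurable_restrictT _ mB); apply: emeasurable_funM => //.
  by apply: emeasurable_funD; apply/measurable_EFinP; exact: measurable_funTS.
move=> y _; rewrite -mulrBl normcM normcR ger0_norm ?tentk_ge0// patchE.
case: ifPn => [_|].
  rewrite -EFinD -EFinM lee_fin (_ : 4 / (4 * d) = d^-1); last by field; rewrite gt_eqF.
  rewrite mulrC; apply: ler_pM; rewrite ?tentk_ge0 ?normc_ge0 ?tentk_le//.
  by apply: le_trans (normc_leD _) _; rewrite ReD ReN ImD ImN.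
rewrite notin_setE /ball/= => /negP; rewrite -leNgt => xy.
rewrite tentk_eq0 ?mulr0//.
have [xy0|] := boolP (x - y <= 0); first by left.
by rewrite -ltNge => xy0; right; move: xy; rewrite gtr0_norm.
Qed.

(** Convergence holds at every common Lebesgue point of the real and imaginary parts of [f]. *)
Lemma conv_tent_cvg a (f : R -> R[i]) : laplace_dom a f -> \forall x \ae mu,
  normc (conv f (fun w => (tentk n.+1%:R^-1 w)%:C%C) x - f x * tentI%:C%C) @[n --> \oo] --> (0 : R).
Proof.
move=> df; have [[m1 m2] _ _] := df.
have l1 := locally_integrable_laplace_dom df m1 (@normc_Re R).
have l2 := locally_integrable_laplace_dom df m2 (@normc_Im R).
have d1 := lebesgue_differentiation l1; have d2 := lebesgue_differentiation l2.
suff H x : lebesgue_pt (fun y => complex.Re (f y)) x -> lebesgue_pt (fun y => complex.Im (f y)) x ->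
    normc (conv f (fun w => (tentk n.+1%:R^-1 w)%:C%C) x - f x * tentI%:C%C) @[n --> \oo] --> (0 : R).
  case: d1 => N1 [mN1 N10 s1]; case: d2 => N2 [mN2 N20 s2].
  exists (N1 `|` N2); split; first exact: measurableU.
    have E : (mu (N1 `|` N2) <= mu N1 + mu N2)%E by exact: measureU2.
    by apply/eqP; rewrite eq_le measure_ge0 andbT; move: E; rewrite N10 N20 adde0.
  move=> x nx; apply: contrapT => /not_orP[n1 n2]; apply: nx; apply: H; apply: contrapT => h.
    by apply: n1; apply: s1.
  by apply: n2; apply: s2.
move=> p1 p2.
have u0 : 2 * n.+1%:R^-1 @[n --> \oo] --> (0 : R)^'+.
  have c : 2 * n.+1%:R^-1 @[n --> \oo] --> (0 : R).
    by rewrite -[X in _ --> X](mulr0 2); apply: cvgM; [exact: cvg_cst|exact: cvg_harmonic].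
  have p n : 0 < 2 * n.+1%:R^-1 :> R by rewrite mulr_gt0 ?invr_gt0.
  move=> A /c cA.
  have cA' : \forall n \near \oo, 0 < 2 * n.+1%:R^-1 :> R -> A (2 * n.+1%:R^-1) by exact: cA.
  suff : \forall n \near \oo, A (2 * n.+1%:R^-1) by [].
  by apply: filterS cA' => n; apply; exact: p.
pose D n := (davg (fun y => complex.Re (f y)) x (2 * n.+1%:R^-1) +
  davg (fun y => complex.Im (f y)) x (2 * n.+1%:R^-1))%E.
have h : (4%:E * D n)%E @[n --> \oo] --> (0 : \bar R).
  rewrite -[X in _ --> X](mule0 4%:E); apply: cvgeZl => //.
  rewrite -[X in _ --> X](adde0 0%E); apply: cvgeD => //.
    exact: (cvg_comp _ _ u0 p1).
  exact: (cvg_comp _ _ u0 p2).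
suff : (normc (conv f (fun w => (tentk n.+1%:R^-1 w)%:C%C) x - f x * tentI%:C%C))%:E @[n --> \oo] --> (0 : \bar R).
  by move=> /fine_cvgP[].
apply: (@squeeze_cvge _ _ _ _ (fun=> 0%E) _ (fun n => (4%:E * D n)%E)); [|exact: cvg_cst|exact: h].
apply: nearW => n; rewrite lee_fin normc_ge0/=.
by apply: conv_tent_le df; rewrite invr_gt0.
Qed.

End Tent.

Section PaleyWienerL2.
Variable R : realType.
Notation mu := (@lebesgue_measure R).

Lemma cvg_normc (u : nat -> R[i]) l : normc (u n - l) @[n --> \oo] --> (0 : R) ->
  normc (u n) @[n --> \oo] --> normc l.
Proof.
move=> ul; apply/(@cvgrPdist_lt _ R) => e e0; move/(@cvgrPdist_lt _ R)/(_ e e0): ul.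
apply: filterS => n; rewrite sub0r normrN ger0_norm ?normc_ge0//.
apply: le_lt_trans; rewrite ler_norml; apply/andP; split.
  by have := ler_dist_normc (u n) l; lra.
by have := ler_dist_normc l (u n); rewrite normcC; lra.
Qed.

Theorem L2_laplace_wL2 (r c c0 : R) (K : R[i] -> R[i]) (f : R -> R[i]) : r < c -> c0 < c -> laplace_dom c0 f ->
  (forall s, r <= complex.Re s <= c -> hol K s) -> strip_growth r c K ->
  (forall t, K (c +i* t)%C = laplace f (c +i* t)%C) ->
  (\int[mu]_t (normc (K (r +i* t)%C) ^+ 2)%:E < +oo)%E -> wL2 r f.
Proof.
move=> rc c0c df hK gK KE K2; have [mf f0 fi] := df.
pose g n := fun w : R => (tentk n.+1%:R^-1 w)%:C%C : R[i].
have d0 n : 0 < n.+1%:R^-1 :> R by rewrite invr_gt0.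
have dg n a : laplace_dom a (g n) := laplace_dom_tentk (d0 n) a.
have gB n w : normc (g n w) <= n.+1%:R^-1^-1.
  by rewrite normcR ger0_norm ?tentk_ge0// tentk_le.
pose Kn n s := K s * laplace (g n) s.
have gnb n : exists C : R, forall s, r <= complex.Re s -> normc (laplace (g n) s) <= C.
  by apply: (laplace_bounded (dg n (r - 1))); rewrite gtrBl.
(* All kernels are supported in [[0, 2]] with mass [tentI], and [e^(- r w) <= e^(2 |r|)] there.
   Unlike the bounds in [gnb], this one is uniform in [n], as Fatou requires. *)
pose B := expR (2 * `|r|) * tentI R.
have B0 : 0 <= B by rewrite mulr_ge0 ?expR_ge0// ltW// tentI_gt0.
have gnr n t : normc (laplace (g n) (r +i* t)%C) <= B.
  have re : r - 1 < complex.Re (r +i* t)%C by rewrite /= gtrBl.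
  apply: le_trans (normc_laplace (dg n (r - 1)) re) _.
  have it : mu.-integrable setT (fun w => (expR (2 * `|r|) * tentk n.+1%:R^-1 w)%:E).
    by under eq_fun do rewrite EFinM; apply: integrableZl => //; exact: integrable_tentk.
  have -> : B = Rintegral mu setT (fun w => expR (2 * `|r|) * tentk n.+1%:R^-1 w).
    by rewrite RintegralZl//; [congr (_ * _); rewrite /Rintegral integral_tentk|exact: integrable_tentk].
  apply: le_Rintegral => //.
    by have [_ _ H] := dg n (r - 1); apply: H.
  move=> w _; rewrite /g normcR ger0_norm ?tentk_ge0// mulrC.
  have R0 : 0 <= expR (2 * `|r|) * tentk n.+1%:R^-1 w by rewrite mulr_ge0 ?expR_ge0 ?tentk_ge0.
  have [w0|] := boolP (w <= 0); first by apply: le_trans R0; rewrite tentk_eq0 ?mulr0//; left.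
  rewrite -ltNge => w0.
  have [w2|] := boolP (2 * n.+1%:R^-1 <= w); first by apply: le_trans R0; rewrite tentk_eq0 ?mulr0//; right.
  rewrite -ltNge => w2; rewrite ler_wpM2r ?tentk_ge0// ler_expR /=.
  have n1 : n.+1%:R^-1 <= 1 :> R by rewrite invf_le1// ler1n.
  have h1 : - r * w <= `|r| * w by rewrite ler_wpM2r ?(ltW w0)// -normrN ler_norm.
  have h2 : `|r| * w <= `|r| * 2 by rewrite ler_wpM2l// ltW// (lt_le_trans w2)// ler_piMr.
  lra.
have bound n : (\int[mu]_x (normc (conv f (g n) x) ^+ 2 * expR (- (2 * r * x)))%:E <=
    (expR ((c - r) ^+ 2) / gaussI R ^+ 2)%:E * ((B ^+ 2)%:E * \int[mu]_t (normc (K (r +i* t)%C) ^+ 2)%:E))%E.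
  have dc := laplace_dom_conv df (dg n c0) (gB n).
  have [M [k [k0 cM]]] := conv_growth df (dg n c0) (gB n).
  have gL x y : normc (g n x - g n y) <= n.+1%:R^-1^-1 ^+ 2 * `|x - y|.
    by rewrite /g -rmorphB normcR; exact: tentk_lip.
  have cc := ccont_conv df (dg n c0) (gB n) gL (sqr_ge0 _).
  have rr : r <= r <= c by rewrite lexx ltW.
  have mKn : measurable_fun setT (fun t => normc (Kn n (r +i* t)%C) ^+ 2).
    apply: measurable_funX; apply: (@cmf_normc _ _ _ setT); apply: ccont_cmf => // t.
    apply: hol_ccont_v; apply: holM; first exact: hK.
    by apply: (hol_laplace (dg n (r - 1))); rewrite /= gtrBl.
  have mK : measurable_fun setT (fun t => normc (K (r +i* t)%C) ^+ 2).
    apply: measurable_funX; apply: (@cmf_normc _ _ _ setT); apply: ccont_cmf => // t.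
    by apply: hol_ccont_v; exact: hK.
  have KnB : (\int[mu]_t (normc (Kn n (r +i* t)%C) ^+ 2)%:E <= (B ^+ 2)%:E * \int[mu]_t (normc (K (r +i* t)%C) ^+ 2)%:E)%E.
    rewrite -ge0_integralZl//; last 3 first.
    - exact/measurable_EFinP.
    - by move=> t _; rewrite lee_fin sqr_ge0.
    - by rewrite lee_fin sqr_ge0.
    apply: ge0_le_integral => //.
    - by move=> t _; rewrite lee_fin sqr_ge0.
    - exact/measurable_EFinP.
    - by apply: emeasurable_funM => //; exact/measurable_EFinP.
    - move=> t _; rewrite -EFinM lee_fin normcM exprMn mulrC ler_wpM2r ?sqr_ge0//.
      by apply: lerXn2r; rewrite ?nnegrE ?normc_ge0.
  apply: (@le_trans _ _ ((expR ((c - r) ^+ 2) / gaussI R ^+ 2)%:E * \int[mu]_t (normc (Kn n (r +i* t)%C) ^+ 2)%:E)%E); last first.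
    by apply: lee_wpmul2l => //; rewrite lee_fin divr_ge0 ?expR_ge0 ?sqr_ge0.
  apply: (L2_laplace_wL2_cont rc c0c dc _ _ _ cc k0 cM).
  - move=> s rs; apply: holM; first exact: hK.
    apply: (hol_laplace (dg n (r - 1))); case/andP: rs => rs _; apply: lt_le_trans rs.
    by rewrite gtrBl.
  - apply: strip_growthM => //; have [C CP] := gnb n.
    by apply: (@strip_growth_bounded _ _ _ _ C) => s /andP[rs _]; exact: CP.
  - by move=> t; rewrite /Kn (laplace_conv df (dg n c0) (gB n))// KE.
  - apply: le_lt_trans KnB _; apply: lte_mul_pinfty => //; by rewrite lee_fin sqr_ge0.
have fin : ((expR ((c - r) ^+ 2) / gaussI R ^+ 2)%:E * ((B ^+ 2)%:E * \int[mu]_t (normc (K (r +i* t)%C) ^+ 2)%:E) < +oo)%E.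
  apply: lte_mul_pinfty => //; first by rewrite lee_fin divr_ge0 ?expR_ge0 ?sqr_ge0.
  by apply: lte_mul_pinfty => //; rewrite lee_fin sqr_ge0.
have F : (\int[mu]_x ((normc (f x) * tentI R) ^+ 2 * expR (- (2 * r * x)))%:E < +oo)%E.
  apply: le_lt_trans fin.
  apply: (@fatou_bound R (fun n x => normc (conv f (g n) x) ^+ 2 * expR (- (2 * r * x)))).
  - by move=> n; apply: measurable_wL2; have [] := laplace_dom_conv df (dg n c0) (gB n).
  - apply: measurable_funM; last exact: measurable_expN.
    apply: measurable_funX; apply: measurable_funM => //; exact: cmf_normc.
  - by move=> n x; apply: mulr_ge0; [exact: sqr_ge0|exact: expR_ge0].
  - by move=> x; apply: mulr_ge0; [exact: sqr_ge0|exact: expR_ge0].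
  - case: (conv_tent_cvg df) => N [mN N0 sN]; exists N; split => // x nx; apply: sN => cx; apply: nx.
    apply: cvgM; last exact: cvg_cst.
    have <- : normc (f x * (tentI R)%:C%C) = normc (f x) * tentI R.
      by rewrite normcM normcR gtr0_norm// tentI_gt0.
    by have cN := cvg_normc cx; rewrite expr2; under eq_cvg do rewrite expr2; apply: cvgM.
  - exact: bound.
have I2 : 0 < tentI R ^+ 2 by rewrite exprn_gt0// tentI_gt0.
have : ((tentI R ^+ 2)%:E * \int[mu]_x (normc (f x) ^+ 2 * expR (- (2 * r * x)))%:E < +oo)%E.
  apply: le_lt_trans F; rewrite -ge0_integralZl//; last 3 first.
  - by apply/measurable_EFinP; exact: measurable_wL2.
  - by move=> x _; rewrite lee_fin; apply: mulr_ge0; [exact: sqr_ge0|exact: expR_ge0].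
  - by rewrite lee_fin ltW.
  by rewrite le_eqVlt; apply/orP; left; apply/eqP; apply: eq_integral => x _; rewrite -EFinM exprMn; congr EFin; ring.
by rewrite -lte_pdivlMl// mulry gtr0_sg ?invr_gt0// mul1e.
Qed.

End PaleyWienerL2.

Arguments normc : simpl never.

(** * Residues of f(s) u^s *)

Section ExpTaylor.
Variable R : realType.
Implicit Types (z w : R[i]).

Definition exp_poly k w : R[i] := \sum_(j < k) w ^+ j / j`!%:R.

Lemma cderive_realfun (g : R -> R) (t d : R) : is_derive t (1 : R) g d ->
  cderive (fun x => (g x)%:C%C) t d%:C%C.
Proof. by move=> gd; split => //=; exact: is_derive_cst. Qed.

Lemma cderive_monomial j w t :
  cderive (fun x => (x%:C%C * w) ^+ j.+1 / j.+1`!%:R) t (w * ((t%:C%C * w) ^+ j / j`!%:R)).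
Proof.
have D : cderive (fun x : R => (x ^+ j.+1)%:C%C) t (j.+1%:R * t ^+ j)%:C%C.
  apply: cderive_realfun; rewrite (_ : (fun x => x ^+ j.+1) = id ^+ j.+1); last first.
    by apply/funext => x; rewrite !fctE.
  apply: is_derive_eq (is_deriveX j.+1 (is_derive_id t 1)) _.
  by rewrite /GRing.scale /= mulr1.
have := cderiveZ (w ^+ j.+1 / j.+1`!%:R) D.
rewrite (_ : (fun x => _) = (fun x : R => (x%:C%C * w) ^+ j.+1 / j.+1`!%:R)).
  congr cderive; rewrite rmorphM rmorph_nat rmorphXn /= exprMn factS natrM exprS.
  have n1 : j.+1%:R != 0 :> R[i] by rewrite pnatr_eq0.
  have n2 : j`!%:R != 0 :> R[i] by rewrite pnatr_eq0 -lt0n fact_gt0.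
  by move: (j.+1%:R : R[i]) (j`!%:R : R[i]) n1 n2 => A B nA nB; field; rewrite nA nB.
by apply/funext => x; rewrite exprMn rmorphXn /=; ring.
Qed.

Lemma cderive_exp_poly k w t :
  cderive (fun x => exp_poly k.+1 (x%:C%C * w)) t (w * exp_poly k (t%:C%C * w)).
Proof.
rewrite /exp_poly; elim: k => [|k IH].
  rewrite big_ord0 mulr0 (_ : (fun x => _) = fun=> 1); first exact: cderive_cst.
  by apply/funext => x; rewrite big_ord1 expr0 fact0 divr1.
rewrite (_ : (fun x => _) = fun x => \sum_(j < k.+1) (x%:C%C * w) ^+ j / j`!%:R + (x%:C%C * w) ^+ k.+1 / k.+1`!%:R).
  by rewrite big_ord_recr /= mulrDr; apply: cderiveD => //; exact: cderive_monomial.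
by apply/funext => x; rewrite big_ord_recr.
Qed.

(** Induction on [k]: along the segment the derivative of one remainder is [w] times the preceding
    one, and each use of [cderive_segment] costs a factor 2. *)
Lemma exp_taylor k w :
  normc (cexp w - exp_poly k w) <= 2 ^+ k * normc w ^+ k * expR (normc w).
Proof.
elim: k w => [|k IH] w; first by rewrite /exp_poly big_ord0 subr0 !mul1r normc_cexp_le.
have := @cderive_segment R (fun t => cexp (t%:C%C * w) + -1 * exp_poly k.+1 (t%:C%C * w))
  (fun t => w * cexp (t%:C%C * w) + -1 * (w * exp_poly k (t%:C%C * w)))
  (2 ^+ k * normc w ^+ k.+1 * expR (normc w)).
rewrite !mul1r !mul0r cexp0 /exp_poly [X in _ - (1 + -1 * X)](_ : _ = 1); last first.
  by rewrite big_ord_recl expr0 fact0 divr1 big1 ?addr0// => i _; rewrite expr0n mul0r.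
rewrite mulr1 addrN subr0 mulN1r => H.
apply: le_trans (H _ _) _ => [t|t t01|]; last by rewrite (exprS 2) !mulrA.
  by apply: cderiveD; [exact: cderive_cexp|apply: cderiveZ; exact: cderive_exp_poly].
rewrite mulN1r -mulrBr normcM (exprS (normc w)) mulrCA -!mulrA ler_wpM2l ?normc_ge0//.
apply: le_trans (IH _) _; rewrite -mulrA ler_wpM2l ?exprn_ge0//.
have n1 := normc_segment w t01.
by apply: ler_pM; rewrite ?exprn_ge0 ?normc_ge0 ?expR_ge0 ?ler_expR// lerXn2r ?nnegrE ?normc_ge0.
Qed.

(** The Taylor remainder of [e^(z x)] divided by [z^k], with its limit as value at 0, so that it is
    entire. *)
Definition exp_tail k (x : R) z : R[i] :=
  if z == 0 then (x%:C%C) ^+ k / k`!%:R else (cexp (z * x%:C%C) - exp_poly k (z * x%:C%C)) / z ^+ k.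

Lemma exp_tailE k x z : z != 0 ->
  cexp (z * x%:C%C) = exp_poly k (z * x%:C%C) + z ^+ k * exp_tail k x z.
Proof.
by move=> z0; rewrite /exp_tail (negbTE z0) [z ^+ k * _]mulrC divfK ?expf_neq0// addrC subrK.
Qed.

Lemma hol_exp_poly k (x : R) z : hol (fun z => exp_poly k (z * x%:C%C) : Cplx R) z.
Proof.
rewrite /exp_poly; elim: k => [|k IH].
  by apply: (eq_hol (f := fun=> 0)); [move=> s; rewrite big_ord0|exact: hol_cst].
apply: (eq_hol (f := fun z => \sum_(j < k) (z * x%:C%C) ^+ j / j`!%:R + (z * x%:C%C) ^+ k / k`!%:R)).
  by move=> s; rewrite big_ord_recr.
apply: holD => //; apply: holM; last exact: hol_cst.
by apply: holX; apply: holM; [exact: hol_id|exact: hol_cst].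
Qed.

(** At 0 the error in the first order expansion is the remainder of order [k + 2] divided by [h^k],
    hence quadratic in [h] by [exp_taylor]. *)
Lemma hol_exp_tail k x z : hol (exp_tail k x) z.
Proof.
have [->|z0] := eqVneq z 0; last first.
  apply: (near_hol (f := fun z => (cexp (z * x%:C%C) - exp_poly k (z * x%:C%C)) / z ^+ k)).
    apply/nbhs_complexP; exists (normc z); first by rewrite normc_gt0.
    move=> w wz; rewrite /exp_tail; case: eqVneq => // w0; move: wz.
    by rewrite w0 sub0r normcN ltxx.
  apply: holM.
    apply: holB; last exact: hol_exp_poly.
    by apply: (hol_comp (g := @cexp R)); [apply: holM; [exact: hol_id|exact: hol_cst]|exact: hol_cexp].
  by apply: holV; [exact: expf_neq0|apply: holX; exact: hol_id].
exists ((x%:C%C) ^+ k.+1 / k.+1`!%:R) => e e0.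
pose C := 2 ^+ k.+2 * `|x| ^+ k.+2 * expR `|x|.
have C0 : 0 <= C by apply: mulr_ge0; [apply: mulr_ge0; exact: exprn_ge0|exact: expR_ge0].
exists (Num.min 1 (e / (C + 1))) => [|h]; first by rewrite lt_min ltr01 divr_gt0// ltr_wpDl.
rewrite lt_min add0r => /andP[h1 he].
rewrite /exp_tail eqxx; case: eqVneq => [->|h0].
  by rewrite subrr mulr0 subr0 normc0 mulr0.
have -> : (cexp (h * x%:C%C) - exp_poly k (h * x%:C%C)) / h ^+ k - x%:C%C ^+ k / k`!%:R - x%:C%C ^+ k.+1 / k.+1`!%:R * h =
    (cexp (h * x%:C%C) - exp_poly k.+2 (h * x%:C%C)) / h ^+ k.
  rewrite /exp_poly !big_ord_recr /= !exprMn.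
  set S := \sum_(_ < _) _; move: (cexp _) => E.
  rewrite (exprS h); field.
  by rewrite expf_neq0// !pnatr_eq0 -!lt0n !fact_gt0.
rewrite normcM normcV normcX ler_pdivrMr ?exprn_gt0 ?normc_gt0//.
apply: le_trans (exp_taylor _ _) _; rewrite normcM normcR.
have hh := normc_ge0 h.
apply: (@le_trans _ _ (C * normc h ^+ k.+2)).
  rewrite exprMn /C (_ : 2 ^+ k.+2 * (normc h ^+ k.+2 * `|x| ^+ k.+2) * expR (normc h * `|x|) =
    2 ^+ k.+2 * `|x| ^+ k.+2 * normc h ^+ k.+2 * expR (normc h * `|x|)); last by ring.
  rewrite [leRHS](_ : _ = 2 ^+ k.+2 * `|x| ^+ k.+2 * normc h ^+ k.+2 * expR `|x|); last by ring.
  apply: ler_wpM2l; last by rewrite ler_expR ler_piMl// ltW.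
  by apply: mulr_ge0; [apply: mulr_ge0|]; exact: exprn_ge0.
rewrite (_ : C * normc h ^+ k.+2 = C * normc h * normc h * normc h ^+ k); last by rewrite !exprS; ring.
rewrite ler_wpM2r ?exprn_ge0// ler_wpM2r//.
apply: (@le_trans _ _ (C * (e / (C + 1)))); first by rewrite ler_wpM2l// ltW.
by rewrite mulrCA ler_piMr ?(ltW e0)// ler_pdivrMr ?mul1r ?lerDl// ltr_wpDl.
Qed.

End ExpTaylor.

Section Residue.
Variable R : realType.
Implicit Types (f h : Cplx R -> Cplx R) (b : nat -> R[i]).
Variable a : R[i].

(** Multiplying by the highest power of [z - a] gives a function that is continuous at [a], zero
    nearby, and equal at [a] to the top coefficient. That coefficient vanishes, and the induction
    goes down. *)
Lemma laurent_eq0 h b N : hol h a ->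
  (\forall z \near (a : Cplx R)^', h z + \sum_(k < N) b k / (z - a) ^+ k.+1 = 0) ->
  forall k, (k < N)%N -> b k = 0.
Proof.
move=> hh; elim: N => // N IH /dnbhs_complexP[e e0 H].
have bN : b N = 0.
  pose g z := h z * (z - a) ^+ N.+1 + \sum_(k < N.+1) b k * (z - a) ^+ (N - k).
  have hl z : hol (fun z => z - a : Cplx R) z by apply: holB; [exact: hol_id|exact: hol_cst].
  have hg : hol g a.
    apply: holD; first by apply: holM => //; exact: holX.
    apply: (@hol_sum _ N.+1 (fun k z => b k * (z - a) ^+ (N - k))) => k.
    by apply: holM; [exact: hol_cst|exact: holX].
  have g0 z : normc (z - a) < e -> z != a -> g z = 0.
    move=> ze za; have zn : z - a != 0 by rewrite subr_eq0.
    have := congr1 ( *%R^~ ((z - a) ^+ N.+1)) (H z ze za).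
    rewrite mul0r mulrDl mulr_suml => <-; rewrite /g; congr (_ + _).
    apply: eq_bigr => k _; rewrite -mulrA; congr (_ * _).
    have kN : (k <= N)%N by rewrite -ltnS.
    move: (nat_of_ord k) kN => j jN.
    rewrite (_ : N.+1 = (N - j + j.+1)%N); last by rewrite addnS subnK.
    by rewrite exprD mulrCA mulVf ?mulr1// expf_neq0.
  have ga : g a = b N.
    rewrite /g subrr expr0n mulr0 add0r big_ord_recr /= subnn expr0 mulr1 big1 ?add0r// => k _.
    by rewrite expr0n subn_eq0 leqNgt ltn_ord mulr0.
  apply/eqP; rewrite -ga -normc_eq0 eq_le normc_ge0 andbT.
  apply/ler_addgt0Pr => d d0; rewrite add0r.
  have [r r0 rP] := hol_continuous hg d0.
  pose t := Num.min r e / 2; have m0 : 0 < Num.min r e by rewrite lt_min r0.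
  have t0 : 0 < t by rewrite divr_gt0.
  have tm : t < Num.min r e by rewrite /t; lra.
  move: tm; rewrite lt_min => /andP[tr te].
  have nt : normc (a + t%:C%C - a) = t by rewrite addrC addKr normcR gtr0_norm.
  have tz : a + t%:C%C != a.
    by rewrite -subr_eq0 -normc_eq0 nt gt_eqF.
  have := rP (a + t%:C%C); rewrite nt => /(_ tr).
  by rewrite g0 ?nt// sub0r normcN => /ltW.
move=> k; rewrite ltnS leq_eqVlt => /predU1P[->//|]; apply: IH.
apply/dnbhs_complexP; exists e => // z ze za.
by have := H z ze za; rewrite big_ord_recr /= bN mul0r addr0.
Qed.

Lemma near_hol_at f a0 : holomorphic_at f a0 <-> \forall s \near a0, hol f s.
Proof. by split; apply: filterS => s /holP. Qed.

Lemma sum_ord_pad b N M z : (N <= M)%N ->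
  \sum_(k < N) b k / z ^+ k.+1 = \sum_(k < M) (if (k < N)%N then b k else 0) / z ^+ k.+1.
Proof.
move=> NM; rewrite (big_ord_widen_cond _ xpredT (fun k => b k / z ^+ k.+1) NM) big_mkcond.
by apply: eq_bigr => k _ /=; case: ifP; rewrite ?mul0r.
Qed.

(** Polar parts of different lengths are padded with zeros to a common length, so that [laurent_eq0]
    applies to their difference. *)
Lemma is_residue_uniq f c d : is_residue f a c -> is_residue f a d -> c = d.
Proof.
move=> [N [b [h [/near_hol_at/nbhs_singleton hh <- /dnbhs_complexP[e e0 H]]]]].
move=> [M [b' [h' [/near_hol_at/nbhs_singleton hh' <- /dnbhs_complexP[e' e0' H']]]]].
apply/eqP; rewrite -subr_eq0; apply/eqP.
pose m := maxn N.+1 M.+1.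
have := @laurent_eq0 (fun z => h z - h' z)
  (fun k => (if (k < N.+1)%N then b k else 0) - (if (k < M.+1)%N then b' k else 0)) m.
move=> /(_ _ _ 0%N) /=; apply; last by rewrite leq_max.
  exact: holB.
apply/dnbhs_complexP; exists (Num.min e e') => [|z]; first by rewrite lt_min e0.
rewrite lt_min => /andP[ze ze'] za.
have E1 := H z ze za; have E2 := H' z ze' za.
rewrite (sum_ord_pad _ _ (leq_maxl N.+1 M.+1)) in E1.
rewrite (sum_ord_pad _ _ (leq_maxr N.+1 M.+1)) in E2.
under eq_bigr do rewrite mulrBl.
rewrite sumrB -/m; rewrite -/m in E1 E2.
set S1 := \sum_(_ < m) _ in E1 *; set S2 := \sum_(_ < m) _ in E2 *.
have -> : h z - h' z + (S1 - S2) = (h z + S1) - (h' z + S2) by ring.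
by rewrite -E1 -E2 subrr.
Qed.

Lemma ResE f c : is_residue f a c -> Res f a = c.
Proof.
move=> fc; rewrite /Res; case: xgetP => [d -> fd|/(_ c)//].
exact: is_residue_uniq fd fc.
Qed.

End Residue.

Section ResidueExp.
Variable R : realType.
Implicit Types (K f : Cplx R -> Cplx R) (b : nat -> R[i]).

(** The coefficient of [z^-(i+1)] in [e^(z x) / z^(k+1)]. *)
Definition exp_coef (x : R) k i : R[i] :=
  if (i <= k)%N then (x ^+ (k - i) / (k - i)`!%:R)%:C%C else 0.

Lemma exp_laurent (x : R) k M z : z != 0 -> (k < M)%N ->
  cexp (z * x%:C%C) / z ^+ k.+1 =
  exp_tail k.+1 x z + \sum_(i < M) exp_coef x k i / z ^+ i.+1.
Proof.
move=> z0 kM; rewrite (exp_tailE k.+1)// mulrDl addrC mulrAC mulfV ?expf_neq0// mul1r.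
congr (_ + _); rewrite -(sum_ord_pad (fun i => (x ^+ (k - i) / (k - i)`!%:R)%:C%C) z kM).
rewrite /exp_poly mulr_suml (reindex_inj rev_ord_inj) /=; apply: eq_bigr => i _.
rewrite subSS; have ik : (i <= k)%N by rewrite -ltnS.
rewrite rmorphM fmorphV rmorph_nat rmorphXn /= exprMn.
move: (nat_of_ord i) ik => j jk.
rewrite (_ : k.+1 = (k - j + j.+1)%N); last by rewrite addnS subnK.
have f0 : (k - j)`!%:R != 0 :> R[i] by rewrite pnatr_eq0 -lt0n fact_gt0.
rewrite exprD; have := expf_neq0 (k - j) z0; have := expf_neq0 j.+1 z0.
move: (z ^+ (k - j)) (z ^+ j.+1) ((k - j)`!%:R : R[i]) f0 => P Q F f0 q0 p0.
by field; rewrite p0 q0 f0.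
Qed.

Lemma is_residue_exp K f b (m : nat) (sigma u : R) : sigma < 1 -> 0 < u ->
  (forall s : R[i], sigma < complex.Re s -> hol K s) ->
  (\forall s \near (1 : Cplx R)^', f s = K s + \sum_(k < m) b k / (s - 1) ^+ k.+1) ->
  is_residue (fun s => f s * cpow u s) 1 (u%:C%C * \sum_(k < m) b k * (ln u ^+ k / k`!%:R)%:C%C).
Proof.
move=> sigma1 u0 hK /dnbhs_complexP[e e0 H].
set x := ln u.
(* [is_residue] sums over one term more than its first witness, so [m] also covers [m = 0]; the
   additional coefficient is 0. *)
exists m, (fun i => u%:C%C * \sum_(k < m) b k * exp_coef x k i),
  (fun s => K s * cpow u s + u%:C%C * \sum_(k < m) b k * exp_tail k.+1 x (s - 1)); split.
- apply/near_hol_at/nbhs_complexP; exists (1 - sigma); rewrite ?subr_gt0// => s s1.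
  have s0 : sigma < complex.Re s.
    have := le_lt_trans (normc_Re _) s1; rewrite ReD ReN /= ltr_norml => /andP[]; lra.
  apply: holD; first apply: holM; first exact: hK.
    apply: (eq_hol (f := fun s => cexp (s * x%:C%C))); first by move=> w; rewrite cpow_cexp.
    by apply: (hol_comp (g := @cexp R)); [apply: holM; [exact: hol_id|exact: hol_cst]|exact: hol_cexp].
  apply: holM; first exact: hol_cst.
  apply: (@hol_sum _ m (fun k s => b k * exp_tail k.+1 x (s - 1))) => k.
  apply: holM; first exact: hol_cst.
  apply: (hol_comp (f := fun s => s - 1)); last exact: hol_exp_tail.
  by apply: holB; [exact: hol_id|exact: hol_cst].
- by congr (_ * _); apply: eq_bigr => k _; rewrite /exp_coef subn0.
apply/dnbhs_complexP; exists e => // s se s1; rewrite (H s se s1) mulrDl -addrA; congr (_ + _).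
have sn : s - 1 != 0 by rewrite subr_eq0.
have -> : cpow u s = u%:C%C * cexp ((s - 1) * x%:C%C).
  have uE : u%:C%C = cexp x%:C%C by rewrite cexpR lnK ?posrE.
  rewrite cpow_cexp {1}uE -cexpD; congr cexp; rewrite -/x; ring.
rewrite mulr_suml.
transitivity (u%:C%C * \sum_(k < m) b k * (exp_tail k.+1 x (s - 1) + \sum_(i < m.+1) exp_coef x k i / (s - 1) ^+ i.+1)).
  rewrite mulr_sumr; apply: eq_bigr => k _.
  rewrite -exp_laurent//; last by rewrite ltnS ltnW.
  by rewrite mulrCA; congr (_ * _); rewrite mulrAC mulrA.
under eq_bigr do rewrite mulrDr.
rewrite big_split /= mulrDr; congr (_ + _).
under [RHS]eq_bigr do rewrite -mulrA mulr_suml.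
rewrite -mulr_sumr; congr (_ * _); rewrite exchange_big /=.
by apply: eq_bigr => k _; rewrite mulr_sumr; apply: eq_bigr => i _; rewrite mulrA.
Qed.

End ResidueExp.

(** * Mellin transforms as Laplace transforms *)

Section Completion.
Variable R : realType.
Notation mu := (@lebesgue_measure R).
Notation leb := (caratheodory_type ((wlength (@idfun R))^*)%mu).
Notation cmu := (@completed_lebesgue_measure R).

Lemma measurable_borel_leb (D : set R) : measurable (D : set (measurableTypeR R)) ->
  measurable (D : set leb).
Proof. exact: sub_caratheodory. Qed.

Definition to_borel (x : leb) : measurableTypeR R := x.

Lemma measurable_to_borel : measurable_fun setT to_borel.
Proof. by move=> _ B mB; rewrite setTI; exact: measurable_borel_leb. Qed.

Lemma measurable_fun_borel_leb d (T : measurableType d) (D : set R) (f : R -> T) :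
  measurable (D : set (measurableTypeR R)) ->
  measurable_fun (D : set (measurableTypeR R)) f -> measurable_fun (D : set leb) f.
Proof. by move=> mD mf _ B mB; apply: measurable_borel_leb; exact: mf. Qed.

(** The Borel measure is the pushforward of the completed one under the identity. *)
Lemma ge0_integral_completed (D : set R) (f : R -> \bar R) :
  measurable (D : set (measurableTypeR R)) ->
  measurable_fun (D : set (measurableTypeR R)) f -> (forall x, D x -> 0 <= f x)%E ->
  (\int[cmu]_(x in D) f x = \int[mu]_(x in D) f x)%E.
Proof.
move=> mD mf f0.
have f0' : {in D, forall y, (0 <= f y)%E} by move=> y; rewrite inE => /f0.
have := @ge0_integral_pushforward _ _ leb (measurableTypeR R) R _ measurable_to_borel cmu D f mD mf f0'.
move=> H; transitivity (\int[pushforward cmu to_borel]_(x in D) f x)%E; first exact: esym H.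
by apply: eq_measure_integral; first exact: measurable_to_borel.
Qed.

Lemma negligible_borel_cover (E : set R) : mu.-negligible E -> exists N : set R,
  [/\ measurable (N : set (measurableTypeR R)), mu N = 0%E & E `<=` N].
Proof. by move=> [N [mN N0 EN]]; exists N. Qed.

(** A Lebesgue set is a Borel set together with part of a null set; removing a Borel null set that
    contains this part leaves a Borel set. *)
Lemma leb_borel_diff (E : set R) : measurable (E : set leb) -> exists N : set R,
  [/\ measurable (N : set (measurableTypeR R)), mu N = 0%E &
    measurable (E `\` N : set (measurableTypeR R))].
Proof.
move=> mE; have : (completed_algebra_gen mu).-sigma.-measurable E.
  by rewrite completed_caratheodory_measurable.
rewrite g_sigma_completed_algebra_genE => -[A /= mA [M /negligible_borel_cover[N [mN N0 MN]]] <-].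
exists N; split => //.
rewrite setDUl (_ : M `\` N = set0) ?setU0; first exact: measurableD.
by apply/seteqP; split => // x [/MN].
Qed.

(* [L2] and [mellin] refer to the completed measure, whereas Fubini's theorem is
   available for the Borel one; functions are therefore corrected on a null set. *)
Lemma borel_version (D : set R) (f : R -> R) : measurable (D : set (measurableTypeR R)) ->
  measurable_fun (D : set leb) (f : leb -> R) -> exists N : set R,
  [/\ measurable (N : set (measurableTypeR R)), mu N = 0%E &
    measurable_fun (D `\` N : set (measurableTypeR R)) f].
Proof.
move=> mD mf.
(* An enumeration of the rationals. Integers that encode none repeat the level 0, which is harmless
   in a countable union. *)
pose Q n : rat := odflt 0 (unpickle n).
have lev n : exists N : set R, [/\ measurable (N : set (measurableTypeR R)), mu N = 0%E &
    measurable ((D `&` f @^-1` `]ratr (Q n), +oo[) `\` N : set (measurableTypeR R))].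
  by apply: leb_borel_diff; apply: mf => //; exact: measurable_borel_leb.
pose M n := projT1 (cid (lev n)).
have MP n := projT2 (cid (lev n)).
have mM n : measurable (M n : set (measurableTypeR R)) by have [] := MP n.
have mU : measurable (\bigcup_n M n : set (measurableTypeR R)) by exact: bigcupT_measurable.
exists (\bigcup_n M n); split => //.
  have : mu.-negligible (\bigcup_n M n).
    by apply: negligible_bigcup => n; exists (M n); split => //; have [] := MP n.
  by case=> B [mB B0 sB]; apply/eqP; rewrite -measure_le0 -B0 le_measure// inE.
apply: (measurability _ (RGenOInfty.measurableE R)) => _ [_ [x ->] <-].
rewrite (_ : _ `&` _ = \bigcup_n (if x < ratr (Q n) then
    ((D `&` f @^-1` `]ratr (Q n), +oo[) `\` M n) `\` \bigcup_n M n else set0)).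
  apply: bigcupT_measurable => n; case: ifP => _ //.
  by apply: measurableD => //; have [] := MP n.
apply/seteqP; split => y.
  move=> [[Dy ny]]; rewrite /= in_itv /= andbT => xy.
  have [q] := rat_in_itvoo xy; rewrite in_itv /= => /andP[xq qy].
  exists (pickle q) => //; rewrite /Q pickleK /= xq; split => //; split.
    by split => //=; rewrite in_itv /= qy.
  by move=> My; apply: ny; exists (pickle q).
move=> [n _]; case: ifP => // xq [[[Dy]] /=]; rewrite in_itv /= andbT => qy nM nU.
by split => //=; rewrite in_itv /= andbT (lt_trans xq).
Qed.

Lemma cborel_version (D : set R) (f : R -> R[i]) : measurable (D : set (measurableTypeR R)) ->
  cmeasurable D f -> exists N : set R,
  [/\ measurable (N : set (measurableTypeR R)), mu N = 0%E &
    cmf (D `\` N : set (measurableTypeR R)) f].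
Proof.
move=> mD [f1 f2].
have [N1 [m1 n1 g1]] := borel_version mD f1; have [N2 [m2 n2 g2]] := borel_version mD f2.
exists (N1 `|` N2); split; first exact: measurableU.
  have E : (mu (N1 `|` N2) <= mu N1 + mu N2)%E by exact: measureU2.
  by apply/eqP; rewrite eq_le measure_ge0 andbT; move: E; rewrite n1 n2 adde0.
by split; [apply: measurable_funS g1|apply: measurable_funS g2]; try exact: measurableD;
  move=> x [Dx nx]; split => // h; apply: nx; [left|right].
Qed.

Lemma measurable_fun_completed (D N : set R) (f g : R -> R) :
  measurable (D : set (measurableTypeR R)) ->
  measurable (N : set (measurableTypeR R)) -> mu N = 0%E ->
  measurable_fun (setT : set (measurableTypeR R)) g -> (forall x, D x -> ~ N x -> f x = g x) ->
  measurable_fun (D : set leb) (f : leb -> R).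
Proof.
move=> mD mN N0 mg fg; apply/measurable_EFinP.
apply: (@ae_measurable_fun _ leb R cmu (@completed_lebesgue_measure_is_complete R) _ (EFin \o g)).
  exists N; split; [exact: measurable_borel_leb|exact: N0|].
  move=> x; apply: contra_notP => nN Dx; rewrite /= fg//.
apply/measurable_EFinP; apply: measurable_fun_borel_leb => //; exact: measurable_funTS.
Qed.

Lemma cmeasurable_completed (D N : set R) (f g : R -> R[i]) :
  measurable (D : set (measurableTypeR R)) ->
  measurable (N : set (measurableTypeR R)) -> mu N = 0%E ->
  cmf (setT : set (measurableTypeR R)) g -> (forall x, D x -> ~ N x -> f x = g x) ->
  cmeasurable D f.
Proof.
move=> mD mN N0 [g1 g2] fg; split; [apply: (measurable_fun_completed mD mN N0 g1)|
  apply: (measurable_fun_completed mD mN N0 g2)] => x Dx nx; by rewrite fg.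
Qed.

Lemma ae_integral_completed (D N : set R) (f g : R -> R) :
  measurable (D : set (measurableTypeR R)) ->
  measurable (N : set (measurableTypeR R)) -> mu N = 0%E ->
  measurable_fun (setT : set (measurableTypeR R)) g -> (forall x, D x -> ~ N x -> f x = g x) ->
  (\int[cmu]_(x in D) (f x)%:E = \int[mu]_(x in D) (g x)%:E)%E.
Proof.
move=> mD mN N0 mg fg.
have mD' : measurable (D : set leb) by exact: measurable_borel_leb.
have mf := measurable_fun_completed mD mN N0 mg fg.
have mg' : measurable_fun (D : set (measurableTypeR R)) (fun x => (g x)%:E).
  by apply/measurable_EFinP; exact: measurable_funTS.
transitivity (\int[cmu]_(x in D) (g x)%:E)%E.
  apply: ae_eq_integral; first exact: mD'.
  - exact/measurable_EFinP.
  - exact: measurable_fun_borel_leb.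
  - exists N; split; [exact: measurable_borel_leb|exact: N0|].
    by move=> x; apply: contra_notP => nN Dx; rewrite /= fg.
rewrite [LHS]integralE [RHS]integralE; congr (_ - _)%E; apply: ge0_integral_completed => //.
  exact: measurable_funepos.
exact: measurable_funeneg.
Qed.

Lemma L2_borel (D N : set R) (w : R -> R) (f g : R -> R[i]) :
  measurable (D : set (measurableTypeR R)) ->
  measurable (N : set (measurableTypeR R)) -> mu N = 0%E ->
  measurable_fun (setT : set (measurableTypeR R)) w ->
  cmf (setT : set (measurableTypeR R)) g -> (forall x, D x -> ~ N x -> f x = g x) ->
  L2 D w f <-> (\int[mu]_(x in D) (normc (g x) ^+ 2 * w x)%:E < +oo)%E.
Proof.
move=> mD mN N0 mw mg fg.
have mgw : measurable_fun (setT : set (measurableTypeR R)) (fun x => normc (g x) ^+ 2 * w x).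
  by apply: measurable_funM => //; apply: measurable_funX; exact: cmf_normc.
have E := @ae_integral_completed D N (fun x => normc (f x) ^+ 2 * w x) _ mD mN N0 mgw.
rewrite /L2 E; last by move=> x Dx nx; rewrite fg.
split=> [[_ //]|H]; split; [exact: (cmeasurable_completed mD mN N0 mg fg)|exact: H].
Qed.

End Completion.

(** * The substitutions [u = e^y] and [u = e^-y] *)

Section ExpSubstitution.
Variable R : realType.
Notation mu := (@lebesgue_measure R).

(* Avoids differentiating a change of variables: with a window [g], integrating
   [h(u) g(u e^(- e y))] in both orders compares the two sides of
   [ge0_integral_exp] up to the common factor [\int tens]. *)
Let tens (e y : R) : R := if 0 <= - (e * y) <= 1 then expR (- (e * y)) else 0.

(** The window is an interval of length 1, and for either sign of [e] the integral is that of the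
    exponential over [[0, 1]]. *)
Lemma integral_exp_window (e : R) : e = 1 \/ e = - 1 ->
  (\int[mu]_y (tens e y)%:E = (expR 1 - 1)%:E)%E.
Proof.
move=> e1.
have W (c : R) : c = 1 \/ c = -1 -> forall a b : R, a <= b ->
    (\int[mu]_(x in `[a, b]) (expR (c * x))%:E = (c^-1 * (expR (c * b) - expR (c * a)))%:E)%E.
  move=> c1 a b ab.
  have c0 : c%:C%C != 0 :> R[i].
    by apply/eqP => -[]; case: c1 => -> /eqP; rewrite ?oppr_eq0 oner_eq0.
  have H : cint mu `[a, b] (fun x => (expR (c * x))%:C%C) = (c^-1 * (expR (c * b) - expR (c * a)))%:C%C.
    rewrite rmorphM rmorphB fmorphV /= [RHS]mulrC -!cexpR.
    transitivity (cint mu `[a, b] (fun x => cexp (x%:C%C * c%:C%C))).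
      by apply: eq_cint => x _; rewrite -rmorphM cexpR mulrC.
    by rewrite cint_cexp// -!rmorphM !(mulrC c).
  have I : mu.-integrable `[a, b] (fun x => (expR (c * x))%:E).
    apply: continuous_compact_integrable; first exact: segment_compact.
    apply: continuous_subspaceT => x; apply: (continuous_comp (f := fun x => c * x) (g := @expR R)).
      by apply: cvgM; [exact: cvg_cst|exact: cvg_id].
    exact: continuous_expR.
  rewrite -[LHS]fineK; last exact: integrable_fin_num.
  by congr EFin; exact: (congr1 (fun z => complex.Re z) H).
have T a b c : (forall y, (0 <= - (e * y) <= 1) = (a <= y <= b)) -> (forall y, - (e * y) = c * y) ->
    (\int[mu]_y (tens e y)%:E = \int[mu]_(y in `[a, b]) (expR (c * y))%:E)%E.
  move=> H1 H2; rewrite [RHS]integral_mkcond; apply: eq_integral => y _.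
  by rewrite patchE /tens mem_setE in_itv /= H1 H2; case: ifP.
case: e1 => eE.
  rewrite (T (-1) 0 (-1)); last 2 first.
  - by move=> y; rewrite eE mul1r oppr_ge0 lerNl andbC.
  - by move=> y; rewrite eE mul1r mulN1r.
  rewrite W ?lerN10//; last by right.
  by rewrite mulr0 expR0 mulrNN mulr1 invrN1 mulN1r opprB.
rewrite (T 0 1 1); last 2 first.
- by move=> y; rewrite eE mulN1r opprK.
- by move=> y; rewrite eE mulN1r opprK mul1r.
rewrite W ?ler01//; last by left.
by rewrite mulr0 expR0 mulr1 invr1 mul1r.
Qed.

Lemma ge0_integral_exp (e : R) (h : R -> R) : e = 1 \/ e = - 1 ->
  measurable_fun setT h -> (forall x, 0 <= h x) ->
  (\int[mu]_(u in `]0%R, +oo[) (h u)%:E = \int[mu]_y (h (expR (e * y)) * expR (e * y))%:E)%E.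
Proof.
move=> e1 mh h0.
have ee : e * e = 1 by case: e1 => ->; ring.
have [H HE] : exists H : R -> R, forall u, H u = if u \in `]0%R, +oo[%classic then h u else 0.
  by exists (fun u => if u \in `]0%R, +oo[%classic then h u else 0).
(* The value [v], rather than 1, completes [e^(e y)] to [v e^(e y)] in [k2]: after a translation in
   [y] the inner integral no longer depends on [v]. *)
have [g gE] : exists g : R -> R, forall v, g v = if v \in `[1, expR 1]%classic then v else 0.
  by exists (fun v => if v \in `[1, expR 1]%classic then v else 0).
have H0 u : 0 <= H u by rewrite HE; case: ifP.
have g0 v : 0 <= g v.
  by rewrite gE; case: ifP => //; rewrite mem_setE in_itv /= => /andP[v1 _]; apply: le_trans v1.
have mcond (D : set R) (k k' : R -> R) : measurable D -> measurable_fun setT k ->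
    (forall u, k' u = if u \in D then k u else 0) -> measurable_fun setT k'.
  move=> mD mk k'E; rewrite (_ : k' = k \_ D); last by apply/funext => u; rewrite patchE k'E.
  by apply/(measurable_restrictT _ mD); exact: measurable_funTS.
have mH : measurable_fun setT H by apply: (mcond _ h H (measurable_itv `]0%R, +oo[) mh).
have mg : measurable_fun setT g by apply: (mcond _ id g (measurable_itv `[1%R, expR 1])).
have Hpos y : H (expR y) = h (expR y) by rewrite HE mem_setE in_itv /= expR_gt0.
have -> : (\int[mu]_(u in `]0%R, +oo[) (h u)%:E = \int[mu]_u (H u)%:E)%E.
  by rewrite integral_mkcond; apply: eq_integral => u _; rewrite patchE HE; case: ifP.
have -> : (\int[mu]_y (h (expR (e * y)) * expR (e * y))%:E = \int[mu]_y (H (expR (e * y)) * expR (e * y))%:E)%E.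
  by apply: eq_integral => y _; rewrite Hpos.
set I := (LHS); set J := (RHS).
pose kap : R := expR 1 - 1; have kap0 : 0 < kap by rewrite subr_gt0 expR_gt1.
have me : measurable_fun setT (fun y => expR (e * y)).
  by apply: measurableT_comp; [exact: measurable_expR|exact: measurable_funM].
have meN : measurable_fun setT (fun y => expR (- (e * y))) by exact: measurable_expN.
have gtens y : g (expR (- (e * y))) = tens e y.
  by rewrite gE mem_setE in_itv /= /tens -{1}expR0 !ler_expR.
have shiftE (F : R -> R) (x : R) : measurable_fun setT F -> (forall y, 0 <= F y) ->
    (\int[mu]_y (F (y + x))%:E = \int[mu]_y (F y)%:E)%E.
  by move=> mF F0; apply: (@ge0_integral_shift R x (EFin \o F)) => //; exact/measurable_EFinP.
pose k (z : R * R) := H z.1 * g (z.1 * expR (- (e * z.2))).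
have mk : measurable_fun setT (fun z => (k z)%:E).
  apply/measurable_EFinP; apply: measurable_funM; first exact: (measurableT_comp mH measurable_fst).
  apply: measurableT_comp => //; apply: measurable_funM => //.
  exact: (measurableT_comp meN measurable_snd).
have k0 z : (0 <= (k z)%:E)%E by rewrite lee_fin mulr_ge0.
have E1 : (\int[mu]_u \int[mu]_y (k (u, y))%:E = kap%:E * I)%E.
  rewrite muleC -ge0_integralZr//; last 3 first.
  - exact/measurable_EFinP.
  - by move=> u _; rewrite lee_fin.
  - by rewrite lee_fin ltW.
  apply: eq_integral => u _; rewrite /k /=.
  have [u0|] := boolP (0 < u); last first.
    move=> u0; have -> : H u = 0 by rewrite HE mem_setE in_itv /= andbT (negbTE u0).
    rewrite mul0e; under eq_integral do rewrite mul0r; exact: integral0.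
  under eq_integral do rewrite EFinM; rewrite ge0_integralZl//; last 3 first.
  - apply/measurable_EFinP; apply: measurableT_comp => //; exact: measurable_funM.
  - by move=> y _; rewrite lee_fin.
  - by rewrite lee_fin.
  congr (_ * _)%E; rewrite /kap -(integral_exp_window e1).
  rewrite -(shiftE (tens e) (- (e * ln u))).
  - apply: eq_integral => y _; rewrite -gtens; congr (g _)%:E.
    rewrite -{1}(@lnK R u) ?posrE// -expRD; congr expR.
    by rewrite mulrDr mulrN mulrA ee; ring.
  - rewrite (_ : tens e = fun y => g (expR (- (e * y)))); last by apply/funext => y; rewrite gtens.
    exact: (measurableT_comp mg meN).
  - by move=> y; rewrite -gtens.
pose k2 (z : R * R) := expR (e * z.1) * H (z.2 * expR (e * z.1)) * g z.2.
have mk2 : measurable_fun setT (fun z => (k2 z)%:E).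
  have mez := measurableT_comp me (@measurable_fst _ _ R R).
  apply/measurable_EFinP; apply: measurable_funM; last exact: (measurableT_comp mg measurable_snd).
  apply: measurable_funM => //; apply: measurableT_comp => //.
  by apply: measurable_funM.
have k20 z : (0 <= (k2 z)%:E)%E by rewrite lee_fin !mulr_ge0 ?expR_ge0.
have E2 : (\int[mu]_u \int[mu]_y (k (u, y))%:E = \int[mu]_y \int[mu]_v (k2 (y, v))%:E)%E.
  rewrite (@fubini_tonelli _ _ _ _ R mu mu _ mk k0) /=; apply: eq_integral => y _.
  have a0 : 0 < expR (e * y) by exact: expR_gt0.
  rewrite (@ge0_integral_affine R (expR (e * y)) 0 (fun u => (k (u, y))%:E))//; last first.
    apply/measurable_EFinP; apply: measurable_funM => //; apply: measurableT_comp => //.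
    by rewrite /=; apply: measurable_funM.
  rewrite -ge0_integralZl//.
  - apply: eq_integral => v _; rewrite -EFinM /k /k2 /= addr0 mulrA; congr (_ * H _ * g _)%:E.
      by rewrite mulrC.
    by rewrite mulrAC -expRD addrN expR0 mul1r.
  - apply/measurable_EFinP.
    have ma : measurable_fun setT (fun v : R => expR (e * y) * v + 0).
      by apply: measurable_funD => //; exact: measurable_funM.
    have mky : measurable_fun setT (fun u : R => k (u, y)).
      have mc : measurable_fun setT (fun u : R => u * expR (- (e * y))) by apply: measurable_funM.
      by rewrite /k /=; apply: measurable_funM => //; exact: (measurableT_comp mg mc).
    exact: (measurableT_comp mky ma).
have E3 : (\int[mu]_y \int[mu]_v (k2 (y, v))%:E = kap%:E * J)%E.
  rewrite (@fubini_tonelli _ _ _ _ R mu mu _ mk2 k20) /=.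
  transitivity (\int[mu]_(v in `[1%R, expR 1]) J)%E.
    rewrite [RHS]integral_mkcond; apply: eq_integral => v _; rewrite patchE /k2 /=.
    have := gE v; case: ifPn => [|_ ->]; last first.
      by under eq_integral do rewrite mulr0; exact: integral0.
    rewrite mem_setE in_itv /= => /andP[v1 _] ->.
    have v0 : 0 < v by exact: lt_le_trans v1.
    rewrite /J -(shiftE (fun y => H (expR (e * y)) * expR (e * y)) (e * ln v)).
    - apply: eq_integral => y _; rewrite mulrDr mulrA ee mul1r expRD lnK ?posrE//.
      by rewrite (mulrC v); congr EFin; ring.
    - by apply: measurable_funM => //; exact: (measurableT_comp mH me).
    - by move=> y; rewrite mulr_ge0 ?expR_ge0.
  have M : mu `[1%R, expR 1]%classic = kap%:E.
    by rewrite lebesgue_measure_itv /= lte_fin (_ : (1 < expR 1 :> R) = true)// expR_gt1 ltr01.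
  transitivity (J * mu `[1%R, expR 1]%classic)%E; first exact: integral_cst.
  by rewrite M muleC.
have : (kap%:E * I = kap%:E * J)%E by rewrite -E1 E2 E3.
move=> /(congr1 (fun z => (kap^-1)%:E * z)%E).
by rewrite !muleA -EFinM mulVf ?mul1e// gt_eqF.
Qed.

End ExpSubstitution.

Section Mellin.
Variable R : realType.
Notation mu := (@lebesgue_measure R).

Lemma cmf_restrict (D : set R) (f : R -> R[i]) : measurable (D : set (measurableTypeR R)) ->
  cmf (D : set (measurableTypeR R)) f -> cmf setT (fun x : R => if x \in D then f x else 0).
Proof.
move=> mD [m1 m2]; split.
- rewrite (_ : (fun x => _) = (fun x => complex.Re (f x)) \_ D).
    exact/(measurable_restrictT _ mD).
  by apply/funext => x; rewrite patchE; case: ifP.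
- rewrite (_ : (fun x => _) = (fun x => complex.Im (f x)) \_ D).
    exact/(measurable_restrictT _ mD).
  by apply/funext => x; rewrite patchE; case: ifP.
Qed.

Lemma integral_exp (e : R) (h : R -> R) : e = 1 \/ e = - 1 -> measurable_fun setT h ->
  (\int[mu]_(u in `]0%R, +oo[) (h u)%:E = \int[mu]_y (h (expR (e * y)) * expR (e * y))%:E)%E.
Proof.
move=> e1 mh; rewrite [LHS]integralE [RHS]integralE.
have mp : measurable_fun setT (fun u => Num.max (h u) 0) by exact: measurable_funrpos.
have mn : measurable_fun setT (fun u => Num.max (- h u) 0) by exact: measurable_funrneg.
congr (_ - _)%E.
- transitivity (\int[mu]_(u in `]0%R, +oo[) (Num.max (h u) 0)%:E)%E.
    by apply: eq_integral => u _; rewrite funeposE EFin_max.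
  rewrite (ge0_integral_exp e1 mp); last by move=> x; rewrite le_max lexx orbT.
  apply: eq_integral => y _; rewrite funeposE -EFin_max; congr EFin.
  by rewrite maxr_pMl ?expR_ge0// mul0r.
- transitivity (\int[mu]_(u in `]0%R, +oo[) (Num.max (- h u) 0)%:E)%E.
    by apply: eq_integral => u _; rewrite funenegE EFin_max EFinN.
  rewrite (ge0_integral_exp e1 mn); last by move=> x; rewrite le_max lexx orbT.
  apply: eq_integral => y _; rewrite funenegE -EFinN -EFin_max; congr EFin.
  by rewrite maxr_pMl ?expR_ge0// mul0r mulNr.
Qed.

Lemma cint_exp (e : R) (h : R -> R[i]) : e = 1 \/ e = - 1 -> cmf setT h ->
  cint mu `]0, +oo[ h = cint mu setT (fun y => h (expR (e * y)) * (expR (e * y))%:C%C).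
Proof.
move=> e1 [h1 h2]; apply: complexP; rewrite /cint /Rintegral /=.
- rewrite (integral_exp e1 h1); congr fine; apply: eq_integral => y _.
  by rewrite ReM /= mulr0 subr0.
- rewrite (integral_exp e1 h2); congr fine; apply: eq_integral => y _.
  by rewrite ImM /= mulr0 add0r.
Qed.

Lemma cmf_cpow (s : R[i]) : cmf setT (fun x : R => cpow x s).
Proof.
rewrite (_ : (fun x => _) = fun x => cexp (s * (ln x)%:C%C)); last first.
  by apply/funext => x; rewrite cpow_cexp.
apply: cmf_cexp; apply: cmfM; first exact: cmf_cst.
by apply: cmf_real; exact: measurable_ln.
Qed.

Lemma mellin_laplace (N : set R) (phi g : R -> R[i]) s :
  measurable (N : set (measurableTypeR R)) -> mu N = 0%E -> cmf setT g ->
  (forall x, 0 < x -> ~ N x -> phi x = g x) ->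
  mellin phi s = laplace (fun x => g (expR (- x))) s.
Proof.
move=> mN N0 mg phig.
have mG : cmf setT (fun x : R => g x * cpow x (s - 1)) by apply: cmfM => //; exact: cmf_cpow.
have E : mellin phi s = cint mu `]0, +oo[ (fun t => g t * cpow t (s - 1)).
  have [m1 m2] := mG.
  have H (p : R[i] -> R) : measurable_fun setT (fun x => p (g x * cpow x (s - 1))) ->
      (\int[@completed_lebesgue_measure R]_(x in (`]0%R, +oo[%classic : set R)) (p (phi x * cpow x (s - 1)))%:E =
       \int[mu]_(x in `]0%R, +oo[) (p (g x * cpow x (s - 1)))%:E)%E.
    move=> mp; apply: (ae_integral_completed (measurable_itv _) mN N0 mp) => x.
    by rewrite /= in_itv /= andbT => x0 nx; rewrite phig.
  apply: complexP; rewrite /mellin /cintegral /cint /Rintegral /=; congr fine.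
  - exact: (H (fun z => complex.Re z)).
  - exact: (H (fun z => complex.Im z)).
rewrite E (cint_exp (e := -1)) //; last by right.
apply: eq_cint => y _; rewrite mulN1r -mulrA; congr (_ * _).
rewrite cpow_cexp expRK -cexpR -cexpD; congr cexp.
by rewrite rmorphN /=; ring.
Qed.

(** Compactness is used in covering form with the filter [M -> +oo]: bounds valid near each point
    are then valid at all points for a common large [M]. *)
Lemma segment_locally_bounded (D : set R) (phi : R -> R[i]) (a b : R) :
  locally_bounded_on D phi -> `[a, b] `<=` D ->
  exists M : R, forall x, a <= x <= b -> normc (phi x) <= M.
Proof.
move=> lb sD.
have cpt := @segment_compact R a b; move/compact_near_coveringP: cpt.
move=> /(_ R (pinfty_nbhs R) (fun M x => normc (phi x) <= M) _).
case.
  move=> x /sD /lb [M HM].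
  exists ([set y | normc (phi y) <= M], [set M' | M <= M']) => /=.
    by split; [exact: HM|apply: nbhs_pinfty_ge; exact: num_real].
  by move=> [y M'] /= [yM MM']; exact: le_trans MM'.
move=> M [_ HM]; exists (M + 1) => x xab; apply: HM; first by rewrite ltrDl.
by rewrite /= in_itv.
Qed.

End Mellin.

(** * Absolute convergence of the Mellin integral *)

Section MellinDomain.
Variable R : realType.
Notation mu := (@lebesgue_measure R).

Lemma powR_expR (x a : R) : 0 < x -> x `^ a = expR (a * ln x).
Proof. by move=> x0; rewrite /powR gt_eqF. Qed.

Lemma bigO_right (f g : R -> R) (x : R) : f =O_ (x^'+) g ->
  exists k d : R, [/\ 0 < k, 0 < d & forall y, x < y < x + d -> `|f y| <= k * `|g y|].
Proof.
move=> /eqO_exP[k k0 H]; have : \forall y \near nbhs x, x < y -> `|f y| <= k * `|g y| by exact: H.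
move=> /nbhs_ballP[d /= d0 Hd]; exists k, d; split => // y /andP[xy yd].
by apply: Hd => //; rewrite /ball /= ltr_distlC; apply/andP; split; lra.
Qed.

Lemma bigO_left (f g : R -> R) (x : R) : f =O_ (x^'-) g ->
  exists k d : R, [/\ 0 < k, 0 < d & forall y, x - d < y < x -> `|f y| <= k * `|g y|].
Proof.
move=> /eqO_exP[k k0 H]; have : \forall y \near nbhs x, y < x -> `|f y| <= k * `|g y| by exact: H.
move=> /nbhs_ballP[d /= d0 Hd]; exists k, d; split => // y /andP[yd xy].
by apply: Hd => //; rewrite /ball /= ltr_distlC; apply/andP; split; lra.
Qed.

Lemma powR_ge_cst (a x e : R) : 0 < a -> a <= x <= 1 -> expR (`|e| * ln a) <= x `^ e.
Proof.
move=> a0 /andP[ax x1]; have x0 : 0 < x by exact: lt_le_trans ax.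
rewrite powR_expR// ler_expR.
have l1 : ln a <= ln x by rewrite ler_ln ?posrE.
have l2 : ln x <= 0 by exact: ln_le0.
apply: (@le_trans _ _ (`|e| * ln x)); first by rewrite ler_wpM2l.
by rewrite ler_wnM2r// ler_norm.
Qed.

Lemma powRN_mono (x p s : R) : 0 < x <= 1 -> p <= s -> x `^ (- p) <= x `^ (- s).
Proof.
move=> /andP[x0 x1] ps; rewrite !powR_expR// ler_expR ler_wnM2r ?ln_le0//.
by rewrite lerN2.
Qed.

Lemma unit_interval_bound (phi : R -> R[i]) (sigma0 sigma1 : R) : sigma1 < 1 ->
  locally_bounded_on `]0, 1[ phi ->
  (fun x => normc (phi x) : R) =O_ (0^'+) (fun x : R => x `^ (- sigma0)) ->
  (fun x => normc (phi x) : R) =O_ (1^'-) (fun x : R => (1 - x) `^ (- sigma1)) ->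
  exists C s : R, [/\ 0 <= C, 0 <= s < 1 & forall x, 0 < x < 1 ->
    normc (phi x) <= C * (if x <= 2^-1 then x `^ (- sigma0) else (1 - x) `^ (- s))].
Proof.
move=> s11 lb /bigO_right[k0 [d0 [k0P d0P H0]]] /bigO_left[k1 [d1 [k1P d1P H1]]].
(* With a nonnegative exponent, [(1 - x)^(- s) >= 1] dominates the constant bound [M] away from the
   endpoint. *)
pose s := Num.max sigma1 0.
pose a := Num.min (d0 / 2) 2^-1; pose b := 1 - Num.min (d1 / 2) 2^-1.
have a0 : 0 < a by rewrite lt_min divr_gt0//= invr_gt0.
have ad : a < d0 by rewrite gt_min; apply/orP; left; lra.
have a1 : a <= 2^-1 by rewrite ge_min lexx orbT.
have c0 : 0 < Num.min (d1 / 2) 2^-1 :> R by rewrite lt_min divr_gt0//= invr_gt0.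
have b1 : b < 1 by rewrite /b; lra.
have bd : 1 - d1 < b.
  have : Num.min (d1 / 2) 2^-1 < d1 by rewrite gt_min; apply/orP; left; lra.
  by rewrite /b; lra.
have b2 : 2^-1 <= b.
  have : Num.min (d1 / 2) 2^-1 <= 2^-1 :> R by rewrite ge_min lexx orbT.
  by rewrite /b; lra.
have [M HM] : exists M : R, forall x, a <= x <= b -> normc (phi x) <= M.
  apply: segment_locally_bounded lb _ => x; rewrite /= !in_itv /= => /andP[ax xb].
  by apply/andP; split; [exact: lt_le_trans ax|exact: le_lt_trans b1].
have M0 : 0 <= M by apply: le_trans (HM a _); rewrite ?normc_ge0// lexx (le_trans a1 b2).
pose K := expR (`|- sigma0| * ln a).
have K0 : 0 < K by exact: expR_gt0.
have sE : sigma1 <= s by rewrite le_max lexx.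
have s0 : 0 <= s by rewrite le_max lexx orbT.
(* [k0] and [k1] serve near the endpoints and [M] on []1/2, b]]. On [[a, 1/2]], [M / K] serves
   because [K] is a lower bound of [x^(- sigma0)] there. *)
exists (k0 + k1 + M + M / K), s; split.
- by rewrite !addr_ge0 ?divr_ge0 ?(ltW k0P) ?(ltW k1P) ?(ltW K0).
- by rewrite s0 /s gt_max s11 ltr01.
move=> x /andP[x0 x1].
have C1 : k0 <= k0 + k1 + M + M / K by rewrite -!addrA lerDl !addr_ge0 ?divr_ge0 ?(ltW k1P) ?(ltW K0).
have C2 : k1 <= k0 + k1 + M + M / K by rewrite (addrC k0) -!addrA lerDl !addr_ge0 ?divr_ge0 ?(ltW k0P) ?(ltW K0).
have C3 : M / K <= k0 + k1 + M + M / K by rewrite lerDr !addr_ge0 ?(ltW k1P) ?(ltW k0P).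
have C4 : M <= k0 + k1 + M + M / K.
  by rewrite -addrA addrCA lerDl !addr_ge0 ?divr_ge0 ?(ltW k1P) ?(ltW k0P) ?(ltW K0).
have [xh|xh] := boolP (x <= 2^-1).
  have p0 := powR_ge0 x (- sigma0).
  have [xa|] := boolP (x < a).
    have := H0 x; rewrite add0r x0 (lt_trans xa ad) => /(_ isT).
    rewrite (ger0_norm (normc_ge0 _)) (ger0_norm p0) => /le_trans; apply.
    by rewrite ler_wpM2r.
  rewrite -leNgt => ax; apply: (@le_trans _ _ M); first by apply: HM; rewrite ax (le_trans xh).
  apply: (@le_trans _ _ (M / K * x `^ (- sigma0))); last by rewrite ler_wpM2r.
  by rewrite -mulrA ler_peMr// ler_pdivlMl// mulr1; apply: powR_ge_cst => //; rewrite ax ltW.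
rewrite -ltNge in xh.
have x1' : 0 < 1 - x by rewrite subr_gt0.
have x1'' : 1 - x <= 1 by rewrite gerBl ltW.
have p1 := powR_ge0 (1 - x) (- s).
have [xb|] := boolP (b < x).
  have := H1 x; rewrite x1 (lt_trans bd xb) => /(_ isT).
  rewrite (ger0_norm (normc_ge0 _)) (ger0_norm (powR_ge0 _ _)) => /le_trans; apply.
  apply: (@le_trans _ _ (k1 * (1 - x) `^ (- s))); last by rewrite ler_wpM2r.
  by rewrite ler_wpM2l ?(ltW k1P)// powRN_mono// x1'.
rewrite -leNgt => xb; apply: (@le_trans _ _ M).
  by apply: HM; rewrite xb andbT (le_trans a1)// ltW.
apply: (@le_trans _ _ (M * (1 - x) `^ (- s))); last by rewrite ler_wpM2r.
rewrite ler_peMr//; have := @powRN_mono (1 - x) 0 s; rewrite x1' x1'' s0 => /(_ isT isT).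
by rewrite oppr0 powRr0.
Qed.

Let win (s u : R) : R := if u \in `]0%R, 1%R[%classic then u `^ (- s) else 0.

Lemma win_ge0 s u : 0 <= win s u.
Proof. by rewrite /win; case: ifP => // _; exact: powR_ge0. Qed.

Lemma measurable_win s : measurable_fun setT (win s).
Proof.
rewrite (_ : win s = (fun u => u `^ (- s)) \_ `]0%R, 1%R[); last first.
  by apply/funext => u; rewrite patchE.
by apply/(measurable_restrictT _ (measurable_itv _)); apply: measurable_funTS; exact: measurable_powR.
Qed.

(** The substitution [u = e^-y] turns the integral into the Laplace integral of [heavi] at
    [1 - s > 0]. *)
Lemma integrable_win s : s < 1 -> mu.-integrable setT (fun u => (win s u)%:E).
Proof.
move=> s1; apply/integrableP; split; first by apply/measurable_EFinP; exact: measurable_win.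
have -> : (\int[mu]_u `|(win s u)%:E| = \int[mu]_(u in `]0%R, +oo[) (win s u)%:E)%E.
  rewrite [RHS]integral_mkcond; apply: eq_integral => u _; rewrite patchE abse_EFin ger0_norm ?win_ge0//.
  case: ifPn => //; rewrite /win !mem_setE !in_itv /= andbT => /negbTE ->; rewrite //.
rewrite (ge0_integral_exp (e := -1) _ (measurable_win s)); [|by right|exact: win_ge0].
have [_ _ /(_ (1 - s))] := laplace_dom_heavi R; rewrite subr_gt0 => /(_ s1) /integrableP[_].
move=> H; apply: le_lt_trans H; rewrite le_eqVlt; apply/orP; left; apply/eqP.
apply: eq_integral => y _; rewrite [RHS]abse_EFin [in RHS]ger0_norm; last first.
  by rewrite mulr_ge0 ?normc_ge0 ?expR_ge0.
congr EFin; rewrite /win mem_setE in_itv /= expR_gt0 mulN1r /= /heavi expR_lt1 oppr_lt0.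
case: ifP => _; last by rewrite normcR normr0 !mul0r.
rewrite normcR normr1 mul1r powR_expR ?expR_gt0// expRK -expRD; congr expR; ring.
Qed.

Lemma ge_half_exp (y : R) : 2^-1 < expR (- y) -> y < 1.
Proof.
move=> h; rewrite ltNge; apply/negP => y1.
have e2 : 2 <= expR 1 :> R by apply: le_trans (expR_ge1Dx 1); rewrite -natr1.
have : expR (- y) <= 2^-1.
  apply: (@le_trans _ _ (expR (- 1))); first by rewrite ler_expR lerN2.
  by rewrite expRN lef_pV2// posrE ?expR_gt0.
by rewrite leNgt h.
Qed.

(** From [1 - e^-y >= y e^-y]; the power [e^(s y)] lost in this comparison is at most [e]. *)
Lemma one_sub_exp (y s : R) : 0 < y < 1 -> 0 <= s <= 1 ->
  (1 - expR (- y)) `^ (- s) <= expR 1 * y `^ (- s).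
Proof.
move=> /andP[y0 y1] /andP[s0 s1].
have e1 : expR (- y) < 1 by rewrite expR_lt1 oppr_lt0.
have H : expR (- y) * y <= 1 - expR (- y).
  have := expR_ge1Dx y => h.
  have : expR (- y) * (1 + y) <= expR (- y) * expR y by rewrite ler_wpM2l ?expR_ge0.
  by rewrite -expRD addNr expR0; lra.
have p0 : 0 < 1 - expR (- y) by rewrite subr_gt0.
rewrite !powR_expR// -expRD ler_expR.
have L : - y + ln y <= ln (1 - expR (- y)).
  have : ln (expR (- y) * y) <= ln (1 - expR (- y)).
    by rewrite ler_ln ?posrE// mulr_gt0 ?expR_gt0.
  by rewrite lnM ?posrE ?expR_gt0// expRK.
have : s * (- y + ln y) <= s * ln (1 - expR (- y)) by rewrite ler_wpM2l.
have : s * y <= 1 by rewrite mulr_ile1// ltW.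
by rewrite mulrDr; lra.
Qed.

(** Where [e^-y <= 1/2] the bound is [e^(sigma0 y)], hence the abscissa [sigma0]. Otherwise [y < 1],
    and the singularity at [x = 1] becomes [y^(- s)], integrable at 0 since [s < 1]. *)
Lemma laplace_dom_mellin (sigma0 s C : R) (g : R -> R[i]) : cmf setT g ->
  (forall x, 1 <= x -> g x = 0) -> 0 <= C -> 0 <= s < 1 ->
  (forall x, 0 < x < 1 ->
    normc (g x) <= C * (if x <= 2^-1 then x `^ (- sigma0) else (1 - x) `^ (- s))) ->
  laplace_dom sigma0 (fun y => g (expR (- y))).
Proof.
move=> mg g1 C0 /andP[s0 s1] Hg.
have mq : cmf setT (fun y : R => g (expR (- y))).
  apply: (cmf_comp _ mg); rewrite (_ : (fun x => _) = fun x : R => expR (- (1 * x))).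
    exact: measurable_expN.
  by apply/funext => x; rewrite mul1r.
split => //; first by move=> x x0; apply: g1; rewrite -expR0 ler_expR oppr_ge0.
move=> b sb.
have I : mu.-integrable setT (fun y => (C * (normc (heavi y : R[i]) * expR (- ((b - sigma0) * y)))
    + C * (expR (1 + `|b|) * win s y))%:E).
  have [_ _ /(_ (b - sigma0))] := laplace_dom_heavi R; rewrite subr_gt0 => /(_ sb) I1.
  have I2 := integrable_win s1.
  have := integrableD measurableT (integrableZl measurableT C I1)
    (integrableZl measurableT (C * expR (1 + `|b|)) I2).
  apply: eq_integrable => // y _ /=; rewrite -EFinM -EFinD mulrA//.
apply: (le_integrable _ _ _ I) => //.
  apply/measurable_EFinP; apply: measurable_funM; last exact: measurable_expN.
  exact: cmf_normc.
move=> y _; rewrite /= lee_fin ger0_norm ?mulr_ge0 ?normc_ge0 ?expR_ge0//.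
apply: le_trans (ler_norm _).
have [y0|] := boolP (0 < y); last first.
  rewrite -leNgt => y0; rewrite g1; last by rewrite -expR0 ler_expR oppr_ge0.
  rewrite normcR normr0 mul0r addr_ge0 ?mulr_ge0 ?normc_ge0 ?expR_ge0//.
  exact: win_ge0.
have T1 : 0 <= C * (normc (heavi y : R[i]) * expR (- ((b - sigma0) * y))).
  by rewrite !mulr_ge0 ?normc_ge0 ?expR_ge0.
have T2 : 0 <= C * (expR (1 + `|b|) * win s y) by rewrite !mulr_ge0 ?win_ge0 ?expR_ge0.
have := Hg (expR (- y)); rewrite expR_gt0 expR_lt1 oppr_lt0 y0 => /(_ isT).
have [xh|xh] := boolP (expR (- y) <= 2^-1) => H.
  apply: (@le_trans _ _ (C * (normc (heavi y : R[i]) * expR (- ((b - sigma0) * y))))); last by rewrite lerDl.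
  apply: (@le_trans _ _ (C * expR (- y) `^ (- sigma0) * expR (- (b * y)))).
    by rewrite ler_wpM2r ?expR_ge0.
  rewrite /heavi y0 normcR normr1 mul1r powR_expR ?expR_gt0// expRK -mulrA -expRD.
  rewrite (_ : - sigma0 * - y - b * y = - ((b - sigma0) * y))//; ring.
move: xh; rewrite -ltNge => /ge_half_exp y1.
apply: (@le_trans _ _ (C * (expR (1 + `|b|) * win s y))); last by rewrite lerDr.
apply: (@le_trans _ _ (C * (1 - expR (- y)) `^ (- s) * expR (- (b * y)))).
  by rewrite ler_wpM2r ?expR_ge0.
rewrite -mulrA ler_wpM2l// /win mem_setE in_itv /= y0 y1 /=.
apply: (@le_trans _ _ (expR 1 * y `^ (- s) * expR (- (b * y)))).
  by rewrite ler_wpM2r ?expR_ge0// one_sub_exp// ?y0// s0 ltW.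
rewrite mulrAC -expRD ler_wpM2r ?powR_ge0// ler_expR lerD2l.
have : - (b * y) <= `|b| * y by rewrite -mulNr ler_wpM2r ?(ltW y0)// -normrN ler_norm.
move/le_trans; apply; rewrite ler_piMr// ltW//.
Qed.

End MellinDomain.

(** * The summatory function *)

Section Dirichlet.
Variable R : realType.
Notation mu := (@lebesgue_measure R).
Implicit Types (q : R -> R[i]) (a : nat -> R[i]) (s : R[i]).

Definition shift_sum a q N (x : R) : R[i] := \sum_(k < N) a k.+1 * q (x - ln k.+1%:R).

(** The terms left out have [x - ln n <= 0], where the functions [q] of interest vanish, so this is
    the full series. *)
Definition dsum a q (x : R) := shift_sum a q (Num.truncn (expR x)) x.

Lemma ln_truncn (x : R) k : (Num.truncn (expR x) <= k)%N -> x - ln k.+1%:R <= 0.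
Proof.
move=> xk; rewrite subr_le0 -ler_expR lnK ?posrE//.
apply/ltW/(lt_le_trans (truncnS_gt (expR x))).
by rewrite ler_nat ltnS.
Qed.

Lemma shift_sum_dsum a q N x : (forall x, x <= 0 -> q x = 0) ->
  (Num.truncn (expR x) <= N)%N -> shift_sum a q N x = dsum a q x.
Proof.
move=> q0 xN; rewrite /dsum /shift_sum -(subnKC xN) big_split_ord /= [X in _ + X]big1 ?addr0//.
by move=> i _; rewrite q0 ?mulr0// ln_truncn// leq_addr.
Qed.

Lemma normc_shift_sum_le a q (A : R) N x : 0 <= A ->
  (forall n, normc (a n.+1) <= A * n.+1%:R) ->
  normc (shift_sum a q N x) <= \sum_(k < N) A * k.+1%:R * normc (q (x - ln k.+1%:R)).
Proof.
move=> A0 aA; apply: le_trans (normc_sum _ _ _) _; apply: ler_sum => k _.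
by rewrite normcM ler_wpM2r ?normc_ge0.
Qed.

Lemma laplace_dom_shift (c0 c : R) q : 0 <= c -> laplace_dom c0 q -> laplace_dom c0 (fun x => q (x - c)).
Proof.
move=> cp [mq q0 qi]; split.
- by apply: (cmf_comp _ mq); exact: measurable_funB.
- by move=> x x0; apply: q0; lra.
- move=> b cb; have := integrable_affine (- c) ltr01 (qi b cb).
  have := fun I => integrableZl (mu := @lebesgue_measure R) measurableT (expR (- (b * c))) I.
  move=> /[apply]; apply: eq_integrable => // x _.
  rewrite /= -EFinM mul1r mulrCA -expRD; congr (_ * expR _)%:E; ring.
Qed.

Lemma laplace_shift (c0 c : R) q s : laplace_dom c0 q -> c0 < complex.Re s ->
  laplace (fun x => q (x - c)) s = cexp (- (s * c%:C%C)) * laplace q s.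
Proof.
move=> dq cs.
have I := cintegrable_laplace dq cs.
pose h (y : R) : R[i] := cexp (- (s * c%:C%C)) * (q y * cexp (- (s * y%:C%C))).
have Ih : cintegrable mu setT h by apply: cintegrableZ.
rewrite /laplace -cintZ// -/h -(cint_shift (- c) Ih); apply: eq_cint => x _.
rewrite /h [RHS]mulrCA -cexpD; congr (_ * cexp _).
by rewrite rmorphD rmorphN /=; ring.
Qed.

Lemma integral_shift_norm (b c : R) q : cmf setT q ->
  (\int[mu]_x (normc (q (x - c)) * expR (- (b * x)))%:E =
   (expR (- (b * c)))%:E * \int[mu]_x (normc (q x) * expR (- (b * x)))%:E)%E.
Proof.
move=> mq; have m1 : measurable_fun setT (fun x => (normc (q x) * expR (- (b * x)))%:E).
  apply/measurable_EFinP; apply: measurable_funM; first exact: cmf_normc.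
  exact: measurable_expN.
have p0 x : (0 <= (normc (q x) * expR (- (b * x)))%:E)%E.
  by rewrite lee_fin mulr_ge0 ?normc_ge0 ?expR_ge0.
rewrite -(ge0_integral_shift (- c) m1 p0) -ge0_integralZl//.
- by apply: eq_integral => x _; rewrite -EFinM mulrCA -expRD; congr (_ * expR _)%:E; ring.
- have ms : measurable_fun setT (fun x : R => x - c) by apply: measurable_funB.
  exact: (measurableT_comp m1 ms).
Qed.

(** Telescoping: [1 / n^2 <= 2 / n - 2 / (n + 1)] because [n + 1 <= 2 n]. *)
Lemma sum_inv_sqr N : \sum_(k < N) (k.+1%:R ^+ 2)^-1 <= 2 - 2 / N.+1%:R :> R.
Proof.
elim: N => [|N IH]; first by rewrite big_ord0 divr1 subrr.
have key (n : R) : 1 <= n -> 2 - 2 / n + (n ^+ 2)^-1 <= 2 - 2 / (n + 1).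
  move=> n1; have n0 : 0 < n by exact: lt_le_trans n1.
  rewrite -subr_ge0 (_ : _ - _ = (n - 1) / (n ^+ 2 * (n + 1))); last first.
    by field; rewrite !gt_eqF// addr_gt0.
  by rewrite divr_ge0 ?subr_ge0// mulr_ge0 ?sqr_ge0// addr_ge0// ltW.
rewrite big_ord_recr /=; apply: (@le_trans _ _ (2 - 2 / N.+1%:R + (N.+1%:R ^+ 2)^-1)).
  by rewrite lerD2r.
have -> : N.+2%:R = N.+1%:R + 1 :> R by rewrite -natr1.
by apply: key; rewrite ler1n.
Qed.

(** Origin of the abscissa 3: a coefficient of size [n] shifted by [ln n] has weight [n^(1 - b)],
    summable by comparison with [n^-2]. *)
Lemma n_mul_exp_le (b : R) n : 3 <= b ->
  n.+1%:R * expR (- (b * ln n.+1%:R)) <= (n.+1%:R ^+ 2)^-1 :> R.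
Proof.
move=> b3; have n0 : 0 < n.+1%:R :> R by [].
have l0 : 0 <= ln n.+1%:R :> R by apply: ln_ge0; rewrite ler1n.
apply: (@le_trans _ _ (n.+1%:R * expR (- (3 * ln n.+1%:R)))).
  by rewrite ler_pM2l// ler_expR lerN2 ler_wpM2r.
rewrite expRN expRM_natl lnK ?posrE// [X in X^-1]exprS invfM mulrA mulfV ?mul1r//.
Qed.

Lemma cvg_complex (u : nat -> R[i]) (l : R[i]) :
  (u : nat -> Cplx R) @ \oo --> (l : Cplx R) -> normc (u n - l) @[n --> \oo] --> (0 : R).
Proof.
move=> ul; apply/cvgrPdist_lt => e e0.
have : \forall w \near (l : Cplx R), normc (w - l) < e.
  by apply/nbhs_complexP; exists e.
move=> H; have H' : \forall n \near \oo, normc (u n - l) < e := ul _ H.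
by apply: filterS H' => n ne; rewrite sub0r normrN ger0_norm ?normc_ge0.
Qed.

Section DsumBound.
Variables (a : nat -> R[i]) (q : R -> R[i]) (A c0 : R).
Hypotheses (A0 : 0 <= A) (aA : forall n, normc (a n.+1) <= A * n.+1%:R).
Hypotheses (dq : laplace_dom c0 q) (c3 : c0 <= 3).

Let q0 x : x <= 0 -> q x = 0. Proof. by have [_ + _] := dq; exact. Qed.

Let mq : cmf setT q. Proof. by have [] := dq. Qed.

(** A majorant with nonnegative terms: it increases with [N], is stationary for each [x], and
    dominates all partial sums by its limit. *)
Let maj N (x : R) : R := \sum_(k < N) A * k.+1%:R * normc (q (x - ln k.+1%:R)).

Let majE N x : (Num.truncn (expR x) <= N)%N -> maj N x = maj (Num.truncn (expR x)) x.
Proof.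
move=> xN; rewrite /maj -(subnKC xN) big_split_ord /= [X in _ + X]big1 ?addr0//.
by move=> i _; rewrite q0 ?normcR ?normr0 ?mulr0// ln_truncn// leq_addr.
Qed.

Let majlim x := maj (Num.truncn (expR x)) x.

Let maj_ge0 N x : 0 <= maj N x.
Proof. by apply: sumr_ge0 => k _; rewrite !mulr_ge0 ?normc_ge0. Qed.

Let maj_le N x : maj N x <= majlim x.
Proof.
have [xN|/ltnW Nx] := leqP (Num.truncn (expR x)) N; first by rewrite majE.
rewrite /majlim /maj -(subnKC Nx) big_split_ord /= lerDl.
by apply: sumr_ge0 => k _; rewrite !mulr_ge0 ?normc_ge0.
Qed.

Let mshift (k : nat) : cmf setT (fun x : R => q (x - ln k.+1%:R)).
Proof. by apply: (cmf_comp _ mq); exact: measurable_funB. Qed.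

Let mmaj N : measurable_fun setT (maj N).
Proof.
by apply: measurable_sum => k; apply: measurable_funM => //; exact: cmf_normc.
Qed.

Let maj_cvg x : maj N x @[N --> \oo] --> majlim x.
Proof.
apply: cvg_near_cst; exists (Num.truncn (expR x)) => // N /= xN; exact: majE.
Qed.

Let mmajlim : measurable_fun setT majlim.
Proof. by apply: (measurable_fun_cvg mmaj) => x _; exact: maj_cvg. Qed.

Let integrable_majlim b : 3 < b -> mu.-integrable setT (fun x => (majlim x * expR (- (b * x)))%:E).
Proof.
move=> b3; have [_ _ /(_ b (le_lt_trans c3 b3)) I] := dq.
pose Q := Rintegral mu setT (fun x => normc (q x) * expR (- (b * x))).
have QE : (\int[mu]_x (normc (q x) * expR (- (b * x)))%:E = Q%:E)%E.
  by rewrite /Q /Rintegral fineK//; exact: integrable_fin_num.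
have Q0 : 0 <= Q.
  by apply: Rintegral_ge0 => x _; rewrite mulr_ge0 ?normc_ge0 ?expR_ge0.
have me := measurable_expN b.
have mT : measurable_fun setT (fun x => majlim x * expR (- (b * x))).
  exact: measurable_funM.
apply/integrableP; split; first exact/measurable_EFinP.
have p0 N x : 0 <= maj N x * expR (- (b * x)) by rewrite mulr_ge0 ?expR_ge0.
have pl x : 0 <= majlim x * expR (- (b * x)) by rewrite mulr_ge0 ?expR_ge0// maj_ge0.
(* Each shifted term integrates to at most [A Q / n^2], and the sum of [1 / n^2] is at most 2. *)
apply: (@le_lt_trans _ _ (2 * (A * Q))%:E); last by rewrite ltry.
under eq_integral do rewrite abse_EFin ger0_norm//.
apply: (@fatou_bound R (fun N x => maj N x * expR (- (b * x)))) => //.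
- by move=> N; exact: measurable_funM.
- by apply: aeW => x; apply: cvgMl; exact: maj_cvg.
move=> N.
have -> : (\int[mu]_x (maj N x * expR (- (b * x)))%:E =
    \sum_(k < N) ((A * k.+1%:R)%:E * \int[mu]_x (normc (q (x - ln k.+1%:R)) * expR (- (b * x)))%:E))%E.
  transitivity (\int[mu]_x \sum_(k < N) ((A * k.+1%:R)%:E * (normc (q (x - ln k.+1%:R)) * expR (- (b * x)))%:E))%E.
    apply: eq_integral => x _; rewrite /maj mulr_suml -sumEFin; apply: eq_bigr => k _.
    by rewrite -EFinM mulrA.
  have mk (k : nat) : measurable_fun setT (fun x : R => (normc (q (x - ln k.+1%:R)) * expR (- (b * x)))%:E).
    by apply/measurable_EFinP; apply: measurable_funM => //; exact: cmf_normc.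
  rewrite ge0_integral_sum//.
  - apply: eq_bigr => k _; rewrite ge0_integralZl//; first exact: mk.
      by move=> x _; rewrite lee_fin mulr_ge0 ?normc_ge0 ?expR_ge0.
    by rewrite lee_fin mulr_ge0.
  - by move=> k; apply: measurable_funeM; exact: mk.
  - by move=> k x _; rewrite -EFinM lee_fin !mulr_ge0 ?normc_ge0 ?expR_ge0.
under eq_bigr do rewrite integral_shift_norm// QE -!EFinM.
rewrite sumEFin lee_fin.
apply: (@le_trans _ _ (\sum_(k < N) (k.+1%:R ^+ 2)^-1 * (A * Q))).
  apply: ler_sum => k _.
  rewrite (_ : A * k.+1%:R * _ = k.+1%:R * expR (- (b * ln k.+1%:R)) * (A * Q)).
    by rewrite ler_wpM2r ?mulr_ge0// n_mul_exp_le// ltW.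
  by rewrite (mulrC A) mulrACA.
rewrite -mulr_suml ler_wpM2r ?mulr_ge0//.
by apply: le_trans (sum_inv_sqr N) _; rewrite gerBl divr_ge0.
Qed.

Let mshift_sum N : cmf setT (shift_sum a q N).
Proof. by apply: cmf_sum => k; apply: cmfZ. Qed.

Let shift_sum_cvg x : normc (shift_sum a q N x - dsum a q x) @[N --> \oo] --> (0 : R).
Proof.
apply: cvg_near_cst; exists (Num.truncn (expR x)) => // N /= xN.
by rewrite (shift_sum_dsum a q0 xN) subrr normcR normr0.
Qed.

Lemma cmf_dsum : cmf setT (dsum a q).
Proof.
have H (p : R[i] -> R) : (forall N, measurable_fun setT (fun x => p (shift_sum a q N x))) ->
    measurable_fun setT (fun x => p (dsum a q x)).
  move=> mp; apply: (measurable_fun_cvg mp) => x _.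
  apply: cvg_near_cst; exists (Num.truncn (expR x)) => // N /= xN.
  by rewrite (shift_sum_dsum a q0 xN).
split; [apply: (H (fun z => complex.Re z))|apply: (H (fun z => complex.Im z))] => N.
- by have [] := mshift_sum N.
- by have [] := mshift_sum N.
Qed.

Lemma laplace_dom_dsum : laplace_dom 3 (dsum a q).
Proof.
split; first exact: cmf_dsum.
  move=> x x0; rewrite /dsum /shift_sum big1// => k _; rewrite q0 ?mulr0//.
  by rewrite subr_le0 (le_trans x0)// ln_ge0// ler1n.
move=> b b3; apply: (le_integrable _ _ _ (integrable_majlim b3)) => //.
  apply/measurable_EFinP; apply: measurable_funM; last exact: measurable_expN.
  by apply: cmf_normc; exact: cmf_dsum.
move=> x _; rewrite /= lee_fin ger0_norm ?mulr_ge0 ?normc_ge0 ?expR_ge0//.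
apply: le_trans (ler_norm _); rewrite ler_wpM2r ?expR_ge0//.
exact: normc_shift_sum_le.
Qed.

Lemma laplace_shift_sum N s : 3 < complex.Re s ->
  cint mu setT (fun x => shift_sum a q N x * cexp (- (s * x%:C%C))) =
  dirichlet_series a s N * laplace q s.
Proof.
move=> s3; have cs := le_lt_trans c3 s3.
have I (k : nat) : cintegrable mu setT (fun x : R => a k.+1 * (q (x - ln k.+1%:R) * cexp (- (s * x%:C%C)))).
  apply: cintegrableZ => //; apply: cintegrable_laplace (laplace_dom_shift _ dq) cs.
  by apply: ln_ge0; rewrite ler1n.
transitivity (cint mu setT (fun x => \sum_(k < N) a k.+1 * (q (x - ln k.+1%:R) * cexp (- (s * x%:C%C))))).
  by apply: eq_cint => x _; rewrite /shift_sum mulr_suml; apply: eq_bigr => k _; rewrite mulrA.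
rewrite cint_sum// /dirichlet_series /series /= big_mkord mulr_suml; apply: eq_bigr => k _.
rewrite cintZ//; last first.
  by apply: cintegrable_laplace (laplace_dom_shift _ dq) cs; apply: ln_ge0; rewrite ler1n.
rewrite -mulrA; congr (_ * _); rewrite cpow_cexp mulNr.
exact: (laplace_shift _ dq cs).
Qed.

(** Dominated convergence in [laplace_shift_sum]: both sides are limits of the same sequence. *)
Lemma laplace_dsum s l : 3 < complex.Re s -> dirichlet_series a s @ \oo --> (l : Cplx R) ->
  laplace (dsum a q) s = l * laplace q s.
Proof.
move=> s3 /cvg_complex dl.
have me := cmf_cexpN s.
have C x : setT x -> normc (shift_sum a q N x * cexp (- (s * x%:C%C)) -
    dsum a q x * cexp (- (s * x%:C%C))) @[N --> \oo] --> (0 : R).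
  move=> _; rewrite (_ : (fun N => _) = fun N => normc (shift_sum a q N x - dsum a q x) *
    normc (cexp (- (s * x%:C%C)))); last by apply/funext => N; rewrite -mulrBl (normcM (_ - _)).
  by rewrite -[X in _ --> X](mul0r (normc (cexp (- (s * x%:C%C))))); apply: cvgMl; exact: shift_sum_cvg.
have B N x : setT x -> normc (shift_sum a q N x * cexp (- (s * x%:C%C))) <=
    majlim x * expR (- (complex.Re s * x)).
  move=> _; rewrite (normcM (shift_sum _ _ _ _)) normc_cexpN ler_wpM2r ?expR_ge0//.
  by apply: le_trans (maj_le N x); exact: normc_shift_sum_le.
have [_] := @cint_dominated _ _ R mu setT (fun N x => shift_sum a q N x * cexp (- (s * x%:C%C)))
  (fun x => dsum a q x * cexp (- (s * x%:C%C)))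
  (fun x => majlim x * expR (- (complex.Re s * x))) measurableT (fun N => cmfM (mshift_sum N) me) (cmfM cmf_dsum me) C
  (integrable_majlim s3) B.
under eq_fun do rewrite (laplace_shift_sum _ s3).
rewrite -/(laplace _ _) => H1.
have H2 : normc (dirichlet_series a s N * laplace q s - l * laplace q s) @[N --> \oo] --> (0 : R).
  rewrite (_ : (fun N => _) = fun N => normc (dirichlet_series a s N - l) * normc (laplace q s)); last first.
    by apply/funext => N; rewrite -mulrBl (normcM (_ - l)).
  by rewrite -[X in _ --> X](mul0r (normc (laplace q s))); apply: cvgMl.
apply/eqP; rewrite -subr_eq0 -normc_eq0 eq_le normc_ge0 andbT.
have := cvgD H1 H2; rewrite addr0 => H3.
apply: (@ler_cvg_cst R _ _ (fun N => normc (dirichlet_series a s N * laplace q s - laplace (dsum a q) s) +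
  normc (dirichlet_series a s N * laplace q s - l * laplace q s))); last exact: H3.
move=> N /=.
rewrite -(normcN (_ - laplace _ _)); apply: le_trans (ler_normcD _ _).
by rewrite le_eqVlt; apply/orP; left; apply/eqP; congr normc; ring.
Qed.

End DsumBound.

End Dirichlet.

(** * The polar part at 1 and the growth of the remainder *)

Section PolarPart.
Variable R : realType.
Implicit Types (G H K : R[i] -> R[i]) (s : R[i]).

Lemma hol_rect_bounded (a b T : R) K :
  (forall s, a <= complex.Re s <= b -> hol K s) ->
  exists C : R, forall s, a <= complex.Re s <= b -> `|complex.Im s| <= T -> normc (K s) <= C.
Proof.
move=> hK.
have cpt : compact ((`[a, b]%classic : set R) `*` (`[- T, T]%classic : set R)).
  by apply: compact_setX; exact: segment_compact.
move/compact_near_coveringP: cpt.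
move=> /(_ R (pinfty_nbhs R) (fun M z => normc (K (z.1 +i* z.2)%C) <= M) _).
case.
  move=> [u v] [/=]; rewrite !in_itv /= => uab vT.
  have [d d0 Hd] := hol_continuous (hK (u +i* v)%C uab) ltr01.
  exists ([set z : R * R | normc (K (z.1 +i* z.2)%C) <= normc (K (u +i* v)%C) + 1],
          [set M' | normc (K (u +i* v)%C) + 1 <= M']) => /=.
    split; last by apply: nbhs_pinfty_ge; exact: num_real.
    exists (ball u (d / 2), ball v (d / 2)) => /=.
      by split; apply: nbhsx_ballx; rewrite divr_gt0.
    move=> [u' v'] /= [/= bu bv]; rewrite -lerBlDl.
    apply: le_trans (ler_dist_normc _ _) _; apply/ltW/Hd.
    apply: le_lt_trans (normc_leD _) _; rewrite ReD ReN ImD ImN /=.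
    move: bu bv; rewrite /ball /= distrC => bu; rewrite distrC => bv.
    by rewrite (splitr d) ltrD.
  by move=> [[u' v'] M'] /= [yM MM']; exact: le_trans MM'.
move=> M [_ HM]; exists (M + 1) => s sab sT.
have := HM (M + 1); rewrite ltrDl ltr01 => /(_ isT (complex.Re s, complex.Im s)) /=.
case: s sab sT => u v /= uab vT; apply; split; rewrite /= in_itv //=.
by rewrite -ler_norml.
Qed.

Lemma strip_growth_far (a b T M : R) n K : 0 <= M ->
  (forall s, a <= complex.Re s <= b -> hol K s) ->
  (forall s, a <= complex.Re s <= b -> T <= `|complex.Im s| ->
    normc (K s) <= expR (M * (1 + `|complex.Im s|) ^+ n)) -> strip_growth a b K.
Proof.
move=> M0 hK HM; have [C HC] := hol_rect_bounded T hK.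
exists (`|C| + M), n; split; first by rewrite addr_ge0.
move=> s sab; have p0 : 1 <= (1 + `|complex.Im s|) ^+ n by rewrite exprn_ege1// lerDl.
have [sT|/ltW sT] := leP `|complex.Im s| T.
  apply: le_trans (HC s sab sT) _; apply: le_trans (ler_norm C) _.
  apply: le_trans (le_expR_id _) _; rewrite ler_expR.
  apply: (@le_trans _ _ (`|C| + M)); first by rewrite lerDl.
  by rewrite ler_peMr// addr_ge0.
apply: le_trans (HM s sab sT) _; rewrite ler_expR ler_wpM2r ?(le_trans _ p0)//.
by rewrite lerDr.
Qed.

Lemma finite_order_strip_growth (sigma a b : R) G : sigma < a -> a <= b ->
  (forall s, half_plane sigma s -> hol G s) -> finite_order_on (half_plane sigma) G ->
  strip_growth a b G.
Proof.
move=> sa ab hG [A [M [rho HG]]].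
(* On the strip, [|s| <= B (1 + |Im s|)]. *)
pose B := `|a| + `|b| + 1; have B1 : 1 <= B by rewrite lerDr addr_ge0.
pose n := Num.truncn `|A|; pose N := n.+1.
have An : A <= N%:R by apply: le_trans (ler_norm A) _; apply/ltW/truncnS_gt.
have sP s : a <= complex.Re s <= b -> half_plane sigma s.
  by rewrite /half_plane /= => /andP[+ _]; exact: lt_le_trans.
(* Beyond [rho] the growth hypothesis is available, and beyond 1 the exponent [A] may be raised to
   the integer [N]. The factor [M] moves into the exponent by [M <= e^|M|]. *)
apply: (@strip_growth_far a b (Num.max 1 rho) (`|M| + B ^+ N) N).
- by rewrite addr_ge0// exprn_ge0// (le_trans ler01 B1).
- by move=> s /sP /hG.
move=> s sab; rewrite ge_max => /andP[s1 sr].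
have ns : `|complex.Im s| <= normc s by exact: normc_Im.
apply: le_trans (HG s (sP s sab) (le_trans sr ns)) _.
have p1 : 1 <= (1 + `|complex.Im s|) ^+ N by rewrite exprn_ege1// lerDl.
apply: (@le_trans _ _ (expR (`|M|) * expR (normc s `^ A))).
  rewrite ler_wpM2r ?expR_ge0//; apply: le_trans (ler_norm M) _; exact: le_expR_id.
rewrite -expRD ler_expR mulrDl lerD//; first by rewrite ler_peMr.
apply: (@le_trans _ _ (normc s `^ N%:R)); first by rewrite ler_powR// (le_trans s1).
rewrite powR_mulrn ?normc_ge0// -exprMn; apply: lerXn2r.
- by rewrite nnegrE normc_ge0.
- by rewrite nnegrE mulr_ge0// ?addr_ge0// (le_trans ler01).
apply: le_trans (normc_leD s) _; rewrite mulrDr mulr1 lerD//; last by rewrite ler_peMl.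
rewrite /B; move/andP: sab => [s2 s3]; rewrite ler_norml.
have := ler_norm b; have := ler_norm (- a); rewrite normrN.
have := normr_ge0 a; have := normr_ge0 b.
by move=> h1 h2 h3 h4; apply/andP; split; lra.
Qed.

Lemma strip_growth_cst (a b : R) (w : R[i]) : strip_growth a b (fun=> w).
Proof. by apply: (@strip_growth_bounded _ a b _ (normc w)). Qed.

(** Where [|Im s| >= 1] one has [|s - 1| >= 1], so [K] is no larger than [H - w]; the remaining part
    of the strip is compact. *)
Lemma strip_growth_divide (a b : R) H K (w : R[i]) :
  (forall s, a <= complex.Re s <= b -> hol K s) -> strip_growth a b H ->
  (forall s, H s = w + (s - 1) * K s) -> strip_growth a b K.
Proof.
move=> hK gH HK.
have [M [n [M0 HM]]] := strip_growthD gH (strip_growth_cst a b (- w)).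
apply: (@strip_growth_far a b 1 M n) => // s sab s1.
apply: le_trans (HM s sab); rewrite HK addrC addrA addNr add0r normcM.
rewrite ler_peMl ?normc_ge0//; apply: le_trans s1 _.
by apply: le_trans (normc_Im (s - 1)); rewrite ImD ImN /= subr0.
Qed.

(** A Taylor expansion with remainder at 1, built by [m] divisions; each keeps both holomorphy on
    the half plane and growth in the strip. *)
Lemma polar_part (sigma a b : R) m H : sigma < 1 -> sigma < a ->
  (forall s, half_plane sigma s -> hol H s) -> strip_growth a b H ->
  exists (h : nat -> R[i]) K, [/\ forall s, half_plane sigma s -> hol K s, strip_growth a b K &
    forall s, H s = \sum_(j < m) h j * (s - 1) ^+ j + (s - 1) ^+ m * K s].
Proof.
move=> s1 sa; elim: m H => [|m IH] H hH gH.
  by exists (fun=> 0), H; split => // s; rewrite big_ord0 add0r expr0 mul1r.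
have [h [K [hK gK HK]]] := IH H hH gH.
have r0 : 0 < 1 - sigma by rewrite subr_gt0.
have [|K1 [K1E hK1]] := @hol_divide R K 1 (1 - sigma) r0.
  move=> s ns; apply: hK; rewrite /half_plane /=.
  have := le_lt_trans (normc_Re (s - 1)) ns; rewrite ReD ReN /= ltr_norml => /andP[+ _].
  by lra.
have hK1' s : half_plane sigma s -> hol K1 s by move=> /hK /hK1.
exists (fun j => if j == m then K 1 else h j), K1; split => //.
  apply: strip_growth_divide gK K1E => s /andP[as_ _]; apply: hK1'.
  by rewrite /half_plane /=; exact: lt_le_trans as_.
move=> s; rewrite HK big_ord_recr /= eqxx (K1E s) exprS.
rewrite [in RHS](eq_bigr (fun j : 'I_m => h j * (s - 1) ^+ j)); last first.
  by move=> i _; rewrite (ltn_eqF (ltn_ord i)).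
by ring.
Qed.

Lemma polar_part_div m (h : nat -> R[i]) (z K : R[i]) : z != 0 ->
  (\sum_(j < m) h j * z ^+ j + z ^+ m * K) / z ^+ m =
  K + \sum_(k < m) h (m - k.+1)%N / z ^+ k.+1.
Proof.
move=> z0; have zm : z ^+ m != 0 by rewrite expf_neq0.
rewrite mulrDl (mulrC (z ^+ m)) mulfK// addrC; congr (_ + _).
rewrite mulr_suml (reindex_inj rev_ord_inj) /=; apply: eq_bigr => k _.
rewrite -mulrA; congr (_ * _).
have -> : z ^+ m = z ^+ (m - k.+1 + k.+1) by rewrite subnK.
rewrite exprD invfM mulrA mulfV ?mul1r//.
by rewrite expf_neq0.
Qed.

End PolarPart.

(** * Null sets, polar terms and the weight on each side *)

Section Assembly.
Variable R : realType.
Notation mu := (@lebesgue_measure R).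

Lemma measurable_ln_comp (f : R -> R[i]) : cmf setT f -> cmf setT (fun u : R => f (ln u)).
Proof. by move=> mf; apply: (cmf_comp _ mf); exact: measurable_ln. Qed.

(** With [c = ln n], these are the [u] with [n / u] in [N]: [psi] evaluates [phi] at such points,
    while [phi] is controlled off a null set. Two exponential substitutions and a translation turn
    the measure into the integral of a density over [N]. *)
Lemma null_dilate (N : set R) (c : R) :
  measurable (N : set (measurableTypeR R)) -> mu N = 0%E ->
  let E := [set u : R | 0 < u /\ N (expR (c - ln u))] in
  measurable (E : set (measurableTypeR R)) /\ mu E = 0%E.
Proof.
move=> mN N0 E.
have md : measurable_fun setT (fun u : R => expR (c - ln u)).
  apply: measurableT_comp; first exact: measurable_expR.
  by apply: measurable_funB => //; exact: measurable_ln.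
have EE : E = `]0, +oo[%classic `&` (fun u : R => expR (c - ln u)) @^-1` N.
  by apply/seteqP; split => u /=; rewrite in_itv /= andbT.
have mP : measurable ((fun u : R => expR (c - ln u)) @^-1` N : set (measurableTypeR R)).
  by rewrite -[X in measurable X]setTI; exact: md.
have mE : measurable (E : set (measurableTypeR R)) by rewrite EE; exact: measurableI.
split => //.
have mi (A : set R) : measurable (A : set (measurableTypeR R)) ->
  measurable_fun setT (\1_A : R -> R) by exact: measurable_indic.
have ge0 (A : set R) x : 0 <= \1_A x :> R by rewrite indicE.
have -> : mu E = (\int[mu]_(u in `]0%R, +oo[) (\1_N (expR (c - ln u)))%:E)%E.
  rewrite -[E in mu E]setIT -integral_indic// [RHS]integral_mkcond.
  apply: eq_integral => u _; rewrite patchE !indicE EE in_setI.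
  rewrite (_ : (u \in _ @^-1` N) = (expR (c - ln u) \in N)); last by apply/idP/idP; rewrite !inE.
  by case: (u \in _).
have mh : measurable_fun setT (fun u : R => \1_N (expR (c - ln u)) : R).
  exact: (measurableT_comp (mi _ mN) md).
rewrite (ge0_integral_exp (e := 1) _ mh)//; last by left.
pose h (u : R) : R := \1_N u * expR (c - 2 * ln u).
have mw : measurable_fun setT (fun u : R => expR (c - 2 * ln u)).
  apply: measurableT_comp; first exact: measurable_expR.
  by apply: measurable_funB => //; apply: measurable_funM => //; exact: measurable_ln.
have mh2 : measurable_fun setT h by apply: measurable_funM => //; exact: mi.
have h0 x : 0 <= h x by rewrite mulr_ge0 ?expR_ge0.
have mk : measurable_fun setT (fun y : R => (\1_N (expR (- y)) * expR (c + y))%:E).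
  have me : measurable_fun setT (fun y : R => expR (- y)).
    rewrite (_ : (fun y => _) = fun y : R => expR (- (1 * y))); first exact: measurable_expN.
    by apply/funext => y; rewrite mul1r.
  have mc : measurable_fun setT (fun y : R => expR (c + y)).
    by apply: measurableT_comp; [exact: measurable_expR|exact: measurable_funD].
  by apply/measurable_EFinP; apply: measurable_funM => //; exact: (measurableT_comp (mi _ mN) me).
transitivity (\int[mu]_y (\1_N (expR (- y)) * expR (c + y))%:E)%E.
  rewrite -(ge0_integral_shift (- c) mk); last by move=> y; rewrite lee_fin mulr_ge0 ?expR_ge0.
  by apply: eq_integral => y _; rewrite !mul1r expRK opprD opprK addrC; congr (_ * expR _)%:E; ring.
transitivity (\int[mu]_y (h (expR (-1 * y)) * expR (-1 * y))%:E)%E.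
  apply: eq_integral => y _; rewrite /h !mulN1r expRK -mulrA -expRD; congr (_ * expR _)%:E; ring.
rewrite -(ge0_integral_exp (e := -1) _ mh2 h0); last by right.
rewrite -[RHS](integral0 mu `]0%R, +oo[%classic); apply: ae_eq_integral => //.
  by apply: measurable_funTS; exact/measurable_EFinP.
exists N; split => // u; apply: contra_notP => nN _ /=.
by rewrite /h indicE memNset// mul0r.
Qed.

Lemma laplace_polar (b : nat -> R[i]) m :
  laplace_dom 1 (fun x => \sum_(k < m) b k * expheavi_pow k x) /\
  forall s, 1 < complex.Re s ->
    laplace (fun x => \sum_(k < m) b k * expheavi_pow k x) s = \sum_(k < m) b k / (s - 1) ^+ k.+1.
Proof.
elim: m => [|m [IH1 IH2]].
  split=> [|s s1].
    split; [|by move=> x _; rewrite big_ord0|].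
      by under eq_fun do rewrite big_ord0; exact: cmf_cst.
    move=> c _; under eq_fun do rewrite big_ord0 normcR normr0 mul0r; exact: integrable0.
  by rewrite big_ord0 -[RHS](cint0 mu setT); apply: eq_cint => x _; rewrite big_ord0 mul0r.
have E : (fun x => \sum_(k < m.+1) b k * expheavi_pow k x) =
    fun x => \sum_(k < m) b k * expheavi_pow k x + b m * expheavi_pow m x :> R[i].
  by apply/funext => x; rewrite big_ord_recr.
have d := laplace_dom_expheavi_pow R m.
rewrite E; split; first by apply: laplace_domD => //; exact: laplace_domZ.
move=> s s1; rewrite (laplaceD IH1 (laplace_domZ (b m) d) s1) IH2// (laplaceZ (b m) d s1) laplace_expheavi_pow//.
by rewrite big_ord_recr.
Qed.

(** The norm depends on [|d|], and [1/s] is the transform of [heavi], so this is a case of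
    [wL2_laplace_L2]. *)
Lemma integral_inv_line (d : R) : d != 0 ->
  (\int[mu]_t (normc ((d +i* t)%C^-1) ^+ 2)%:E < +oo)%E.
Proof.
move=> d0; have n0 : 0 < `|d| by rewrite normr_gt0.
have -> : (\int[mu]_t (normc ((d +i* t)%C^-1) ^+ 2)%:E = \int[mu]_t (normc ((`|d| +i* t)%C^-1) ^+ 2)%:E)%E.
  apply: eq_integral => t _; congr EFin.
  have E (e : R) : normc ((e +i* t)%C^-1) ^+ 2 = (e ^+ 2 + t ^+ 2)^-1.
    by rewrite normcV exprVn sqr_normcE.
  by rewrite !E real_normK ?num_real.
apply: (@wL2_laplace_L2 R `|d| (`|d| + 1) 0 (fun s => s^-1) (@heavi R)).
- by rewrite ltrDl.
- exact: laplace_dom_heavi.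
- move=> s /andP[s1 _]; apply: holV; last exact: hol_id.
  by apply/eqP => s0; move: s1; rewrite s0 /= leNgt n0.
- apply: (@strip_growth_bounded _ _ _ _ (`|d|^-1)) => s /andP[s1 _].
  rewrite normcV lef_pV2 ?posrE//.
    by apply: le_trans s1 _; apply: le_trans (normc_Re s); exact: ler_norm.
  by apply: lt_le_trans n0 _; apply: le_trans s1 _; apply: le_trans (normc_Re s); exact: ler_norm.
- by move=> t; rewrite laplace_heavi//= ltr_wpDl.
- rewrite /wL2; have [_] := integrableP _ _ _ (integrable_expN_pos (mulr_gt0 (ltr0n R 2) n0)).
  apply: le_lt_trans; rewrite le_eqVlt; apply/orP; left; apply/eqP; apply: eq_integral => x _.
  rewrite abse_EFin ger0_norm ?mulr_ge0 ?normc_ge0 ?expR_ge0//; congr (_ * _)%:E.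
  by rewrite /heavi; case: ifP => _; rewrite normcR ?normr0 ?normr1 ?expr0n ?expr1n.
Qed.

Lemma integral_sqrD (f g : R -> R[i]) : cmf setT f -> cmf setT g ->
  (\int[mu]_t (normc (f t) ^+ 2)%:E < +oo)%E -> (\int[mu]_t (normc (g t) ^+ 2)%:E < +oo)%E ->
  (\int[mu]_t (normc (f t + g t) ^+ 2)%:E < +oo)%E.
Proof.
move=> mf mg If Ig.
have m2 (h : R -> R[i]) : cmf setT h -> measurable_fun setT (fun t : R => (normc (h t) ^+ 2)%:E).
  by move=> mh; apply/measurable_EFinP; apply: measurable_funX; exact: cmf_normc.
have p h (t : R) : (0 <= (normc (h t : R[i]) ^+ 2)%:E)%E by rewrite lee_fin sqr_ge0.
apply: (@le_lt_trans _ _ (\int[mu]_t (2%:E * (normc (f t) ^+ 2)%:E + 2%:E * (normc (g t) ^+ 2)%:E))%E).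
  apply: ge0_le_integral => //.
  - by move=> t _; exact: (p (fun t => f t + g t)).
  - by apply: (m2 (fun t => f t + g t)); exact: cmfD.
  - by apply: emeasurable_funD; apply: measurable_funeM; exact: m2.
  move=> t _; rewrite -!EFinM -EFinD lee_fin.
  apply: (@le_trans _ _ ((normc (f t) + normc (g t)) ^+ 2)).
    by apply: lerXn2r; rewrite ?nnegrE ?normc_ge0 ?addr_ge0 ?normc_ge0// ler_normcD.
  by rewrite -subr_ge0 (_ : _ - _ = (normc (f t) - normc (g t)) ^+ 2) ?sqr_ge0//; ring.
rewrite ge0_integralD//.
- rewrite !ge0_integralZl//; [|exact: m2|exact: m2].
  by rewrite lte_add_pinfty// lte_mul_pinfty.
- by move=> t _; rewrite -EFinM lee_fin mulr_ge0// sqr_ge0.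
- by apply: measurable_funeM; exact: m2.
- by move=> t _; rewrite -EFinM lee_fin mulr_ge0// sqr_ge0.
- by apply: measurable_funeM; exact: m2.
Qed.

Lemma integral_weight (r : R) (f : R -> R[i]) : cmf setT f -> (forall x : R, x <= 0 -> f x = 0 :> R[i]) ->
  (\int[mu]_(u in `]1%R, +oo[) (normc (- f (ln u)) ^+ 2 * u `^ (- (1 + 2 * r)))%:E =
   \int[mu]_x (normc (f x) ^+ 2 * expR (- (2 * r * x)))%:E)%E.
Proof.
move=> mf f0.
pose h (u : R) := normc (- f (ln u)) ^+ 2 * u `^ (- (1 + 2 * r)).
have mh : measurable_fun setT h.
  apply: measurable_funM; last exact: measurable_powR.
  by apply: measurable_funX; apply: cmf_normc; apply: cmfN; exact: measurable_ln_comp.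
have h0 u : 0 <= h u by rewrite mulr_ge0 ?sqr_ge0 ?powR_ge0.
transitivity (\int[mu]_(u in `]0%R, +oo[) (h u)%:E)%E.
  rewrite integral_mkcond [RHS]integral_mkcond; apply: eq_integral => u _.
  rewrite !patchE !mem_setE !in_itv /= !andbT.
  have [u1|u1] := boolP (1 < u); first by rewrite (lt_trans ltr01 u1).
  case: ifP => // u0; rewrite /h f0; last by apply: ln_le0; rewrite leNgt.
  by rewrite oppr0 normcR normr0 expr0n mul0r.
rewrite (ge0_integral_exp (e := 1) _ mh h0); last by left.
apply: eq_integral => x _; rewrite /h mul1r expRK normcN powR_expR ?expR_gt0// expRK -(mulrA (normc (f x) ^+ 2)) -expRD.
by congr (_ * expR _)%:E; ring.
Qed.

End Assembly.

Section Main.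
Variable R : realType.
Notation mu := (@lebesgue_measure R).

Lemma coef_bound (a : nat -> R[i]) :
  (fun n => normc (a n) : R) =O_\oo (fun n : nat => n%:R `^ 1) ->
  exists A : R, 0 <= A /\ forall n, normc (a n.+1) <= A * n.+1%:R.
Proof.
move=> /eqO_exP[k k0 [N _ HN]].
(* The finitely many coefficients before the asymptotic bound takes effect are dominated by the sum
   of their norms. *)
exists (k + \sum_(i < N) normc (a i)); split.
  by rewrite addr_ge0 ?(ltW k0)// sumr_ge0// => i _; exact: normc_ge0.
move=> n; have n1 : 1 <= n.+1%:R :> R by rewrite ler1n.
have S0 : 0 <= \sum_(i < N) normc (a i) by apply: sumr_ge0 => i _; exact: normc_ge0.
have [Nn|nN] := leqP N n.+1.
  have := HN _ Nn; rewrite /= powRr1// !ger0_norm ?normc_ge0// => /le_trans; apply.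
  by rewrite ler_wpM2r// lerDl.
apply: (@le_trans _ _ (\sum_(i < N) normc (a i))).
  rewrite (bigD1 (Ordinal nN)) //= lerDl; apply: sumr_ge0 => i _; exact: normc_ge0.
apply: (@le_trans _ _ (k + \sum_(i < N) normc (a i))); first by rewrite lerDr ltW.
by rewrite ler_peMr// addr_ge0 ?(ltW k0).
Qed.

(** [is_residue_exp] evaluates the residue. The two sums can differ in the term [n = u], for which
    [g 1 = 0]. *)
Lemma psi_dsum (a : nat -> R[i]) (L K : R[i] -> R[i]) (phi g : R -> R[i]) (b : nat -> R[i]) (m : nat)
  (sigma u : R) : sigma < 1 -> (forall s, half_plane sigma s -> hol K s) ->
  (forall s, half_plane sigma s -> s != 1 ->
    L s * mellin phi s = K s + \sum_(k < m) b k / (s - 1) ^+ k.+1) ->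
  (forall x, 1 <= x -> g x = 0) -> 1 < u ->
  (forall n, (0 < n)%N -> n%:R < u -> phi (n%:R / u) = g (n%:R / u)) ->
  psi a L phi u = \sum_(k < m) b k * expheavi_pow k (ln u) - dsum a (fun y => g (expR (- y))) (ln u).
Proof.
move=> s1 hK LK g1 u1 phig; have u0 : 0 < u by exact: lt_trans u1.
rewrite /psi; congr (_ - _).
  have : \forall s \near (1 : Cplx R)^', L s * mellin phi s = K s + \sum_(k < m) b k / (s - 1) ^+ k.+1.
    apply/dnbhs_complexP; exists (1 - sigma) => [|s ns]; first by rewrite subr_gt0.
    apply: LK; rewrite /half_plane /=.
    by have := le_lt_trans (normc_Re _) ns; rewrite ReD ReN /= ltr_norml => /andP[]; lra.
  move=> /(is_residue_exp s1 u0 hK) /ResE ->; rewrite mulr_sumr; apply: eq_bigr => k _.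
  rewrite /expheavi_pow /heavi_pow /heavi ln_gt0// mulr1 lnK ?posrE//.
  by rewrite mulrCA.
rewrite /dsum /shift_sum lnK ?posrE// big_add1 /= big_mkord big_mkcond /=.
apply: eq_bigr => k _; have k0 : 0 < k.+1%:R :> R by [].
have E : expR (- (ln u - ln k.+1%:R)) = k.+1%:R / u.
  by rewrite opprB expRD expRN !lnK ?posrE.
rewrite E; case: ifPn => [ku|]; first by rewrite phig.
by rewrite -leNgt => uk; rewrite g1 ?mulr0// ler_pdivlMr// mul1r.
Qed.

(** On the line [|s - 1| >= |r - 1| > 0], so each higher power of [1 / (s - 1)] is bounded by a
    constant times the first, which is square integrable. Without a pole the sum is empty, and
    [r = 1] is allowed. *)
Lemma polar_L2 (b : nat -> R[i]) m (r : R) : ((1 <= m)%N -> r <> 1) ->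
  let E t := \sum_(k < m) b k / ((r +i* t)%C - 1) ^+ k.+1 in
  cmf setT E /\ (\int[mu]_t (normc (E t) ^+ 2)%:E < +oo)%E.
Proof.
case: m => [_|m /(_ isT)/eqP r1] E.
  have E0 : E = fun=> 0 by apply/funext => t; rewrite /E big_ord0.
  rewrite E0; split; first exact: cmf_cst.
  by under eq_integral do rewrite normcR normr0 expr0n /=; rewrite integral0.
have d0 : r - 1 != 0 by rewrite subr_eq0.
have zE t : (r +i* t)%C - 1 = ((r - 1) +i* t)%C :> R[i] by apply: complexP; rewrite !ReImE /= ?subr0.
have z0 t : ((r - 1) +i* t)%C != 0 :> R[i] by rewrite eq_complex /= negb_and d0.
have mV : cmf setT (fun t : R => ((r - 1) +i* t)%C^-1).
  apply: ccont_cmf => // t.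
  have := @hol_line R (fun s => s^-1) (r - 1)%:C%C 'i%C t.
  have lE x : (r - 1)%:C%C + x%:C%C * 'i%C = ((r - 1) +i* x)%C by apply: complexP; rewrite !ReImE /=; ring.
  rewrite lE => H; have := H (holV (z0 t) (hol_id _)).
  by under eq_fun do rewrite lE.
have mE : cmf setT E.
  apply: cmf_sum => k; apply: cmfZ; rewrite (_ : (fun x => _) = fun t => ((r - 1) +i* t)%C^-1 ^+ k.+1).
    elim: {k}(nat_of_ord k) => [|k IH]; first by under eq_fun do rewrite expr1.
    by under eq_fun do rewrite exprS; exact: cmfM.
  by apply/funext => t; rewrite zE exprVn.
split => //.
pose C := \sum_(k < m.+1) normc (b k) * (`|r - 1|^-1) ^+ k.
have C0 : 0 <= C by apply: sumr_ge0 => k _; rewrite mulr_ge0 ?normc_ge0// exprn_ge0// invr_ge0.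
have EC t : normc (E t) <= C * normc ((r - 1) +i* t)%C^-1.
  apply: le_trans (normc_sum _ _ _) _; rewrite mulr_suml; apply: ler_sum => k _.
  rewrite normcM zE -exprVn normcX exprSr mulrA ler_wpM2r ?normc_ge0// ler_wpM2l ?normc_ge0//.
  apply: lerXn2r; rewrite ?nnegrE ?normc_ge0 ?invr_ge0// normcV lef_pV2 ?posrE ?normc_gt0 ?normr_gt0//.
  exact: (normc_Re ((r - 1) +i* t)%C).
apply: (@le_lt_trans _ _ (\int[mu]_t ((C ^+ 2)%:E * (normc ((r - 1) +i* t)%C^-1 ^+ 2)%:E))%E).
  apply: ge0_le_integral => //.
  - by move=> t _; rewrite lee_fin sqr_ge0.
  - by apply/measurable_EFinP; apply: measurable_funX; exact: cmf_normc.
  - by apply: measurable_funeM; apply/measurable_EFinP; apply: measurable_funX; exact: cmf_normc.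
  - move=> t _; rewrite -EFinM lee_fin -exprMn; apply: lerXn2r; rewrite ?nnegrE ?normc_ge0//.
    by rewrite mulr_ge0 ?normc_ge0.
rewrite ge0_integralZl//.
- by rewrite lte_mul_pinfty ?lee_fin ?sqr_ge0// integral_inv_line.
- by apply/measurable_EFinP; apply: measurable_funX; exact: cmf_normc.
- by move=> t _; rewrite lee_fin sqr_ge0.
- by rewrite lee_fin sqr_ge0.
Qed.

End Main.

Lemma L2_line_polar (R : realType) (m : nat) (b : nat -> R[i]) (F K : R -> R[i]) (r : R) :
  ((1 <= m)%N -> r <> 1) -> cmf setT K ->
  (forall t, (r +i* t)%C != 1 :> R[i] -> F t = K t + \sum_(k < m) b k / ((r +i* t)%C - 1) ^+ k.+1) ->
  L2 setT (fun=> 1) F <-> (\int[@lebesgue_measure R]_t (normc (K t) ^+ 2)%:E < +oo)%E.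
Proof.
move=> hr mK FK; have [mE IE] := polar_L2 b hr.
set E := (fun t : R => \sum_(k < m) _) in mE IE.
have mKE : cmf setT (fun t => K t + E t) by exact: cmfD.
(* The hypothesis on [F] excludes [s = 1], which can lie on the line for [t = 0] alone. *)
have N0 : lebesgue_measure [set 0 : R] = 0%E by exact: lebesgue_measure_set1.
rewrite (@L2_borel R setT [set 0 : R] (fun=> 1) F (fun t => K t + E t))//; last first.
  move=> t _ t0; apply: FK; apply/eqP => -[_ /t0]; exact.
have -> : (\int[@lebesgue_measure R]_t (normc (K t + E t) ^+ 2 * 1)%:E =
  \int[@lebesgue_measure R]_t (normc (K t + E t) ^+ 2)%:E)%E.
  by apply: eq_integral => t _; rewrite mulr1.
split=> [H|H]; last exact: integral_sqrD.
have IN : (\int[@lebesgue_measure R]_t (normc (- E t) ^+ 2)%:E < +oo)%E.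
  by under eq_integral do rewrite normcN.
have := integral_sqrD mKE (cmfN mE) H IN.
by under eq_integral do rewrite addrK.
Qed.

Theorem theorem1 (R : realType)
  (a : nat -> R[i]) (L : Cplx R -> Cplx R) (sigma0 : R) (m : nat)
  (phi : R -> R[i]) (sigma1 r : R)
  (ha : forall e : R, 0 < e ->
          (fun n => normc (a n) : R) =O_\oo (fun n : nat => n%:R `^ e))
  (hL : forall s : Cplx R, 1 < complex.Re s ->
          dirichlet_series a s @ \oo --> L s)
  (hsigma0 : sigma0 < 1)
  (hmero : holomorphic_on (half_plane sigma0 `\ 1) L)
  (hpole : pole_of_order L 1 m)
  (horder : exists G : Cplx R -> Cplx R,
    [/\ holomorphic_on (half_plane sigma0) G,
        (forall s, half_plane sigma0 s -> s <> 1 ->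
           G s = (s - 1) ^+ m * L s)
      & finite_order_on (half_plane sigma0) G])
  (hphi_meas : cmeasurable `[0, +oo[ phi)
  (hphi_supp : forall x : R, 1 < x -> phi x = 0)
  (hphi_bnd : locally_bounded_on `]0, 1[ phi)
  (hphi0 : (fun x => normc (phi x) : R) =O_ (0^'+) (fun x : R => x `^ (- sigma0)))
  (hsigma1 : sigma1 < 1 / 2)
  (hphi1 : (fun x => normc (phi x) : R) =O_ (1^'-) (fun x : R => (1 - x) `^ (- sigma1)))
  (hr : sigma0 < r)
  (hr1 : (1 <= m)%N -> r <> 1) :
  L2 `]1, +oo[ (fun u => u `^ (- (1 + 2 * r))) (psi a L phi)
  <->
  L2 setT (fun=> 1) (fun t => L (r +i* t)%C * mellin phi (r +i* t)%C).
Proof.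
have [N [mN N0 mphi]] := cborel_version (measurable_itv _) hphi_meas.
pose D : set R := `]0, 1[%classic `\` N.
have mD : measurable (D : set (measurableTypeR R)) by apply: measurableD.
pose g (x : R) : R[i] := if x \in D then phi x else 0.
have mg : cmf setT g.
  apply: cmf_restrict => //; apply: (cmfS _ _ mphi).
    by apply: measurableD.
  move=> x [/=]; rewrite !in_itv /= => /andP[x0 _] nx; split => //=.
  by rewrite (ltW x0).
have g1 x : 1 <= x -> g x = 0.
  move=> x1; rewrite /g memNset// => -[/=]; rewrite in_itv /= => /andP[_].
  by rewrite ltNge x1.
(* The value [phi 1] is unconstrained whereas [g 1 = 0], so the point 1 joins the exceptional
   set. *)
pose N' := N `|` [set 1].
have mN' : measurable (N' : set (measurableTypeR R)) by exact: measurableU.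
have N'0 : lebesgue_measure N' = 0%E.
  have E : (lebesgue_measure N' <= lebesgue_measure N + lebesgue_measure [set 1%R : R])%E by exact: measureU2.
  by apply/eqP; rewrite eq_le measure_ge0 andbT; move: E; rewrite N0 lebesgue_measure_set1 adde0.
have phig x : 0 < x -> ~ N' x -> phi x = g x.
  move=> x0 nx; have [x1|x1] := boolP (x < 1).
    rewrite /g mem_set//; split; first by rewrite /= in_itv /= x0.
    by move=> Nx; apply: nx; left.
  rewrite g1; last by rewrite leNgt.
  apply: hphi_supp; rewrite lt_neqAle leNgt x1 andbT.
  by apply/eqP => x1'; apply: nx; right.
pose q (y : R) := g (expR (- y)).
have mel s : mellin phi s = laplace q s by exact: (mellin_laplace _ mN' N'0 mg phig).
have [C [sg [C0 sg01 HC]]] := unit_interval_bound (lt_trans hsigma1 (ltac:(lra) : 1 / 2 < 1 :> R))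
  hphi_bnd hphi0 hphi1.
have dq : laplace_dom sigma0 q.
  apply: (laplace_dom_mellin mg g1 C0 sg01) => x x01; rewrite /g; case: ifP => _; first exact: HC.
  by rewrite normcR normr0 mulr_ge0//; case: ifP => _; exact: powR_ge0.
have [A [A0 aA]] := coef_bound (ha 1 ltr01).
have c3 : sigma0 <= 3 by apply: le_trans (ltW hsigma0) _; rewrite ler1n.
have dS := laplace_dom_dsum A0 aA dq c3.
have [G [hG GL fG]] := horder.
(* To the right of [r] and of 3, the abscissa from which the transform of [dsum] is known. *)
pose c : R := Num.max 4 (r + 1).
have rc : r < c by rewrite lt_max ltrDl ltr01 orbT.
have c4 : 3 < c by rewrite lt_max ltr_nat.
(* This is [(s - 1)^m L(s) mellin phi (s)] away from 1, extended holomorphically through 1. *)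
pose H s := G s * laplace q s.
have hG' s : half_plane sigma0 s -> hol G s by move=> /hG /holP.
have hH s : half_plane sigma0 s -> hol H s.
  by move=> sP; apply: holM; [exact: hG'|exact: hol_laplace dq sP].
have gH : strip_growth r c H.
  apply: strip_growthM; first exact: (finite_order_strip_growth hr (ltW rc) hG' fG).
  have [B HB] := laplace_bounded dq hr.
  by apply: (@strip_growth_bounded _ _ _ _ B) => s /andP[rs _]; exact: HB.
have [h [K [hK gK HK]]] := polar_part m hsigma0 hr hH gH.
pose b k := h (m - k.+1)%N.
have LK s : half_plane sigma0 s -> s != 1 ->
    L s * mellin phi s = K s + \sum_(k < m) b k / (s - 1) ^+ k.+1.
  move=> sP s1; have z0 : s - 1 != 0 by rewrite subr_eq0.
  rewrite -polar_part_div// -HK /H (GL s sP); last exact/eqP.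
  by rewrite mel -(mulrA ((s - 1) ^+ m)) [RHS]mulrC mulKf// expf_neq0.
pose P (x : R) : R[i] := \sum_(k < m) b k * expheavi_pow k x.
have [dP ltP] := laplace_polar b m.
pose f x := dsum a q x + (-1) * P x.
have dP3 : laplace_dom 3 (fun x => (-1) * P x).
  by apply: laplace_domZ; apply: laplace_domW dP; rewrite ler1n.
have df : laplace_dom 3 f by exact: laplace_domD.
have Kf t : K (c +i* t)%C = laplace f (c +i* t)%C.
  have s3 : 3 < complex.Re (c +i* t)%C by [].
  have s1 : 1 < complex.Re (c +i* t)%C by apply: lt_trans s3; rewrite ltr1n.
  have sP : half_plane sigma0 (c +i* t)%C by apply: lt_trans s1.
  rewrite /f (laplaceD dS dP3 s3) (laplace_dsum A0 aA dq c3 s3 (hL _ s1)) (laplaceZ _ dP s1) ltP//.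
  rewrite -mel LK//; last by apply/eqP => E; move: s1; rewrite E ltxx.
  by rewrite mulN1r addrK.
have hK' s : r <= complex.Re s <= c -> hol K s.
  by move=> /andP[rs _]; apply: hK; exact: lt_le_trans rs.
have PW : wL2 r f <-> (\int[@lebesgue_measure R]_t (normc (K (r +i* t)%C) ^+ 2)%:E < +oo)%E.
  by split; [exact: (wL2_laplace_L2 rc df hK' gK Kf)|exact: (L2_laplace_wL2 rc c4 df hK' gK Kf)].
have [mf f0 _] := df.
have mK : cmf setT (fun t => K (r +i* t)%C).
  apply: ccont_cmf => // t; apply: hol_ccont_v; exact: hK.
rewrite (@L2_line_polar R m b _ (fun t => K (r +i* t)%C) r hr1 mK); last first.
  by move=> t t1; exact: LK.
have IW := integral_weight r mf f0.
rewrite -PW; clear PW; unfold wL2.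
rewrite -IW.
(* [psi u] involves [phi (n / u)] for every [n < u]; the [u] for which some [n / u] is exceptional
   form a countable union of null sets. *)
pose E n := [set u : R | 0 < u /\ N' (expR (ln n.+1%:R - ln u))].
have mE n : measurable (E n : set (measurableTypeR R)) by have [] := null_dilate (ln n.+1%:R) mN' N'0.
have E0 n : lebesgue_measure (E n) = 0%E by have [] := null_dilate (ln n.+1%:R) mN' N'0.
have mU : measurable (\bigcup_n E n : set (measurableTypeR R)) by exact: bigcupT_measurable.
apply: (@L2_borel R `]1, +oo[%classic (\bigcup_n E n)) => //.
- have : (@lebesgue_measure R).-negligible (\bigcup_n E n).
    by apply: negligible_bigcup => n; exists (E n); split; [exact: mE|exact: E0|].
  by case=> B [mB B0 sB]; apply/eqP; rewrite -measure_le0 -B0 le_measure// inE.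
- by apply: cmfN; exact: measurable_ln_comp.
move=> u; rewrite /= in_itv /= andbT => u1 nu.
have u0 : 0 < u by exact: lt_trans u1.
rewrite (psi_dsum a hsigma0 hK LK g1 u1).
  by rewrite /f mulN1r opprD opprK addrC.
move=> n n0 nu1; apply: phig; first by rewrite divr_gt0// ltr0n.
(* The sets [E] are indexed from 0, so the integer [n] belongs to the index [n.-1]. *)
move=> Nnu; apply: nu; exists n.-1 => //; split => //.
by rewrite prednK// expRD expRN !lnK ?posrE ?ltr0n.
Qed.
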